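(* Let $n\ge2$, $a>1$, $b\in(a/p,\,n+a)$ and let $f$ be a radial function on $\mathbb{R}^n$. Then $$\big\||w(x,t)|^{b/2}e^{itD^a}f\big\|_{L^2_{t,x}}\le C\,\|D^{(b-a)/2}f\|_2$$ if $w\in\mathfrak{L}^{1,pb}_{a-par}(\mathbb{R}^{n+1})$ for $\max\{a/(b-1),1\}<p\le (n+a)/b$. Here $C$ is a constant independent of $f$.
   Context: $\widehat f$ is the Fourier transform of $f$ on $\mathbb{R}^n$. $D^\sigma$ is the Fourier multiplier on $\mathbb{R}^n$ with symbol $|\xi|^\sigma$, so $D^a=(-\Delta)^{a/2}$, and $$e^{itD^a}f(x)=\frac{1}{(2\pi)^n}\int_{\mathbb{R}^n}e^{ix\cdot\xi}e^{it|\xi|^a}\widehat f(\xi)\,d\xi .$$ $L^2_{t,x}=L^2(\mathbb{R}^{n+1})$ and $\|\cdot\|_2$ is the norm of $L^2(\mathbb{R}^n)$. A weight is a locally integrable function with values in $[0,\infty]$ that is zero or infinite only on a set of Lebesgue measure zero. For $\beta>0$, $a\ge1$ and $1\le p\le (n+a)/\beta$, the $a$-parabolic Morrey-Campanato class $\mathfrak{L}^{\beta,p}_{a-par}=\mathfrak{L}^{\beta,p}_{a-par}(\mathbb{R}^{n+1})$ consists of the weights $w$ on $\mathbb{R}^{n+1}$ with $$\|w\|_{\mathfrak{L}^{\beta,p}_{a-par}}:=\sup_{(x,t)\in\mathbb{R}^{n+1},\,r>0} r^\beta\bigg(\frac{1}{r^{n+a}}\int_{Q(x,r)\times I(t,r^a)}w(y,s)^p\,dy\,ds\bigg)^{1/p}<\infty,$$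 where $Q(x,r)$ is the cube in $\mathbb{R}^n$ centered at $x$ with side length $r$, and $I(t,l)$ is the interval in $\mathbb{R}$ centered at $t$ with length $l$. In the claim the exponents are $1$ and $pb$ in place of $\beta$ and $p$.
   Formalization: The condition b > 1, implicit in max{a/(b-1),1} < p, is assumed explicitly, since for b < 1 the estimate fails (e.g. w = max(|x|,|t|^{1/a})^{-1}) and at b = 1 the quotient a/(b-1) is undefined; f is taken to be a radial function in L^2. *)

(* Defs.v *)
From HB Require Import structures.
From mathcomp Require Import all_boot all_order all_algebra.
From mathcomp Require Import all_classical all_reals all_analysis.
From mathcomp Require Import measurable_realfun complex.

Set Implicit Arguments.
Unset Strict Implicit.
Unset Printing Implicit Defensive.

Import Order.TTheory GRing.Theory Num.Theory.
Import numFieldNormedType.Exports.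

Local Open Scope classical_set_scope.
Local Open Scope ring_scope.

(* R^n with its Borel sigma-algebra (the product sigma-algebra of the library
   on tuples). *)
Definition Rn (R : realType) (n : nat) := n.-tuple (measurableTypeR R).

(* R^(n+1), whose points are written (x, t). *)
Definition spacetime (R : realType) (n : nat) :=
  (Rn R n * measurableTypeR R)%type.

Section LebesgueMeasure.
Context {R : realType}.

Definition Rn_cons (n : nat) (z : spacetime R n) : Rn R n.+1 :=
  [the n.+1.-tuple (measurableTypeR R) of z.2 :: z.1].

Lemma measurable_Rn_cons (n : nat) :
  measurable_fun [set: spacetime R n] (@Rn_cons n).
Proof. exact: measurable_cons. Qed.

(* The unit mass on the one-point Rn R^0, and then the pushforward of the
   product measure under the bijection R^n x R -> R^(n+1). The measure structure
   of a pushforward has the measurability of the map as an argument and cannot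
   be inferred, so it is given by name. *)
Fixpoint lebesgue_Rn (n : nat) : {measure set (Rn R n) -> \bar R} :=
  match n return {measure set (Rn R n) -> \bar R} with
  | 0%N => \d_([tuple] : Rn R 0)
  | n'.+1 => measure_function_pushforward__canonical__measure_function_Measure
               (lebesgue_Rn n' \x @lebesgue_measure R)%E
               (@measurable_Rn_cons n')
  end.

Definition lebesgue_spacetime (n : nat) :
    {measure set (spacetime R n) -> \bar R} :=
  (lebesgue_Rn n \x @lebesgue_measure R)%E.

End LebesgueMeasure.

Section Euclidean.
Context {R : realType} {n : nat}.
Implicit Types x y : Rn R n.

Definition dotp x y : R := \sum_(i < n) (tnth x i : R) * (tnth y i : R).

Definition enorm x : R := Num.sqrt (dotp x x).

Definition radial (f : Rn R n -> R[i]) : Prop :=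
  forall x y, enorm x = enorm y -> f x = f y.

End Euclidean.

Section ComplexFunctions.
Context {R : realType} {d : measure_display} {T : measurableType d}.
Variable mu : {measure set T -> \bar R}.
Implicit Types f : T -> R[i].

Definition cmeasurable f : Prop :=
  measurable_fun [set: T] (fun x => complex.Re (f x)) /\
  measurable_fun [set: T] (fun x => complex.Im (f x)).

Definition cabs (z : R[i]) : R := ComplexField.Normc.normc z.

Definition cintegral (D : set T) f : R[i] :=
  Complex (\int[mu]_(x in D) complex.Re (f x))
          (\int[mu]_(x in D) complex.Im (f x)).

Definition L2norm f : \bar R := Lnorm mu 2%:E (fun x => (cabs (f x))%:E).

Definition L2 f : Prop := cmeasurable f /\ (L2norm f < +oo)%E.

End ComplexFunctions.

Section Fourier.
Context {R : realType} {n : nat}.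
Implicit Types f F g : Rn R n -> R[i].

Let mu : {measure set (Rn R n) -> \bar R} := lebesgue_Rn n.

Definition cis (theta : R) : R[i] := Complex (cos theta) (sin theta).

Definition cball (r : R) : set (Rn R n) := [set x | enorm x <= r].

Definition fourier_trunc f (r : R) (xi : Rn R n) : R[i] :=
  cintegral mu (cball r) (fun x => cis (- dotp x xi) * f x).

Definition inv_fourier_trunc F (r : R) (x : Rn R n) : R[i] :=
  Complex (((2 * pi) ^+ n)^-1) 0 *
  cintegral mu (cball r) (fun xi => cis (dotp x xi) * F xi).

(* The (inverse) Fourier transform on L^2: its defining integral, which need
   not converge absolutely, is the L^2-limit of the integrals over the balls of
   radius k. As a relation it determines F from f (resp. f from F) up to
   Lebesgue null sets. *)
Definition is_fourier f F : Prop :=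
  [/\ L2 mu f, L2 mu F &
      L2norm mu (fun xi => fourier_trunc f k%:R xi - F xi)
        @[k --> \oo] --> (0 : \bar R)].

Definition is_inv_fourier F f : Prop :=
  [/\ L2 mu F, L2 mu f &
      L2norm mu (fun x => inv_fourier_trunc F k%:R x - f x)
        @[k --> \oo] --> (0 : \bar R)].

Definition is_multiplier (m f g : Rn R n -> R[i]) : Prop :=
  exists2 F, is_fourier f F & is_inv_fourier (fun xi => m xi * F xi) g.

(* g = D^sigma f *)
Definition is_D (sigma : R) f g : Prop :=
  is_multiplier (fun xi => Complex (enorm xi `^ sigma) 0) f g.

(* u(., t) = e^{i t D^a} f for every t, where u is a jointly measurable
   representative of the solution. *)
Definition is_flow (a : R) f (u : spacetime R n -> R[i]) : Prop :=
  cmeasurable u /\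
  forall t : R,
    is_multiplier (fun xi => cis (t * enorm xi `^ a)) f (fun x => u (x, t)).

End Fourier.

Section MorreyCampanato.
Context {R : realType} {n : nat}.
Implicit Types w : spacetime R n -> \bar R.

Let nu : {measure set (spacetime R n) -> \bar R} := lebesgue_spacetime n.

Definition cube (x : Rn R n) (r : R) : set (Rn R n) :=
  [set y | forall i, `|(tnth y i : R) - (tnth x i : R)| <= r / 2].

Definition centered_itv (t l : R) : set (measurableTypeR R) :=
  [set s | `|(s : R) - t| <= l / 2].

Definition weight w : Prop :=
  [/\ measurable_fun [set: spacetime R n] w,
      forall z, (0 <= w z)%E,
      forall r : R,
        (\int[nu]_(z in cball r `*` centered_itv 0 (2 * r)) w z < +oo)%E &
      nu.-negligible [set z | w z = 0%E \/ w z = +oo%E]].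

Definition morrey_norm (a beta p : R) w : \bar R :=
  ereal_sup [set m : \bar R |
    exists (x : Rn R n) (t r : R), 0 < r /\
      m = ((r `^ beta)%:E *
            (((r `^ (n%:R + a))^-1)%:E *
              \int[nu]_(z in cube x r `*` centered_itv t (r `^ a))
                (w z `^ p)) `^ p^-1)%E].

(* w belongs to the a-parabolic class of exponents beta and p. *)
Definition morrey_class (a beta p : R) w : Prop :=
  weight w /\ (morrey_norm a beta p w < +oo)%E.

End MorreyCampanato.

(* Main.v *)
(* Since f is radial, u(x, .) is the one-dimensional Fourier transform, in
   tau = |xi|^a, of m_x(tau) Phi(tau), where m_x(tau) = S(|x| tau^(1/a)) and the
   normalized Bessel kernel S decays, with its derivative, like s^(-(n-1)/2).
   For |x| ~ r and |xi| ~ rho put M = max(r, 1/rho). On a time interval of length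
   M^a the transform sees Phi averaged at scale M^(-a), a scale at which m_x is
   nearly constant; integrating by parts, both the supremum and the L^2 norm of
   u(x, .) over the interval are controlled, uniformly in x, by local averages
   of the transform of Phi alone, whose total over all intervals is bounded by
   Plancherel. The Morrey hypothesis enters, on a parabolic cube of side ~ M,
   through
     W Y <= lam Y + lam^(1-p) (sup Y) W^p,   W = w^b,
   and the optimal lam leaves the factor min(r rho, 1/(r rho))^eps with
   eps = min(b - 1 - a/p, n - n/p) > 0, so that the dyadic pieces can be summed.
   General data are reached by Fatou's lemma from the truncated transforms of f,
   which are continuous functions of |xi|.

   The Fourier analysis comes from Gaussians. Two kernels with equal integrals
   against exp(-l |xi|^2), l = 1, 2, ..., have equal integrals against all
   functions of |xi|; this yields polar coordinates and the Bessel formula. The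
   weighted bound of F by g = D^((b-a)/2) f comes from testing against
   combinations of the exp(-l |xi|^2), which Weierstrass' theorem makes dense. *)

(* The interval length M^a meets two demands at once. By the chain rule |m_x'| is at most about r
   rho^(1-a) times the size of the Bessel kernel, and r rho^(1-a) <= M^a because a > 1; so m_x
   changes by no more than its own size over frequencies M^(-a). And M^a is the time length of a
   parabolic cube of side M >= r, large enough to hold the shell after a dilation by 4. The kernel
   contributes min(1, (r rho)^(1-n)) to |u|^2; times the optimal lam r^n this is at most rho^(b-n)
   times (r rho)^(a/p+1-b) for r rho >= 1 and (r rho)^(n-n/p) for r rho <= 1. That both rates are
   favourable is p > a/(b-1) and p > 1.

   The transform, D^sigma and the flow are relations given by L^2 limits, the flow separately at
   each time, so that nothing is known of u pointwise. Everything is proved for frequencies and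
   positions in a dyadic annulus, where all integrals converge absolutely, and carried to the limit
   by weak convergence and Fatou. One-sided estimates survive this and suffice: Plancherel on the
   line is only an inequality, and Parseval on R^n is computed for Gaussians alone. *)
Require Import Defs.
From HB Require Import structures.
From mathcomp Require Import all_boot all_order all_algebra.
From mathcomp Require Import all_classical all_reals all_analysis.
From mathcomp Require Import measurable_realfun complex ring lra.

Set Implicit Arguments.
Unset Strict Implicit.
Unset Printing Implicit Defensive.

Import Order.TTheory GRing.Theory Num.Theory.
Import numFieldNormedType.Exports.

Local Open Scope classical_set_scope.
Local Open Scope ring_scope.

(** * Integration on R^n *)

Section RnMeasure.
Context {R : realType}.
Local Notation leb := (@lebesgue_measure R).

Lemma measurable_tnthR n (i : 'I_n) : measurable_fun setT (fun x : Rn R n => (tnth x i : measurableTypeR R)).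
Proof. exact: measurable_tnth. Qed.

Lemma measurable_cube n (x : Rn R n) r : measurable (cube x r).
Proof.
have -> : cube x r = \bigcap_(i in [set: 'I_n]) [set y | `|(tnth y i : R) - (tnth x i : R)| <= r / 2].
  apply/seteqP; split => y /=; first by move=> h i _; exact: h.
  by move=> h i; exact: h.
apply: fin_bigcap_measurable => // i _.
rewrite -[X in measurable X]setTI.
have mf : measurable_fun setT (fun y : Rn R n => `|(tnth y i : R) - (tnth x i : R)|).
  apply: measurableT_comp => //.
  apply: measurable_funB => //; exact: measurable_tnthR.
have := mf measurableT `]-oo, (r/2)]%classic (measurable_itv _).
by congr measurable; apply/seteqP; split => y /=; rewrite in_itv.
Qed.

Lemma centered_itvE (t l : R) : centered_itv t l = `[t - l / 2, t + l / 2]%classic.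
Proof.
apply/seteqP; split => s; rewrite /centered_itv /= in_itv /= ler_norml.
  by move=> /andP[h1 h2]; apply/andP; split; lra.
by move=> /andP[h1 h2]; apply/andP; split; lra.
Qed.

Lemma measurable_centered_itv (t l : R) : measurable (centered_itv t l).
Proof. by rewrite centered_itvE; exact: measurable_itv. Qed.

Lemma lebesgue_Rn_cube n (x : Rn R n) r : 0 <= r -> lebesgue_Rn n (cube x r) = (r ^+ n)%:E.
Proof.
move=> r0; elim: n x => [|n IHn] x.
  rewrite /= diracE mem_set ?expr0// => -[] //.
case/tupleP: x => t x /=.
rewrite /pushforward.
have -> : (@Rn_cons R n) @^-1` cube [tuple of t :: x] r = cube x r `*` centered_itv t r.
  apply/seteqP; split => -[y s] /=.
    move=> h; split => [i|]; last by have := h ord0; rewrite !tnth0.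
    by have := h (lift ord0 i); rewrite !tnthS.
  move=> [h1 h2] i; case: (unliftP ord0 i) => [j ->|->]; last by rewrite !tnth0.
  by rewrite !tnthS; exact: h1.
rewrite product_measure1E; [|exact: measurable_cube|exact: measurable_centered_itv].
rewrite [X in (X * _)%E]IHn centered_itvE.
rewrite [X in (_ * X)%E](lebesgue_measure_itv `[t - r/2, t + r/2]) /= lte_fin.
case: ifPn => h.
  rewrite -EFinD -EFinM exprS; congr (_%:E); lra.
have -> : r = 0 by lra.
by rewrite mule0 exprS mul0r.
Qed.

Lemma sigma_finite_lebesgue_Rn n : sigma_finite setT (@lebesgue_Rn R n).
Proof.
exists (fun k : nat => cube ([tuple of nseq n 0] : Rn R n) (2 * k%:R)); last first.
  move=> k; split; first exact: measurable_cube.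
  by rewrite lebesgue_Rn_cube ?mulr_ge0// ltry.
apply/esym/seteqP; split => // x _ /=.
pose m := \sum_(i < n) `|(tnth x i : R)|.
exists (Num.truncn m).+1 => //= i.
rewrite [X in _ - X](_ : _ = 0) ?subr0; last by rewrite tnth_nseq.
have h : `|(tnth x i : R)| <= m.
  by rewrite /m (bigD1 i)//= lerDl sumr_ge0.
apply: (le_trans h).
rewrite mulrC mulrA mulVf// mul1r ltW//.
exact: truncnS_gt.
Qed.

End RnMeasure.

(** * Real-valued integrals *)

Section RealIntegral.
Context d (T : measurableType d) (R : realType) (mu : {measure set T -> \bar R}).
Implicit Types f g : T -> R.

Definition intgr f : Prop := mu.-integrable [set: T] (EFin \o f).
Definition Rint f : R := Rintegral mu [set: T] f.

Lemma intgr_meas f : intgr f -> measurable_fun setT f.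
Proof. by move=> /integrableP[/measurable_EFinP]. Qed.

Lemma intgr_dom f g : measurable_fun setT f -> (forall x, `|f x| <= g x) ->
  intgr g -> intgr f.
Proof.
move=> mf fg; apply: le_integrable => //; first exact/measurable_EFinP.
move=> x _ /=; rewrite lee_fin (le_trans (fg x))//.
by rewrite ger0_norm// (le_trans _ (fg x)).
Qed.

Lemma intgrD f g : intgr f -> intgr g -> intgr (fun x => f x + g x).
Proof. by move=> hf hg; exact: (integrableD measurableT hf hg). Qed.

Lemma intgrB f g : intgr f -> intgr g -> intgr (fun x => f x - g x).
Proof. by move=> hf hg; exact: (integrableB measurableT hf hg). Qed.

Lemma intgrZl k f : intgr f -> intgr (fun x => k * f x).
Proof. by move=> hf; exact: (integrableZl measurableT k hf). Qed.

Lemma intgr_norm f : intgr f -> intgr (fun x => `|f x|).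
Proof. by move=> hf; exact: (integrable_norm hf). Qed.

Lemma EFin_Rint f : intgr f -> (Rint f)%:E = (\int[mu]_x (f x)%:E)%E.
Proof. by move=> hf; rewrite /Rint /Rintegral fineK//; exact: integrable_fin_num. Qed.

Lemma RintD f g : intgr f -> intgr g -> Rint (fun x => f x + g x) = Rint f + Rint g.
Proof. by move=> hf hg; rewrite /Rint (RintegralD measurableT hf hg). Qed.

Lemma RintB f g : intgr f -> intgr g -> Rint (fun x => f x - g x) = Rint f - Rint g.
Proof. by move=> hf hg; rewrite /Rint (RintegralB measurableT hf hg). Qed.

Lemma RintZl k f : intgr f -> Rint (fun x => k * f x) = k * Rint f.
Proof. by move=> hf; rewrite /Rint (RintegralZl k measurableT hf). Qed.

Lemma Rint_le f g : intgr f -> intgr g -> (forall x, f x <= g x) -> Rint f <= Rint g.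
Proof. by move=> hf hg fg; rewrite /Rint; apply: (le_Rintegral measurableT hf hg). Qed.

Lemma Rint_ge0 f : (forall x, 0 <= f x) -> 0 <= Rint f.
Proof. by move=> h; apply: Rintegral_ge0. Qed.

Lemma Rint_norm f : intgr f -> `|Rint f| <= Rint (fun x => `|f x|).
Proof. by move=> hf; exact: (le_normr_Rintegral measurableT hf). Qed.

Lemma eq_Rint f g : f =1 g -> Rint f = Rint g.
Proof. by move=> /funext ->. Qed.

Lemma Rint0 : Rint (fun=> 0) = 0.
Proof. by rewrite /Rint /Rintegral integral0. Qed.

Lemma intgr0 : intgr (fun=> 0).
Proof. exact: integrable0. Qed.

Lemma intgr_lty f : (forall x, 0 <= f x) -> measurable_fun setT f ->
  (\int[mu]_x (f x)%:E < +oo)%E -> intgr f.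
Proof.
move=> f0 mf h; apply/integrableP; split; first exact/measurable_EFinP.
by under eq_integral do rewrite /= ger0_norm//.
Qed.

Lemma intgr_sum I (s : seq I) (h : I -> T -> R) : (forall i, intgr (h i)) ->
  intgr (fun x => \sum_(i <- s) h i x).
Proof.
move=> hi; elim: s => [|i s IHs].
  by under eq_fun do rewrite big_nil; exact: intgr0.
by under eq_fun do rewrite big_cons; exact: intgrD.
Qed.

Lemma Rint_sum I (s : seq I) (h : I -> T -> R) : (forall i, intgr (h i)) ->
  Rint (fun x => \sum_(i <- s) h i x) = \sum_(i <- s) Rint (h i).
Proof.
move=> hi; elim: s => [|i s IHs].
  by under eq_Rint do rewrite big_nil; rewrite big_nil Rint0.
under eq_Rint do rewrite big_cons.
by rewrite RintD ?big_cons ?IHs//; exact: intgr_sum.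
Qed.

Lemma Rint_cvg (f_ : nat -> T -> R) f g : (forall n, measurable_fun setT (f_ n)) ->
  (forall x, f_ ^~ x @ \oo --> f x) -> intgr g -> (forall n x, `|f_ n x| <= g x) ->
  intgr f /\ (fun n => Rint (f_ n)) @ \oo --> Rint f.
Proof.
move=> mf_ cf ig fg.
have mf : measurable_fun setT f by apply: (measurable_fun_cvg mf_) => x _; exact: cf.
have [||||h1 _ h3] := @dominated_convergence _ _ _ mu _ measurableT
  (fun n => EFin \o f_ n) (EFin \o f) (EFin \o g) _ _ _ ig.
- by move=> n; exact/measurable_EFinP.
- exact/measurable_EFinP.
- by apply: aeW => x _; apply: cvg_EFin; [exact: nearW|exact: cf].
- by apply: aeW => x n _; rewrite /= lee_fin.
by split => //; apply: (@fine_cvg _ _ _ _ (fun n => (\int[mu]_x (f_ n x)%:E)%E)); rewrite EFin_Rint.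
Qed.

End RealIntegral.

(** [lebesgue_Rn] is defined by recursion as a bare measure, while the Tonelli and Fubini theorems
    expect a packed sigma-finite one. The equation allows the exchange by rewriting. *)
Lemma sigma_finite_pack d (T : measurableType d) (R : realType)
    (m : {measure set T -> \bar R}) : sigma_finite setT m ->
  exists sm : {sigma_finite_measure set T -> \bar R}, (sm : {measure set T -> \bar R}) = m.
Proof.
case: m => m c s.
pose M : {measure set T -> \bar R} := Measure.Pack c.
by exists (HB.pack_for {sigma_finite_measure set T -> \bar R} m c (@Measure_isSigmaFinite.Build _ _ _ M s)).
Qed.

(** * Tonelli and Fubini for sigma-finite measures *)

Section Fubini.
Context d1 d2 (T1 : measurableType d1) (T2 : measurableType d2) (R : realType).
Variables (m1 : {measure set T1 -> \bar R}) (m2 : {measure set T2 -> \bar R}).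
Hypotheses (s1 : sigma_finite setT m1) (s2 : sigma_finite setT m2).

Section ge0.
Local Open Scope ereal_scope.
Variable f : T1 * T2 -> \bar R.
Hypotheses (mf : measurable_fun setT f) (f0 : forall z, 0 <= f z).

Lemma measurable_Tonelli1 : measurable_fun setT (fun x => \int[m2]_y f (x, y)).
Proof.
have [sm <-] := sigma_finite_pack s2.
exact: (@measurable_fun_fubini_tonelli_F _ _ _ _ _ sm).
Qed.

Lemma measurable_Tonelli2 : measurable_fun setT (fun y => \int[m1]_x f (x, y)).
Proof.
have [sm <-] := sigma_finite_pack s1.
exact: (@measurable_fun_fubini_tonelli_G _ _ _ _ _ sm).
Qed.

Lemma Tonelli : \int[m1]_x \int[m2]_y f (x, y) = \int[m2]_y \int[m1]_x f (x, y).
Proof.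
have [sm <-] := sigma_finite_pack s1; have [sm' <-] := sigma_finite_pack s2.
exact: (@fubini_tonelli _ _ _ _ _ sm sm').
Qed.
End ge0.

End Fubini.

Section Fubini_packed.
Context d1 d2 (T1 : measurableType d1) (T2 : measurableType d2) (R : realType).
Variables (m1 : {sigma_finite_measure set T1 -> \bar R}) (m2 : {sigma_finite_measure set T2 -> \bar R}).
Variable f : T1 * T2 -> R.
Variables (A : T1 -> R) (B : T2 -> R).
Hypotheses (mf : measurable_fun setT f) (iA : intgr m1 A) (iB : intgr m2 B).
Hypothesis fAB : forall x y, `|f (x, y)| <= A x * B y.

Let in1 y : intgr m1 (fun x => f (x, y)).
Proof.
apply: (@intgr_dom _ _ _ _ _ (fun x => B y * A x)); last exact: intgrZl.
  exact: measurableT_comp.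
by move=> x; rewrite mulrC.
Qed.

Let in2 x : intgr m2 (fun y => f (x, y)).
Proof.
apply: (@intgr_dom _ _ _ _ _ (fun y => A x * B y)) => //; last exact: intgrZl.
exact: measurableT_comp.
Qed.

Let g : T1 * T2 -> \bar R := EFin \o f.

Let ig : (m1 \x m2)%E.-integrable setT g.
Proof.
apply/integrable12ltyP; first exact/measurable_EFinP.
apply: (@le_lt_trans _ _ (\int[m1]_x (`|A x|%:E * \int[m2]_y `|B y|%:E))%E).
  apply: ge0_le_integral => //.
  - by move=> x _; exact: integral_ge0.
  - have := @measurable_fun_fubini_tonelli_F _ _ _ _ _ m2 (fun z => `|g z|%E); apply => //.
    by apply: measurableT_comp => //; exact/measurable_EFinP.
  - apply: emeasurable_funM => //; apply/measurable_EFinP.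
    by apply: measurableT_comp => //; exact: intgr_meas iA.
  - move=> x _; rewrite -ge0_integralZl//; last first.
      by apply/measurable_EFinP; apply: measurableT_comp => //; exact: intgr_meas iB.
    apply: ge0_le_integral => //.
    + by apply: measurableT_comp => //; apply/measurable_EFinP; exact: measurableT_comp.
    + apply: emeasurable_funM => //; apply/measurable_EFinP.
      by apply: measurableT_comp => //; exact: intgr_meas iB.
    + move=> y _; rewrite /g /= lee_fin (le_trans (fAB x y))//.
      by rewrite -normrM ler_norm.
have /integrableP[_ hA] := iA; have /integrableP[_ hB] := iB.
rewrite ge0_integralZr//; last 2 first.
- by apply/measurable_EFinP; apply: measurableT_comp => //; exact: intgr_meas iA.
- by apply: integral_ge0 => y _; rewrite lee_fin.
rewrite lte_mul_pinfty//; first by apply: integral_ge0 => y _; rewrite lee_fin.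
rewrite ge0_fin_numE//; by apply: integral_ge0 => y _; rewrite lee_fin.
Qed.

Let out1 : intgr m1 (fun x => Rint m2 (fun y => f (x, y))).
Proof.
apply: eq_integrable (integrable_fubini_F ig) => // x _; rewrite /fubini_F /=.
by rewrite EFin_Rint//; exact: in2.
Qed.

(** Domination by a product [A x * B y] makes every section integrable, not merely almost every one,
    so the inner integrals are honest real numbers at each point and no null set has to be carried
    along. *)
Lemma RFubini_packed : intgr m1 (fun x => Rint m2 (fun y => f (x, y))) /\
  Rint m1 (fun x => Rint m2 (fun y => f (x, y))) =
  Rint m2 (fun y => Rint m1 (fun x => f (x, y))).
Proof.
split; first exact: out1.
rewrite [RHS]/Rint [LHS]/Rint /Rintegral; congr fine.
have h := Fubini ig.
under eq_integral do rewrite (EFin_Rint (in2 _)).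
rewrite h; apply: eq_integral => y _; rewrite -(EFin_Rint (in1 _))//.
Qed.

End Fubini_packed.

Section RFubini.
Context d1 d2 (T1 : measurableType d1) (T2 : measurableType d2) (R : realType).
Variables (m1 : {measure set T1 -> \bar R}) (m2 : {measure set T2 -> \bar R}).
Hypotheses (s1 : sigma_finite setT m1) (s2 : sigma_finite setT m2).
Variable f : T1 * T2 -> R.
Variables (A : T1 -> R) (B : T2 -> R).
Hypotheses (mf : measurable_fun setT f) (iA : intgr m1 A) (iB : intgr m2 B).
Hypothesis fAB : forall x y, `|f (x, y)| <= A x * B y.

Lemma Fubini_in2 x : intgr m2 (fun y => f (x, y)).
Proof.
apply: (@intgr_dom _ _ _ _ _ (fun y => A x * B y)) => //; last exact: intgrZl.
exact: measurableT_comp.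
Qed.

Lemma Fubini_out1 : intgr m1 (fun x => Rint m2 (fun y => f (x, y))).
Proof.
have [sm1 e1] := sigma_finite_pack s1; have [sm2 e2] := sigma_finite_pack s2.
move: iA iB; rewrite -e1 -e2 => iA' iB'.
by have [] := @RFubini_packed _ _ _ _ _ sm1 sm2 f A B mf iA' iB' fAB.
Qed.

Lemma RFubini : Rint m1 (fun x => Rint m2 (fun y => f (x, y))) =
  Rint m2 (fun y => Rint m1 (fun x => f (x, y))).
Proof.
have [sm1 e1] := sigma_finite_pack s1; have [sm2 e2] := sigma_finite_pack s2.
move: iA iB; rewrite -e1 -e2 => iA' iB'.
by have [] := @RFubini_packed _ _ _ _ _ sm1 sm2 f A B mf iA' iB' fAB.
Qed.

End RFubini.

Lemma Fubini_out2 d1 d2 (T1 : measurableType d1) (T2 : measurableType d2) (R : realType)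
  (m1 : {measure set T1 -> \bar R}) (m2 : {measure set T2 -> \bar R})
  (s1 : sigma_finite setT m1) (s2 : sigma_finite setT m2)
  (f : T1 * T2 -> R) (A : T1 -> R) (B : T2 -> R) :
  measurable_fun setT f -> intgr m1 A -> intgr m2 B ->
  (forall x y, `|f (x, y)| <= A x * B y) ->
  intgr m2 (fun y => Rint m1 (fun x => f (x, y))).
Proof.
move=> mf iA iB fAB.
apply: (@Fubini_out1 _ _ _ _ _ m2 m1 s2 s1 (fun z => f (z.2, z.1)) B A) => //.
  exact: (measurableT_comp mf (measurable_fun_pair measurable_snd measurable_fst)).
by move=> x y /=; rewrite mulrC.
Qed.

(** * Integration over R^(n+1) by slices *)

Section RnIntegral.
Context {R : realType}.
Local Notation leb := (@lebesgue_measure R).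

Lemma sigma_finite_leb : sigma_finite setT leb.
Proof. exact: sigma_finiteT. Qed.

Lemma Tonelli_prod d1 d2 (T1 : measurableType d1) (T2 : measurableType d2)
  (m1 : {measure set T1 -> \bar R}) (m2 : {sigma_finite_measure set T2 -> \bar R}) (s1 : sigma_finite setT m1)
  (f : T1 * T2 -> \bar R) : measurable_fun setT f -> (forall z, (0 <= f z)%E) ->
  (\int[m1 \x m2]_z f z = \int[m1]_x \int[m2]_y f (x, y))%E.
Proof.
move=> mf f0; have [sm1 e1] := sigma_finite_pack s1; rewrite -e1.
exact: (@fubini_tonelli1 _ _ _ _ _ sm1 m2 f).
Qed.

Lemma Fubini_prod d1 d2 (T1 : measurableType d1) (T2 : measurableType d2)
  (m1 : {measure set T1 -> \bar R}) (m2 : {sigma_finite_measure set T2 -> \bar R}) (s1 : sigma_finite setT m1)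
  (f : T1 * T2 -> \bar R) : measurable_fun setT f ->
  (\int[m1]_x \int[m2]_y `|f (x, y)| < +oo)%E ->
  (\int[m1 \x m2]_z f z = \int[m1]_x \int[m2]_y f (x, y))%E.
Proof.
move=> mf; have [sm1 <-] := sigma_finite_pack s1 => foo.
rewrite -(@integral12_prod_meas1 _ _ _ _ _ sm1 m2 f)//.
exact/integrable12ltyP.
Qed.

Lemma integral_Rn_S n (f : Rn R n.+1 -> \bar R) : measurable_fun setT f -> (forall x, 0 <= f x)%E ->
  (\int[lebesgue_Rn n.+1]_x f x = \int[lebesgue_Rn n]_x \int[leb]_t f (Rn_cons (x, t)))%E.
Proof.
move=> mf f0.
rewrite (ge0_integral_pushforward (@measurable_Rn_cons R n))// preimage_setT.
apply: (@Tonelli_prod _ _ _ _ (lebesgue_Rn n) leb (@sigma_finite_lebesgue_Rn R n) (fun z => f (Rn_cons z))) => //.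
exact: (measurableT_comp mf (@measurable_Rn_cons R n)).
Qed.

Lemma Rint_Rn_S n (f : Rn R n.+1 -> R) (A : Rn R n -> R) (B : R -> R) :
  measurable_fun setT f -> intgr (lebesgue_Rn n) A -> intgr leb B ->
  (forall x t, `|f (Rn_cons (x, t))| <= A x * B t) ->
  intgr (lebesgue_Rn n.+1) f /\
  Rint (lebesgue_Rn n.+1) f = Rint (lebesgue_Rn n) (fun x => Rint leb (fun t => f (Rn_cons (x, t)))).
Proof.
move=> mf iA iB h.
have mfc : measurable_fun setT (fun z : spacetime R n => f (Rn_cons z)).
  exact: (measurableT_comp mf (@measurable_Rn_cons R n)).
have iF : intgr (lebesgue_Rn n.+1) f.
  apply/integrableP; split; first exact/measurable_EFinP.
  have mN : measurable_fun setT (abse \o (EFin \o f)).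
    by apply: measurableT_comp => //; exact/measurable_EFinP.
  rewrite (integral_Rn_S mN)//; last by move=> x; exact: abse_ge0.
  have i1 := @Fubini_out1 _ _ _ _ _ (lebesgue_Rn n) leb (@sigma_finite_lebesgue_Rn _ n) sigma_finite_leb
     (fun z => `|f (Rn_cons z)|) A B (measurableT_comp (@normr_measurable _ _) mfc) iA iB.
  have i2 x : intgr leb (fun t => `|f (Rn_cons (x, t))|).
    apply: (@Fubini_in2 _ _ _ _ _ leb (fun z => `|f (Rn_cons z)|) A B) => //.
      exact: (measurableT_comp (@normr_measurable _ _) mfc).
    by move=> y t; rewrite normr_id.
  under eq_integral do rewrite -(EFin_Rint (i2 _)).
  rewrite -EFin_Rint ?ltry//; apply: i1.
  by move=> x t; rewrite normr_id.
split=> //.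
have i1 := @Fubini_out1 _ _ _ _ _ (lebesgue_Rn n) leb (@sigma_finite_lebesgue_Rn _ n) sigma_finite_leb
  (fun z => f (Rn_cons z)) A B mfc iA iB h.
have i2 x : intgr leb (fun t => f (Rn_cons (x, t))).
  exact: (@Fubini_in2 _ _ _ _ _ leb (fun z => f (Rn_cons z)) A B).
apply: EFin_inj; rewrite !EFin_Rint//.
under [RHS]eq_integral do rewrite EFin_Rint//.
have mE : measurable_fun setT (EFin \o f) by exact/measurable_EFinP.
have mN : measurable_fun setT (abse \o (EFin \o f)) by exact: measurableT_comp.
move: (iF) => /integrableP[_ iF'].
rewrite (integral_pushforward (@measurable_Rn_cons R n) (f := EFin \o f))//; last first.
  rewrite preimage_setT; apply/integrableP; split; first exact/measurable_EFinP.
  by move: iF'; rewrite (ge0_integral_pushforward (@measurable_Rn_cons R n)).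
rewrite preimage_setT.
apply: (@Fubini_prod _ _ _ _ (lebesgue_Rn n) leb (@sigma_finite_lebesgue_Rn R n) (fun z => (f (Rn_cons z))%:E)) => //.
  exact/measurable_EFinP.
by move: iF'; rewrite integral_Rn_S.
Qed.

End RnIntegral.

(** * Weierstrass approximation and the moment problem *)

Section Weierstrass.
Context {R : realType}.
Implicit Types (x y : R) (q : R -> R).

(* [(bernstein N phi).[x]] is the expectation of [phi k] for [k] binomial with
   parameters [N] and [x]; the recursion conditions on the first trial. *)
Fixpoint bernstein (N : nat) (phi : nat -> R) : {poly R} :=
  if N is N'.+1 then
   'X * bernstein N' (fun k => phi k.+1) + (1 - 'X) * bernstein N' phi
  else (phi 0%N)%:P.

Lemma bernsteinS N phi x : (bernstein N.+1 phi).[x] =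
  x * (bernstein N (fun k => phi k.+1)).[x] + (1 - x) * (bernstein N phi).[x].
Proof. by rewrite /= !hornerE. Qed.

Lemma bernstein_lin N (phi psi : nat -> R) (c x : R) :
  (bernstein N (fun k => phi k + c * psi k)).[x] = (bernstein N phi).[x] + c * (bernstein N psi).[x].
Proof.
elim: N phi psi => [|N IH] phi psi; first by rewrite !hornerC.
by rewrite !bernsteinS !IH; ring.
Qed.

Lemma bernstein_cst N (c x : R) : (bernstein N (fun=> c)).[x] = c.
Proof. by elim: N => [|N IH]; rewrite ?hornerC// bernsteinS IH; ring. Qed.

(** The centre [c] is left free so that the induction closes: a success at the first trial shifts it
    to [c - 1]. *)
Lemma bernstein_var N (c x : R) :
  (bernstein N (fun k => (k%:R - c) ^+ 2)).[x] = (N%:R * x - c) ^+ 2 + N%:R * (x * (1 - x)).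
Proof.
elim: N c => [|N IH] c; first by rewrite hornerC; ring.
rewrite bernsteinS.
have -> : bernstein N (fun k => (k.+1%:R - c) ^+ 2) = bernstein N (fun k => (k%:R - (c - 1)) ^+ 2).
  by congr bernstein; apply/funext => k; rewrite -natr1; ring.
by rewrite !IH -natr1; ring.
Qed.

Lemma bernstein_le N (phi psi : nat -> R) x : 0 <= x <= 1 ->
  (forall k, (k <= N)%N -> phi k <= psi k) -> (bernstein N phi).[x] <= (bernstein N psi).[x].
Proof.
move=> /andP[x0 x1]; elim: N phi psi => [|N IH] phi psi h; first by rewrite !hornerC h.
rewrite !bernsteinS lerD// ler_wpM2l ?subr_ge0//; apply: IH => k kN; by apply: h; rewrite ?ltnS// (leq_trans kN).
Qed.

(** Bernstein polynomials control second moments only, so the modulus of continuity is put in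
    quadratic form. Uniform continuity gives [e] for points closer than [d]; for the others the
    bound 2M on the difference is at most (2M / d^2) (x - y)^2. *)
Lemma quadratic_modulus q (e : R) : continuous q -> 0 < e ->
  exists2 C : R, 0 <= C & forall x y, 0 <= x <= 1 -> 0 <= y <= 1 ->
    `|q x - q y| <= e + C * (x - y) ^+ 2.
Proof.
move=> cq e0.
have K := @segment_compact R 0 1.
have [M M0 hM] : exists2 M : R, 0 <= M & forall x, 0 <= x <= 1 -> `|q x| <= M.
  have h01 : (0 : R) <= 1 by [].
  have [c _ hc] := @EVT_max R (fun x => `|q x|) 0 1 h01 (continuous_subspaceT (fun x => continuous_comp (cq x) (@norm_continuous _ _ _))).
  by exists `|q c| => // x x01; apply: hc; rewrite in_itv.
have [d d0 hd] : exists2 d : R, 0 < d & forall x y, 0 <= x <= 1 -> `|x - y| < d -> `|q x - q y| < e.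
  move: K => /compact_near_coveringP => K.
  have : \forall d \near (0:R)^'+, `[0, 1]%classic `<=` (fun x => forall y, `|x - y| < d -> `|q x - q y| < e).
    apply: K => x _.
    have [r r0 hr] : exists2 r, 0 < r & forall z, `|x - z| < r -> `|q x - q z| < e / 2.
      have /cvgrPdist_lt /(_ (e / 2)) := cq x; rewrite divr_gt0// => /(_ isT) /nbhs_ballP[r r0 hr].
      by exists r => // z xz; exact: hr.
    have r2 : r / 2 < r by rewrite ltr_pdivrMr// ltr_pMr// ltr1n.
    near=> x' d => y dy.
    have xx' : `|x - x'| < r / 2.
      by near: x'; apply: nbhsx_ballx; rewrite divr_gt0.
    have dr : d < r / 2 by near: d; apply: nbhs_right_lt; rewrite divr_gt0.
    rewrite -(subrKA (q x)) (le_lt_trans (ler_normD _ _))//.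
    rewrite [ltRHS](splitr e) ltrD//.
      by rewrite distrC hr// (lt_trans xx').
    apply: hr; rewrite -(subrKA x') (le_lt_trans (ler_normD _ _))//.
    by rewrite [ltRHS](splitr r) ltrD// (lt_trans dy).
  move=> h; have [d [d0 hd]] := filter_ex (filterI (nbhs_right_gt 0) h).
  by exists d => // x y x01 xy; apply: hd => //=; rewrite in_itv.
exists (2 * M / d ^+ 2) => [|x y hx hy]; first by apply: divr_ge0; [apply: mulr_ge0|apply: sqr_ge0].
have [xy|xy] := ltP `|x - y| d.
  rewrite (le_trans (ltW (hd _ _ hx xy)))// lerDl; apply: mulr_ge0; rewrite ?sqr_ge0//.
  by apply: divr_ge0; [apply: mulr_ge0|apply: sqr_ge0].
apply: (@le_trans _ _ (2 * M)).
  by rewrite (le_trans (ler_normB _ _))// mulr2n mulrDl !mul1r lerD ?hM.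
rewrite -[leLHS]add0r lerD ?(ltW e0)//.
rewrite -mulrA ler_peMr ?mulr_ge0// -(real_normK (num_real (x - y))).
rewrite ler_pdivlMl ?exprn_gt0// mulr1 lerXn2r// nnegrE ?normr_ge0// ltW//.
Unshelve. all: by end_near.
Qed.

(** Bernstein's proof: the mean of k/N is x and its variance x(1-x)/N, so the quadratic modulus
    costs e/2 + C/N at most, and [N] is taken with C/N <= e/2. *)
Lemma Weierstrass q (e : R) : continuous q -> 0 < e ->
  exists p : {poly R}, forall x, 0 <= x <= 1 -> `|q x - p.[x]| <= e.
Proof.
move=> cq e0; have e20 : 0 < e / 2 by rewrite divr_gt0.
have [C C0 hC] := quadratic_modulus cq e20.
pose N := (Num.truncn (C / (e / 2))).+1.
have N0 : 0 < N%:R :> R by rewrite ltr0n.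
have CN : C / N%:R <= e / 2.
  rewrite ler_pdivrMr// mulrC -ler_pdivrMr// ltW// /N; exact: truncnS_gt.
exists (bernstein N (fun k => q (k%:R / N%:R))) => x x01.
have key : forall k, (k <= N)%N -> `|q x - q (k%:R / N%:R)| <=
    e / 2 + (C / N%:R ^+ 2) * (k%:R - N%:R * x) ^+ 2.
  move=> k kN; have /(hC _ _ x01) : 0 <= (k%:R : R) / N%:R <= 1.
    by rewrite divr_ge0 ?ler0n//= ler_pdivrMr// mul1r ler_nat.
  move/le_trans; apply; rewrite lerD2l -mulrA ler_wpM2l// le_eqVlt; apply/orP; left; apply/eqP.
  by field; rewrite gt_eqF.
have bnd : (bernstein N (fun k => e / 2 + C / N%:R ^+ 2 * (k%:R - N%:R * x) ^+ 2)).[x] <= e.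
  rewrite bernstein_lin bernstein_cst bernstein_var subrr expr0n/= add0r.
  have -> : C / N%:R ^+ 2 * (N%:R * (x * (1 - x))) = C / N%:R * (x * (1 - x)).
    by field; rewrite gt_eqF.
  have : C / N%:R * (x * (1 - x)) <= e / 2 * 1.
    by case/andP: x01 => x0 x1; apply: ler_pM => //; [rewrite divr_ge0|nra|nra].
  by lra.
have E : (bernstein N (fun k => q (k%:R / N%:R))).[x] - q x =
   (bernstein N (fun k => q (k%:R / N%:R) + (-1) * q x)).[x].
  by rewrite (@bernstein_lin N _ (fun=> q x)) bernstein_cst; ring.
have E2 : q x - (bernstein N (fun k => q (k%:R / N%:R))).[x] =
   (bernstein N (fun k => q x + (-1) * q (k%:R / N%:R))).[x].
  by rewrite (@bernstein_lin N (fun=> q x)) bernstein_cst; ring.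
rewrite ler_norml; apply/andP; split; last first.
  rewrite E2 (le_trans _ bnd)// bernstein_le// => k kN.
  by rewrite (le_trans _ (key k kN))// mulN1r ler_norm.
rewrite lerNl opprB E (le_trans _ bnd)// bernstein_le// => k kN.
by rewrite (le_trans _ (key k kN))// mulN1r distrC ler_norm.
Qed.

End Weierstrass.

(** * Hausdorff's moment problem *)

Section density.
Context d (T : measurableType d) (R : realType) (m : {measure set T -> \bar R}).
Variables (k y : T -> R).
Hypotheses (mk : measurable_fun setT k) (k0 : forall x, 0 <= k x) (my : measurable_fun setT y).
Local Open Scope ereal_scope.
Import HBNNSimple.

Let dens (A : set (measurableTypeR R)) := \int[m]_(x in y @^-1` A) (k x)%:E.

Let mpre (A : set (measurableTypeR R)) : measurable A -> measurable (y @^-1` A).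
Proof. by move=> mA; rewrite -[X in measurable X]setTI; exact: my. Qed.

Let dens0 : dens set0 = 0.
Proof. by rewrite /dens preimage_set0 integral_set0. Qed.

Let dens_ge0 A : 0 <= dens A.
Proof. by apply: integral_ge0 => x _; rewrite lee_fin. Qed.

Let dens_sadd : semi_sigma_additive dens.
Proof.
move=> F mF tF mUF; rewrite /dens preimage_bigcup ge0_integral_bigcup//.
- by apply: is_cvg_ereal_nneg_natsum_cond => n _ _; exact: dens_ge0.
- by move=> i; exact: mpre.
- by apply/measurable_EFinP/measurable_funTS.
- by move=> x _; rewrite lee_fin.
- apply/trivIsetP => i j _ _ ij; rewrite -preimage_setI.
  by move/trivIsetP: tF => ->//; rewrite preimage_set0.
Qed.

(** The image under y of the measure with density k. It turns f |-> int k f(y) into integration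
    against a measure on the line, so that an identity for all f can be tested on a generating class
    of sets. *)
Lemma density_pushforward : exists D : {measure set (measurableTypeR R) -> \bar R},
  (forall A, D A = \int[m]_(x in y @^-1` A) (k x)%:E) /\
  (forall f : measurableTypeR R -> \bar R, measurable_fun setT f -> (forall x, 0 <= f x) ->
    \int[D]_x f x = \int[m]_x ((k x)%:E * f (y x))).
Proof.
pose D : {measure set (measurableTypeR R) -> \bar R} :=
  HB.pack dens (isMeasure.Build _ _ _ dens dens0 dens_ge0 dens_sadd).
exists D; split => // f mf f0.
pose h := nnsfun_approx measurableT mf.
have hf x : (h n x)%:E @[n --> \oo] --> f x by exact: cvg_nnsfun_approx.
have nd x a b : (a <= b)%N -> (h a x <= h b x)%R by move=> ab; exact/lefP/nd_nnsfun_approx.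
have mh n : measurable_fun setT (fun x => (h n x)%:E).
  by apply/measurable_EFinP; exact: measurable_funP.
have mhy n : measurable_fun setT (fun x => (h n (y x))%:E) by exact: (measurableT_comp (mh n) my).
have -> : \int[D]_x f x = lim (\int[D]_x (h n x)%:E @[n --> \oo]).
  under eq_integral => x _ do rewrite -(cvg_lim (@ereal_hausdorff _) (hf x)).
  apply: monotone_convergence => //.
    by move=> n x _; rewrite lee_fin.
  by move=> x _ a b ab; rewrite lee_fin; exact: nd.
have -> : \int[m]_x ((k x)%:E * f (y x)) = lim (\int[m]_x ((k x)%:E * (h n (y x))%:E) @[n --> \oo]).
  have kf x : (k x)%:E * (h n (y x))%:E @[n --> \oo] --> (k x)%:E * f (y x) by apply: cvgeZl.
  under eq_integral => x _ do rewrite -(cvg_lim (@ereal_hausdorff _) (kf x)).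
  apply: monotone_convergence => //.
  - by move=> n; apply: emeasurable_funM => //; exact/measurable_EFinP.
  - by move=> n x _; rewrite mule_ge0 ?lee_fin.
  - by move=> x _ a b ab; apply: lee_wpmul2l; rewrite lee_fin ?k0//; exact: nd.
apply: (congr1 (fun u : nat -> \bar R => limn u)); apply/funext => n.
under [LHS]eq_integral do rewrite fimfunE -fsumEFin//.
under [RHS]eq_integral => x _.
  rewrite (fimfunE (h n) (y x)) -fsumEFin// ge0_mule_fsumr; last by move=> r; exact: nnfun_muleindic_ge0.
  over.
have mi r : measurable_fun setT (fun x => (r * \1_(h n @^-1` [set r]) x)%:E).
  by apply/measurable_EFinP; apply: measurable_funM.
rewrite ge0_integral_fsum//; last by move=> r x _; exact: nnfun_muleindic_ge0.
rewrite ge0_integral_fsum//; last 2 first.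
- move=> r; apply: emeasurable_funM => //; first exact/measurable_EFinP.
  exact: (measurableT_comp (mi r) my).
- by move=> r x _; apply: mule_ge0; [rewrite lee_fin|rewrite EFinM nnfun_muleindic_ge0].
apply: eq_fsbigr => r /[!inE] -[x _ rE].
have r0 : (0 <= r)%R by rewrite -rE.
under eq_integral do rewrite EFinM.
rewrite ge0_integralZl//; last by apply/measurable_EFinP.
rewrite integral_indic// setIT.
under [RHS]eq_integral do rewrite EFinM muleCA.
have mp : measurable (y @^-1` (h n @^-1` [set r])) by exact: mpre.
rewrite ge0_integralZl//; last 2 first.
- apply: emeasurable_funM; first exact/measurable_EFinP.
  apply: (eq_measurable_fun (EFin \o \1_(y @^-1` (h n @^-1` [set r])))) => //.
  by apply/measurable_EFinP; exact: measurable_indic.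
- by move=> z _; rewrite mule_ge0 ?lee_fin.
congr (_ * _); rewrite /= /dens integral_mkcond.
apply: eq_integral => z _; rewrite patchE indicE.
case: ifPn => [/set_mem hz|/negP hz]; first by rewrite mem_set ?mule1.
by rewrite memNset ?mule0// => h'; apply: hz; exact/mem_set.
Qed.

End density.

Section Hausdorff1.
Context (R : realType) d (T : measurableType d) (m : {measure set T -> \bar R}).
Variables (k y : T -> R).
Hypotheses (k0 : forall x, 0 <= k x) (ik : intgr m k).
Hypotheses (my : measurable_fun setT y) (y01 : forall x, 0 <= y x <= 1).

Lemma intgr_kq (q : R -> R) (B : R) : measurable_fun setT q ->
  (forall x, 0 <= x <= 1 -> `|q x| <= B) -> intgr m (fun x => k x * q (y x)).
Proof.
move=> mq qB; apply: (@intgr_dom _ _ _ _ _ (fun x => B * k x)); last exact: intgrZl.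
  by apply: measurable_funM; [exact: intgr_meas ik|exact: measurableT_comp].
by move=> x; rewrite normrM (ger0_norm (k0 x)) mulrC ler_wpM2r// qB.
Qed.

Lemma Rint_kpoly (p : {poly R}) : intgr m (fun x => k x * p.[y x]) /\
  Rint m (fun x => k x * p.[y x]) = \sum_(j < size p) p`_j * Rint m (fun x => k x * y x ^+ j).
Proof.
have ij (j : nat) : intgr m (fun x => k x * y x ^+ j).
  apply: (@intgr_kq (fun z => z ^+ j) 1); first exact: exprn_measurable.
  by move=> x /andP[x0 x1]; rewrite ger0_norm ?exprn_ge0// exprn_ile1.
have E : (fun x => k x * p.[y x]) = (fun x => \sum_(j < size p) (p`_j * (k x * y x ^+ j))).
  apply/funext => x; rewrite horner_coef big_distrr/=; apply: eq_bigr => j _; ring.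
rewrite E; split; first by apply: intgr_sum => j; exact: intgrZl.
rewrite Rint_sum; last by move=> j; exact: intgrZl.
by apply: eq_bigr => j _; rewrite RintZl.
Qed.

Lemma Rint_kapprox (q : R -> R) (p : {poly R}) (e : R) : continuous q ->
  (forall x, 0 <= x <= 1 -> `|q x - p.[x]| <= e) ->
  `|Rint m (fun x => k x * q (y x)) - Rint m (fun x => k x * p.[y x])| <= e * Rint m k.
Proof.
move=> cq qp.
have mq : measurable_fun setT q by exact: continuous_measurable_fun.
have mp : measurable_fun setT (fun x => p.[x]) by apply: continuous_measurable_fun; exact: continuous_horner.
have id : intgr m (fun x => k x * (q (y x) - p.[y x])).
  by apply: (@intgr_kq (fun z => q z - p.[z]) e) => //; exact: measurable_funB.
have [ip _] := Rint_kpoly p.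
have iq : intgr m (fun x => k x * q (y x)).
  have : intgr m (fun x => k x * (q (y x) - p.[y x]) + k x * p.[y x]) by exact: intgrD.
  by congr intgr; apply/funext => x; ring.
rewrite -RintB//.
have -> : (fun x => k x * q (y x) - k x * p.[y x]) = (fun x => k x * (q (y x) - p.[y x])).
  by apply/funext => x; ring.
rewrite (le_trans (Rint_norm id))// -RintZl//.
apply: Rint_le; [exact: intgr_norm|exact: intgrZl|move=> x].
by rewrite normrM (ger0_norm (k0 x)) mulrC ler_wpM2r// qp.
Qed.

End Hausdorff1.
Section Hausdorff.
Context (R : realType) d1 d2 (T1 : measurableType d1) (T2 : measurableType d2).
Variables (m1 : {measure set T1 -> \bar R}) (m2 : {measure set T2 -> \bar R}).
Variables (k1 y1 : T1 -> R) (k2 y2 : T2 -> R).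
Hypotheses (k10 : forall x, 0 <= k1 x) (k20 : forall x, 0 <= k2 x).
Hypotheses (ik1 : intgr m1 k1) (ik2 : intgr m2 k2).
Hypotheses (my1 : measurable_fun setT y1) (my2 : measurable_fun setT y2).
Hypotheses (y101 : forall x, 0 <= y1 x <= 1) (y201 : forall x, 0 <= y2 x <= 1).
Hypothesis moments : forall j : nat,
  Rint m1 (fun x => k1 x * y1 x ^+ j) = Rint m2 (fun x => k2 x * y2 x ^+ j).

Lemma moment_continuous (q : R -> R) : continuous q ->
  Rint m1 (fun x => k1 x * q (y1 x)) = Rint m2 (fun x => k2 x * q (y2 x)).
Proof.
move=> cq; apply/eqP; rewrite -subr_eq0 -normr_le0; apply/ler_addgt0Pl => e e0.
(* The total mass of the two weights, increased by 1 to be positive: a polynomial within [e / K] of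
   [q] costs at most [e] altogether. *)
rewrite addr0; pose K := Rint m1 k1 + Rint m2 k2 + 1.
have K0 : 0 < K by rewrite ltr_wpDl// addr_ge0// Rint_ge0.
have [p hp] := Weierstrass cq (divr_gt0 e0 K0).
have h1 := Rint_kapprox k10 ik1 my1 y101 cq hp; have h2 := Rint_kapprox k20 ik2 my2 y201 cq hp.
have [_ p1] := Rint_kpoly k10 ik1 my1 y101 p; have [_ p2] := Rint_kpoly k20 ik2 my2 y201 p.
have E : Rint m1 (fun x => k1 x * p.[y1 x]) = Rint m2 (fun x => k2 x * p.[y2 x]).
  by rewrite p1 p2; apply: eq_bigr => j _; rewrite moments.
rewrite -(subrKA (Rint m1 (fun x => k1 x * p.[y1 x]))) (le_trans (ler_normD _ _))//.
rewrite {2}E [X in _ + X]distrC (le_trans (lerD h1 h2))// -mulrDr -mulrA ler_piMr ?(ltW e0)//.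
by rewrite mulrC ler_pdivrMr// mul1r /K lerDl.
Qed.

(** Continuous functions that increase with n to the indicator of ]c, +oo[. *)
Let ramp (c : R) (n : nat) (z : R) : R := Num.max 0 (Num.min 1 (n%:R * (z - c))).

Let cramp c n : continuous (ramp c n).
Proof.
have -> : ramp c n = (fun=> 0) \max ((fun=> 1) \min (fun z => n%:R * (z - c))) by [].
apply: max_fun_continuous; first by move=> z; exact: cst_continuous.
apply: min_fun_continuous => z; first exact: cst_continuous.
by apply: cvgM; [exact: cvg_cst|apply: cvgB; [exact: cvg_id|exact: cvg_cst]].
Qed.

Let ramp01 c n z : 0 <= ramp c n z <= 1.
Proof. by rewrite /ramp le_max lexx/= ge_max ler01 ge_min lexx. Qed.

Let ramp_cvg c z : ramp c n z @[n --> \oo] --> (\1_(`]c, +oo[%classic) z : R).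
Proof.
rewrite indicE; have [cz|zc] := ltP c z.
  rewrite mem_set/=; last by rewrite in_itv/= andbT.
  apply: cvg_near_cst.
  exists (Num.truncn (z - c)^-1).+1 => // n /= hn.
  rewrite /ramp; have zc0 : 0 < z - c by rewrite subr_gt0.
  have h : 1 <= n%:R * (z - c).
    rewrite -ler_pdivrMr// div1r (le_trans (ltW (truncnS_gt _)))// ler_nat//.
  by rewrite min_l// max_r.
rewrite memNset/=; last by rewrite in_itv/= andbT ltNge zc.
apply: cvg_near_cst; apply: nearW => n; rewrite /ramp.
have h : n%:R * (z - c) <= 0 by rewrite mulr_ge0_le0// subr_le0.
by rewrite max_l// ge_min h orbT.
Qed.

Let moment_itv c : Rint m1 (fun x => k1 x * \1_(`]c, +oo[%classic) (y1 x)) =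
  Rint m2 (fun x => k2 x * \1_(`]c, +oo[%classic) (y2 x)).
Proof.
have aux d (T : measurableType d) (m : {measure set T -> \bar R}) (k y : T -> R) :
    (forall x, 0 <= k x) -> intgr m k -> measurable_fun setT y ->
  (fun n => Rint m (fun x => k x * ramp c n (y x))) @ \oo --> Rint m (fun x => k x * \1_(`]c, +oo[%classic) (y x)).
  move=> k0 ik my.
  apply: (proj2 (@Rint_cvg _ _ _ m (fun n x => k x * ramp c n (y x)) (fun x => k x * \1_(`]c, +oo[%classic) (y x)) k _ _ ik _)).
  - move=> n; apply: measurable_funM; first exact: intgr_meas ik.
    by apply: measurableT_comp => //; apply: continuous_measurable_fun; exact: cramp.
  - by move=> x; apply: cvgMr; exact: ramp_cvg.
  - move=> n x; rewrite normrM (ger0_norm (k0 x)) ler_piMr//.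
    by have /andP[h0 h1] := ramp01 c n (y x); rewrite ger0_norm.
have h1 := aux _ _ m1 k1 y1 k10 ik1 my1.
have h2 := aux _ _ m2 k2 y2 k20 ik2 my2.
have E : (fun n => Rint m1 (fun x => k1 x * ramp c n (y1 x))) = (fun n => Rint m2 (fun x => k2 x * ramp c n (y2 x))).
  by apply/funext => n; apply: moment_continuous; exact: cramp.
rewrite E in h1; exact: (cvg_unique _ h1 h2).
Qed.

(** The moments determine the integrals of continuous functions of y by Weierstrass, these determine
    the masses of the half-lines ]c, +oo[ by ramps, and the half-lines form a pi-system generating
    the Borel sets. *)
Lemma moment_transfer (f : R -> \bar R) : measurable_fun setT f -> (forall x, (0 <= f x)%E) ->
  (\int[m1]_x ((k1 x)%:E * f (y1 x)) = \int[m2]_x ((k2 x)%:E * f (y2 x)))%E.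
Proof.
move=> mf f0.
have [D1 [D1E D1i]] := density_pushforward m1 (intgr_meas ik1) k10 my1.
have [D2 [D2E D2i]] := density_pushforward m2 (intgr_meas ik2) k20 my2.
rewrite -(D1i f)// -(D2i f)//.
apply: eq_measure_integral => A mA _.
have aux d (T : measurableType d) (m : {measure set T -> \bar R}) (k y : T -> R) (c : R) :
    (forall x, 0 <= k x) -> intgr m k -> measurable_fun setT y ->
    (\int[m]_(x in y @^-1` (`]c, +oo[%classic)) (k x)%:E = (Rint m (fun x => k x * \1_(`]c, +oo[%classic) (y x)))%:E)%E.
  move=> k0 ik my; rewrite EFin_Rint; last first.
    apply: (intgr_dom _ _ ik).
      by apply: measurable_funM; [exact: intgr_meas ik|exact: measurableT_comp].
    move=> x; rewrite normrM (ger0_norm (k0 x)) ler_piMr// indicE; case: (_ \in _); rewrite ?normr1 ?normr0//.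
  rewrite integral_mkcond; apply: eq_integral => z _; rewrite patchE indicE.
  case: ifPn => [/set_mem h|/negP h]; first by rewrite mem_set ?mulr1.
  by rewrite memNset ?mulr0// => h'; apply: h; exact/mem_set.
apply: (@measure_unique _ _ (measurableTypeR R) [set A | exists x, A = `]x, +oo[%classic] (fun n => `](- n%:R), +oo[%classic)) => //.
- exact: RGenOInfty.measurableE.
- move=> _ _ [a ->] [b ->]; exists (Num.max a b).
  by apply/seteqP; split => z /=; rewrite !in_itv/= !andbT gt_max => /andP.
- by move=> n; exists (- n%:R).
- apply/seteqP; split => // z _; exists (Num.truncn `|z|).+1 => //=.
  rewrite in_itv/= andbT ltrNl (le_lt_trans _ (truncnS_gt _))//.
  by rewrite -normrN ler_norm.
- by move=> _ [c ->]; rewrite D1E D2E !aux// moment_itv.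
- by move=> n; rewrite D1E aux// ltry.
Qed.

End Hausdorff.

(** * Laplace transforms known at the positive integers *)

Section Laplace.
Context (R : realType) d1 d2 (T1 : measurableType d1) (T2 : measurableType d2).
Variables (m1 : {measure set T1 -> \bar R}) (m2 : {measure set T2 -> \bar R}).
Variables (k1 v1 : T1 -> R) (k2 v2 : T2 -> R).

(** With y = exp(-v) in [0, 1], the values of the Laplace transform at 1, 2, 3, ... are the moments
    of y for the weight k exp(-v). That weight is integrable even where k is not, for instance for k
    = 1 on R^n. *)
Lemma Laplace_transfer :
  (forall x, 0 <= k1 x) -> (forall x, 0 <= k2 x) ->
  measurable_fun setT v1 -> measurable_fun setT v2 ->
  (forall x, 0 <= v1 x) -> (forall x, 0 <= v2 x) ->
  intgr m1 (fun x => k1 x * expR (- v1 x)) -> intgr m2 (fun x => k2 x * expR (- v2 x)) ->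
  (forall j : nat, Rint m1 (fun x => k1 x * expR (- (j.+1%:R * v1 x))) = Rint m2 (fun x => k2 x * expR (- (j.+1%:R * v2 x)))) ->
  forall f : R -> \bar R, measurable_fun setT f -> (forall x, (0 <= f x)%E) ->
  (\int[m1]_x ((k1 x)%:E * f (v1 x)) = \int[m2]_x ((k2 x)%:E * f (v2 x)))%E.
Proof.
move=> k10 k20 mv1 mv2 v10 v20 i1 i2 L f mf f0.
have H := @moment_transfer R _ _ T1 T2 m1 m2 (fun x => k1 x * expR (- v1 x)) (fun x => expR (- v1 x))
  (fun x => k2 x * expR (- v2 x)) (fun x => expR (- v2 x)).
have aux d (T : measurableType d) (m : {measure set T -> \bar R}) (k v : T -> R) :
  (\int[m]_x ((k x)%:E * f (v x)) = \int[m]_x ((k x * expR (- v x))%:E *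
     ((expR (- ln (expR (- v x))))%:E * f (- ln (expR (- v x)))%R)))%E.
  by apply: eq_integral => x _; rewrite expRK opprK muleA -EFinM -mulrA -expRD addNr expR0 mulr1.
have mE d (T : measurableType d) (v : T -> R) : measurable_fun setT v -> measurable_fun setT (fun x => expR (- v x)).
  by move=> mv; apply: measurableT_comp => //; exact: measurableT_comp.
have h01 d (T : measurableType d) (v : T -> R) : (forall x, 0 <= v x) -> forall x, 0 <= expR (- v x) <= 1.
  by move=> v0 x; rewrite expR_ge0/= expR_le1 oppr_le0.
have LE d (T : measurableType d) (m : {measure set T -> \bar R}) (k v : T -> R) j :
  Rint m (fun x => k x * expR (- v x) * expR (- v x) ^+ j) = Rint m (fun x => k x * expR (- (j.+1%:R * v x))).
  by apply: eq_Rint => x; rewrite -mulrA -exprS -expRM_natl mulrN.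
rewrite (aux _ _ m1) (aux _ _ m2).
(* The factor 1/y, which undoes the weight exp(-v), is written exp(- ln y), and v is recovered as -
   ln y. *)
apply: (H _ _ _ _ _ _ _ _ _ (fun y => ((expR (- ln y))%:E * f (- ln y)%R)%E)) => //.
- by move=> x; rewrite mulr_ge0 ?expR_ge0.
- by move=> x; rewrite mulr_ge0 ?expR_ge0.
- exact: mE.
- exact: mE.
- exact: h01.
- exact: h01.
- by move=> j; rewrite !LE.
- have ml : measurable_fun setT (fun y : R => - ln y) by apply: measurableT_comp => //; exact: measurable_ln.
  apply: emeasurable_funM; last exact: measurableT_comp.
  by apply/measurable_EFinP; exact: measurableT_comp.
- by move=> x; rewrite mule_ge0 ?lee_fin ?expR_ge0.
Qed.

End Laplace.

(** * Derivatives of real functions *)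

Section Der.
Context {R : realType}.
Implicit Types (f g : R -> R) (x a b : R).

(** The value of the derivative is an argument, so that a computation is assembled by unification
    and brought to the desired form once, by [der_eq]. *)
Definition der f x a : Prop := is_derive x (1 : R) f a.

Lemma der_eq f x a b : der f x a -> a = b -> der f x b.
Proof. by move=> h <-. Qed.

Lemma derC c x : der (fun=> c) x 0.
Proof. exact: is_derive_cst. Qed.

Lemma derI x : der (fun y => y) x 1.
Proof. exact: is_derive_id. Qed.

Lemma derD f g x a b : der f x a -> der g x b -> der (fun y => f y + g y) x (a + b).
Proof. exact: is_deriveD. Qed.

Lemma derN f x a : der f x a -> der (fun y => - f y) x (- a).
Proof. exact: is_deriveN. Qed.

Lemma derB f g x a b : der f x a -> der g x b -> der (fun y => f y - g y) x (a - b).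
Proof. exact: is_deriveB. Qed.

Lemma derM f g x a b : der f x a -> der g x b -> der (fun y => f y * g y) x (a * g x + f x * b).
Proof.
move=> ha hb; apply: der_eq; first exact: (is_deriveM ha hb).
by rewrite /GRing.scale/= addrC mulrC.
Qed.

Lemma derZ c f x a : der f x a -> der (fun y => c * f y) x (c * a).
Proof. by move=> h; apply: der_eq; [exact: derM (derC c x) h|rewrite mul0r add0r]. Qed.

Lemma der_comp f g x a b : der f (g x) a -> der g x b -> der (fun y => f (g y)) x (a * b).
Proof. exact: is_derive1_comp. Qed.

Lemma derX n f x a : der f x a -> der (fun y => f y ^+ n) x (n%:R * f x ^+ n.-1 * a).
Proof.
move=> h; elim: n => [|n IH]; first by apply: der_eq; [exact: derC|rewrite !mul0r].
rewrite (_ : (fun y => f y ^+ n.+1) = (fun y => f y * f y ^+ n)); last by apply/funext => y; rewrite exprS.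
apply: der_eq; first exact: derM h IH.
case: n IH => [|n] _; first by rewrite !expr0 !mul0r !mulr0 addr0 mulr1 !mul1r.
by rewrite /= -[in RHS]natr1 exprS; ring.
Qed.

Lemma derExp f x a : der f x a -> der (fun y => expR (f y)) x (expR (f x) * a).
Proof. by move=> h; apply: der_comp h; exact: is_derive_expR. Qed.

Lemma derSin f x a : der f x a -> der (fun y => sin (f y)) x (cos (f x) * a).
Proof. by move=> h; apply: der_comp h; exact: is_derive_sin. Qed.

Lemma derCos f x a : der f x a -> der (fun y => cos (f y)) x (- sin (f x) * a).
Proof. by move=> h; apply: der_comp h; exact: is_derive_cos. Qed.

Lemma derPow p x : 0 < x -> der (fun y => y `^ p) x (p * x `^ (p - 1)).
Proof. by move=> x0; exact: is_derive1_powR. Qed.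

Lemma derP f x a : der f x a <-> derivable f x 1 /\ f^`()%classic x = a.
Proof.
split=> [[h1 h2]|[h1 h2]]; first by split=> //; rewrite derive1E.
by split => //; rewrite -derive1E.
Qed.

Lemma der_unique f x a b : der f x a -> der f x b -> a = b.
Proof. by move=> /derP[_ <-] /derP[_ <-]. Qed.

Lemma der_near f g x a : (\forall y \near x, f y = g y) -> der f x a -> der g x a.
Proof.
move=> fg [d1 d2]; split; last by rewrite -(@near_eq_derive _ _ _ f g x _ fg).
apply: near_eq_derivable d1.
by apply: filterS fg => y ->.
Qed.

Lemma der_cont f x a : der f x a -> {for x, continuous f}.
Proof. by move=> [d1 _]; apply: differentiable_continuous; exact/derivable1_diffP. Qed.

End Der.

(** * Gaussians and Bessel kernels *)

Section BesselSeries.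
Context {R : realType}.
Implicit Types (q z s : R).

(* [bP q (s ^+ 2)] is [Gamma(q) (2/s)^(q-1) J_(q-1)(s)], with [J] the Bessel
   function; as a power series in [s ^+ 2] it is entire. *)
Definition poch q k : R := \prod_(i < k) (q + i%:R).
Definition bc q k : R := (-1) ^+ k / (4 ^+ k * k`!%:R * poch q k).
Definition bP q z : R := limn (pseries (bc q) z).

Lemma pochSr q k : poch q k.+1 = poch q k * (q + k%:R).
Proof. by rewrite /poch big_ord_recr. Qed.

Lemma pochSl q k : poch q k.+1 = q * poch (q + 1) k.
Proof.
rewrite /poch big_ord_recl addr0; congr (_ * _); apply: eq_bigr => i _.
by rewrite /= /bump/= natrD addrA.
Qed.

Lemma poch_gt0 q k : 0 < q -> 0 < poch q k.
Proof. by move=> q0; apply: prodr_gt0 => i _; rewrite ltr_pwDl. Qed.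

(** Factor by factor, 4 (q + k) >= k + 1 as soon as q >= 1/4. This threshold, kept throughout,
    admits q = 1/2 (the cosine) and every q = n/2. *)
Lemma fact_le_poch q k : 4^-1 <= q -> k`!%:R <= 4 ^+ k * poch q k.
Proof.
move=> q4; elim: k => [|k IH]; first by rewrite fact0 expr0 /poch big_ord0 mulr1.
rewrite factS natrM exprS pochSr.
have -> : 4 * 4 ^+ k * (poch q k * (q + k%:R)) = (4 * (q + k%:R)) * (4 ^+ k * poch q k) by ring.
apply: ler_pM => //; rewrite -natr1.
have : (0 : R) <= k%:R by []. 
by lra.
Qed.

(** The square of the factorial matters: one k! gives convergence of the series, the other pays for
    its termwise integration against a Gaussian in [bP_partial_le]. *)
Lemma bc_le q k : 4^-1 <= q -> `|bc q k| <= (k`!%:R * k`!%:R)^-1.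
Proof.
move=> q4; have q0 : 0 < q by rewrite (lt_le_trans _ q4).
have f0 : (0 : R) < k`!%:R by rewrite ltr0n fact_gt0.
rewrite /bc normrM normrX normrN1 expr1n mul1r normfV ger0_norm; last first.
  by rewrite !mulr_ge0// ltW// poch_gt0.
have e0 : (0 : R) < 4 ^+ k by rewrite exprn_gt0.
rewrite lef_pV2 ?posrE ?mulr_gt0 ?poch_gt0//.
by rewrite mulrAC ler_wpM2r ?(ltW f0)// fact_le_poch.
Qed.

Lemma cvg_bP q z : 4^-1 <= q -> cvgn (pseries (bc q) z).
Proof.
move=> q4; apply: normed_cvg.
apply: (@series_le_cvg _ _ (exp_coeff `|z|)) => [n|n|n|].
- exact: normr_ge0.
- exact: exp_coeff_ge0.
- rewrite /= normrM normrX /exp_coeff /= mulrC ler_wpM2l ?exprn_ge0//.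
  rewrite (le_trans (bc_le n q4))// lef_pV2 ?posrE ?mulr_gt0 ?ltr0n ?fact_gt0//.
  by rewrite ler_peMr// ler1n fact_gt0.
- exact: is_cvg_series_exp_coeff.
Qed.

Lemma bcS q k : 0 < q -> k.+1%:R * bc q k.+1 = - (4 * q)^-1 * bc (q + 1) k.
Proof.
move=> q0; rewrite /bc factS natrM pochSl !exprS.
have p0 : poch (q + 1) k != 0 by rewrite gt_eqF// poch_gt0// ltr_wpDr.
have f0 : k`!%:R != 0 :> R by rewrite pnatr_eq0 -lt0n fact_gt0.
have k0 : k.+1%:R != 0 :> R by rewrite pnatr_eq0.
have e0 : 4 ^+ k != 0 :> R by rewrite expf_eq0 pnatr_eq0 andbF.
have q00 : q != 0 by rewrite gt_eqF.
move: (poch (q + 1) k) (k`!%:R) (k.+1%:R) (4 ^+ k) ((-1) ^+ k) p0 f0 k0 e0 => a b c e g a0 b0 c0 e0.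
by field; rewrite a0 b0 c0 e0 q00.
Qed.

Lemma pseries_scale (c : R) (f : nat -> R) z : pseries (fun k => c * f k) z = (fun n => c * pseries f z n).
Proof.
apply/funext => n; rewrite /pseries /series/= mulr_sumr; apply: eq_bigr => i _; ring.
Qed.

Lemma bP_diffs q : 0 < q -> pseries_diffs (bc q) = fun k => - (4 * q)^-1 * bc (q + 1) k.
Proof. by move=> q0; apply/funext => k; rewrite /pseries_diffs bcS. Qed.

(** For Bessel functions this is (s^(-nu) J_nu)' = - s^(-nu) J_(nu+1) with nu = q - 1.
    Differentiating the series term by term requires the first two differentiated series to
    converge; they are again such series, for q + 1 and q + 2. *)
Lemma is_derive_bP q z : 4^-1 <= q -> is_derive z 1 (bP q) (- (4 * q)^-1 * bP (q + 1) z).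
Proof.
move=> q4; have q0 : 0 < q by rewrite (lt_le_trans _ q4).
have q14 : 4^-1 <= q + 1 by rewrite (le_trans q4)// lerDl.
have q24 : 4^-1 <= q + 1 + 1 by rewrite (le_trans q14)// lerDl.
have := @pseries_snd_diffs R (bc q) (`|z| + 1) z.
have D1 : pseries (pseries_diffs (bc q)) = fun z n => - (4 * q)^-1 * pseries (bc (q + 1)) z n.
  by apply/funext => w; rewrite bP_diffs// pseries_scale.
have D2 : pseries (pseries_diffs (pseries_diffs (bc q))) =
    fun z n => - (4 * q)^-1 * (- (4 * (q + 1))^-1 * pseries (bc (q + 1 + 1)) z n).
  apply/funext => w; rewrite bP_diffs//.
  rewrite (_ : pseries_diffs _ = fun k => - (4 * q)^-1 * (- (4 * (q + 1))^-1 * bc (q + 1 + 1) k)).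
    by rewrite pseries_scale pseries_scale.
  by apply/funext => k; rewrite /pseries_diffs mulrCA bcS// ltr_wpDr.
rewrite D1 D2; have -> : limn (fun n => - (4 * q)^-1 * pseries (bc (q + 1)) z n) = - (4 * q)^-1 * bP (q + 1) z.
  by apply/cvg_lim => //; apply: cvgMr; exact: cvg_bP.
apply; first exact: cvg_bP.
- by apply: is_cvgMr; exact: cvg_bP.
- by apply: is_cvgMr; apply: is_cvgMr; exact: cvg_bP.
- by rewrite (@ger0_norm _ (`|z| + 1))// ltrDl.
Qed.

Lemma bP0 q : bP q 0 = 1.
Proof.
rewrite /bP; apply/cvg_lim => //; apply: cvg_near_cst.
exists 1%N => // -[//|n] _; rewrite /pseries /series /= big_nat_recl//= expr0 mulr1.
rewrite big1 ?addr0; last by move=> i _; rewrite exprS mul0r mulr0.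
by rewrite /bc /poch big_ord0 !expr0 fact0 !mulr1 divr1.
Qed.

(** The three-term recurrence J_(nu-1) + J_(nu+1) = (2 nu / s) J_nu at nu = q. It replaces the
    second derivative, which involves q + 2, by the function itself, and so yields Bessel's
    equation. *)
Lemma bP_recurrence q z : 4^-1 <= q ->
  bP q z = bP (q + 1) z - z / (4 * q * (q + 1)) * bP (q + 1 + 1) z.
Proof.
move=> q4; have q0 : 0 < q by rewrite (lt_le_trans _ q4).
have q14 : 4^-1 <= q + 1 by rewrite (le_trans q4)// lerDl.
have q24 : 4^-1 <= q + 1 + 1 by rewrite (le_trans q14)// lerDl.
rewrite /bP; apply/cvg_lim => //; rewrite -cvg_shiftS/=.
have -> : (fun n => pseries (bc q) z n.+1) =
  (fun n => pseries (bc (q + 1)) z n.+1 - z / (4 * q * (q + 1)) * pseries (bc (q + 1 + 1)) z n).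
  apply/funext => n; rewrite /pseries /series/= !big_mkord !big_ord_recl/= !expr0 !mulr1.
  rewrite -addrA; congr (_ + _); first by rewrite /bc /poch !big_ord0.
  rewrite mulr_sumr -sumrB; apply: eq_bigr => i _; rewrite /bump/= add1n exprS.
  suff -> : bc q i.+1 = bc (q + 1) i.+1 - (4 * q * (q + 1))^-1 * bc (q + 1 + 1) i by ring.
  have e : poch (q + 1) i * (q + 1 + i%:R) = (q + 1) * poch (q + 1 + 1) i by rewrite -pochSr pochSl.
  have e2 : poch (q + 1) i = (q + 1) * poch (q + 1 + 1) i / (q + 1 + i%:R).
    by rewrite -e mulfK// gt_eqF// !ltr_pwDl// ltr_pwDr.
  rewrite /bc factS natrM (pochSl q) (pochSl (q + 1)) !exprS e2.
  have p0 : poch (q + 1 + 1) i != 0 by rewrite gt_eqF// poch_gt0// !ltr_wpDr.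
  have f0 : i`!%:R != 0 :> R by rewrite pnatr_eq0 -lt0n fact_gt0.
  have k0 : i%:R + 1 != 0 :> R by rewrite natr1 pnatr_eq0.
  have e0 : 4 ^+ i != 0 :> R by rewrite expf_eq0 pnatr_eq0 andbF.
  have q00 : q != 0 by rewrite gt_eqF.
  have q10 : q + 1 != 0 by rewrite gt_eqF// ltr_wpDr.
  have qi0 : q + 1 + i%:R != 0 by rewrite gt_eqF// ltr_wpDr// ltr_wpDr.
  rewrite -[i.+1%:R]natr1.
  move: (poch (q + 1 + 1) i) (i`!%:R : R) (4 ^+ i : R) ((-1) ^+ i : R) p0 f0 e0 => A B E G A0 B0 E0.
  by field; rewrite A0 B0 k0 E0 q00 q10 qi0.
apply: cvgB; first by rewrite cvg_shiftS; exact: cvg_bP.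
by apply: cvgMr; exact: cvg_bP.
Qed.

End BesselSeries.

(** * Gaussian integrals and their moments *)

Section Gauss.
Context {R : realType}.
Local Notation leb := (@lebesgue_measure R).

Lemma gauss1 (l : R) : 0 < l -> intgr leb (fun t => expR (- (l * t ^+ 2))) /\
  Rint leb (fun t => expR (- (l * t ^+ 2))) = Num.sqrt (pi / l).
Proof.
move=> l0; pose s := Num.sqrt (2 * l)^-1.
have s0 : s != 0 by rewrite gt_eqF// sqrtr_gt0 invr_gt0 mulr_gt0.
have s2 : s ^+ 2 = (2 * l)^-1 by rewrite sqr_sqrtr// invr_ge0 mulr_ge0// ltW.
have E t : expR (- (l * t ^+ 2)) = Num.sqrt (pi / l) * normal_pdf 0 s t.
  rewrite normal_pdfE// /normal_peak /normal_fun s2 subr0.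
  have -> : (2 * l)^-1 * pi *+ 2 = pi / l by rewrite -mulr_natr; field; rewrite gt_eqF.
  rewrite mulVKf; last by rewrite gt_eqF// sqrtr_gt0 divr_gt0// pi_gt0.
  congr expR; rewrite -mulr_natr; field; by rewrite gt_eqF.
have i := @integrable_normal_pdf R 0 s.
have -> : (fun t => expR (- (l * t ^+ 2))) = (fun t => Num.sqrt (pi / l) * normal_pdf 0 s t).
  exact/funext.
split; first exact: intgrZl.
by rewrite RintZl// /Rint /Rintegral integral_normal_pdf /= mulr1.
Qed.

End Gauss.

Section Moments.
Context {R : realType} d (T : measurableType d) (m : {measure set T -> \bar R}).
Variables (v : T -> R) (c q : R).
Hypotheses (mv : measurable_fun setT v) (v0 : forall x, 0 <= v x).
Hypothesis ie : forall l, 0 < l -> intgr m (fun x => expR (- (l * v x))).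
Hypothesis Ie : forall l, 0 < l -> Rint m (fun x => expR (- (l * v x))) = c * l `^ (- q).

Lemma expX_le (a y : R) k : 0 < a -> 0 <= y -> y ^+ k <= k`!%:R / a ^+ k * expR (a * y).
Proof.
move=> a0 y0; have f0 : (0 : R) < k`!%:R by rewrite ltr0n fact_gt0.
have ay0 : 0 <= a * y by rewrite mulr_ge0// ltW.
have : (a * y) ^+ k / k`!%:R <= expR (a * y).
  case: k f0 => [|k] f0; first by rewrite expr0 fact0 divr1 -expR0 ler_expR.
  by apply: le_trans (expR_ge1Dxn k ay0); rewrite lerDr.
by rewrite ler_pdivrMr// exprMn mulrAC ler_pdivlMr ?exprn_gt0// => h; lra.
Qed.

Lemma measurable_vexp l k : measurable_fun setT (fun x => v x ^+ k * expR (- (l * v x))).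
Proof.
apply: measurable_funM; first exact: measurable_funX.
apply: measurableT_comp => //; apply: measurableT_comp => //; exact: measurable_funM.
Qed.

Lemma intgr_moment l k : 0 < l -> intgr m (fun x => v x ^+ k * expR (- (l * v x))).
Proof.
move=> l0; have l20 : 0 < l / 2 by rewrite divr_gt0.
apply: (@intgr_dom _ _ _ _ _ (fun x => k`!%:R / (l / 2) ^+ k * expR (- (l / 2 * v x)))).
- exact: measurable_vexp.
- move=> x; rewrite ger0_norm ?mulr_ge0 ?expR_ge0 ?exprn_ge0//.
  have -> : - (l / 2 * v x) = l / 2 * v x - l * v x by lra.
  by rewrite expRD mulrA ler_wpM2r ?expR_ge0// expX_le.
- by apply: intgrZl; exact: ie.
Qed.

(** Each moment comes from the previous one by differentiating in l under the integral. The measure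
    enters only through int exp(-l v) = c l^(-q); it will be Lebesgue measure on R with v = t^2, q =
    1/2, and on R^n with v = |x|^2, q = n/2. *)
Lemma moment l k : 0 < l ->
  Rint m (fun x => v x ^+ k * expR (- (l * v x))) = c * poch q k * l `^ (- q - k%:R).
Proof.
elim: k l => [|k IH] l l0.
  by rewrite /poch big_ord0 mulr1 subr0 -Ie//; apply: eq_Rint => x; rewrite expr0 mul1r.
pose f y x := v x ^+ k * expR (- (y * v x)).
pose F y := Rint m (f y).
have df y x : der (f ^~ x) y (- (v x ^+ k.+1 * expR (- (y * v x)))).
  apply: der_eq; first by apply: derZ; apply: derExp; apply: derN; apply: derM; [exact: derI|exact: derC].
  by rewrite exprS; ring.
have d1f y x : partial1of2 f y x = - (v x ^+ k.+1 * expR (- (y * v x))).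
  by have /derP[_] := df y x.
have Ia : `]l / 2, 2 * l[%classic l by rewrite /= in_itv/=; lra.
have intf y : `]l / 2, 2 * l[%classic y -> m.-integrable [set: T] (EFin \o f y).
  by rewrite /= in_itv/= => /andP[y1 y2]; apply: intgr_moment; lra.
have derf y x : `]l / 2, 2 * l[%classic y -> [set: T] x -> derivable (f ^~ x) y 1.
  by move=> _ _; have /derP[] := df y x.
(* Dominates the derivative in y for all y in ]l/2, 2l[ at once. *)
pose G x := v x ^+ k.+1 * expR (- (l / 2 * v x)).
have G0 x : 0 <= G x by rewrite mulr_ge0 ?expR_ge0 ?exprn_ge0.
have iG : m.-integrable [set: T] (EFin \o G) by apply: intgr_moment; lra.
have Gub y x : `]l / 2, 2 * l[%classic y -> [set: T] x -> `|partial1of2 f y x| <= G x.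
  rewrite /= in_itv/= => /andP[y1 y2] _; rewrite d1f normrN ger0_norm; last by rewrite mulr_ge0 ?expR_ge0 ?exprn_ge0.
  by rewrite ler_wpM2l ?exprn_ge0// ler_expR lerN2 ler_wpM2r// ltW.
have dF : der F l (- Rint m (fun x => v x ^+ k.+1 * expR (- (l * v x)))).
  apply/derP; split; first exact: (derivable_under_integral measurableT Ia intf derf G0 iG Gub).
  rewrite (differentiation_under_integral measurableT Ia intf derf G0 iG Gub).
  under eq_Rintegral do rewrite d1f.
  rewrite -[LHS]/(Rint m (fun x => - (v x ^+ k.+1 * expR (- (l * v x))))) -mulN1r.
  by rewrite -RintZl; [apply: eq_Rint => x; rewrite mulN1r|exact: intgr_moment].
(* The induction hypothesis holds for every y near l, so both of its sides may be differentiated. *)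
have dF' : der F l (c * poch q k * ((- q - k%:R) * l `^ (- q - k%:R - 1))).
  apply: (der_near (f := fun y => c * poch q k * y `^ (- q - k%:R))); last by apply: derZ; exact: derPow.
  near=> y; rewrite /F IH//; near: y; exact: lt_nbhsr.
have := der_unique dF dF' => h.
rewrite -[LHS]opprK h pochSr -natr1 opprD addrA; ring.
Unshelve. all: by end_near.
Qed.

Definition bessel_bound (s l : R) := expR (2 * s ^+ 2 / l).

(** The k-th term is at most (s^2 v)^k / (k!)^2, the product of (2 s^2 / l)^k / k! and (l v / 2)^k /
    k!. The first factor is at most [bessel_bound s l]; the second sums to at most exp(l v / 2),
    half of the available decay. *)
Lemma bP_partial_le (s l : R) n x : 4^-1 <= q -> 0 < l ->
  `|pseries (bc q) (s ^+ 2 * v x) n * expR (- (l * v x))| <=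
  bessel_bound s l * expR (- (l / 2 * v x)).
Proof.
move=> q4 l0; have -> : - (l * v x) = l / 2 * v x * -1 + - (l / 2 * v x) by lra.
rewrite expRD mulrA [leLHS]normrM (ger0_norm (expR_ge0 _)) ler_wpM2r ?expR_ge0//.
rewrite mulrN1 normrM (ger0_norm (expR_ge0 _)) expRN ler_pdivrMr ?expR_gt0//.
rewrite /pseries /series/= (le_trans (ler_norm_sum _ _ _))//.
have lv : 0 <= l / 2 * v x by rewrite mulr_ge0// ltW// divr_gt0.
apply: (@le_trans _ _ (\sum_(0 <= k < n) bessel_bound s l * exp_coeff (l / 2 * v x) k)).
  have sv : 0 <= s ^+ 2 * v x by rewrite mulr_ge0 ?sqr_ge0.
  apply: ler_sum => k _; rewrite normrM normrX (ger0_norm sv).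
  have f0 : (0 : R) < k`!%:R by rewrite ltr0n fact_gt0.
  apply: (@le_trans _ _ ((k`!%:R * k`!%:R)^-1 * (s ^+ 2 * v x) ^+ k)).
    rewrite ler_wpM2r ?bc_le// exprn_ge0//; apply: mulr_ge0; rewrite ?sqr_ge0//.
  have -> : (k`!%:R * k`!%:R)^-1 * (s ^+ 2 * v x) ^+ k =
     ((2 * s ^+ 2 / l) ^+ k / k`!%:R) * exp_coeff (l / 2 * v x) k.
    rewrite /exp_coeff/= mulf_div -exprMn mulrC; congr (_ ^+ k / _).
    by field; rewrite gt_eqF.
  rewrite ler_wpM2r ?exp_coeff_ge0//.
  have a0 : 0 <= 2 * s ^+ 2 / l by apply: divr_ge0 (ltW l0); apply: mulr_ge0; rewrite ?sqr_ge0.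
  have := @expX_le 1 _ k ltr01 a0; rewrite expr1n divr1 mul1r ler_pdivrMr// => /le_trans; apply.
  by rewrite /bessel_bound mulrC.
rewrite -mulr_sumr ler_wpM2l ?expR_ge0// /expR.
apply: nondecreasing_cvgn_le; last exact: is_cvg_series_exp_coeff.
by apply: nondecreasing_series => i _ _; exact: exp_coeff_ge0.
Qed.

(** Weber's integral. Term by term, the Pochhammer symbol of the moment cancels that of the
    coefficient and leaves the exponential series of - s^2 / (4 l). *)
Lemma bP_Laplace (s l : R) : 4^-1 <= q -> 0 < l ->
  intgr m (fun x => bP q (s ^+ 2 * v x) * expR (- (l * v x))) /\
  Rint m (fun x => bP q (s ^+ 2 * v x) * expR (- (l * v x))) = c * l `^ (- q) * expR (- (s ^+ 2 / (4 * l))).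
Proof.
move=> q4 l0; have q0 : 0 < q by rewrite (lt_le_trans _ q4).
have E n x : pseries (bc q) (s ^+ 2 * v x) n * expR (- (l * v x)) =
  \sum_(0 <= k < n) (bc q k * s ^+ 2 ^+ k) * (v x ^+ k * expR (- (l * v x))).
  by rewrite /pseries /series/= mulr_suml; apply: eq_bigr => k _; rewrite exprMn; ring.
have h1 n : measurable_fun setT (fun x => pseries (bc q) (s ^+ 2 * v x) n * expR (- (l * v x))).
  under eq_fun do rewrite E.
  by apply: measurable_sum => k; apply: measurable_funM => //; exact: measurable_vexp.
have h2 x : (fun n => pseries (bc q) (s ^+ 2 * v x) n * expR (- (l * v x))) @ \oo --> bP q (s ^+ 2 * v x) * expR (- (l * v x)).
  by apply: cvgMl; exact: cvg_bP.
have h3 : intgr m (fun x => bessel_bound s l * expR (- (l / 2 * v x))).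
  by apply: intgrZl; apply: ie; rewrite divr_gt0.
have [i1 i2] := Rint_cvg h1 h2 h3 (fun n x => bP_partial_le s n x q4 l0).
split => //; apply: (cvg_unique _ i2) => //.
have -> : (fun n => Rint m (fun x => pseries (bc q) (s ^+ 2 * v x) n * expR (- (l * v x)))) =
  (fun n => c * l `^ (- q) * series (exp_coeff (- (s ^+ 2 / (4 * l)))) n).
  apply/funext => n; under eq_Rint do rewrite E.
  rewrite Rint_sum; last by move=> k; apply: intgrZl; exact: intgr_moment.
  rewrite /series/= mulr_sumr; apply: eq_bigr => k _.
  rewrite RintZl; last exact: intgr_moment.
  rewrite moment// /bc /exp_coeff/= powRB ?(gt_eqF l0) ?implybT// powR_mulrn ?ltW//.
  rewrite [(- (s ^+ 2 / _)) ^+ k]exprNn.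
  rewrite expr_div_n exprMn [(4 * l) ^+ k]exprMn.
  have p0 : poch q k != 0 by rewrite gt_eqF// poch_gt0.
  have f0 : k`!%:R != 0 :> R by rewrite pnatr_eq0 -lt0n fact_gt0.
  have e0 : 4 ^+ k != 0 :> R by rewrite expf_eq0 pnatr_eq0 andbF.
  have lk0 : l ^+ k != 0 by rewrite expf_eq0 (gt_eqF l0) andbF.
  move: (poch q k) (k`!%:R : R) (4 ^+ k : R) (l ^+ k) p0 f0 e0 lk0 => A B D L A0 B0 D0 L0.
  by field; rewrite A0 B0 D0 L0.
by apply: cvgMr; exact: is_cvg_series_exp_coeff.
Qed.

End Moments.

(** * Fourier transforms of Gaussians *)

Section BesselGauss.
Context {R : realType}.
Local Notation leb := (@lebesgue_measure R).

Lemma bP_cos (s : R) : bP 2^-1 (s ^+ 2) = cos s.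
Proof.
rewrite /bP; apply/cvg_lim => //.
suff -> : pseries (bc 2^-1) (s ^+ 2) = series (cos_coeff' s) by exact: cvg_cos_coeff'.
apply/funext => n; apply: eq_bigr => k _; rewrite /= /cos_coeff' /bc -exprM.
have -> : k.*2`!%:R = 4 ^+ k * k`!%:R * poch 2^-1 k :> R.
  elim: k => [|k IH]; first by rewrite double0 fact0 expr0 /poch big_ord0 !mul1r.
  rewrite doubleS !factS !natrM IH pochSr exprS -[(k.*2).+2%:R]natr1 -[(k.*2).+1%:R]natr1 -[k.+1%:R]natr1 -muln2 natrM.
  by field.
by rewrite mul2n -exprnP; ring.
Qed.

Lemma sqrt_powR (l : R) : 0 < l -> Num.sqrt (pi / l) = Num.sqrt pi * l `^ (- 2^-1).
Proof.
move=> l0; rewrite sqrtrM ?pi_ge0// powRN powR12_sqrt ?ltW// sqrtrV//; exact: ltW.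
Qed.

(** The cosine is the kernel with q = 1/2, so its Gaussian integral is a case of [bP_Laplace]. *)
Lemma gauss1_cos (l x : R) : 0 < l -> intgr leb (fun t => cos (x * t) * expR (- (l * t ^+ 2))) /\
  Rint leb (fun t => cos (x * t) * expR (- (l * t ^+ 2))) = Num.sqrt (pi / l) * expR (- (x ^+ 2 / (4 * l))).
Proof.
move=> l0.
have := @bP_Laplace R _ _ leb (fun t => t ^+ 2) (Num.sqrt pi) 2^-1 _ _ _ _ x l.
rewrite sqrt_powR// => H.
have E : (fun t : R => bP 2^-1 (x ^+ 2 * t ^+ 2) * expR (- (l * t ^+ 2))) = (fun t => cos (x * t) * expR (- (l * t ^+ 2))).
  by apply/funext => t; rewrite -exprMn bP_cos.
move: H; rewrite E; apply => //.
- by move=> t; rewrite sqr_ge0.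
- by move=> l' l'0; case: (gauss1 l'0).
- by move=> l' l'0; case: (gauss1 l'0) => _ ->; rewrite sqrt_powR.
- by rewrite lef_pV2 ?posrE// ler_nat.
Qed.

Lemma ge0_integral_opp (f : R -> R) : continuous f -> (forall x, 0 <= f x) ->
  (\int[leb]_x (f (- x))%:E = \int[leb]_x (f x)%:E)%E.
Proof.
move=> cf f0.
have split (g : R -> R) : continuous g -> (forall x, 0 <= g x) ->
    (\int[leb]_x (g x)%:E = \int[leb]_(x in `[0%R, +oo[) (g (- x)%R)%:E + \int[leb]_(x in `[0%R, +oo[) (g x)%:E)%E.
  move=> cg g0; have mg : measurable_fun [set: R] (EFin \o g).
    by apply/measurable_EFinP; exact: continuous_measurable_fun.
  rewrite -(setUv `]-oo, 0%R]%classic) ge0_integral_setU//= ; last 4 first.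
  - exact: measurableC.
  - by rewrite setUv.
  - by move=> x _; rewrite lee_fin.
  - exact/disj_setPCl.
  rewrite -{1}oppr0 ge0_integration_by_substitutionNy//; last exact: continuous_subspaceT.
  congr (_ + _)%E; rewrite setCitvl integral_itv_obnd_cbnd//.
  exact: measurable_funTS.
have cfN : continuous (fun x => f (- x)).
  by move=> x; apply: continuous_comp; [exact: opp_continuous|exact: cf].
rewrite split// [RHS]split// addeC; congr (_ + _)%E.
by apply: eq_integral => x _; rewrite opprK.
Qed.

Lemma gauss1_sin (l x : R) : 0 < l -> intgr leb (fun t => sin (x * t) * expR (- (l * t ^+ 2))) /\
  Rint leb (fun t => sin (x * t) * expR (- (l * t ^+ 2))) = 0.
Proof.
move=> l0; have i : intgr leb (fun t => sin (x * t) * expR (- (l * t ^+ 2))).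
  have [i _] := gauss1 l0; apply: (intgr_dom _ _ i).
    apply: measurable_funM; last by have := intgr_meas i.
    apply: measurableT_comp => //; first by apply: continuous_measurable_fun; exact: continuous_sin.
    move=> t; rewrite normrM (ger0_norm (expR_ge0 _)) ler_piMl ?expR_ge0//.
  by rewrite ler_norml sin_geN1 sin_le1.
split => //.
have [ig _] := gauss1 l0.
(* The reflection lemma is for nonnegative functions: 1 is added to the sine, and comparing f(t)
   with f(-t) isolates the odd part. *)
pose f t := (1 + sin (x * t)) * expR (- (l * t ^+ 2)).
have cf : continuous f.
  have d t : der f t (x * cos (x * t) * expR (- (l * t ^+ 2)) + (1 + sin (x * t)) * (expR (- (l * t ^+ 2)) * - (l * (2%:R * t ^+ 1 * 1)))).
    apply: der_eq; first apply: derM.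
    - by apply: derD; [exact: derC|apply: derSin; apply: derZ; exact: derI].
    - by apply: derExp; apply: derN; apply: derZ; apply: derX; exact: derI.
    - by rewrite /=; ring.
  by move=> t; exact: der_cont (d t).
have f0 t : 0 <= f t by rewrite mulr_ge0 ?expR_ge0// -lerBlDl sub0r sin_geN1.
have ep t : f t = expR (- (l * t ^+ 2)) + sin (x * t) * expR (- (l * t ^+ 2)) by rewrite /f; ring.
have em t : f (- t) = expR (- (l * t ^+ 2)) - sin (x * t) * expR (- (l * t ^+ 2)).
  by rewrite /f mulrN sinN sqrrN; ring.
have := ge0_integral_opp cf f0.
under eq_integral do rewrite em; under [X in _ = X -> _]eq_integral do rewrite ep.
rewrite -(EFin_Rint (intgrB ig i)) -(EFin_Rint (intgrD ig i)) RintB// RintD// => -[]; lra.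
Qed.

Lemma dotp_cons n (x y : Rn R n) (s t : R) : dotp (Rn_cons (x, s)) (Rn_cons (y, t)) = s * t + dotp x y.
Proof.
rewrite /dotp big_ord_recl !tnth0; congr (_ + _); apply: eq_bigr => i _.
by rewrite !tnthS.
Qed.

Lemma measurable_dotp n (x : Rn R n) : measurable_fun setT (fun y : Rn R n => dotp x y).
Proof.
apply: measurable_sum => i; apply: measurable_funM => //; exact: measurable_tnthR.
Qed.

Lemma measurable_dotpp n : measurable_fun setT (fun y : Rn R n => dotp y y).
Proof.
apply: measurable_sum => i; apply: measurable_funM => //; exact: measurable_tnthR.
Qed.

Lemma dotpp_ge0 n (x : Rn R n) : 0 <= dotp x x.
Proof. by apply: sumr_ge0 => i _; rewrite -expr2 sqr_ge0. Qed.

Lemma measurable_cos_dotp n (x : Rn R n) : measurable_fun setT (fun y : Rn R n => cos (dotp x y)).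
Proof.
apply: measurableT_comp; last exact: measurable_dotp.
by apply: continuous_measurable_fun; exact: continuous_cos.
Qed.

Lemma measurable_sin_dotp n (x : Rn R n) : measurable_fun setT (fun y : Rn R n => sin (dotp x y)).
Proof.
apply: measurableT_comp; last exact: measurable_dotp.
by apply: continuous_measurable_fun; exact: continuous_sin.
Qed.

Lemma measurable_gauss_Rn n (l : R) : measurable_fun setT (fun y : Rn R n => expR (- (l * dotp y y))).
Proof.
apply: measurableT_comp => //; apply: measurableT_comp => //; apply: measurable_funM => //.
exact: measurable_dotpp.
Qed.

Lemma norm_cos_le1 (x : R) : `|cos x| <= 1.
Proof. by rewrite ler_norml cos_geN1 cos_le1. Qed.

Lemma norm_sin_le1 (x : R) : `|sin x| <= 1.
Proof. by rewrite ler_norml sin_geN1 sin_le1. Qed.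

Lemma Rint_Rn0 (f : Rn R 0 -> R) : measurable_fun setT f -> Rint (lebesgue_Rn 0) f = f [tuple] .
Proof.
move=> mf; rewrite /Rint /Rintegral /=.
by rewrite integral_dirac// ?diracT ?mul1e//; exact/measurable_EFinP.
Qed.

Lemma gauss_Rn n (l : R) : 0 < l -> intgr (lebesgue_Rn n) (fun y => expR (- (l * dotp y y))) /\
  Rint (lebesgue_Rn n) (fun y => expR (- (l * dotp y y))) = Num.sqrt (pi / l) ^+ n.
Proof.
move=> l0; have [i1 I1] := gauss1 l0.
elim: n => [|n [IHi IHe]].
  have m0 := @measurable_gauss_Rn 0 l.
  have E (x : Rn R 0) : expR (- (l * dotp x x)) = 1 by rewrite /dotp big_ord0 mulr0 oppr0 expR0.
  split; last by rewrite Rint_Rn0// E expr0.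
  apply: intgr_lty => //.
  by rewrite /= integral_dirac// ?diracT ?mul1e ?ltry//; exact/measurable_EFinP.
have E x (t : R) : expR (- (l * dotp (Rn_cons (x, t)) (Rn_cons (x, t)))) = expR (- (l * dotp x x)) * expR (- (l * t ^+ 2)).
  by rewrite dotp_cons -expRD; congr expR; ring.
have [|i e] := Rint_Rn_S (@measurable_gauss_Rn n.+1 l) IHi i1.
  by move=> x t; rewrite E ger0_norm ?mulr_ge0 ?expR_ge0.
split => //; rewrite e.
under eq_Rint do under eq_Rint do rewrite E.
under eq_Rint do rewrite RintZl// I1 mulrC.
by rewrite RintZl// IHe exprS.
Qed.

(** Induction on n by the addition formulas; each product with a sine in the last variable
    integrates to 0 by [gauss1_sin]. *)
Lemma gauss_Rn_cis n (l : R) (x : Rn R n) : 0 < l ->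
  Rint (lebesgue_Rn n) (fun y => cos (dotp x y) * expR (- (l * dotp y y))) =
    Num.sqrt (pi / l) ^+ n * expR (- (dotp x x / (4 * l))) /\
  Rint (lebesgue_Rn n) (fun y => sin (dotp x y) * expR (- (l * dotp y y))) = 0.
Proof.
move=> l0; have [i1 I1] := gauss1 l0.
elim: n x => [|n IH] x.
  split; rewrite Rint_Rn0.
  - by rewrite /dotp !big_ord0 cos0 mul0r mulr0 oppr0 expR0 expr0.
  - by apply: measurable_funM; [exact: measurable_cos_dotp|exact: measurable_gauss_Rn].
  - by rewrite /dotp !big_ord0 sin0 mul0r.
  - by apply: measurable_funM; [exact: measurable_sin_dotp|exact: measurable_gauss_Rn].
have [IHi _] := @gauss_Rn n l l0.
case/tupleP: x => s x; rewrite -[[tuple of s :: x]]/(Rn_cons (x, s)).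
have [IHc IHs] := IH x.
have [ic Ic] := gauss1_cos s l0; have [iis Is] := gauss1_sin s l0.
have E (y : Rn R n) (t : R) : expR (- (l * dotp (Rn_cons (y, t)) (Rn_cons (y, t)))) = expR (- (l * dotp y y)) * expR (- (l * t ^+ 2)).
  by rewrite dotp_cons -expRD; congr expR; ring.
pose gy (y : Rn R n) := expR (- (l * dotp y y)); pose gt (t : R) := expR (- (l * t ^+ 2)).
have icy : intgr (lebesgue_Rn n) (fun y => cos (dotp x y) * gy y).
  apply: (intgr_dom _ _ IHi); first by apply: measurable_funM; [exact: measurable_cos_dotp|exact: measurable_gauss_Rn].
  by move=> y; rewrite normrM (ger0_norm (expR_ge0 _)) ler_piMl ?expR_ge0 ?norm_cos_le1.
have isy : intgr (lebesgue_Rn n) (fun y => sin (dotp x y) * gy y).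
  apply: (intgr_dom _ _ IHi); first by apply: measurable_funM; [exact: measurable_sin_dotp|exact: measurable_gauss_Rn].
  by move=> y; rewrite normrM (ger0_norm (expR_ge0 _)) ler_piMl ?expR_ge0 ?norm_sin_le1.
have Ecos y t : cos (dotp (Rn_cons (x, s)) (Rn_cons (y, t))) * expR (- (l * dotp (Rn_cons (y, t)) (Rn_cons (y, t)))) =
   (cos (dotp x y) * gy y) * (cos (s * t) * gt t) - (sin (dotp x y) * gy y) * (sin (s * t) * gt t).
  by rewrite E dotp_cons cosD; rewrite -/(gy y) -/(gt t); ring.
have Esin y t : sin (dotp (Rn_cons (x, s)) (Rn_cons (y, t))) * expR (- (l * dotp (Rn_cons (y, t)) (Rn_cons (y, t)))) =
   (sin (dotp x y) * gy y) * (cos (s * t) * gt t) + (cos (dotp x y) * gy y) * (sin (s * t) * gt t).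
  by rewrite E dotp_cons sinD; rewrite -/(gy y) -/(gt t); ring.
have dc : dotp (Rn_cons (x, s)) (Rn_cons (x, s)) / (4 * l) = s ^+ 2 / (4 * l) + dotp x x / (4 * l).
  by rewrite dotp_cons expr2 mulrDl.
split.
- have [||_ ->] := Rint_Rn_S (f := fun y => cos (dotp (Rn_cons (x, s)) y) * expR (- (l * dotp y y))) _ IHi i1.
  + by apply: measurable_funM; [exact: measurable_cos_dotp|exact: measurable_gauss_Rn].
  + move=> y t; rewrite normrM E (ger0_norm (x := _ * expR _)) ?mulr_ge0 ?expR_ge0// ler_piMl ?mulr_ge0 ?expR_ge0 ?norm_cos_le1//.
  under eq_Rint do (under eq_Rint do rewrite Ecos; rewrite RintB ?RintZl ?Ic ?Is//; try exact: intgrZl).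
  under eq_Rint do rewrite mulr0 subr0 mulrC.
  rewrite RintZl// IHc dc opprD expRD.
  by move: (expR _) (expR _) (Num.sqrt _) => A B C; rewrite mulrACA -exprS.
- have [||_ ->] := Rint_Rn_S (f := fun y => sin (dotp (Rn_cons (x, s)) y) * expR (- (l * dotp y y))) _ IHi i1.
  + by apply: measurable_funM; [exact: measurable_sin_dotp|exact: measurable_gauss_Rn].
  + move=> y t; rewrite normrM E (ger0_norm (x := _ * expR _)) ?mulr_ge0 ?expR_ge0// ler_piMl ?mulr_ge0 ?expR_ge0 ?norm_sin_le1//.
  under eq_Rint do (under eq_Rint do rewrite Esin; rewrite RintD ?RintZl ?Ic ?Is//; try exact: intgrZl).
  under eq_Rint do rewrite mulr0 addr0 mulrC.
  by rewrite RintZl// IHs mulr0.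
Qed.

End BesselGauss.

(** * Energy estimates for the Bessel kernel *)

Section BesselBounds.
Context {R : realType}.

Lemma der_nonincreasing (f g : R -> R) (a b : R) : a <= b ->
  (forall x, a <= x <= b -> der f x (g x)) -> (forall x, a <= x <= b -> g x <= 0) -> f b <= f a.
Proof.
rewrite le_eqVlt => /predU1P[->//|ab] df g0.
have [||c /[!in_itv]/= /andP[ac cb] E] := @MVT R f g a b ab.
- by move=> x /[!in_itv]/= /andP[ax xb]; apply: df; rewrite !ltW.
- apply: derivable_within_continuous => x /[!in_itv]/= xab.
  by have [] := df x xab.
- by rewrite -subr_le0 E mulr_le0_ge0 ?g0 ?subr_ge0 ?(ltW ab)// !ltW.
Qed.

Variable m : nat.
Hypothesis m1 : (1 <= m)%N.
Let q : R := m.+1%:R / 2.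

Let q4 : 4^-1 <= q.
Proof.
have : (1 : R) <= m.+1%:R by rewrite ler1n.
by rewrite /q; lra.
Qed.

Let q0 : q != 0.
Proof. by rewrite gt_eqF// (lt_le_trans _ q4). Qed.

(* With [m = n.-1], [bS] is the kernel S of the radial Fourier transform on R^n,
   and [bD] is its derivative. *)
Definition bS (s : R) : R := bP (m.+1%:R / 2) (s ^+ 2).
(** This is S'(s)/s, kept as an entire function so that s = 0 needs no separate treatment. *)
Definition bB (s : R) : R := - (m.+1%:R)^-1 * bP (m.+1%:R / 2 + 1) (s ^+ 2).
Definition bD (s : R) : R := s * bB s.

Lemma der_bS s : der bS s (bD s).
Proof.
have d2 : der (fun s : R => s ^+ 2) s (2%:R * s ^+ 1 * 1) by apply: derX; exact: derI.
rewrite -[bS]/(fun y => bP q (y ^+ 2)).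
apply: der_eq; first exact: (@der_comp R (bP q) (fun y => y ^+ 2) s _ _ (is_derive_bP _ q4) d2).
have E : (m.+1%:R : R) = 2 * q by rewrite /q; lra.
rewrite /bD /bB E [2 * q / 2](_ : _ = q); last by lra.
by field.
Qed.

(** Bessel's equation S'' + (m/s) S' + S = 0. *)
Lemma der_bD s : der bD s (- bS s - m%:R * bB s).
Proof.
have d2 : der (fun s : R => s ^+ 2) s (2%:R * s ^+ 1 * 1) by apply: derX; exact: derI.
have q14 : 4^-1 <= q + 1 by rewrite (le_trans q4)// lerDl.
have dB := derZ (- (m.+1%:R)^-1) (@der_comp R (bP (q + 1)) (fun y => y ^+ 2) s _ _ (is_derive_bP _ q14) d2).
have dD := derM (derI s) dB.
apply: der_eq; first exact: dD.
have := bP_recurrence (s ^+ 2) q4; rewrite /bS /bB -/q => ->.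
have q10 : q + 1 != 0 by rewrite gt_eqF// ltr_wpDl// (le_trans _ q4).
have -> : (m.+1%:R : R) = 2 * q by rewrite /q; lra.
have -> : (m%:R : R) = 2 * q - 1 by rewrite /q -[m.+1%:R]natr1; lra.
rewrite expr1 !mulr1; field; by rewrite q0 q10.
Qed.

(** The energy S^2 + S'^2 decreases along Bessel's equation: its derivative is - 2 m S'^2 / s. At 0
    it equals 1. *)
Lemma bSD_le1 s : 0 <= s -> bS s ^+ 2 + bD s ^+ 2 <= 1.
Proof.
move=> s0.
have -> : 1 = bS 0 ^+ 2 + bD 0 ^+ 2.
  have z2 : (0 : R) ^+ 2 = 0 by rewrite expr0n.
  by rewrite /bD mul0r /bS z2 bP0 expr1n addr0.
pose g x := 2%:R * bS x ^+ 1 * bD x + 2%:R * bD x ^+ 1 * (- bS x - m%:R * bB x).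
apply: (@der_nonincreasing (fun x => bS x ^+ 2 + bD x ^+ 2) g) => //.
  by move=> x _; apply: derD; apply: derX; [exact: der_bS|exact: der_bD].
move=> x /andP[x0 _].
have -> : g x = - (2 * m%:R * (x * bB x ^+ 2)) by rewrite /g /bD !expr1; ring.
by rewrite oppr_le0; apply: mulr_ge0 => //; apply: mulr_ge0 => //; exact: sqr_ge0.
Qed.

(** The derivative of s^m (S^2 + S'^2) is m s^(m-1) (S^2 - S'^2), which oscillates but is not
    integrable in size. The added term m s^(m-1) S S' cancels it and leaves only - m s^(m-2) S S',
    smaller by a factor 1/s. *)
Let E s := s ^+ m * (bS s ^+ 2 + bD s ^+ 2) + m%:R * (s ^+ m.-1 * (bS s * bD s)).

Let derE s : s != 0 -> der E s (- (m%:R * (s ^+ m.-1 * (bS s * bB s)))).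
Proof.
move=> s0; apply: der_eq.
  apply: derD; last apply: derZ.
  - apply: derM; first by apply: derX; exact: derI.
    by apply: derD; apply: derX; [exact: der_bS|exact: der_bD].
  - apply: derM; first by apply: derX; exact: derI.
    by apply: derM; [exact: der_bS|exact: der_bD].
rewrite /= /bD; case: m m1 => // k _ /=.
case: k => [|k] /=; first by rewrite !expr1 !expr0; ring.
by rewrite -[k.+2%:R]natr1 -[k.+1%:R]natr1 !exprS; ring.
Qed.

(** Beyond s = m the corrected energy [E] is comparable to s^m (S^2 + S'^2) and satisfies E' <= (m /
    s^2) E, whose coefficient is integrable at infinity; so E stays bounded. Before s = m the bound
    [bSD_le1] suffices. The constant is 2 times the bound 2 m^m exp(1) for E exp(m/s) at s = m. *)
Lemma bessel_decay : exists2 C : R, 1 <= C & forall s, 0 <= s -> s ^+ m * (bS s ^+ 2 + bD s ^+ 2) <= C.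
Proof.
have M1 : (1 : R) <= m%:R by rewrite ler1n.
have M0 : (0 : R) < m%:R by lra.
have e1 : (1 : R) <= expR 1 by rewrite -expR0 ler_expR.
have Mm : (1 : R) <= m%:R ^+ m by rewrite exprn_ege1.
exists (4 * expR 1 * m%:R ^+ m).
  by rewrite -[leLHS]mulr1 ler_pM//; nra.
move=> s s0; have [sm|ms] := leP s m%:R.
  apply: (@le_trans _ _ (m%:R ^+ m * 1)).
    by rewrite ler_pM ?exprn_ge0 ?addr_ge0 ?sqr_ge0 ?bSD_le1// lerXn2r// nnegrE.
  by rewrite mulrC ler_wpM2r ?exprn_ge0//; lra.
have spos : 0 < s by lra.
(* The difference of the two sides is x^(m-1) (m (S + S')^2 + (x - m) (S^2 + S'^2)). *)
have lowE x : m%:R <= x -> x ^+ m * (bS x ^+ 2 + bD x ^+ 2) <= 2 * E x.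
  move=> mx; have x0 : 0 < x by lra.
  have y0 : 0 <= x ^+ m.-1 by rewrite exprn_ge0// ltW.
  have xm : x ^+ m = x * x ^+ m.-1 by rewrite -exprS prednK.
  rewrite /E xm; set y := x ^+ m.-1 in y0 *; set a := bS x; set b := bD x.
  have h1 : 0 <= y * (m%:R * (a + b) ^+ 2) by apply: mulr_ge0 => //; apply: mulr_ge0; [exact: ltW|exact: sqr_ge0].
  have h2 : 0 <= y * ((x - m%:R) * (a ^+ 2 + b ^+ 2)).
    by apply: mulr_ge0 => //; apply: mulr_ge0; [rewrite subr_ge0|rewrite addr_ge0 ?sqr_ge0].
  by nra.
have E0 x : m%:R <= x -> 0 <= E x.
  move=> mx; have := lowE x mx; have : 0 <= x ^+ m * (bS x ^+ 2 + bD x ^+ 2).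
    apply: mulr_ge0; [apply: exprn_ge0; lra|by rewrite addr_ge0 ?sqr_ge0].
  by lra.
(* The Gronwall factor: h' = - (m / x^2) (E + x^m S S') exp(m/x), and E + x^m S S' >= 0 by
   [lowE]. *)
pose h x := E x * expR (m%:R / x).
pose g x := - (m%:R * (x ^+ m.-1 * (bS x * bB x))) * expR (m%:R / x) + E x * (expR (m%:R / x) * (m%:R * (- 1 / x ^+ 2))).
have hle : h s <= h m%:R.
  apply: (@der_nonincreasing h g) => [|x /andP[mx xs]|x /andP[mx xs]]; first exact: ltW.
    have x0 : x != 0 by rewrite gt_eqF//; lra.
    apply: derM; first exact: derE.
    apply: derExp; apply: derZ.
    by apply: der_eq; [exact: (is_deriveV x0 (is_derive_id x 1))|rewrite /GRing.scale/= mulr1 mulN1r].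
  have x0 : 0 < x by lra.
  rewrite /g.
  have -> : forall e, - (m%:R * (x ^+ m.-1 * (bS x * bB x))) * e + E x * (e * (m%:R * (- 1 / x ^+ 2))) =
     - (m%:R * (E x + x * x ^+ m.-1 * (bS x * bD x)) / x ^+ 2 * e).
    by move=> e; rewrite /bD; field; rewrite gt_eqF.
  rewrite oppr_le0; apply: mulr_ge0; last exact: expR_ge0.
  apply: mulr_ge0; last by rewrite invr_ge0 sqr_ge0.
  apply: mulr_ge0; first exact: ltW.
  have := lowE x mx; rewrite -exprS prednK//.
  have : 0 <= x ^+ m * (bS x + bD x) ^+ 2 by apply: mulr_ge0; [apply/exprn_ge0/ltW|apply: sqr_ge0].
  by nra.
have hm : h m%:R <= 2 * m%:R ^+ m * expR 1.
  rewrite /h divff ?gt_eqF// ler_wpM2r ?expR_ge0// /E.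
  have -> : m%:R * (m%:R ^+ m.-1 * (bS m%:R * bD m%:R)) = m%:R ^+ m * (bS m%:R * bD m%:R).
    by rewrite mulrA -exprS prednK.
  rewrite -mulrDr mulrC ler_wpM2r ?(le_trans _ Mm)//.
  have := bSD_le1 (ltW M0); have : 0 <= (bS m%:R - bD m%:R) ^+ 2 by rewrite sqr_ge0.
  by nra.
have : E s <= h s.
  by rewrite /h ler_peMr ?E0 ?(ltW ms)// -expR0 ler_expR divr_ge0// ltW.
have := lowE s (ltW ms); lra.
Qed.

End BesselBounds.

(** * Kernels with equal Gaussian integrals *)

Section KernelTransfer.
Context {R : realType} d (T : measurableType d) (m : {measure set T -> \bar R}).
Variables (v k1 k2 : T -> R).
Hypotheses (mv : measurable_fun setT v) (v0 : forall x, 0 <= v x).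
Hypotheses (mk1 : measurable_fun setT k1) (mk2 : measurable_fun setT k2).
Hypotheses (k1b : forall x, `|k1 x| <= 1) (k2b : forall x, `|k2 x| <= 1).
Hypothesis ie : forall l : R, 0 < l -> intgr m (fun x => expR (- (l * v x))).
Hypothesis Lk : forall l : R, 0 < l -> Rint m (fun x => k1 x * expR (- (l * v x))) = Rint m (fun x => k2 x * expR (- (l * v x))).

Let intgr_bdd (k f : T -> R) : measurable_fun setT k -> (forall x, `|k x| <= 1) -> intgr m f -> intgr m (fun x => k x * f x).
Proof.
move=> mk kb i; apply: (intgr_dom _ _ (intgr_norm i)); first by apply: measurable_funM => //; exact: intgr_meas i.
by move=> x; rewrite normrM ler_piMl.
Qed.

Let transfer_ge0 (H : R -> R) : measurable_fun setT H -> (forall y, 0 <= H y) -> intgr m (fun x => H (v x)) ->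
  Rint m (fun x => k1 x * H (v x)) = Rint m (fun x => k2 x * H (v x)).
Proof.
move=> mH H0 iH.
have k0 (k : T -> R) x : `|k x| <= 1 -> 0 <= 1 + k x.
  by rewrite ler_norml => /andP[h _]; rewrite -lerBlDl sub0r.
have E1 l x : expR (- (1 * v x)) = expR (- v x) by rewrite mul1r.
have split (k f : T -> R) : measurable_fun setT k -> (forall x, `|k x| <= 1) -> intgr m f ->
    intgr m (fun x => (1 + k x) * f x) /\ Rint m (fun x => (1 + k x) * f x) = Rint m f + Rint m (fun x => k x * f x).
  move=> mk kb i.
  have -> : (fun x => (1 + k x) * f x) = (fun x => f x + k x * f x) by apply/funext => x; ring.
  by split; [apply: intgrD => //; exact: intgr_bdd|rewrite RintD//; exact: intgr_bdd].
have i1 : intgr m (fun x => expR (- v x)).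
  by have := ie ltr01; under eq_fun do rewrite mul1r.
have := @Laplace_transfer R _ _ T T m m (fun x => 1 + k1 x) v (fun x => 1 + k2 x) v
  (fun x => k0 k1 x (k1b x)) (fun x => k0 k2 x (k2b x)) mv mv v0 v0
  (split k1 _ mk1 k1b i1).1 (split k2 _ mk2 k2b i1).1.
have h : forall j : nat, Rint m (fun x => (1 + k1 x) * expR (- (j.+1%:R * v x))) =
  Rint m (fun x => (1 + k2 x) * expR (- (j.+1%:R * v x))).
  move=> j; have j0 : (0 : R) < j.+1%:R by rewrite ltr0n.
  by rewrite (split k1 _ mk1 k1b (ie j0)).2 (split k2 _ mk2 k2b (ie j0)).2 Lk.
move=> /(_ h (fun y => (H y)%:E)) => hh.
have : (\int[m]_x ((1 + k1 x)%:E * (H (v x))%:E) = \int[m]_x ((1 + k2 x)%:E * (H (v x))%:E))%E.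
  by apply: hh; [exact/measurable_EFinP|move=> y; rewrite lee_fin].
have [j1 e1] := split k1 _ mk1 k1b iH; have [j2 e2] := split k2 _ mk2 k2b iH.
under eq_integral do rewrite -EFinM; under [X in _ = X -> _]eq_integral do rewrite -EFinM.
rewrite -(EFin_Rint j1) -(EFin_Rint j2) e1 e2 => -[]; lra.
Qed.

(** Since the kernels are bounded by 1, adding 1 makes them nonnegative, as [Laplace_transfer]
    requires; the integral of H alone is then subtracted from both sides. A signed H is split into
    its two parts. *)
Lemma kernel_transfer (H : R -> R) : measurable_fun setT H -> intgr m (fun x => H (v x)) ->
  Rint m (fun x => k1 x * H (v x)) = Rint m (fun x => k2 x * H (v x)).
Proof.
move=> mH iH.
pose Hp y := Num.max (H y) 0; pose Hn y := Num.max (- H y) 0.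
have mHp : measurable_fun setT Hp by apply: measurable_maxr => //; exact: measurable_cst.
have mHn : measurable_fun setT Hn.
  by apply: measurable_maxr; [exact: measurableT_comp|exact: measurable_cst].
have Hp0 y : 0 <= Hp y by rewrite /Hp le_max lexx orbT.
have Hn0 y : 0 <= Hn y by rewrite /Hn le_max lexx orbT.
have HE y : H y = Hp y - Hn y.
  by rewrite /Hp /Hn; have [h|h] := leP 0 (H y); have [h'|h'] := leP 0 (- H y); lra.
have Hpn y : `|H y| = Hp y + Hn y.
  rewrite /Hp /Hn; have [h|h] := leP 0 (H y); have [h'|h'] := leP 0 (- H y);
  rewrite ?(ger0_norm h) ?(ltr0_norm h); lra.
have ip : intgr m (fun x => Hp (v x)).
  apply: (intgr_dom _ _ (intgr_norm iH)); first exact: measurableT_comp.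
  by move=> x; rewrite Hpn ger0_norm// lerDl.
have inn : intgr m (fun x => Hn (v x)).
  apply: (intgr_dom _ _ (intgr_norm iH)); first exact: measurableT_comp.
  by move=> x; rewrite Hpn ger0_norm// lerDr.
have E (k : T -> R) : measurable_fun setT k -> (forall x, `|k x| <= 1) ->
  Rint m (fun x => k x * H (v x)) = Rint m (fun x => k x * Hp (v x)) - Rint m (fun x => k x * Hn (v x)).
  move=> mk kb; rewrite -RintB; [|exact: intgr_bdd..].
  by apply: eq_Rint => x; rewrite HE; ring.
by rewrite !E// (transfer_ge0 mHp)// (transfer_ge0 mHn).
Qed.

End KernelTransfer.

(** * Radial Fourier transforms and polar coordinates *)

Section RadialFourier.
Context {R : realType} (n : nat).
Hypothesis n2 : (2 <= n)%N.
Local Notation mu := (lebesgue_Rn n : {measure set Rn R n -> \bar R}).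

Lemma bS_dim : (n.-1.+1%:R : R) = n%:R.
Proof. by rewrite prednK// (ltn_trans _ n2). Qed.

Let n1 : (1 <= n.-1)%N. Proof. by case: n n2 => [|[|]]. Qed.

Lemma bS_le1 (s : R) : 0 <= s -> `|bS n.-1 s| <= 1.
Proof.
move=> s0; have h := bSD_le1 n.-1 s0.
by rewrite -ler_sqr ?nnegrE// expr1n real_normK ?num_real// (le_trans _ h)// lerDl sqr_ge0.
Qed.

Lemma bD_le1 (s : R) : 0 <= s -> `|bD n.-1 s| <= 1.
Proof.
move=> s0; have h := bSD_le1 n.-1 s0.
by rewrite -ler_sqr ?nnegrE// expr1n real_normK ?num_real// (le_trans _ h)// lerDr sqr_ge0.
Qed.

Lemma enorm_ge0 (x : Rn R n) : 0 <= enorm x.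
Proof. exact: sqrtr_ge0. Qed.

Lemma enorm_sqr (x : Rn R n) : enorm x ^+ 2 = dotp x x.
Proof. by rewrite sqr_sqrtr// dotpp_ge0. Qed.

Lemma measurable_enorm : measurable_fun setT (@enorm R n).
Proof.
have -> : @enorm R n = (fun x => dotp x x `^ 2^-1).
  by apply/funext => x; rewrite powR12_sqrt// dotpp_ge0.
by apply: (measurableT_comp (measurable_powR _)); exact: measurable_dotpp.
Qed.

Lemma continuous_bS m : (1 <= m)%N -> continuous (@bS R m).
Proof. by move=> m1 s; exact: der_cont (der_bS m s). Qed.

(** The value agrees with the Gaussian integral of cos(x.y) in [gauss_Rn_cis]. This identifies the
    spherical mean of the cosine with the Bessel kernel without any surface measure. *)
Lemma bS_Laplace (x : Rn R n) (l : R) : 0 < l ->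
  intgr mu (fun y => bS n.-1 (enorm x * enorm y) * expR (- (l * dotp y y))) /\
  Rint mu (fun y => bS n.-1 (enorm x * enorm y) * expR (- (l * dotp y y))) =
   Num.sqrt (pi / l) ^+ n * expR (- (dotp x x / (4 * l))).
Proof.
move=> l0.
have := @bP_Laplace R _ _ mu (fun y => dotp y y) (Num.sqrt pi ^+ n) (n%:R / 2) (@measurable_dotpp R n) (@dotpp_ge0 R n) _ _ (enorm x) l.
have E : (fun y : Rn R n => bP (n%:R / 2) (enorm x ^+ 2 * dotp y y) * expR (- (l * dotp y y))) =
  (fun y => bS n.-1 (enorm x * enorm y) * expR (- (l * dotp y y))).
  by apply/funext => y; rewrite /bS bS_dim exprMn (enorm_sqr y).
rewrite E enorm_sqr.
have E2 (l' : R) : 0 < l' -> Num.sqrt (pi / l') ^+ n = Num.sqrt pi ^+ n * l' `^ (- (n%:R / 2)).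
  move=> l'0; rewrite sqrt_powR// exprMn; congr (_ * _).
  by rewrite -powR_mulrn ?powR_ge0// -powRrM; congr (_ `^ _); lra.
rewrite -E2// => H; apply: H => //.
- by move=> l' l'0; case: (gauss_Rn n l'0).
- by move=> l' l'0; case: (gauss_Rn n l'0) => _ ->; rewrite E2.
- have : (2 : R) <= n%:R by rewrite ler_nat. 
  by lra.
Qed.

Lemma measurable_bS_enorm (x : Rn R n) : measurable_fun setT (fun y : Rn R n => bS n.-1 (enorm x * enorm y)).
Proof.
apply: (measurableT_comp (f := @bS R n.-1)); first by apply: continuous_measurable_fun; exact: continuous_bS.
by apply: measurable_funM => //; exact: measurable_enorm.
Qed.

Lemma radial_cos (x : Rn R n) (H : R -> R) : measurable_fun setT H -> intgr mu (fun y => H (dotp y y)) ->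
  Rint mu (fun y => cos (dotp x y) * H (dotp y y)) = Rint mu (fun y => bS n.-1 (enorm x * enorm y) * H (dotp y y)).
Proof.
move=> mH iH; apply: (@kernel_transfer R _ _ mu (fun y => dotp y y)) => //.
- exact: measurable_dotpp.
- exact: dotpp_ge0.
- exact: measurable_cos_dotp.
- exact: measurable_bS_enorm.
- by move=> y; exact: norm_cos_le1.
- by move=> y; apply: bS_le1; rewrite mulr_ge0 ?enorm_ge0.
- by move=> l l0; case: (gauss_Rn n l0).
- by move=> l l0; rewrite (gauss_Rn_cis x l0).1 (bS_Laplace x l0).2.
Qed.

Lemma radial_sin (x : Rn R n) (H : R -> R) : measurable_fun setT H -> intgr mu (fun y => H (dotp y y)) ->
  Rint mu (fun y => sin (dotp x y) * H (dotp y y)) = 0.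
Proof.
move=> mH iH; rewrite (@kernel_transfer R _ _ mu (fun y => dotp y y) (fun y => sin (dotp x y)) (fun=> 0)) => //.
- by under eq_Rint do rewrite mul0r; rewrite Rint0.
- exact: measurable_dotpp.
- exact: dotpp_ge0.
- exact: measurable_sin_dotp.
- by move=> y; exact: norm_sin_le1.
- by move=> y; rewrite normr0.
- by move=> l l0; case: (gauss_Rn n l0).
- by move=> l l0; rewrite (gauss_Rn_cis x l0).2; under eq_Rint do rewrite mul0r; rewrite Rint0.
Qed.

End RadialFourier.

(** * Windows as real factors *)

Section Windows.
Context {R : realType}.
Local Notation leb := (@lebesgue_measure R).

(** An indicator as a factor of the integrand, not as a domain of integration: the ends may then
    depend on another variable of integration, and joint measurability and Fubini apply
    unchanged. *)
Definition win (a b x : R) : R := ((a <= x) && (x <= b))%:R.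

Lemma win_ge0 a b x : 0 <= win a b x. Proof. by rewrite /win ler0n. Qed.
Lemma win_le1 a b x : win a b x <= 1.
Proof. by rewrite /win; case: (_ && _). Qed.
Lemma win_idem a b x : win a b x * win a b x = win a b x.
Proof. by rewrite /win; case: (_ && _); rewrite ?mulr1 ?mulr0. Qed.

Lemma winE a b x : win a b x = \1_(`[a, b]%classic) x.
Proof.
rewrite indicE /win; congr (_%:R); congr (nat_of_bool _).
by apply/idP/idP => [h|/set_mem/= /[!in_itv]/=//]; rewrite mem_set//= in_itv/= h.
Qed.

Lemma measurable_win d (T : measurableType d) (f g h : T -> R) :
  measurable_fun setT f -> measurable_fun setT g -> measurable_fun setT h ->
  measurable_fun setT (fun x => win (f x) (g x) (h x)).
Proof.
move=> mf mg mh.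
have mb : measurable_fun setT (fun x => (f x <= h x) && (h x <= g x)).
  by apply: measurable_and; exact: measurable_fun_ler.
by apply: (measurableT_comp (f := fun b : bool => b%:R : R)) => //.
Qed.

Lemma intgr_win a b : intgr leb (win a b).
Proof.
have -> : win a b = \1_(`[a, b]%classic) by apply/funext => x; rewrite winE.
exact: integrable_indic_itv.
Qed.

Lemma Rint_win a b : a <= b -> Rint leb (win a b) = b - a.
Proof.
move=> ab; have -> : win a b = \1_(`[a, b]%classic) by apply/funext => x; rewrite winE.
rewrite /Rint /Rintegral integral_indic// setIT [X in fine X](lebesgue_measure_itv `[a, b])/= lte_fin.
case: (ltP a b) => [//|ba].
have -> : a = b by apply: le_anti; rewrite ab ba.
by rewrite subrr.
Qed.

Lemma Rint_winE a b (f : R -> R) : Rint leb (fun x => win a b x * f x) = \int[leb]_(x in `[a, b]) f x.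
Proof.
rewrite [RHS]Rintegral_mkcond; apply: eq_Rint => x; rewrite patchE winE indicE.
by case: ifPn => _; rewrite ?mul1r ?mul0r.
Qed.

Lemma integral_winE a b (f : R -> R) :
  (\int[leb]_x (win a b x * f x)%:E = \int[leb]_(x in `[a, b]) (f x)%:E)%E.
Proof.
rewrite [RHS]integral_mkcond; apply: eq_integral => x _; rewrite patchE winE indicE.
by case: ifPn => _; rewrite ?mul1r ?mul0r.
Qed.

Lemma intgr_win_bdd a b (f : R -> R) (B : R) : measurable_fun setT f -> (forall x, a <= x <= b -> `|f x| <= B) ->
  intgr leb (fun x => win a b x * f x).
Proof.
move=> mf fB; apply: (@intgr_dom _ _ _ leb _ (fun x => B * win a b x)); last exact/intgrZl/intgr_win.
  by apply: measurable_funM => //; apply: measurable_win => //; exact: measurable_cst.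
move=> x; rewrite normrM (ger0_norm (win_ge0 _ _ _)) mulrC /win.
by case: (boolP ((a <= x) && (x <= b))) => h; rewrite ?mulr1 ?mulr0 ?fB.
Qed.

Lemma intgr_win_cont a b (f : R -> R) : (forall x, a <= x <= b -> {for x, continuous f}) ->
  intgr leb (fun x => win a b x * f x).
Proof.
move=> cf; have h : leb.-integrable (`[a, b]%classic : set (measurableTypeR R)) (EFin \o (f : measurableTypeR R -> R)).
  apply: continuous_compact_integrable; first exact: segment_compact.
  by apply: continuous_in_subspaceT => x; rewrite inE/= in_itv/=; exact: cf.
have mab : measurable (`[a, b]%classic : set (measurableTypeR R)) by exact: measurable_itv.
have {h} := (integrable_mkcond (mu := leb) (EFin \o f) mab).1 h; congr (_.-integrable _ _).
apply/funext => x; rewrite patchE /= winE indicE.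
by case: ifPn => _ /=; rewrite ?mul1r ?mul0r.
Qed.

End Windows.

(** The absolute value makes the power continuous on the whole line, where several later statements
    require continuity. *)
Lemma continuous_normpowR (R : realType) (e : R) : 0 < e -> continuous (fun y : R => `|y| `^ e).
Proof.
move=> e0 y.
have [->|y0] := eqVneq y 0; last first.
  apply: (continuous_comp (f := fun y : R => `|y|) (g := fun z => z `^ e)); first exact: norm_continuous.
  by apply: der_cont (derPow _ _); rewrite normr_gt0.
apply/cvgrPdist_lt => eps eps0; rewrite normr0 powR0 ?gt_eqF//.
exists (eps `^ e^-1); first exact: powR_gt0.
move=> z /=; rewrite !sub0r !normrN => h; rewrite ger0_norm ?powR_ge0//.
have -> : eps = (eps `^ e^-1) `^ e by rewrite -powRrM mulVf ?gt_eqF// powRr1// ltW.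
by apply: gt0_ltr_powR => //; rewrite nnegrE ?powR_ge0.
Qed.

(** * Polar coordinates *)

Section Polar.
Context {R : realType} (n : nat).
Hypothesis n2 : (2 <= n)%N.
Local Notation leb := (@lebesgue_measure R).
Local Notation mu := (lebesgue_Rn n : {measure set Rn R n -> \bar R}).

Let N : R := n%:R.
Let N2 : 2 <= N. Proof. by rewrite /N ler_nat. Qed.
Let N0 : 0 < N. Proof. by have := N2; lra. Qed.

(** The variable y stands for |x|^n. In it the radial part of Lebesgue measure has constant density,
    and a Gaussian becomes exp(-l y^(2/n)). *)
Let G (l y : R) : R := expR (- (l * `|y| `^ (2 / N))).

Let mG l : measurable_fun setT (G l).
Proof.
apply: measurableT_comp => //; apply: measurableT_comp => //; apply: measurable_funM => //.
by apply: (measurableT_comp (measurable_powR _)).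
Qed.

Let cG l : {within `[0, +oo[, continuous (G l)}.
Proof.
apply: continuous_subspaceT => y.
apply: (continuous_comp (f := fun y => - (l * `|y| `^ (2 / N))) (g := expR)); last exact: continuous_expR.
apply: cvgN; apply: cvgMr.
by apply: continuous_normpowR; rewrite divr_gt0.
Qed.

Let J (l : R) := (\int[leb]_(y in `[0%R, +oo[) (G l y)%:E)%E.

Let J1_lty : (J 1 < +oo)%E.
Proof.
pose F (y : R) := - (1 + y)^-1; pose f (y : R) := ((1 + y) ^+ 2)^-1.
have cf : {within `[0, +oo[, continuous f}.
  apply: continuous_in_subspaceT => y; rewrite inE/= in_itv/= andbT => y0.
  have y1 : (1 + y) ^+ 2 != 0 by rewrite expf_neq0// gt_eqF//; lra.
  apply: cvgV => //.
  by apply: cvgM; apply: cvgD; [exact: cvg_cst|exact: cvg_id|exact: cvg_cst|exact: cvg_id].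
have I : (\int[leb]_(y in `[0%R, +oo[) (f y)%:E = 0%:E - (F 0)%:E)%E.
  have dF y : 0 <= y -> der F y (f y).
    move=> y0; have y1 : 1 + y != 0 by rewrite gt_eqF//; lra.
    have := derN (@is_deriveV _ (fun z => 1 + z) y _ 1 y1 (derD (derC 1 y) (derI y))).
    by move/der_eq; apply; rewrite /f /GRing.scale/= add0r mulr1 opprK.
  apply: ge0_continuous_FTC2y.
  - by move=> x x0; rewrite invr_ge0 sqr_ge0.
  - exact: cf.
  - rewrite -[0 in X in _ --> X]oppr0; apply: cvgN.
    by apply/gtr0_cvgV0; [near=> z; have : 0 < z by []; lra|exact: cvg_addrl].
  - by move=> x x0; have /derP[] := dF x (ltW x0).
  - by apply: cvg_at_right_filter; exact: der_cont (dF 0 (lexx _)).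
  - by move=> x; rewrite in_itv/= andbT => x0; have /derP[_ ->] := dF x (ltW x0).
(* Comes from (1 + y)^2 <= 2 + 2 y^2, with G <= 1 and G y^2 <= n!, the latter being z^n exp(-z) <=
   n! at z = y^(2/n). *)
pose C : R := 2 + 2 * n`!%:R.
have Gf y : 0 <= y -> G 1 y <= C * f y.
  move=> y0; rewrite /f ler_pdivlMr; last by rewrite exprn_gt0//; lra.
  have h1 : G 1 y <= 1 by rewrite /G -[X in _ <= X](@expR0 R) ler_expR oppr_le0 mul1r powR_ge0.
  have h2 : G 1 y * y ^+ 2 <= n`!%:R.
    have := @expX_le R 1 (`|y| `^ (2 / N)) n ltr01 (powR_ge0 _ _).
    rewrite -powR_mulrn ?powR_ge0// -powRrM.
    have -> : 2 / N * n%:R = 2%:R by rewrite divfK// gt_eqF.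
    rewrite powR_mulrn// real_normK ?num_real// expr1n divr1 mul1r => h.
    by rewrite /G expRN mulrC mul1r ler_pdivrMr ?expR_gt0.
  have h0 : 0 <= G 1 y by rewrite /G expR_ge0.
  have h3 : 0 <= G 1 y * (1 - y) ^+ 2 by rewrite mulr_ge0 ?sqr_ge0.
  by rewrite /C; lra.
have C0 : 0 <= C by rewrite /C addr_ge0// mulr_ge0.
have mf : measurable_fun (`[0, +oo[%classic : set R) (EFin \o f).
  by apply/measurable_EFinP; exact: subspace_continuous_measurable_fun.
apply: (@le_lt_trans _ _ (\int[leb]_(y in `[0%R, +oo[) (C * f y)%:E)%E).
  apply: ge0_le_integral => //=.
  - by move=> y _; rewrite lee_fin expR_ge0.
  - by apply: measurable_funTS; apply/measurable_EFinP; exact: mG.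
  - by apply/measurable_EFinP; apply: measurable_funM => //; exact/measurable_EFinP.
  - by move=> y; rewrite in_itv/= andbT => y0; rewrite lee_fin Gf.
under eq_integral => y _ do rewrite EFinM.
rewrite ge0_integralZl//; last by move=> y _; rewrite lee_fin invr_ge0 sqr_ge0.
by rewrite I -EFinB -EFinM ltry.
Unshelve. all: by end_near. Qed.

Let J_scale l : 0 < l -> J l = ((l `^ (- (N / 2)))%:E * J 1)%E.
Proof.
move=> l0; pose c := l `^ (N / 2); have c0 : 0 < c by rewrite powR_gt0.
pose F (y : R) := c * y.
have dF y : der F y c by apply: der_eq (derZ c (derI y)) _; rewrite mulr1.
have F' : F^`()%classic = cst c by apply/funext => y; have /derP[_ <-] := dF y; rewrite derive1E.
have F0 : F 0 = 0 by rewrite /F mulr0.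
have -> : (J 1 = c%:E * J l)%E.
  rewrite /J -[X in (\int[leb]_(y in `[X, +oo[) (G 1 y)%:E)%E]F0.
  rewrite increasing_ge0_integration_by_substitutiony.
  - rewrite F' -ge0_integralZl//.
    + apply: eq_integral => y; rewrite inE/= in_itv/= andbT => y0.
      rewrite -EFinM; congr (_%:E).
      rewrite -[LHS]/(expR (- (1 * `|c * y| `^ (2 / N))) * c) mulrC; congr (_ * _).
      rewrite normrM (ger0_norm (ltW c0)) powRM ?normr_ge0 ?ltW// mul1r -powRrM.
      have -> : N / 2 * (2 / N) = 1 by field; rewrite gt_eqF.
      by rewrite powRr1// ltW.
    + by apply: measurable_funTS; apply/measurable_EFinP; exact: mG.
    + by move=> y _; rewrite lee_fin expR_ge0.
    + by rewrite lee_fin ltW.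
  - by move=> x y _ _ xy; rewrite /F ltr_pM2l.
  - by rewrite F' => x _; exact: cvg_cst.
  - by rewrite F'; apply: is_cvg_cst.
  - by rewrite F'; apply: is_cvg_cst.
  - split; first by move=> x _; have /derP[] := dF x.
    by apply: cvg_at_right_filter; exact: der_cont (dF 0).
  - apply/cvgryPge => A; near=> y.
    by rewrite /F mulrC -ler_pdivrMr//; near: y; exact: nbhs_pinfty_ge.
  - by rewrite F0; exact: cG.
  - by move=> x _; rewrite expR_ge0.
rewrite muleA -EFinM /c -powRD; last by rewrite (gt_eqF l0) implybT.
by rewrite addNr powRr0 mul1e.
Unshelve. all: by end_near. Qed.

Let J1_gt0 : (0 < J 1)%E.
Proof.
have h : (\int[leb]_(y in `[0%R, 1%R]) (expR (-1))%:E <= J 1)%E.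
  apply: (@le_trans _ _ (\int[leb]_(y in `[0%R, 1%R]) (G 1 y)%:E)%E).
    apply: ge0_le_integral => //=.
    - by apply: measurable_funTS; apply/measurable_EFinP; exact: mG.
    - move=> y; rewrite in_itv/= => /andP[y0 y1]; rewrite lee_fin ler_expR lerN2 mul1r ger0_norm//.
      apply: (@le_trans _ _ (1 `^ (2 / N))); last by rewrite powR1.
      apply: ge0_ler_powR; rewrite ?nnegrE//.
      by rewrite ltW// divr_gt0.
  apply: ge0_subset_integral => //=.
  - by apply: measurable_funTS; apply/measurable_EFinP; exact: mG.
  - by move=> y _; rewrite lee_fin expR_ge0.
  - by move=> y /=; rewrite !in_itv/= andbT => /andP[].
apply: lt_le_trans h; rewrite integral_cst//= [X in (_ * X)%E](lebesgue_measure_itv `[0,1])/= lte_fin ltr01.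
by rewrite oppr0 adde0 mule1 lte_fin expR_gt0.
Qed.

(** The density [om] is the volume of the unit ball, found by comparing the Gaussian integrals for
    one l; the scaling [J_scale] makes them agree for all l, and [Laplace_transfer] extends the
    equality to every radial function. *)
Lemma polar : exists2 om : R, 0 < om & forall H : R -> \bar R, measurable_fun setT H -> (forall s, (0 <= H s)%E) ->
  (\int[mu]_x H (dotp x x) = \int[leb]_y ((om * ((0 <= y)%R)%:R)%R%:E * H (`|y| `^ (2 / N))%R))%E.
Proof.
pose j := fine (J 1).
have J1E : J 1 = j%:E by rewrite fineK// ge0_fin_numE// ltW.
have j0 : 0 < j by have := J1_gt0; rewrite J1E lte_fin.
pose om := Num.sqrt pi ^+ n / j; pose k2 (y : R) := om * ((0 <= y)%R)%:R.
have om0 : 0 < om by rewrite divr_gt0// exprn_gt0// sqrtr_gt0 pi_gt0.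
exists om => // H mH H0.
have mk2 : measurable_fun setT k2.
  apply: measurable_funM => //.
  apply: (measurableT_comp (f := fun b : bool => b%:R : R)) => //.
  by apply: measurable_fun_ler.
have k20 y : 0 <= k2 y by rewrite /k2 mulr_ge0 ?ler0n// ltW.
have mv : measurable_fun setT (fun y : R => `|y| `^ (2 / N)).
  by apply: (measurableT_comp (measurable_powR _)).
have Ik l : 0 < l -> (\int[leb]_y (k2 y * G l y)%:E = (om * (l `^ (- (N / 2)) * j))%:E)%E.
  move=> l0; rewrite [RHS]EFinM [X in (_ * X)%E]EFinM -J1E -J_scale// /J.
  rewrite -ge0_integralZl//=; last by rewrite lee_fin ltW.
  - rewrite [RHS]integral_mkcond; apply: eq_integral => y _; rewrite patchE mem_setE in_itv/= andbT /k2 -EFinM.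
    by case: (0 <= y); rewrite ?mulr1// mulr0 mul0r.
  - by apply: measurable_funTS; apply/measurable_EFinP; exact: mG.
  - by move=> y _; rewrite lee_fin expR_ge0.
have := @Laplace_transfer R _ _ _ _ mu leb (fun=> 1) (fun x => dotp x x) k2 (fun y : R => `|y| `^ (2 / N)).
move=> /(_ (fun=> ler01) k20 (@measurable_dotpp R n) mv (@dotpp_ge0 _ _) (fun=> powR_ge0 _ _)).
have i1 : intgr mu (fun x => 1 * expR (- dotp x x)).
  have [i _] := @gauss_Rn R n 1 ltr01; move: i; congr (intgr _ _); apply/funext => x.
  by rewrite mul1r mul1r.
have i2 l : 0 < l -> intgr leb (fun y => k2 y * G l y).
  move=> l0; apply: intgr_lty.
  - by move=> y; rewrite mulr_ge0 ?expR_ge0.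
  - by apply: measurable_funM => //; exact: mG.
  - by rewrite Ik// ltry.
move/(_ i1); have i2' : intgr leb (fun y : R => k2 y * expR (- `|y| `^ (2 / N))).
  by have := i2 1 ltr01; congr (intgr _ _); apply/funext => x; rewrite /G mul1r.
move/(_ i2') => h; rewrite -h//.
  by apply: eq_integral => x _; rewrite mul1e.
move=> m; under eq_Rint do rewrite mul1r.
have [_ ->] := @gauss_Rn R n m.+1%:R (ltr0Sn _ _).
rewrite /Rint /Rintegral Ik//= sqrt_powR// exprMn -[X in _ * X = _]powR_mulrn ?powR_ge0// -powRrM /om.
have -> : - 2^-1 * n%:R = - (N / 2) by rewrite mulNr mulrC.
by move: (Num.sqrt _ ^+ _) (_ `^ _) => A B; field; rewrite gt_eqF.
Qed.

Definition shell_fun (r1 r2 : R) (g : R -> R) (x : Rn R n) : R := win r1 r2 (enorm x) * g (enorm x).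

Lemma measurable_enorm_comp (g : R -> R) : measurable_fun setT g -> measurable_fun setT (fun x : Rn R n => g (enorm x)).
Proof. by move=> mg; apply: (measurableT_comp mg); exact: measurable_enorm. Qed.

(** The variable is now |xi|^a, in which the factor of the flow is exp(i t tau) and time evolution
    is a one-dimensional Fourier transform. On a shell away from 0 the substitution is smooth. *)
Lemma polar_shell (a : R) : 0 < a -> exists2 om : R, 0 < om & forall r1 r2 (g : R -> R), 0 < r1 -> r1 <= r2 -> continuous g ->
  intgr mu (shell_fun r1 r2 g) /\
  Rint mu (shell_fun r1 r2 g) = Rint leb (fun t => win (r1 `^ a) (r2 `^ a) t * (om * t `^ (N / a - 1) * g (t `^ a^-1))).
Proof.
move=> a0; have [om om0 P] := polar; exists (om * (N / a)); first by rewrite mulr_gt0// divr_gt0.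
have H0 r1 r2 (g : R -> R) : 0 < r1 -> r1 <= r2 -> continuous g -> (forall x, 0 <= g x) ->
  (\int[mu]_x (shell_fun r1 r2 g x)%:E = \int[leb]_t (win (r1 `^ a) (r2 `^ a) t * (om * (N / a) * t `^ (N / a - 1) * g (t `^ a^-1)))%:E)%E.
  move=> r10 r12 cg g0; have r20 : 0 < r2 by lra.
  have mg : measurable_fun setT g by exact: continuous_measurable_fun.
  pose H (s : R) := (win r1 r2 (Num.sqrt s) * g (Num.sqrt s))%:E.
  have ms : measurable_fun setT (fun s : R => Num.sqrt s).
    have -> : (fun s : R => Num.sqrt s) = (fun s => Num.max s 0 `^ 2^-1).
      apply/funext => s; case: (leP s 0) => h; last by rewrite powR12_sqrt// ltW.
      by rewrite ler0_sqrtr// powR0// invr_eq0.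
    by apply: (measurableT_comp (measurable_powR _)); apply: measurable_maxr.
  have mH : measurable_fun setT H.
    by apply/measurable_EFinP; apply: measurable_funM; [exact: measurable_win|exact: measurableT_comp].
  rewrite -[LHS]/(\int[mu]_x H (dotp x x))%E P//; last by move=> s; rewrite lee_fin mulr_ge0 ?win_ge0.
  pose G1 (y : R) := om * g (`|y| `^ N^-1).
  have -> : (\int[leb]_y ((om * ((0 <= y)%R)%:R)%R%:E * H (`|y| `^ (2 / N))%R) = \int[leb]_(y in `[(r1 `^ N)%R, (r2 `^ N)%R]) (G1 y)%:E)%E.
    rewrite -integral_winE; apply: eq_integral => y _; rewrite /H -EFinM; congr (_%:E).
    have -> : Num.sqrt (`|y| `^ (2 / N)) = `|y| `^ N^-1.
      by rewrite -powR12_sqrt ?powR_ge0// -powRrM; congr (_ `^ _); field; rewrite gt_eqF.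
    rewrite /G1.
    suff E : ((0 <= y)%R)%:R * win r1 r2 (`|y| `^ N^-1) = win (r1 `^ N) (r2 `^ N) y.
      by rewrite -E; ring.
    have rt z : 0 <= z -> z = (z `^ N^-1) `^ N :> R.
      by move=> z0; rewrite -powRrM mulVf ?gt_eqF// powRr1.
    have le_N z z' : 0 <= z -> 0 <= z' -> (z `^ N <= z' `^ N) = (z <= z').
      move=> z0 z0'; apply/idP/idP => [|h]; last by apply: ge0_ler_powR; rewrite ?nnegrE// ltW.
      by apply: contraTT; rewrite -!ltNge => h; apply: gt0_ltr_powR; rewrite ?nnegrE.
    rewrite /win; case: (leP 0 y) => y0.
      by rewrite mul1r ger0_norm// {3 4}(rt _ y0) !le_N ?powR_ge0// ltW.
    by rewrite mul0r leNgt (lt_le_trans y0) ?powR_ge0.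
  (* From t = |x|^a to y = |x|^n; the derivative of [F] supplies the factor N / a and the power N /
     a - 1. *)
  pose F (t : R) := t `^ (N / a).
  have FE r : 0 < r -> r `^ N = F (r `^ a).
    by move=> r0; rewrite /F -powRrM; congr (_ `^ _); field; rewrite gt_eqF.
  have dF t : 0 < t -> der F t (N / a * t `^ (N / a - 1)) by move=> t0; exact: derPow.
  have F' t : 0 < t -> F^`()%classic t = N / a * t `^ (N / a - 1) by move=> /dF/derP[].
  have ra0 : 0 < r1 `^ a by rewrite powR_gt0.
  have rab0 : 0 < r2 `^ a by rewrite powR_gt0.
  have cF' t : 0 < t -> {for t, continuous F^`()%classic}.
    move=> t0; apply: (@der_cont _ _ _ (N / a * ((N / a - 1) * t `^ (N / a - 1 - 1)))).
    apply: der_near (derZ _ (derPow _ t0)).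
    near=> z; rewrite F'//; near: z; exact: lt_nbhsr.
  rewrite !FE// integration_by_substitution_increasing.
  - rewrite -integral_winE; apply: eq_integral => t _; congr (_%:E); rewrite /win.
    case: (boolP (_ && _)) => [/andP[t1 _]|_]; rewrite ?mul0r// !mul1r.
    have t0 : 0 < t by lra.
    rewrite -[LHS]/(om * g (`|F t| `^ N^-1) * F^`()%classic t) F'// ger0_norm ?powR_ge0// -powRrM.
    have -> : N / a * N^-1 = a^-1 by field; rewrite !gt_eqF.
    by ring.
  - by apply: ge0_ler_powR; rewrite ?nnegrE// ltW.
  - move=> x y; rewrite !in_itv/= => /andP[x1 _] /andP[y1 _] xy; apply: gt0_ltr_powR; rewrite ?nnegrE ?divr_gt0//; lra.
  - by move=> x; rewrite in_itv/= => /andP[x1 _]; apply: cF'; lra.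
  - by apply/cvg_ex; exists (F^`()%classic (r1 `^ a)); apply: cvg_at_right_filter; exact: cF'.
  - by apply/cvg_ex; exists (F^`()%classic (r2 `^ a)); apply: cvg_at_left_filter; exact: cF'.
  - split.
    + by move=> x; rewrite in_itv/= => /andP[x1 _]; have /derP[] := dF x (lt_trans ra0 x1).
    + by apply: cvg_at_right_filter; exact: der_cont (dF _ _).
    + by apply: cvg_at_left_filter; exact: der_cont (dF _ _).
  - apply: continuous_subspaceT => y; apply: cvgMr.
    apply: (continuous_comp (f := fun y : R => `|y| `^ N^-1) (g := g)); last exact: cg.
    by apply: continuous_normpowR; rewrite invr_gt0.
(* The identity [H0] is for g >= 0; a signed g is the difference of its positive and negative parts,
   which are again continuous. *)
have shE r1 r2 (g : R -> R) x : shell_fun r1 r2 g x = shell_fun r1 r2 (fun x => Num.max (g x) 0) x - shell_fun r1 r2 (fun x => Num.max (- g x) 0) x.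
  rewrite /shell_fun -mulrBr; congr (_ * _); case: (leP (g (enorm x)) 0) => h; case: (leP (- g (enorm x)) 0) => h'; lra.
have I r1 r2 (g : R -> R) : 0 < r1 -> r1 <= r2 -> continuous g -> (forall x, 0 <= g x) -> intgr mu (shell_fun r1 r2 g) /\
    intgr leb (fun t => win (r1 `^ a) (r2 `^ a) t * (om * (N / a) * t `^ (N / a - 1) * g (t `^ a^-1))).
  move=> r10 r12 cg g0; have mg : measurable_fun setT g by exact: continuous_measurable_fun.
  have r20 : 0 < r2 by lra.
  have mi : measurable_fun setT (fun t : R => om * (N / a) * t `^ (N / a - 1) * g (t `^ a^-1)).
    apply: measurable_funM; last by apply: (measurableT_comp mg); exact: measurable_powR.
    by apply: measurable_funM => //; exact: measurable_powR.
  suff il : intgr leb (fun t => win (r1 `^ a) (r2 `^ a) t * (om * (N / a) * t `^ (N / a - 1) * g (t `^ a^-1))).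
    split=> //; apply: intgr_lty.
    - by move=> x; rewrite /shell_fun mulr_ge0 ?win_ge0.
    - apply: (@measurable_enorm_comp (fun s => win r1 r2 s * g s)).
      by apply: measurable_funM => //; exact: measurable_win.
    - by rewrite H0// -EFin_Rint// ltry.
  apply: intgr_win_cont => t t1.
  have t0 : 0 < t by have : 0 < r1 `^ a by [rewrite powR_gt0|]; lra.
  apply: cvgM; first by apply: cvgMr; exact: der_cont (derPow _ t0).
  by apply: (continuous_comp (f := fun y : R => y `^ a^-1) (g := g)); [exact: der_cont (derPow _ t0)|exact: cg].
move=> r1 r2 g r10 r12 cg.
have c1 : continuous (fun x => Num.max (g x) 0) by apply: max_fun_continuous => // x; exact: cvg_cst.
have c2 : continuous (fun x => Num.max (- g x) 0) by apply: max_fun_continuous => x; [apply: cvgN; exact: cg|exact: cvg_cst].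
have p1 x : 0 <= Num.max (g x) 0 by rewrite le_max lexx orbT.
have p2 x : 0 <= Num.max (- g x) 0 by rewrite le_max lexx orbT.
have [i1 j1] := I _ _ _ r10 r12 c1 p1; have [i2 j2] := I _ _ _ r10 r12 c2 p2.
have E : shell_fun r1 r2 g = fun x => shell_fun r1 r2 (fun x => Num.max (g x) 0) x - shell_fun r1 r2 (fun x => Num.max (- g x) 0) x by apply/funext => x.
rewrite E; split; first exact: intgrB.
rewrite RintB// /Rint /Rintegral !H0// -!/(Rint _ _) -/(Rintegral _ _ _) -RintB//.
apply: eq_Rint => t; rewrite -mulrBr -mulrBr; congr (_ * (_ * _)).
by move: (g _) => z; case: (leP z 0) => h; case: (leP (- z) 0) => h'; lra.
Unshelve. all: by end_near. Qed.

End Polar.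

(** * Fatou's lemma *)

Section Limits.
Context d (T : measurableType d) (R : realType) (mu : {measure set T -> \bar R}).

Lemma fatou_le (f_ : nat -> T -> \bar R) (f : T -> \bar R) (B : \bar R) :
  (forall n, measurable_fun setT (f_ n)) -> (forall n x, (0 <= f_ n x)%E) ->
  (forall x, (f x <= limn_einf (f_ ^~ x))%E) -> measurable_fun setT f -> (forall x, (0 <= f x)%E) ->
  (forall n, (\int[mu]_x f_ n x <= B)%E) -> (\int[mu]_x f x <= B)%E.
Proof.
move=> mf f0 fle mff ff0 fB.
apply: (@le_trans _ _ (\int[mu]_x (limn_einf (f_ ^~ x)))%E).
  apply: ge0_le_integral => //.
  have -> : (fun x => limn_einf (f_ ^~ x)) = (fun x => - limn_esup (-%E \o (f_ ^~ x)))%E.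
    by apply/funext => x; rewrite limn_esupN oppeK.
  apply: measurableT_comp => //; apply: measurable_fun_limn_esup => m.
  exact: measurableT_comp.
apply: le_trans (fatou mu measurableT mf (fun n x _ => f0 n x)) _.
apply: le_trans (limn_einf_sup _) _.
apply: (@le_trans _ _ (ereal_sup [set (\int[mu]_x f_ n x)%E | n in setT])).
  by apply: ereal_inf_lbound; exists setT => //; exact: filterT.
by apply: ge_ereal_sup => _ [n _ <-].
Qed.

Lemma fatou_cvg (f_ : nat -> T -> R) (f : T -> R) (B : \bar R) :
  (forall n, measurable_fun setT (f_ n)) -> (forall n x, 0 <= f_ n x) ->
  (forall x, f_ ^~ x @ \oo --> f x) ->
  (forall n, (\int[mu]_x (f_ n x)%:E <= B)%E) -> (\int[mu]_x (f x)%:E <= B)%E.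
Proof.
move=> mf f0 cf fB.
apply: (@fatou_le (fun n x => (f_ n x)%:E)) => //.
- by move=> n; exact/measurable_EFinP.
- move=> x; rewrite (_ : (f x)%:E = limn (fun n => (f_ n x)%:E)).
    by rewrite is_cvg_limn_einfE//; apply/cvg_ex; exists (f x)%:E; apply: cvg_EFin; [exact: nearW|exact: cf].
  by apply/esym/cvg_lim => //; apply: cvg_EFin; [exact: nearW|exact: cf].
- by apply/measurable_EFinP; apply: (measurable_fun_cvg mf) => x _; exact: cf.
- move=> x; rewrite lee_fin -(cvg_lim (@Rhausdorff R) (cf x)); apply: limr_ge; last exact: nearW.
  by apply/cvg_ex; exists (f x).
Qed.

End Limits.

(** * One-dimensional transforms *)

Section Transforms.
Context {R : realType}.
Local Notation leb := (@lebesgue_measure R).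
Implicit Types (f h : R -> R) (t : R).

(* The real and imaginary parts of the transform are kept apart, as real
   integrals. *)
Definition Fc f t := Rint leb (fun y => cos (t * y) * f y).
Definition Fs f t := Rint leb (fun y => sin (t * y) * f y).

Lemma measurable_cosM d (T : measurableType d) (f g : T -> R) : measurable_fun setT f -> measurable_fun setT g ->
  measurable_fun setT (fun x => cos (f x * g x)).
Proof.
move=> mf mg; apply: (measurableT_comp (f := cos)); last exact: measurable_funM.
by apply: continuous_measurable_fun => x; exact: continuous_cos.
Qed.

Lemma measurable_sinM d (T : measurableType d) (f g : T -> R) : measurable_fun setT f -> measurable_fun setT g ->
  measurable_fun setT (fun x => sin (f x * g x)).
Proof.
move=> mf mg; apply: (measurableT_comp (f := sin)); last exact: measurable_funM.
by apply: continuous_measurable_fun => x; exact: continuous_sin.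
Qed.

Lemma measurable_expN d (T : measurableType d) (g : T -> R) : measurable_fun setT g ->
  measurable_fun setT (fun x => expR (- g x)).
Proof. by move=> mg; apply: measurableT_comp => //; exact: measurableT_comp. Qed.

Lemma intgr_cosM f t : intgr leb f -> intgr leb (fun y => cos (t * y) * f y).
Proof.
move=> i; apply: (@intgr_dom _ _ _ leb _ (fun y => `|f y|)); last exact: intgr_norm.
  by apply: measurable_funM; [exact: measurable_cosM|exact: intgr_meas i].
by move=> y; rewrite normrM ler_piMl ?norm_cos_le1.
Qed.

Lemma intgr_sinM f t : intgr leb f -> intgr leb (fun y => sin (t * y) * f y).
Proof.
move=> i; apply: (@intgr_dom _ _ _ leb _ (fun y => `|f y|)); last exact: intgr_norm.
  by apply: measurable_funM; [exact: measurable_sinM|exact: intgr_meas i].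
by move=> y; rewrite normrM ler_piMl ?norm_sin_le1.
Qed.

Lemma norm_Fc f t : intgr leb f -> `|Fc f t| <= Rint leb (fun y => `|f y|).
Proof.
move=> i; apply: le_trans (Rint_norm (intgr_cosM t i)) _.
apply: Rint_le; [exact: intgr_norm (intgr_cosM t i)|exact: intgr_norm|].
by move=> y; rewrite normrM ler_piMl ?norm_cos_le1.
Qed.

Lemma norm_Fs f t : intgr leb f -> `|Fs f t| <= Rint leb (fun y => `|f y|).
Proof.
move=> i; apply: le_trans (Rint_norm (intgr_sinM t i)) _.
apply: Rint_le; [exact: intgr_norm (intgr_sinM t i)|exact: intgr_norm|].
by move=> y; rewrite normrM ler_piMl ?norm_sin_le1.
Qed.

End Transforms.

Lemma measurable_Rint d1 d2 (T1 : measurableType d1) (T2 : measurableType d2) (R : realType)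
  (m2 : {measure set T2 -> \bar R}) (s2 : sigma_finite setT m2) (f : T1 * T2 -> R) :
  measurable_fun setT f -> measurable_fun setT (fun x => Rint m2 (fun y => f (x, y))).
Proof.
move=> mf.
have -> : (fun x => Rint m2 (fun y => f (x, y))) =
  (fun x => fine (\int[m2]_y ((EFin \o f)^\+ (x, y)) - \int[m2]_y ((EFin \o f)^\- (x, y))))%E.
  apply/funext => x; rewrite /Rint /Rintegral integralE; congr (fine (_ - _)%E);
    by apply: eq_integral => y _; rewrite ?funeposE ?funenegE.
have mF : measurable_fun setT (EFin \o f) by exact/measurable_EFinP.
apply: (measurableT_comp (f := fine)) => //.
apply: emeasurable_funB.
- by apply: measurable_Tonelli1 => //; exact: measurable_funepos.
- by apply: measurable_Tonelli1 => //; exact: measurable_funeneg.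
Qed.

(** * Plancherel's inequality on the line *)

Section Plancherel.
Context {R : realType}.
Local Notation leb := (@lebesgue_measure R).
Variable f : R -> R.
Hypothesis i1 : intgr leb f.
Hypothesis i2 : intgr leb (fun y => f y ^+ 2).

Let mf : measurable_fun setT f. Proof. exact: intgr_meas i1. Qed.

Lemma measurable_Fc : measurable_fun setT (Fc f).
Proof.
apply: (@measurable_Rint _ _ (measurableTypeR R) (measurableTypeR R) R leb (@sigma_finite_leb R) (fun z => cos (z.1 * z.2) * f z.2)).
apply: measurable_funM; first exact: measurable_cosM.
exact: measurableT_comp.
Qed.

Lemma measurable_Fs : measurable_fun setT (Fs f).
Proof.
apply: (@measurable_Rint _ _ (measurableTypeR R) (measurableTypeR R) R leb (@sigma_finite_leb R) (fun z => sin (z.1 * z.2) * f z.2)).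
apply: measurable_funM; first exact: measurable_sinM.
exact: measurableT_comp.
Qed.

(** The Fourier transform of exp(-l t^2). Its mass is 2 pi for every l, and this is the constant in
    Plancherel's inequality. *)
Let Kg (l x : R) : R := Num.sqrt (pi / l) * expR (- (x ^+ 2 / (4 * l))).

Let Kg_ge0 l x : 0 <= Kg l x. Proof. by rewrite mulr_ge0 ?sqrtr_ge0 ?expR_ge0. Qed.

Let mKg d (T : measurableType d) (g : T -> R) l : measurable_fun setT g -> measurable_fun setT (fun x => Kg l (g x)).
Proof.
move=> mg; apply: measurable_funM => //; apply: measurableT_comp => //; apply: measurableT_comp => //.
by apply: measurable_funM => //; exact: measurable_funX.
Qed.

Let int_Kg l x : 0 < l -> (\int[leb]_y (Kg l (x - y))%:E = (2 * pi)%:E)%E.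
Proof.
move=> l0; pose s := Num.sqrt (2 * l); have s0 : 0 < s by rewrite sqrtr_gt0 mulr_gt0.
have s2 : s ^+ 2 = 2 * l by rewrite sqr_sqrtr// mulr_ge0// ltW.
have -> : (2 * pi)%:E = ((2 * pi)%:E * \int[leb]_y (normal_pdf x s y)%:E)%E by rewrite integral_normal_pdf mule1.
have p0 := @pi_gt0 R.
rewrite -ge0_integralZl//; last 3 first.
- by apply/measurable_EFinP; exact: measurable_normal_pdf.
- by move=> y _; rewrite lee_fin normal_pdf_ge0.
- by rewrite lee_fin mulr_ge0// ltW.
apply: eq_integral => y _; rewrite -EFinM; congr (_%:E).
rewrite /normal_pdf gt_eqF// /normal_peak /normal_fun /Kg mulrA s2; congr (_ * expR _); last first.
  by rewrite -mulr_natr; field; rewrite gt_eqF.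
have -> : 2 * l * pi *+ 2 = 4 * l * pi by ring.
have -> : 4 * l * pi = (4 * l ^+ 2) * (pi / l) by field; rewrite gt_eqF.
have pl : 0 < pi / l by rewrite divr_gt0.
have l4 : 0 <= 4 * l ^+ 2 by apply: mulr_ge0 => //; exact: sqr_ge0.
rewrite (sqrtrM _ l4).
have -> : Num.sqrt (4 * l ^+ 2) = 2 * l.
  have -> : 4 * l ^+ 2 = (2 * l) ^+ 2 by ring.
  by rewrite sqrtr_sqr ger0_norm// mulr_ge0// ltW.
have := sqr_sqrtr (ltW pl); have := sqrtr_gt0 (pi / l); rewrite pl.
move: (Num.sqrt _) => q q0 qE.
have -> : pi = l * q ^+ 2 by rewrite qE; field; rewrite gt_eqF.
by field; rewrite !gt_eqF.
Qed.

Let K l := fun t : R => expR (- (l * t ^+ 2)).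

Let M1 := Rint leb (fun y => `|f y|).

(** The Gaussian factor makes the integral over t absolutely convergent, so that Fubini can be used
    twice: once for each of the two copies of f in the square. *)
Let planch_gauss l : 0 < l ->
  Rint leb (fun t => K l t * (Fc f t ^+ 2 + Fs f t ^+ 2)) =
  Rint leb (fun x => f x * Rint leb (fun y => f y * Kg l (x - y))).
Proof.
move=> l0.
have [iK _] := gauss1 l0.
have M10 : 0 <= M1 by apply: Rint_ge0.
have mK d (T : measurableType d) (g : T -> R) : measurable_fun setT g -> measurable_fun setT (fun x => K l (g x)).
  by move=> mg; apply: measurable_expN; apply: measurable_funM => //; exact: measurable_funX.
have mc := measurable_Fc; have ms := measurable_Fs.
(* The real part of exp(-i t x) (Fc f t + i Fs f t). *)
pose D (x t : R) := cos (t * x) * Fc f t + sin (t * x) * Fs f t.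
have mD : measurable_fun setT (fun z : measurableTypeR R * measurableTypeR R => D z.2 z.1).
  by apply: measurable_funD; apply: measurable_funM; [exact: measurable_cosM|exact: measurableT_comp|exact: measurable_sinM|exact: measurableT_comp].
have mDx t : measurable_fun setT (D ^~ t).
  by apply: measurable_funD; apply: measurable_funM => //; [exact: measurable_cosM|exact: measurable_sinM].
have mDt x : measurable_fun setT (D x).
  by apply: measurable_funD; apply: measurable_funM => //; [exact: measurable_cosM|exact: measurable_sinM].
have DB x t : `|D x t| <= 2 * M1.
  rewrite (le_trans (ler_normD _ _))// !normrM mulr_natl mulr2n lerD// -[leRHS]mul1r ler_pM//.
  - exact: norm_cos_le1. - exact: norm_Fc. - exact: norm_sin_le1. - exact: norm_Fs.
have -> : Rint leb (fun t => K l t * (Fc f t ^+ 2 + Fs f t ^+ 2)) = Rint leb (fun t => Rint leb (fun x => K l t * (f x * D x t))).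
  apply: eq_Rint => t; rewrite RintZl; last first.
    apply: (@intgr_dom _ _ _ leb _ (fun x => (2 * M1) * `|f x|)); last exact/intgrZl/intgr_norm.
      by apply: measurable_funM => //; exact: mDx.
    by move=> x; rewrite normrM mulrC ler_wpM2r.
  congr (_ * _); rewrite !expr2 {1}/Fc {1}/Fs.
  rewrite [X in X + _]mulrC -RintZl; last exact: intgr_cosM.
  rewrite [X in _ + X]mulrC -RintZl; last exact: intgr_sinM.
  rewrite -RintD; [|by apply: intgrZl; exact: intgr_cosM|by apply: intgrZl; exact: intgr_sinM].
  by apply: eq_Rint => x; rewrite /D; ring.
rewrite (@RFubini _ _ _ _ _ leb leb sigma_finite_leb sigma_finite_leb (fun z => K l z.1 * (f z.2 * D z.2 z.1)) (fun t => (2 * M1) * K l t) (fun x => `|f x|)).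
- apply: eq_Rint => x /=.
  have -> : Rint leb (fun t => K l t * (f x * D x t)) = f x * Rint leb (fun t => K l t * D x t).
    rewrite -RintZl; first by apply: eq_Rint => t; ring.
    apply: (@intgr_dom _ _ _ leb _ (fun t => (2 * M1) * K l t)); last exact/intgrZl.
      by apply: measurable_funM; [exact: intgr_meas iK|exact: mDt].
    by move=> t; rewrite normrM mulrC (ger0_norm (expR_ge0 _)) ler_wpM2r ?expR_ge0.
  congr (_ * _).
  have -> : Rint leb (fun t => K l t * D x t) = Rint leb (fun t => Rint leb (fun y => K l t * (cos ((x - y) * t) * f y))).
    apply: eq_Rint => t; rewrite RintZl; last first.
      apply: (@intgr_dom _ _ _ leb _ (fun y => `|f y|)); last exact: intgr_norm.
        by apply: measurable_funM => //; apply: measurable_cosM => //; exact: measurable_funB.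
      by move=> y; rewrite normrM ler_piMl ?norm_cos_le1.
    congr (_ * _); rewrite /D /Fc /Fs -RintZl; last exact: intgr_cosM.
    rewrite -RintZl; last exact: intgr_sinM.
    rewrite -RintD; [|by apply: intgrZl; exact: intgr_cosM|by apply: intgrZl; exact: intgr_sinM].
    by apply: eq_Rint => y; rewrite mulrBl cosB [x * t]mulrC [y * t]mulrC; ring.
  rewrite (@RFubini _ _ _ _ _ leb leb sigma_finite_leb sigma_finite_leb (fun z => K l z.1 * (cos ((x - z.2) * z.1) * f z.2)) (K l) (fun x => `|f x|)).
  + apply: eq_Rint => y /=; have [ig eg] := gauss1_cos (x - y) l0.
    rewrite /Kg -eg -RintZl//; by apply: eq_Rint => t; rewrite /K; ring.
  + apply: measurable_funM; first exact: mK.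
    by apply: measurable_funM; [apply: measurable_cosM => //; exact: measurable_funB|exact: measurableT_comp].
  + exact: iK.
  + exact: intgr_norm.
  + by move=> t y; rewrite !normrM (ger0_norm (expR_ge0 _)) ler_wpM2l ?expR_ge0// ler_piMl ?norm_cos_le1.
- apply: measurable_funM; first exact: mK.
  by apply: measurable_funM => //; exact: measurableT_comp.
- exact: intgrZl.
- exact: intgr_norm.
- move=> t x /=; rewrite !normrM (ger0_norm (expR_ge0 _)).
  have h : 0 <= K l t * `|f x| by rewrite mulr_ge0 ?expR_ge0.
  have := ler_wpM2r h (DB x t); rewrite -/(K l t).
  by move: (K l t) `|f x| `|D x t| => A B C; lra.
Qed.

(** Schur's test: f(x) f(y) <= (f(x)^2 + f(y)^2) / 2, and the kernel has mass 2 pi in each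
    variable. *)
Let planch_gauss_le l : 0 < l ->
  (\int[leb]_t (K l t * (Fc f t ^+ 2 + Fs f t ^+ 2))%:E <= (2 * pi * Rint leb (fun y => f y ^+ 2))%:E)%E.
Proof.
move=> l0; have [iK _] := gauss1 l0; have M10 : 0 <= M1 by apply: Rint_ge0.
have mc := measurable_Fc; have ms := measurable_Fs.
have p0 := @pi_gt0 R.
have mf2 : measurable_fun setT (fun y => f y ^+ 2) by exact: measurable_funX.
have iKp : intgr leb (fun t => K l t * (Fc f t ^+ 2 + Fs f t ^+ 2)).
  apply: (@intgr_dom _ _ _ leb _ (fun t => (2 * M1 ^+ 2) * K l t)); last exact/intgrZl.
    apply: measurable_funM; first exact: intgr_meas iK.
    by apply: measurable_funD; exact: measurable_funX.
  move=> t; rewrite normrM (ger0_norm (expR_ge0 _)) mulrC ler_wpM2r ?expR_ge0//.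
  rewrite ger0_norm ?addr_ge0 ?sqr_ge0// mulr_natl mulr2n lerD// -[leLHS]real_normK ?num_real// lerXn2r ?nnegrE//.
    exact: norm_Fc. exact: norm_Fs.
rewrite -EFin_Rint// lee_fin planch_gauss//.
have mKxy : measurable_fun setT (fun z : measurableTypeR R * measurableTypeR R => Kg l (z.1 - z.2)).
  by apply: mKg; exact: measurable_funB.
have mKx x : measurable_fun setT (fun y : measurableTypeR R => Kg l (x - y)) by apply: mKg; exact: measurable_funB.
have intKg x : intgr leb (fun y => Kg l (x - y)).
  by apply: intgr_lty => //; rewrite int_Kg// ltry.
have intKg' y : (\int[leb]_x (Kg l (x - y))%:E = (2 * pi)%:E)%E.
  rewrite -(int_Kg y l0); apply: eq_integral => x _; congr (_%:E).
  by rewrite /Kg -opprB sqrrN.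
have T2 : (\int[leb]_x \int[leb]_y (f y ^+ 2 * Kg l (x - y))%:E = (2 * pi * Rint leb (fun y => f y ^+ 2))%:E)%E.
  rewrite (@Tonelli _ _ _ _ _ leb leb sigma_finite_leb sigma_finite_leb (fun z => (f z.2 ^+ 2 * Kg l (z.1 - z.2))%:E))/=.
  - under eq_integral => y _.
      under eq_integral do rewrite EFinM.
      rewrite ge0_integralZl//; [|by apply/measurable_EFinP; apply: mKg; exact: measurable_funB|by move=> x _; rewrite lee_fin|by rewrite lee_fin sqr_ge0].
      rewrite intKg' muleC.
    over.
    rewrite ge0_integralZl//; [|exact/measurable_EFinP|by move=> x _; rewrite lee_fin sqr_ge0|by rewrite lee_fin mulr_ge0// ltW].
    by rewrite -EFin_Rint.
  - by apply/measurable_EFinP; apply: measurable_funM => //; exact: (measurableT_comp mf2).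
  - by move=> z; rewrite lee_fin mulr_ge0 ?sqr_ge0.
pose Kx (x : R) : R := Rint leb (fun y => f y ^+ 2 * Kg l (x - y)).
have mKx2 : measurable_fun setT (fun z : measurableTypeR R * measurableTypeR R => f z.2 ^+ 2 * Kg l (z.1 - z.2)).
  by apply: measurable_funM => //; exact: (measurableT_comp mf2).
have KgB x : Kg l x <= Num.sqrt (pi / l).
  rewrite /Kg ler_piMr ?sqrtr_ge0// -[leRHS]expR0 ler_expR oppr_le0 divr_ge0 ?sqr_ge0// mulr_ge0// ltW//.
have iKx x : intgr leb (fun y => f y ^+ 2 * Kg l (x - y)).
  apply: (@intgr_dom _ _ _ leb _ (fun y => Num.sqrt (pi / l) * f y ^+ 2)); last exact: intgrZl.
    by apply: measurable_funM.
  by move=> y; rewrite normrM (ger0_norm (sqr_ge0 _)) (ger0_norm (Kg_ge0 _ _)) mulrC ler_wpM2r ?sqr_ge0.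
have EKx : (\int[leb]_x (Kx x)%:E = (2 * pi * Rint leb (fun y => f y ^+ 2))%:E)%E.
  by rewrite -T2; apply: eq_integral => x _; rewrite /Kx EFin_Rint.
have KxI : intgr leb Kx.
  apply: intgr_lty; last by rewrite EKx ltry.
  - by move=> x; apply: Rint_ge0 => y; rewrite mulr_ge0 ?sqr_ge0.
  - exact: (@measurable_Rint _ _ (measurableTypeR R) (measurableTypeR R) R leb (@sigma_finite_leb R) _ mKx2).
have RKx : Rint leb Kx = 2 * pi * Rint leb (fun y => f y ^+ 2) by apply/EFin_inj; rewrite EFin_Rint.
apply: (@le_trans _ _ (Rint leb (fun x => pi * f x ^+ 2 + 2^-1 * Kx x))); last first.
  rewrite RintD; [|exact: intgrZl|exact: intgrZl].
  by rewrite !RintZl// RKx; move: (Rint _ _) => z; lra.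
have ifK x : intgr leb (fun y => f y * Kg l (x - y)).
  apply: (@intgr_dom _ _ _ leb _ (fun y => Num.sqrt (pi / l) * `|f y|)); last exact/intgrZl/intgr_norm.
    by apply: measurable_funM.
  by move=> y; rewrite normrM (ger0_norm (Kg_ge0 _ _)) mulrC ler_wpM2r.
have bd x : f x * Rint leb (fun y => f y * Kg l (x - y)) <= pi * f x ^+ 2 + 2^-1 * Kx x.
  have RK : Rint leb (fun y => Kg l (x - y)) = 2 * pi.
    by apply/EFin_inj; rewrite EFin_Rint// int_Kg.
  have -> : pi * f x ^+ 2 = Rint leb (fun y => (2^-1 * f x ^+ 2) * Kg l (x - y)).
    by rewrite RintZl// RK; field.
  rewrite -RintZl// /Kx -[X in _ <= _ + X]RintZl// -RintD; [|exact: intgrZl|exact: intgrZl].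
  apply: Rint_le; [exact: intgrZl|by apply: intgrD; exact: intgrZl|move=> y].
  have := Kg_ge0 l (x - y); move: (Kg _ _) => k k0.
  have : 0 <= k * (f x - f y) ^+ 2 by rewrite mulr_ge0 ?sqr_ge0.
  by lra.
apply: Rint_le => //; last first.
  by apply: intgrD; exact: intgrZl.
apply: (@intgr_dom _ _ _ leb _ (fun x => (Num.sqrt (pi / l) * M1) * `|f x|)); last exact/intgrZl/intgr_norm.
  apply: measurable_funM => //.
  apply: (@measurable_Rint _ _ (measurableTypeR R) (measurableTypeR R) R leb (@sigma_finite_leb R) (fun z => f z.2 * Kg l (z.1 - z.2))).
  by apply: measurable_funM => //; exact: measurableT_comp.
move=> x; rewrite normrM mulrC ler_wpM2r//; apply: le_trans (Rint_norm (ifK x)) _.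
rewrite /M1 -RintZl; last exact: intgr_norm.
apply: Rint_le; [exact: intgr_norm|exact/intgrZl/intgr_norm|move=> y].
by rewrite normrM (ger0_norm (Kg_ge0 _ _)) mulrC ler_wpM2r.
Qed.

(** The bound with a Gaussian factor is uniform in l; Fatou's lemma removes the factor along l =
    1/(j+1). *)
Lemma Plancherel_le : (\int[leb]_t (Fc f t ^+ 2 + Fs f t ^+ 2)%:E <= (2 * pi * Rint leb (fun y => f y ^+ 2))%:E)%E.
Proof.
apply: (@fatou_cvg _ _ _ leb (fun j t => K j.+1%:R^-1 t * (Fc f t ^+ 2 + Fs f t ^+ 2))).
- move=> j; apply: measurable_funM.
    by apply: measurable_expN; apply: measurable_funM => //; exact: measurable_funX.
  by apply: measurable_funD; apply: measurable_funX; [exact: measurable_Fc|exact: measurable_Fs].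
- by move=> j x; rewrite mulr_ge0 ?expR_ge0// addr_ge0 ?sqr_ge0.
- move=> t; rewrite -[X in _ --> X]mul1r; apply: cvgM; last exact: cvg_cst.
  rewrite -[X in _ --> X](@expR0 R) /K; apply: continuous_cvg; first exact: continuous_expR.
  rewrite -[X in _ --> X]oppr0 -[X in _ --> - X](mul0r (t ^+ 2)); apply: cvgN; apply: cvgMl; exact: cvg_harmonic.
- by move=> j; exact: planch_gauss_le.
Qed.

End Plancherel.

(** * The Cauchy-Schwarz inequality *)

Section CauchySchwarz.
Context d (T : measurableType d) (R : realType) (mu : {measure set T -> \bar R}).
Implicit Types f g : T -> R.

Lemma intgr_mul f g : measurable_fun setT f -> measurable_fun setT g ->
  intgr mu (fun x => f x ^+ 2) -> intgr mu (fun x => g x ^+ 2) -> intgr mu (fun x => f x * g x).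
Proof.
move=> mf mg i j; apply: (@intgr_dom _ _ _ mu _ (fun x => f x ^+ 2 + g x ^+ 2)); last exact: intgrD.
  exact: measurable_funM.
move=> x; rewrite ler_norml; move: (f x) (g x) => u v.
have := sqr_ge0 (u - v); have := sqr_ge0 (u + v); have := sqr_ge0 u; have := sqr_ge0 v.
by move=> *; apply/andP; split; lra.
Qed.

Lemma CauchySchwarz f g : measurable_fun setT f -> measurable_fun setT g ->
  intgr mu (fun x => f x ^+ 2) -> intgr mu (fun x => g x ^+ 2) ->
  Rint mu (fun x => f x * g x) ^+ 2 <= Rint mu (fun x => f x ^+ 2) * Rint mu (fun x => g x ^+ 2).
Proof.
move=> mf mg i j; have k := intgr_mul mf mg i j.
set a := Rint mu (fun x => f x ^+ 2); set b := Rint mu (fun x => f x * g x); set c := Rint mu (fun x => g x ^+ 2).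
have Q (s t : R) : 0 <= s ^+ 2 * a + 2 * s * t * b + t ^+ 2 * c.
  have : 0 <= Rint mu (fun x => (s * f x + t * g x) ^+ 2) by apply: Rint_ge0 => x; exact: sqr_ge0.
  have -> : Rint mu (fun x => (s * f x + t * g x) ^+ 2) =
      Rint mu (fun x => (s ^+ 2 * f x ^+ 2 + 2 * s * t * (f x * g x)) + t ^+ 2 * g x ^+ 2).
    by apply: eq_Rint => x; ring.
  by rewrite RintD ?RintD ?RintZl//; try (apply: intgrD); apply: intgrZl.
have a0 : 0 <= a by apply: Rint_ge0 => x; exact: sqr_ge0.
have c0 : 0 <= c by apply: Rint_ge0 => x; exact: sqr_ge0.
(* The pair (b, -a) gives a (a c - b^2) >= 0 and (c, -b) gives c (a c - b^2) >= 0; the pairs (b, 1)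
   and (-b, 1) settle the case a = c = 0. *)
have := Q c (- b); have := Q b (- a); have := Q 1 (- b); have := Q 1 b; have := Q (- b) 1; have := Q b 1.
case: (eqVneq a 0) => [->|an0] q1 q2 q3 q4 q5 q6.
  case: (eqVneq c 0) => [->|cn0]; first by rewrite mulr0 in q1 q2 *; nra.
  have cp : 0 < c by rewrite lt0r cn0.
  have : 0 <= c * (- b ^+ 2) by move: q6; nra.
  by rewrite pmulr_rge0// mul0r; lra.
have ap : 0 < a by rewrite lt0r an0.
have : 0 <= a * (a * c - b ^+ 2) by move: q5; nra.
by rewrite pmulr_rge0//; lra.
Qed.

(** Here [g] is the indicator of a set that carries f. *)
Lemma Rint_sqr_le f : measurable_fun setT f -> intgr mu (fun x => f x ^+ 2) -> forall g,
  measurable_fun setT g -> (forall x, g x * f x = f x) -> (forall x, g x ^+ 2 = g x) -> intgr mu g ->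
  Rint mu f ^+ 2 <= Rint mu g * Rint mu (fun x => f x ^+ 2).
Proof.
move=> mf i g mg gf gg ig; have e : (fun x => g x ^+ 2) = g by apply/funext.
have := CauchySchwarz mg mf; rewrite e => /(_ ig i).
by have -> : Rint mu (fun x => g x * f x) = Rint mu f by exact: eq_Rint.
Qed.

End CauchySchwarz.

Definition prim (R : realType) (psi : R -> R) (e y : R) : R :=
  Rint (@lebesgue_measure R) (fun s => win e y s * psi s).

Lemma measurable_prim (R : realType) d (T : measurableType d) (psi : T -> R -> R) (f g : T -> R) :
  measurable_fun setT (fun z : T * measurableTypeR R => psi z.1 z.2) ->
  measurable_fun setT f -> measurable_fun setT g -> measurable_fun setT (fun x => prim (psi x) (f x) (g x)).
Proof.
move=> mpsi mf mg.
apply: (@measurable_Rint _ _ _ (measurableTypeR R) R lebesgue_measure (@sigma_finite_leb R)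
  (fun z => win (f z.1) (g z.1) z.2 * psi z.1 z.2)).
by apply: measurable_funM => //; apply: measurable_win => //; exact: measurableT_comp.
Qed.

(** * Slowly varying multipliers *)

Section ByParts.
Context {R : realType}.
Local Notation leb := (@lebesgue_measure R).

Lemma FTC_win (a b : R) (m m' : R -> R) : a <= b -> (forall x, a <= x <= b -> der m x (m' x)) ->
  (forall x, a <= x <= b -> {for x, continuous m'}) ->
  Rint leb (fun y => win a b y * m' y) = m b - m a.
Proof.
move=> ab dm cm'.
have [ab'|ba] := ltP a b; last first.
  have -> : a = b by apply: le_anti; rewrite ab ba.
  rewrite Rint_winE subrr /Rintegral set_itv1 integral_set1//.
rewrite Rint_winE /Rintegral (@continuous_FTC2 _ _ m)//.
- by apply: continuous_in_subspaceT => x; rewrite inE/= in_itv/=; exact: cm'.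
- split.
  + by move=> x; rewrite in_itv/= => /andP[x1 x2]; have /derP[] := dm x (introT andP (conj (ltW x1) (ltW x2))).
  + by apply: cvg_at_right_filter; apply: der_cont (dm _ _); rewrite lexx ab.
  + by apply: cvg_at_left_filter; apply: der_cont (dm _ _); rewrite lexx ab.
- by move=> x; rewrite in_itv/= => /andP[x1 x2]; have /derP[] := dm x (introT andP (conj (ltW x1) (ltW x2))).
Qed.

Variables (al be T B0 ka : R) (psi m m' : R -> R).
Hypotheses (al0 : 0 < al) (ab : al <= be) (T0 : 0 < T) (B00 : 0 <= B0) (ka0 : 0 <= ka).
Hypotheses (mpsi : measurable_fun setT psi) (psiB : forall x, `|psi x| <= B0 * win al be x).
Hypotheses (mm : measurable_fun setT m) (mm' : measurable_fun setT m').
Hypotheses (dm : forall x, al <= x <= be -> der m x (m' x)) (cm' : forall x, al <= x <= be -> {for x, continuous m'}).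
Hypotheses (mB : forall x, al <= x <= be -> `|m x| <= ka) (m'B : forall x, al <= x <= be -> `|m' x| <= ka * T).

Let psi0 x : ~~ (al <= x <= be) -> psi x = 0.
Proof. by move=> h; have := psiB x; rewrite /win (negbTE h) mulr0 normr_le0 => /eqP. Qed.

Lemma intgr_winM e y : intgr leb (fun s => win e y s * psi s).
Proof.
apply: (@intgr_win_bdd _ _ _ _ B0) => // x _; apply: le_trans (psiB x) _.
by rewrite ler_piMr// win_le1.
Qed.

Lemma norm_prim e y : e <= y -> `|prim psi e y| <= B0 * (y - e).
Proof.
move=> ey; apply: le_trans (Rint_norm (intgr_winM _ _)) _.
rewrite -(Rint_win ey) -RintZl; last exact: intgr_win.
apply: Rint_le; [exact/intgr_norm/intgr_winM|exact/intgrZl/intgr_win|move=> s].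
rewrite normrM (ger0_norm (win_ge0 _ _ _)) mulrC ler_wpM2r ?win_ge0//.
by apply: le_trans (psiB s) _; rewrite ler_piMr// win_le1.
Qed.

(** Integration by parts against the primitive of psi from e. In m' the factor T is offset by the
    window length 1/T: Cauchy-Schwarz turns (ka T int |prim|)^2 into ka^2 T int prim^2. Of the
    multiplier only its size [ka] remains, so that one majorant built from psi alone serves all
    multipliers. *)
Lemma by_parts_le e d : e <= d -> d - e = T^-1 ->
  Rint leb (fun s => win e d s * (m s * psi s)) ^+ 2 <=
  2 * ka ^+ 2 * (prim psi e d ^+ 2 + T * Rint leb (fun y => win e d y * prim psi e y ^+ 2)).
Proof.
(* The multiplier is controlled on [al, be] only, so the window is first cut down to this interval,
   which carries psi. *)
move=> ed dE; set c := Num.max e al; set d' := Num.min d be.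
have ec : e <= c by rewrite le_max lexx.
have ac : al <= c by rewrite le_max lexx orbT.
have dd : d' <= d by rewrite ge_min lexx.
have db : d' <= be by rewrite ge_min lexx orbT.
have wE s : win e d s * psi s = win c d' s * psi s.
  have [h|/psi0->] := boolP (al <= s <= be); last by rewrite !mulr0.
  by move/andP: h => [h1 h2]; rewrite /win /c /d' ge_max le_min h1 h2 !andbT.
have mprim : measurable_fun setT (prim psi e).
  by apply: (@measurable_prim _ _ (measurableTypeR R) (fun=> psi) (fun=> e) id) => //; exact: measurableT_comp.
have iw2 : intgr leb (fun y => win e d y * prim psi e y ^+ 2).
  apply: (@intgr_win_bdd _ _ _ _ ((B0 * (d - e)) ^+ 2)); first exact: measurable_funX.
  move=> x /andP[h1 h2]; rewrite normrX lerXn2r ?nnegrE ?mulr_ge0 ?subr_ge0//.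
  by apply: le_trans (norm_prim h1) _; rewrite ler_wpM2l// lerD2r.
have rhs0 : 0 <= Rint leb (fun y => win e d y * prim psi e y ^+ 2).
  by apply: Rint_ge0 => y; rewrite mulr_ge0 ?win_ge0 ?sqr_ge0.
have -> : Rint leb (fun s => win e d s * (m s * psi s)) = Rint leb (fun s => win c d' s * (m s * psi s)).
  by apply: eq_Rint => s; rewrite mulrCA wE mulrCA.
have [cd|dc] := leP c d'; last first.
  have -> : Rint leb (fun s => win c d' s * (m s * psi s)) = 0.
    rewrite -[RHS](Rint0 leb); apply: eq_Rint => s; rewrite /win.
    by case: (boolP (_ && _)) => [/andP[h1 h2]|_]; rewrite ?mul0r//; lra.
  by rewrite expr0n/=; apply: mulr_ge0; [rewrite mulr_ge0 ?sqr_ge0|apply: addr_ge0; [exact: sqr_ge0|exact: mulr_ge0 (ltW T0) rhs0]].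
have inab x : c <= x <= d' -> al <= x <= be by move=> /andP[h1 h2]; rewrite (le_trans ac h1) (le_trans h2 db).
pose V y := Rint leb (fun s => win c y s * psi s).
have VE y : c <= y <= d' -> V y = prim psi e y.
  move=> /andP[h1 h2]; apply: eq_Rint => s.
  have [h|/psi0->] := boolP (al <= s <= be); last by rewrite !mulr0.
  by move/andP: h => [h3 h4]; rewrite /win /c ge_max h3 andbT.
have VdE : Rint leb (fun s => win c d' s * psi s) = prim psi e d by apply: eq_Rint => s; rewrite wE.
have E1 : Rint leb (fun s => win c d' s * (m s * psi s)) =
   m d' * prim psi e d - Rint leb (fun y => win c d' y * (m' y * prim psi e y)).
  (* psi is merely measurable, so integration by parts takes the form of Fubini's theorem: m(s) is
     m(d') minus the integral of m' from s to d'. *)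
  have -> : Rint leb (fun s => win c d' s * (m s * psi s)) =
      Rint leb (fun s => m d' * (win c d' s * psi s) - Rint leb (fun y => win c d' s * psi s * (win s d' y * m' y))).
    apply: eq_Rint => s; have [h|h] := boolP (c <= s <= d').
      have /andP[h1 h2] := h.
      rewrite RintZl; last first.
        apply: (@intgr_win_bdd _ _ _ _ (ka * T)) => // x /andP[x1 x2]; apply: m'B; apply: inab.
        by rewrite (le_trans h1 x1).
      rewrite (@FTC_win _ _ m m')//; first by ring.
        by move=> x /andP[x1 x2]; apply: dm; apply: inab; rewrite (le_trans h1 x1).
      by move=> x /andP[x1 x2]; apply: cm'; apply: inab; rewrite (le_trans h1 x1).
    have -> : win c d' s = 0 by rewrite /win (negbTE h).
    by under eq_Rint do rewrite !mul0r; rewrite Rint0 !mul0r mulr0 subrr.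
  have mW : measurable_fun setT (fun z : measurableTypeR R * measurableTypeR R => win c d' z.1 * psi z.1 * (win z.1 d' z.2 * m' z.2)).
    apply: measurable_funM; apply: measurable_funM; try exact: measurableT_comp; exact: measurable_win.
  have dom x y : `|win c d' x * psi x * (win x d' y * m' y)| <= (B0 * win c d' x) * (ka * T * win c d' y).
    rewrite !normrM !(ger0_norm (win_ge0 _ _ _)).
    rewrite /win; case: (boolP (c <= x <= d')) => [/andP[h1 h2]|_]; last by rewrite !mul0r mulr0 mul0r.
    case: (boolP (x <= y <= d')) => [/andP[h3 h4]|_]; last first.
      rewrite mul0r mulr0; apply: mulr_ge0; first by rewrite mulr1.
      by apply: mulr_ge0; rewrite ?ler0n// mulr_ge0// ltW.
    have h : c <= y <= d' by rewrite (le_trans h1 h3) h4.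
    rewrite h !mul1r !mulr1; apply: ler_pM => //.
      by apply: le_trans (psiB x) _; rewrite ler_piMr// win_le1.
    exact/m'B/inab.
  have iA : intgr leb (fun x => B0 * win c d' x) by exact/intgrZl/intgr_win.
  have iB : intgr leb (fun y => ka * T * win c d' y) by exact/intgrZl/intgr_win.
  rewrite RintB; [|exact/intgrZl/intgr_winM|exact: (@Fubini_out1 _ _ _ _ _ leb leb sigma_finite_leb sigma_finite_leb _ _ _ mW iA iB dom)].
  rewrite RintZl; last exact: intgr_winM.
  rewrite VdE; congr (_ - _).
  rewrite (@RFubini _ _ _ _ _ leb leb sigma_finite_leb sigma_finite_leb _ _ _ mW iA iB dom).
  apply: eq_Rint => y /=; have [h|h] := boolP (c <= y <= d'); last first.
    rewrite [in RHS]/win (negbTE h) mul0r -[RHS](Rint0 leb); apply: eq_Rint => x; rewrite /win.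
    case: (boolP (c <= x <= d')) => [/andP[h1 h2]|_]; last by rewrite !mul0r.
    case: (boolP (x <= y <= d')) => [/andP[h3 h4]|_]; last by rewrite !mul0r mulr0.
    by move: h; rewrite (le_trans h1 h3) h4.
  rewrite -(VE _ h) mulrA /V -RintZl; last exact: intgr_winM.
  apply: eq_Rint => x; rewrite /win h; move/andP: h => [h1 h2]; rewrite h2 andbT.
  case: (leP c x) => h3/=; last by rewrite !mul0r mulr0.
  case: (leP x y) => h4; last by rewrite !(mul0r, mulr0).
  by rewrite (le_trans h4 h2) !mul1r mulrC.
have iwp : intgr leb (fun y => win c d' y * `|prim psi e y|).
  apply: (@intgr_win_bdd _ _ _ _ (B0 * (d - e))); first exact: measurableT_comp.
  move=> x /andP[h1 h2]; rewrite normr_id; apply: le_trans (norm_prim (le_trans ec h1)) _.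
  by rewrite ler_wpM2l// lerD2r (le_trans h2).
have E2 : `|Rint leb (fun y => win c d' y * (m' y * prim psi e y))| <= ka * T * Rint leb (fun y => win c d' y * `|prim psi e y|).
  have iwm : intgr leb (fun y => win c d' y * (m' y * prim psi e y)).
    apply: (@intgr_win_bdd _ _ _ _ (ka * T * (B0 * (d - e)))); first exact: measurable_funM.
    move=> x h; rewrite normrM ler_pM//; first exact/m'B/inab.
    move/andP: h => [h1 h2]; apply: le_trans (norm_prim (le_trans ec h1)) _.
    by rewrite ler_wpM2l// lerD2r (le_trans h2).
  apply: le_trans (Rint_norm iwm) _; rewrite -RintZl//.
  apply: Rint_le; [exact: intgr_norm|exact: intgrZl|move=> y].
  rewrite !normrM (ger0_norm (win_ge0 _ _ _)) /win.
  by case: (boolP (c <= y <= d')) => h; rewrite ?mul0r ?mulr0// !mul1r ler_wpM2r// m'B// inab.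
(* Cauchy-Schwarz on a window of length at most 1/T. *)
have E3 : Rint leb (fun y => win c d' y * `|prim psi e y|) ^+ 2 <= T^-1 * Rint leb (fun y => win e d y * prim psi e y ^+ 2).
  have sq y : (win c d' y * `|prim psi e y|) ^+ 2 = win c d' y * prim psi e y ^+ 2.
    by rewrite exprMn real_normK ?num_real// expr2 win_idem.
  have iw2' : intgr leb (fun y => win c d' y * prim psi e y ^+ 2).
    apply: (@intgr_dom _ _ _ leb _ (fun y => win e d y * prim psi e y ^+ 2)) => //.
      by apply: measurable_funM; [exact: measurable_win|exact: measurable_funX].
    move=> y; rewrite normrM (ger0_norm (win_ge0 _ _ _)) (ger0_norm (sqr_ge0 _)) ler_wpM2r ?sqr_ge0// /win.
    by case: (boolP (c <= y <= d')) => [/andP[h1 h2]|_]; rewrite ?ler0n// (le_trans ec h1) (le_trans h2 dd).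
  apply: le_trans (@Rint_sqr_le _ _ _ leb _ _ _ (win c d') _ _ _ _) _.
  - by apply: measurable_funM; [exact: measurable_win|exact: measurableT_comp].
  - by under eq_fun do rewrite sq.
  - exact: measurable_win.
  - by move=> y; rewrite mulrA win_idem.
  - by move=> y; rewrite expr2 win_idem.
  - exact: intgr_win.
  rewrite Rint_win// -dE; under eq_Rint do rewrite sq.
  apply: ler_pM; [by rewrite subr_ge0|by apply: Rint_ge0 => y; rewrite mulr_ge0 ?win_ge0 ?sqr_ge0|by rewrite lerB|].
  apply: Rint_le => // y; rewrite ler_wpM2r ?sqr_ge0// /win.
  by case: (boolP (c <= y <= d')) => [/andP[h1 h2]|_]; rewrite ?ler0n// (le_trans ec h1) (le_trans h2 dd).
have cd' : c <= d' <= d' by rewrite cd lexx.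
have := mB (inab _ cd'); move: E1 E2 E3 rhs0; rewrite -/c -/d'.
move: (prim psi e d) (m d') (Rint leb (fun s => win c d' s * (m s * psi s))) (Rint leb (fun y => win c d' y * (m' y * prim psi e y)))
  (Rint leb (fun y => win c d' y * `|prim psi e y|)) (Rint leb (fun y => win e d y * prim psi e y ^+ 2)) => P m1 X I1 I2 J -> h2 h3 J0 h1.
have a1 : (m1 * P) ^+ 2 <= ka ^+ 2 * P ^+ 2.
  rewrite exprMn ler_wpM2r ?sqr_ge0// -[leLHS]real_normK ?num_real// lerXn2r ?nnegrE//.
have a2 : I1 ^+ 2 <= ka ^+ 2 * (T * J).
  rewrite -[leLHS]real_normK ?num_real//; apply: (@le_trans _ _ ((ka * T * I2) ^+ 2)).
    by rewrite lerXn2r ?nnegrE// (le_trans _ h2).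
  rewrite exprMn exprMn -mulrA ler_wpM2l ?sqr_ge0//.
  have := ler_wpM2l (sqr_ge0 T) h3.
  by have -> : T ^+ 2 * (T^-1 * J) = T * J by field; rewrite gt_eqF.
by have := sqr_ge0 (m1 * P + I1); lra.
Qed.

End ByParts.

(** * Averages at scale 1/T *)

Section Mollification.
Context {R : realType}.
Local Notation leb := (@lebesgue_measure R).

(** Translating the transform amounts to multiplying A by exp(i t0 y). Plancherel is stated for real
    functions, so the cosine and sine parts of this product are treated apart. *)
Lemma shift_Plancherel (A : R -> R) (t0 : R) : intgr leb A -> intgr leb (fun y => A y ^+ 2) ->
  (\int[leb]_t (Fc A (t - t0) ^+ 2 + Fs A (t - t0) ^+ 2)%:E <= (8 * pi * Rint leb (fun y => A y ^+ 2))%:E)%E.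
Proof.
move=> iA iA2; have mA := intgr_meas iA.
pose C y := cos (t0 * y) * A y; pose S y := sin (t0 * y) * A y.
have iC : intgr leb C by exact: intgr_cosM.
have iS : intgr leb S by exact: intgr_sinM.
have E y : C y ^+ 2 + S y ^+ 2 = A y ^+ 2.
  by rewrite !exprMn -mulrDl cos2Dsin2 mul1r.
have iC2 : intgr leb (fun y => C y ^+ 2).
  apply: (@intgr_dom _ _ _ leb _ (fun y => A y ^+ 2)) => //; first by apply: measurable_funX; exact: intgr_meas iC.
  by move=> y; rewrite ger0_norm ?sqr_ge0// -E lerDl sqr_ge0.
have iS2 : intgr leb (fun y => S y ^+ 2).
  apply: (@intgr_dom _ _ _ leb _ (fun y => A y ^+ 2)) => //; first by apply: measurable_funX; exact: intgr_meas iS.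
  by move=> y; rewrite ger0_norm ?sqr_ge0// -E lerDr sqr_ge0.
have Ec t : Fc A (t - t0) = Fc C t + Fs S t.
  rewrite /Fc /Fs -RintD; [|exact: intgr_cosM|exact: intgr_sinM].
  by apply: eq_Rint => y; rewrite mulrBl cosB /C /S; ring.
have Es t : Fs A (t - t0) = Fs C t - Fc S t.
  rewrite /Fc /Fs -RintB; [|exact: intgr_sinM|exact: intgr_cosM].
  by apply: eq_Rint => y; rewrite mulrBl sinB /C /S; ring.
have mC := measurable_Fc iC; have mCs := measurable_Fs iC; have mS := measurable_Fc iS; have mSs := measurable_Fs iS.
have mCC : measurable_fun setT (fun t => Fc C t ^+ 2 + Fs C t ^+ 2) by apply: measurable_funD; exact: measurable_funX.
have mSS : measurable_fun setT (fun t => Fc S t ^+ 2 + Fs S t ^+ 2) by apply: measurable_funD; exact: measurable_funX.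
apply: (@le_trans _ _ (\int[leb]_t (2%:E * ((Fc C t ^+ 2 + Fs C t ^+ 2)%:E + (Fc S t ^+ 2 + Fs S t ^+ 2)%:E)))%E).
  apply: ge0_le_integral => //.
  - by move=> t _; rewrite lee_fin addr_ge0 ?sqr_ge0.
  - apply/measurable_EFinP; under eq_fun do rewrite Ec Es.
    by apply: measurable_funD; apply: measurable_funX; [exact: measurable_funD|exact: measurable_funB].
  - by apply: emeasurable_funM => //; apply: emeasurable_funD; exact/measurable_EFinP.
  - move=> t _; rewrite -EFinD -EFinM lee_fin Ec Es.
    move: (Fc C t) (Fs C t) (Fc S t) (Fs S t) => x y z w.
    by have := sqr_ge0 (x - w); have := sqr_ge0 (y + z); lra.
have ge0C (X : R -> R) : (forall t, setT t -> 0%E <= (Fc X t ^+ 2 + Fs X t ^+ 2)%:E)%E.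
  by move=> t _; rewrite lee_fin addr_ge0 ?sqr_ge0.
rewrite ge0_integralZl//; [|by apply: emeasurable_funD; exact/measurable_EFinP|by move=> t _; apply: adde_ge0; exact: ge0C].
rewrite ge0_integralD//; [|exact: ge0C|exact/measurable_EFinP|exact: ge0C|exact/measurable_EFinP].
have EA : Rint leb (fun y => C y ^+ 2) + Rint leb (fun y => S y ^+ 2) = Rint leb (fun y => A y ^+ 2).
  by rewrite -RintD//; apply: eq_Rint => y.
have := leeD (Plancherel_le iC iC2) (Plancherel_le iS iS2).
rewrite -EFinD -mulrDr EA => h.
apply: (@le_trans _ _ (2%:E * (2 * pi * Rint leb (fun y => A y ^+ 2))%:E)%E); first exact: lee_wpmul2l.
rewrite -EFinM lee_fin; have : 0 <= pi * Rint leb (fun y => A y ^+ 2).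
  by rewrite mulr_ge0 ?pi_ge0//; apply: Rint_ge0 => y; exact: sqr_ge0.
by lra.
Qed.

End Mollification.

Section SinBound.
Context {R : realType}.

Lemma sin_le_id (v : R) : 0 <= v -> sin v <= v.
Proof.
move=> v0; have := @der_nonincreasing R (fun x => sin x - x) (fun x => cos x - 1) 0 v v0.
rewrite sin0 subr0 => h; rewrite -subr_le0; apply: h => x _.
- by apply: derB (derI _); exact: is_derive_sin.
- by rewrite subr_le0 cos_le1.
Qed.

Lemma half_le_sin (v : R) : 0 <= v <= 1 -> v / 2 <= sin v.
Proof.
move=> /andP[v0 v1]; have := @der_nonincreasing R (fun x => x * 2^-1 - sin x) (fun x => 1 * 2^-1 - cos x) 0 v v0.
rewrite sin0 subr0 mul0r => h; rewrite -subr_le0; apply: h => x /andP[x0 x1].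
- apply: derB; last exact: is_derive_sin.
  by apply: der_eq (derM (derI x) (derC _ x)) _; rewrite mulr0 addr0.
- have -> : cos x = 1 - 2 * sin (x / 2) ^+ 2.
    have {1}-> : x = x / 2 + x / 2 by field.
    by rewrite cosD; have := cos2Dsin2 (x / 2); lra.
  have s0 : 0 <= sin (x / 2).
    by apply: sin_ge0_pi; have := @pi_ge2 R; move=> ?; apply/andP; split; lra.
  have := @sin_le_id (x / 2); move: s0; move: (sin _) => s s0 /(_ _) h1.
  have : s <= x / 2 by apply: h1; lra.
  move=> h2; have h3 : s <= 2^-1 by lra.
  by have := ler_pM s0 s0 h3 h3; lra.
Qed.

Lemma sin_sqr_ge (v : R) : `|v| <= 1 -> v ^+ 2 / 4 <= sin v ^+ 2.
Proof.
move=> h; have h1 : 0 <= `|v| <= 1 by rewrite normr_ge0.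
have h2 := half_le_sin h1.
have -> : v ^+ 2 / 4 = (`|v| / 2) ^+ 2 by rewrite exprMn real_normK ?num_real//; field.
have -> : sin v ^+ 2 = sin `|v| ^+ 2 by case: (ger0P v) => // _; rewrite sinN sqrrN.
by rewrite !expr2; apply: ler_pM => //; exact: divr_ge0.
Qed.

End SinBound.

Section Mollified.
Context {R : realType}.
Local Notation leb := (@lebesgue_measure R).
Variables (al be T B0 : R) (h : R -> R).
Hypotheses (ab : al <= be) (T0 : 0 < T) (Tbe : T^-1 <= be) (al0 : 0 <= al) (B00 : 0 <= B0).
Hypotheses (mh : measurable_fun setT h) (hB : forall x, `|h x| <= B0 * win al be x).

Let L := T^-1.
Let L0 : 0 < L. Proof. by rewrite invr_gt0. Qed.
(* Averaging over windows of length 1/T multiplies the transform by a sinc factor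
   that is at least 1/2 for |t| <= T/2. *)
Definition moll (e : R) : R := T * prim h (e - T^-1 / 2) (e + T^-1 / 2).
Let W := win (al - L / 2) (be + L / 2).

Let ih : intgr leb h.
Proof. by apply: (@intgr_dom _ _ _ leb _ _ mh hB); exact/intgrZl/intgr_win. Qed.

Lemma measurable_moll : measurable_fun setT moll.
Proof.
apply: measurable_funM => //.
apply: (@measurable_prim _ _ (measurableTypeR R) (fun=> h)).
- exact: measurableT_comp.
- exact: measurable_funB.
- exact: measurable_funD.
Qed.

Lemma moll_bound e : `|moll e| <= B0 * W e.
Proof.
rewrite /moll normrM (gtr0_norm T0).
have [he|he] := boolP (al - L / 2 <= e <= be + L / 2).
  have -> : W e = 1 by rewrite /W /win he.
  have := @norm_prim R al be B0 h B00 mh hB (e - L / 2) (e + L / 2).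
  have -> : e + L / 2 - (e - L / 2) = L by field.
  move=> /(_ _) h1; rewrite mulrC mulr1 -ler_pdivlMr//; apply: h1.
  by have := L0; lra.
have -> : W e = 0 by rewrite /W /win (negbTE he).
rewrite mulr0 (_ : prim _ _ _ = 0) ?normr0 ?mulr0// -[RHS](Rint0 leb); apply: eq_Rint => s.
have := hB s; rewrite /win; case: (boolP (al <= s <= be)) => [/andP[h1 h2] _|_]; last first.
  by rewrite mulr0 normr_le0 => /eqP ->; rewrite mulr0.
case: (boolP (_ && _)) => [/andP[h3 h4]|_]; last by rewrite mul0r.
by move: he; rewrite -/L in h3 h4; move/negP; case; apply/andP; split; lra.
Qed.

Lemma intgr_moll : intgr leb moll.
Proof. by apply: (@intgr_dom _ _ _ leb _ _ measurable_moll moll_bound); exact/intgrZl/intgr_win. Qed.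

Lemma intgr_moll2 : intgr leb (fun e => moll e ^+ 2).
Proof.
apply: (@intgr_dom _ _ _ leb _ (fun e => B0 ^+ 2 * W e)); last exact/intgrZl/intgr_win.
  by apply: measurable_funX; exact: measurable_moll.
move=> e; rewrite normrX; have := moll_bound e; rewrite -(@ler_pXn2r _ 2)// ?nnegrE ?mulr_ge0 ?win_ge0//.
by rewrite exprMn [X in _ <= _ * X -> _]expr2 win_idem.
Qed.

(** The factor sin(v)/v at v = s L / 2, with its value 1 at s = 0. *)
Let p s := if s == 0 then 1 else 2 * T * sin (s * L / 2) / s.

Let p_ge s : `|s| <= T / 2 -> 4^-1 <= p s ^+ 2.
Proof.
move=> sT; rewrite /p; case: eqVneq => [_|s0]; first by rewrite expr1n; lra.
have -> : 2 * T * sin (s * L / 2) / s = sin (s * L / 2) / (s * L / 2).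
  by rewrite /L; field; rewrite s0 gt_eqF.
have v0 : s * L / 2 != 0 by rewrite !mulf_neq0// gt_eqF.
have : `|s * L / 2| <= 1.
  rewrite !normrM (gtr0_norm L0) (@gtr0_norm _ 2^-1)//.
  have := ler_wpM2r (ltW L0) sT; have -> : T / 2 * L = 2^-1 by rewrite /L; field; rewrite gt_eqF.
  by lra.
move: (s * L / 2) v0 => v v0 /sin_sqr_ge h1.
have v2 : 0 < v ^+ 2 by rewrite exprn_even_gt0.
by rewrite expr_div_n ler_pdivlMr// mulrC.
Qed.

(** A point x lies in the window about e exactly when e lies in the window about x, so the integral
    over e is elementary. *)
Let inner s x : Rint leb (fun e => cos (s * e) * win (e - L / 2) (e + L / 2) x) = L * p s * cos (s * x) /\
  Rint leb (fun e => sin (s * e) * win (e - L / 2) (e + L / 2) x) = L * p s * sin (s * x).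
Proof.
have wE e : win (e - L / 2) (e + L / 2) x = win (x - L / 2) (x + L / 2) e.
  rewrite /win; congr (nat_of_bool _)%:R.
  by apply/andP/andP => -[h1 h2]; split; lra.
have xL : x - L / 2 <= x + L / 2 by have := L0; lra.
have [s0|s0] := eqVneq s 0.
  rewrite /p s0 eqxx mul0r cos0 sin0 !mulr1 mulr0; split.
    under eq_Rint do rewrite mul0r cos0 mul1r wE.
    by rewrite Rint_win//; field.
  by under eq_Rint do rewrite mul0r sin0 mul0r; rewrite Rint0.
rewrite /p (negbTE s0); split.
  under eq_Rint do rewrite wE mulrC.
  rewrite (@FTC_win _ _ _ (fun e => sin (s * e) * s^-1))//.
  - by rewrite mulrBr mulrDr sinD sinB !mulrA /L; field; rewrite s0 (gt_eqF T0).
  - move=> e _; apply: der_eq (derM (derSin (derZ s (derI e))) (derC _ e)) _.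
    by rewrite mulr0 addr0 mulr1 -mulrA divff// mulr1.
  - move=> e _; exact: der_cont (derCos (derZ s (derI e))).
under eq_Rint do rewrite wE mulrC.
rewrite (@FTC_win _ _ _ (fun e => - cos (s * e) * s^-1))//.
- by rewrite mulrBr mulrDr cosD cosB !mulrA /L; field; rewrite s0 (gt_eqF T0).
- move=> e _; apply: der_eq (derM (derN (derCos (derZ s (derI e)))) (derC _ e)) _.
  by rewrite mulr0 addr0 mulr1; field.
- move=> e _; exact: der_cont (derSin (derZ s (derI e))).
Qed.

Let trans (c : R -> R) (mc : measurable_fun setT c) (cB : forall x, `|c x| <= 1) s :
  (forall x, Rint leb (fun e => c e * win (e - L / 2) (e + L / 2) x) = L * p s * c x) ->
  Rint leb (fun e => c e * moll e) = p s * Rint leb (fun x => c x * h x).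
Proof.
move=> E.
have -> : Rint leb (fun e => c e * moll e) = Rint leb (fun e => Rint leb (fun x => (T * c e) * (win (e - L / 2) (e + L / 2) x * h x))).
  apply: eq_Rint => e; rewrite RintZl; last exact: (@intgr_winM R al be B0 h B00 mh hB).
  by rewrite /moll mulrA [c e * T]mulrC.
have mW : measurable_fun setT (fun z : measurableTypeR R * measurableTypeR R => (T * c z.1) * (win (z.1 - L / 2) (z.1 + L / 2) z.2 * h z.2)).
  apply: measurable_funM; first by apply: measurable_funM => //; exact: measurableT_comp.
  apply: measurable_funM; last exact: measurableT_comp.
  by apply: measurable_win => //; [exact: measurable_funB|exact: measurable_funD].
rewrite (@RFubini _ _ _ _ _ leb leb sigma_finite_leb sigma_finite_leb _ (fun e => T * W e) (fun x => B0 * win al be x) mW).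
- rewrite -RintZl; last first.
    apply: (@intgr_dom _ _ _ leb _ (fun x => `|h x|)); last exact: intgr_norm.
      exact: measurable_funM.
    by move=> x; rewrite normrM ler_piMl.
  apply: eq_Rint => x /=.
  have -> : Rint leb (fun e => T * c e * (win (e - L / 2) (e + L / 2) x * h x)) =
     (T * h x) * Rint leb (fun e => c e * win (e - L / 2) (e + L / 2) x).
    rewrite -RintZl; first by apply: eq_Rint => e; ring.
    apply: (@intgr_dom _ _ _ leb _ (win (x - L / 2) (x + L / 2))); last exact: intgr_win.
      by apply: measurable_funM => //; apply: measurable_win => //; [exact: measurable_funB|exact: measurable_funD].
    move=> e; rewrite normrM (ger0_norm (win_ge0 _ _ _)).
    have -> : win (e - L / 2) (e + L / 2) x = win (x - L / 2) (x + L / 2) e.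
      by rewrite /win; congr (nat_of_bool _)%:R; apply/andP/andP => -[h1 h2]; split; lra.
    by rewrite ler_piMl ?win_ge0.
  by rewrite E /L; field; rewrite gt_eqF.
- exact/intgrZl/intgr_win.
- exact/intgrZl/intgr_win.
- move=> e x /=; rewrite !normrM (gtr0_norm T0) (ger0_norm (win_ge0 _ _ _)).
  have h2 : win (e - L / 2) (e + L / 2) x * `|h x| <= W e * (B0 * win al be x).
    apply: le_trans (ler_wpM2l (win_ge0 _ _ _) (hB x)) _.
    rewrite mulrCA [leRHS]mulrCA ler_wpM2l//.
    rewrite /win /W /win; case: (boolP (al <= x <= be)) => [/andP[h1 h2]|_]; last by rewrite !mulr0.
    case: (boolP (e - L / 2 <= x <= e + L / 2)) => [/andP[h3 h4]|_]; last by rewrite mul0r; case: (_ && _); rewrite ?mul0r ?mul1r.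
    have -> : al - L / 2 <= e <= be + L / 2 by apply/andP; split; lra.
    by [].
  rewrite -!mulrA ler_pM2l//; apply: le_trans h2.
  by rewrite ler_piMl// mulr_ge0 ?win_ge0.
Qed.

(** For |s| <= T/2 the sinc factor is at least 1/2, so averaging loses at most a factor 4 in the
    squared transform. The transform of h on the whole time interval is thus governed by averages of
    h. *)
Lemma mollE s : `|s| <= T / 2 -> Fc h s ^+ 2 + Fs h s ^+ 2 <= 4 * (Fc moll s ^+ 2 + Fs moll s ^+ 2).
Proof.
move=> sT; have p4 := p_ge sT.
have -> : Fc moll s = p s * Fc h s.
  by apply: trans => [|x|x]; [exact: measurable_cosM|exact: norm_cos_le1|have [] := inner s x].
have -> : Fs moll s = p s * Fs h s.
  by apply: trans => [|x|x]; [exact: measurable_sinM|exact: norm_sin_le1|have [] := inner s x].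
rewrite !exprMn -mulrDr mulrA ler_peMl ?addr_ge0 ?sqr_ge0//; lra.
Qed.

(** Cauchy-Schwarz on the support of [moll], whose length be - al + 1/T is at most 2 be because 1/T
    <= be. So the L^2 norm of [moll] controls the supremum over the interval as well as the L^2 norm
    over it. *)
Lemma moll_sup s : `|s| <= T / 2 -> Fc h s ^+ 2 + Fs h s ^+ 2 <= 16 * be * Rint leb (fun e => moll e ^+ 2).
Proof.
move=> /mollE h1; apply: le_trans h1 _.
have b1 : Rint leb (fun e => `|moll e|) ^+ 2 <= 2 * be * Rint leb (fun e => moll e ^+ 2).
  have sq e : `|moll e| ^+ 2 = moll e ^+ 2 by rewrite real_normK ?num_real.
  have mn : measurable_fun setT (fun e => `|moll e|) by apply: measurableT_comp => //; exact: measurable_moll.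
  apply: le_trans (@Rint_sqr_le _ _ _ leb _ mn _ W _ _ _ _) _.
  - by under eq_fun do rewrite sq; exact: intgr_moll2.
  - exact: measurable_win.
  - move=> e; have := moll_bound e; rewrite /W /win; case: (_ && _); rewrite ?mul1r// mulr0 normr_le0 => /eqP ->.
    by rewrite normr0 mulr0.
  - by move=> e; rewrite expr2 win_idem.
  - exact: intgr_win.
  have hL : al - L / 2 <= be + L / 2.
    by have := ab; have := L0; move: L => l l0 h'; lra.
  have -> : Rint leb W = be - al + L by rewrite /W Rint_win//; move: L => l; field.
  under eq_Rint do rewrite sq.
  apply: ler_wpM2r; first by apply: Rint_ge0 => e; exact: sqr_ge0.
  by move: Tbe ab al0; rewrite -/L; move: L => l h1 h2 h3; lra.
have c1 : Fc moll s ^+ 2 <= Rint leb (fun e => `|moll e|) ^+ 2.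
  rewrite -[leLHS]real_normK ?num_real// lerXn2r ?nnegrE//; first by apply: Rint_ge0.
  exact: norm_Fc intgr_moll.
have c2 : Fs moll s ^+ 2 <= Rint leb (fun e => `|moll e|) ^+ 2.
  rewrite -[leLHS]real_normK ?num_real// lerXn2r ?nnegrE//; first by apply: Rint_ge0.
  exact: norm_Fs intgr_moll.
by lra.
Qed.

Lemma moll_L2 t0 : (\int[leb]_t (win (t0 - T / 2) (t0 + T / 2) t * (Fc h (t - t0) ^+ 2 + Fs h (t - t0) ^+ 2))%:E
  <= (32 * pi * Rint leb (fun e => moll e ^+ 2))%:E)%E.
Proof.
apply: (@le_trans _ _ (\int[leb]_t (4%:E * (Fc moll (t - t0) ^+ 2 + Fs moll (t - t0) ^+ 2)%:E))%E).
  have ms (f : R -> R) : intgr leb f -> measurable_fun setT (fun t : R => Fc f (t - t0) ^+ 2 + Fs f (t - t0) ^+ 2).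
    move=> i; have mt : measurable_fun setT (fun t : R => t - t0) by exact: measurable_funB.
    by apply: measurable_funD; apply: measurable_funX; [exact: (measurableT_comp (measurable_Fc i) mt)|exact: (measurableT_comp (measurable_Fs i) mt)].
  apply: ge0_le_integral => //.
  - by move=> t _; rewrite lee_fin mulr_ge0 ?win_ge0// addr_ge0 ?sqr_ge0.
  - by apply/measurable_EFinP; apply: measurable_funM; [exact: measurable_win|exact: ms].
  - by apply: emeasurable_funM => //; apply/measurable_EFinP; apply: ms; exact: intgr_moll.
  - move=> t _; rewrite -EFinM lee_fin /win.
    case: (boolP (_ && _)) => [/andP[h1 h2]|_].
      by rewrite mul1r mollE// ler_norml; apply/andP; split; lra.
    by rewrite mul0r mulr_ge0// addr_ge0 ?sqr_ge0.
have hP := shift_Plancherel t0 intgr_moll intgr_moll2.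
rewrite ge0_integralZl//; last first.
  by move=> t _; rewrite lee_fin addr_ge0 ?sqr_ge0.
  have mt : measurable_fun setT (fun t : R => t - t0) by exact: measurable_funB.
  apply/measurable_EFinP; apply: measurable_funD; apply: measurable_funX.
    exact: (measurableT_comp (measurable_Fc intgr_moll) mt).
  exact: (measurableT_comp (measurable_Fs intgr_moll) mt).
apply: le_trans (lee_wpmul2l _ hP) _ => //.
by rewrite -EFinM lee_fin; lra.
Qed.

End Mollified.

(** * One majorant for all slowly varying multipliers *)

Section Core.
Context {R : realType}.
Local Notation leb := (@lebesgue_measure R).
Variables (al be T B0 : R) (P : R -> R).
Hypotheses (ab : al <= be) (T0 : 0 < T) (Tbe : T^-1 <= be) (al0 : 0 < al) (B00 : 0 <= B0).
Hypotheses (mP : measurable_fun setT P) (PB : forall x, `|P x| <= B0 * win al be x).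

Let L := T^-1.
Let L0 : 0 < L. Proof. by rewrite invr_gt0. Qed.

Let psc t0 (x : R) := cos (t0 * x) * P x.
Let pss t0 (x : R) := sin (t0 * x) * P x.

(* [core_maj t0] majorizes the transform of [m P] for |t - t0| <= T/2, whatever the
   slowly varying [m]: it involves only the integrals of [exp(i t0 x) P(x)] over
   windows of length at most 1/T. *)
Definition tsq t0 e y := prim (psc t0) e y ^+ 2 + prim (pss t0) e y ^+ 2.

Definition core_ker t0 e : \bar R := ((tsq t0 (e - T^-1 / 2) (e + T^-1 / 2))%:E +
  T%:E * \int[leb]_y (win (e - T^-1 / 2) (e + T^-1 / 2) y * tsq t0 (e - T^-1 / 2) y)%:E)%E.

Definition core_maj t0 : \bar R := ((T ^+ 2)%:E * \int[leb]_e core_ker t0 e)%E.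

Let tsq_ge0 t0 e y : 0 <= tsq t0 e y. Proof. by rewrite addr_ge0 ?sqr_ge0. Qed.

Let measurable_tsq d (X : measurableType d) (f g h : X -> R) :
  measurable_fun setT f -> measurable_fun setT g -> measurable_fun setT h -> measurable_fun setT (fun x => tsq (f x) (g x) (h x)).
Proof.
move=> mf mg mh; apply: measurable_funD; apply: measurable_funX.
  apply: (@measurable_prim _ _ _ (fun x => psc (f x))) => //.
  by apply: measurable_funM; [apply: measurable_cosM => //; exact: measurableT_comp|exact: measurableT_comp].
apply: (@measurable_prim _ _ _ (fun x => pss (f x))) => //.
by apply: measurable_funM; [apply: measurable_sinM => //; exact: measurableT_comp|exact: measurableT_comp].
Qed.

Let measurable_core_ker : measurable_fun setT (fun z : measurableTypeR R * measurableTypeR R => core_ker z.1 z.2).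
Proof.
have m1 : measurable_fun setT (fun z : measurableTypeR R * measurableTypeR R => z.2 - T^-1 / 2) by exact: measurable_funB.
have m2 : measurable_fun setT (fun z : measurableTypeR R * measurableTypeR R => z.2 + T^-1 / 2) by exact: measurable_funD.
apply: emeasurable_funD; first by apply/measurable_EFinP; exact: measurable_tsq.
apply: emeasurable_funM => //.
apply: (@measurable_Tonelli1 _ _ (measurableTypeR R * measurableTypeR R)%type (measurableTypeR R) R leb sigma_finite_leb
  (fun z => (win (z.1.2 - T^-1 / 2) (z.1.2 + T^-1 / 2) z.2 * tsq z.1.1 (z.1.2 - T^-1 / 2) z.2)%:E)).
  apply/measurable_EFinP; apply: measurable_funM.
    by apply: measurable_win => //; [exact: (measurableT_comp m1)|exact: (measurableT_comp m2)].
  by apply: measurable_tsq => //; [exact: measurableT_comp|exact: (measurableT_comp m1)].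
by move=> z; rewrite lee_fin mulr_ge0 ?win_ge0.
Qed.

Let core_ker_ge0 t0 e : (0 <= core_ker t0 e)%E.
Proof.
apply: adde_ge0; first by rewrite lee_fin.
apply: mule_ge0; first by rewrite lee_fin ltW.
by apply: integral_ge0 => y _; rewrite lee_fin mulr_ge0 ?win_ge0.
Qed.

Lemma measurable_core_maj : measurable_fun setT core_maj.
Proof.
apply: emeasurable_funM => //.
exact: (@measurable_Tonelli1 _ _ (measurableTypeR R) (measurableTypeR R) R leb sigma_finite_leb _ measurable_core_ker).
Qed.

Lemma core_maj_ge0 t0 : (0 <= core_maj t0)%E.
Proof. by apply: mule_ge0; [rewrite lee_fin sqr_ge0|exact: integral_ge0]. Qed.

Let iP2 : intgr leb (fun x => P x ^+ 2).
Proof.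
apply: (@intgr_dom _ _ _ leb _ (fun x => B0 ^+ 2 * win al be x)); [exact: measurable_funX| |exact/intgrZl/intgr_win].
move=> x; rewrite normrX; have := PB x; rewrite -(@ler_pXn2r _ 2)// ?nnegrE ?mulr_ge0 ?win_ge0//.
by rewrite exprMn [X in _ <= _ * X -> _]expr2 win_idem.
Qed.

Let iwP e y : intgr leb (fun x => win e y x * P x).
Proof. exact: (@intgr_winM R al be B0 P B00 mP PB). Qed.

Let sqwP e y x : (win e y x * P x) ^+ 2 = win e y x * P x ^+ 2.
Proof. by rewrite exprMn expr2 win_idem. Qed.

Let iwP2 e y : intgr leb (fun x => win e y x * P x ^+ 2).
Proof.
apply: (@intgr_dom _ _ _ leb _ (fun x => P x ^+ 2)) => //.
  by apply: measurable_funM; [exact: measurable_win|exact: measurable_funX].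
by move=> x; rewrite normrM (ger0_norm (win_ge0 _ _ _)) (ger0_norm (sqr_ge0 _)) ler_piMl ?sqr_ge0 ?win_le1.
Qed.

Let int_tsq e y : (\int[leb]_t (tsq t e y)%:E <= (2 * pi * Rint leb (fun x => win e y x * P x ^+ 2))%:E)%E.
Proof.
have := Plancherel_le (iwP e y); under [X in intgr _ X -> _]eq_fun do rewrite sqwP.
move=> /(_ (iwP2 e y)); under eq_Rint do rewrite sqwP.
apply: le_trans; rewrite le_eqVlt; apply/orP; left; apply/eqP.
apply: eq_integral => t _; congr (_%:E).
by rewrite /tsq /prim /Fc /Fs; congr (_ ^+ 2 + _ ^+ 2); apply: eq_Rint => x; rewrite mulrCA.
Qed.

(** For a fixed window, [tsq] as a function of t0 is the squared transform of P cut to that window,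
    and Plancherel applies. In the second term the factor T cancels the length of the y-window.
    Integration over the centres e gives another 1/T, so T^2 becomes T. *)
Lemma int_core_maj : (\int[leb]_t core_maj t <= (4 * pi * T * Rint leb (fun x => P x ^+ 2))%:E)%E.
Proof.
have mk1 e : measurable_fun setT (core_ker ^~ e) by exact: (measurableT_comp measurable_core_ker (pair2_measurable e)).
have mk2 t : measurable_fun setT (core_ker t) by exact: (measurableT_comp measurable_core_ker (pair1_measurable t)).
have pi0 := @pi_gt0 R.
rewrite /core_maj ge0_integralZl//; last 3 first.
- exact: (@measurable_Tonelli1 _ _ (measurableTypeR R) (measurableTypeR R) R leb sigma_finite_leb _ measurable_core_ker).
- by move=> t _; exact: integral_ge0.
- by rewrite lee_fin sqr_ge0.
rewrite (@Tonelli _ _ _ _ _ leb leb sigma_finite_leb sigma_finite_leb (fun z => core_ker z.1 z.2))//=.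
pose G e := Rint leb (fun x => win (e - T^-1 / 2) (e + T^-1 / 2) x * P x ^+ 2).
have G0 e : 0 <= G e by apply: Rint_ge0 => x; rewrite mulr_ge0 ?win_ge0 ?sqr_ge0.
have eL e : e - T^-1 / 2 <= e + T^-1 / 2 by have := L0; rewrite /L; move: T^-1 => l l0; lra.
have K1 e : (\int[leb]_t core_ker t e <= (4 * pi * G e)%:E)%E.
  have mt (y : R) : measurable_fun setT (fun t => tsq t (e - T^-1 / 2) y) by exact: measurable_tsq.
  have mW : measurable_fun setT (fun z : measurableTypeR R * measurableTypeR R =>
      (win (e - T^-1 / 2) (e + T^-1 / 2) z.2 * tsq z.1 (e - T^-1 / 2) z.2)%:E).
    by apply/measurable_EFinP; apply: measurable_funM; [exact: measurable_win|exact: measurable_tsq].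
  have mI : measurable_fun setT (fun t => \int[leb]_y (win (e - T^-1 / 2) (e + T^-1 / 2) y * tsq t (e - T^-1 / 2) y)%:E)%E.
    apply: (@measurable_Tonelli1 _ _ (measurableTypeR R) (measurableTypeR R) R leb sigma_finite_leb _ mW).
    by move=> z; rewrite lee_fin mulr_ge0 ?win_ge0.
  rewrite /core_ker ge0_integralD//; last 4 first.
  - by move=> t _; rewrite lee_fin.
  - by apply/measurable_EFinP; exact: mt.
  - move=> t _; apply: mule_ge0; first by rewrite lee_fin ltW.
    by apply: integral_ge0 => y _; rewrite lee_fin mulr_ge0 ?win_ge0.
  - exact: emeasurable_funM.
  have h2 : (\int[leb]_t (T%:E * \int[leb]_y (win (e - T^-1 / 2) (e + T^-1 / 2) y * tsq t (e - T^-1 / 2) y)%:E) <= (2 * pi * G e)%:E)%E.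
    rewrite ge0_integralZl//; last first.
    - by rewrite lee_fin ltW.
    - by move=> t _; apply: integral_ge0 => y _; rewrite lee_fin mulr_ge0 ?win_ge0.
    rewrite (@Tonelli _ _ _ _ _ leb leb sigma_finite_leb sigma_finite_leb
      (fun z => (win (e - T^-1 / 2) (e + T^-1 / 2) z.2 * tsq z.1 (e - T^-1 / 2) z.2)%:E))//; last first.
      by move=> z; rewrite lee_fin mulr_ge0 ?win_ge0.
    apply: (@le_trans _ _ (T%:E * \int[leb]_y ((2 * pi * G e) * win (e - T^-1 / 2) (e + T^-1 / 2) y)%:E)%E).
      apply: lee_wpmul2l; first by rewrite lee_fin ltW.
      apply: ge0_le_integral; first exact: measurableT.
      + by move=> y _; apply: integral_ge0 => t _; rewrite lee_fin mulr_ge0 ?win_ge0.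
      + apply: (@measurable_Tonelli2 _ _ (measurableTypeR R) (measurableTypeR R) R leb sigma_finite_leb
          (fun z => (win (e - T^-1 / 2) (e + T^-1 / 2) z.2 * tsq z.1 (e - T^-1 / 2) z.2)%:E)) => //.
        by move=> z; rewrite lee_fin mulr_ge0 ?win_ge0.
      + by apply/measurable_EFinP; apply: measurable_funM => //; exact: measurable_win.
      move=> y _ /=; under eq_integral do rewrite EFinM.
      rewrite ge0_integralZl//; last first.
      * by rewrite lee_fin win_ge0.
      * by move=> t _; rewrite lee_fin.
      * by apply/measurable_EFinP; exact: mt.
      rewrite /win; case: (boolP (_ && _)) => [/andP[h3 h4]|_]; last by rewrite mul0e mulr0.
      rewrite mul1e mulr1; apply: le_trans (int_tsq _ _) _; rewrite lee_fin ler_wpM2l//.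
        by rewrite mulr_ge0// ltW.
      apply: Rint_le => // x; rewrite ler_wpM2r ?sqr_ge0// /win.
      by case: (boolP (_ && _)) => [/andP[h5 h6]|_]; rewrite ?ler0n// h5 (le_trans h6 h4).
    rewrite -EFin_Rint; last exact/intgrZl/intgr_win.
    rewrite RintZl ?Rint_win//; last exact: intgr_win.
    rewrite -EFinM lee_fin le_eqVlt; apply/orP; left; apply/eqP; field; rewrite gt_eqF//.
  apply: le_trans (leeD (int_tsq _ _) h2) _.
  by rewrite -EFinD lee_fin -/(G e); lra.
have mWP : measurable_fun setT (fun z : measurableTypeR R * measurableTypeR R => (win (z.1 - T^-1 / 2) (z.1 + T^-1 / 2) z.2 * P z.2 ^+ 2)%:E).
  apply/measurable_EFinP; apply: measurable_funM; last by apply: measurable_funX; exact: measurableT_comp.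
  by apply: measurable_win => //; [exact: measurable_funB|exact: measurable_funD].
have GE e : (G e)%:E = (\int[leb]_x (win (e - T^-1 / 2) (e + T^-1 / 2) x * P x ^+ 2)%:E)%E by rewrite EFin_Rint.
have mG : measurable_fun setT (fun e => (G e)%:E).
  under eq_fun do rewrite GE.
  apply: (@measurable_Tonelli1 _ _ (measurableTypeR R) (measurableTypeR R) R leb sigma_finite_leb _ mWP).
  by move=> z; rewrite lee_fin mulr_ge0 ?win_ge0 ?sqr_ge0.
have EG : (\int[leb]_e (G e)%:E = (L * Rint leb (fun x => P x ^+ 2))%:E)%E.
  under eq_integral do rewrite GE.
  rewrite (@Tonelli _ _ _ _ _ leb leb sigma_finite_leb sigma_finite_leb _ mWP)/=; last first.
    by move=> z; rewrite lee_fin mulr_ge0 ?win_ge0 ?sqr_ge0.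
  rewrite -RintZl// EFin_Rint; last exact: intgrZl.
  apply: eq_integral => x _; have -> : (L * P x ^+ 2)%:E = (\int[leb]_e (P x ^+ 2 * win (x - T^-1 / 2) (x + T^-1 / 2) e)%:E)%E.
    rewrite -EFin_Rint; last exact/intgrZl/intgr_win.
    rewrite RintZl ?Rint_win//; last exact: intgr_win.
    by congr (_%:E); by rewrite /L; field; rewrite gt_eqF.
  apply: eq_integral => e _; rewrite mulrC; congr (_ * _)%:E; congr (nat_of_bool _)%:R.
  by apply/andP/andP => -[h1 h2]; split; lra.
apply: (@le_trans _ _ ((T ^+ 2)%:E * ((4 * pi)%:E * \int[leb]_e (G e)%:E))%E).
  apply: lee_wpmul2l; first by rewrite lee_fin sqr_ge0.
  rewrite -ge0_integralZl//.
  - apply: ge0_le_integral => //.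
    + by move=> e _; exact: integral_ge0.
    + exact: (@measurable_Tonelli2 _ _ (measurableTypeR R) (measurableTypeR R) R leb sigma_finite_leb _ measurable_core_ker).
    + by under eq_fun do rewrite EFinM; exact: emeasurable_funM.
  - by move=> e _; rewrite lee_fin.
  - by rewrite lee_fin mulr_ge0// ltW.
rewrite EG -!EFinM lee_fin le_eqVlt; apply/orP; left; apply/eqP; by rewrite /L; field; rewrite gt_eqF.
Qed.

Section Multiplier.
Variables (ka : R) (m m' : R -> R).
Hypotheses (ka0 : 0 <= ka) (mm : measurable_fun setT m) (mm' : measurable_fun setT m').
Hypotheses (dm : forall x, al <= x <= be -> der m x (m' x)) (cm' : forall x, al <= x <= be -> {for x, continuous m'}).
Hypotheses (mB : forall x, al <= x <= be -> `|m x| <= ka) (m'B : forall x, al <= x <= be -> `|m' x| <= ka * T).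

Let psB (c : R -> R) t0 x : (forall y, `|c y| <= 1) -> `|c (t0 * x) * P x| <= B0 * win al be x.
Proof. by move=> h; rewrite normrM; apply: le_trans (PB x); rewrite ler_piMl. Qed.

Let hB (psi : R -> R) x : (forall x, `|psi x| <= B0 * win al be x) -> `|m x * psi x| <= (ka * B0) * win al be x.
Proof.
move=> h; rewrite normrM; have := h x; rewrite /win; case: (boolP (al <= x <= be)) => [hx|_].
  by rewrite !mulr1 => h1; apply: ler_pM => //; exact: mB.
by rewrite !mulr0 normr_le0 => /eqP ->; rewrite normr0 mulr0.
Qed.

(** [by_parts_le] in every window of length 1/T, integrated over the centres. The cosine and sine
    modulations of P are two instances, each dominated by its own term of [tsq]. *)
Let moll_core t0 (psi : R -> R) : measurable_fun setT psi -> (forall x, `|psi x| <= B0 * win al be x) ->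
  (forall e y, prim psi e y ^+ 2 <= tsq t0 e y) ->
  ((Rint leb (fun e => moll T (fun x => m x * psi x) e ^+ 2))%:E <= (2 * ka ^+ 2)%:E * core_maj t0)%E.
Proof.
move=> mpsi psiB ptsq.
have mh : measurable_fun setT (fun x => m x * psi x) by exact: measurable_funM.
have kB : 0 <= ka * B0 by rewrite mulr_ge0.
have hB' x := hB x psiB.
rewrite EFin_Rint; last exact: (@intgr_moll2 _ al be T (ka * B0) _ T0 kB mh hB').
have mk2 t : measurable_fun setT (core_ker t) by exact: (measurableT_comp measurable_core_ker (pair1_measurable t)).
have cT0 : 0 <= 2 * ka ^+ 2 * T ^+ 2.
  by apply: mulr_ge0; [apply: mulr_ge0 => //|]; exact: sqr_ge0.
rewrite /core_maj muleA -EFinM -ge0_integralZl; [|exact: measurableT|exact: mk2|by move=> e _; exact: core_ker_ge0|by rewrite lee_fin].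
apply: ge0_le_integral; first exact: measurableT.
- by move=> e _; rewrite lee_fin sqr_ge0.
- by apply/measurable_EFinP; apply: measurable_funX; exact: measurable_moll.
- by apply: emeasurable_funM; [exact: measurable_cst|exact: mk2].
move=> e _; have eL : e - T^-1 / 2 <= e + T^-1 / 2 by have := L0; rewrite /L; move: T^-1 => l l0; lra.
have dE : e + T^-1 / 2 - (e - T^-1 / 2) = T^-1 by field; rewrite gt_eqF.
have := by_parts_le T0 B00 ka0 mpsi psiB mm' dm cm' mB m'B eL dE.
set X := Rint leb _ => hX.
have -> : moll T (fun x => m x * psi x) e ^+ 2 = T ^+ 2 * X ^+ 2 by rewrite /moll /prim exprMn.
apply: (@le_trans _ _ ((T ^+ 2 * (2 * ka ^+ 2 * (prim psi (e - T^-1 / 2) (e + T^-1 / 2) ^+ 2 + T * Rint leb (fun y => win (e - T^-1 / 2) (e + T^-1 / 2) y * prim psi (e - T^-1 / 2) y ^+ 2))))%:E)).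
  by rewrite lee_fin ler_wpM2l ?sqr_ge0.
have EY (Y : R) : T ^+ 2 * (2 * ka ^+ 2 * Y) = 2 * ka ^+ 2 * T ^+ 2 * Y by ring.
rewrite EY [leLHS]EFinM; apply: lee_wpmul2l; first by rewrite lee_fin.
rewrite EFinD EFinM; apply: leeD; first by rewrite lee_fin ptsq.
rewrite [leLHS]EFinM; apply: lee_wpmul2l; first by rewrite lee_fin ltW.
have mprim : measurable_fun setT (prim psi (e - T^-1 / 2)).
  by apply: (@measurable_prim _ _ (measurableTypeR R) (fun=> psi) (fun=> e - T^-1 / 2) id) => //; exact: measurableT_comp.
rewrite EFin_Rint; last first.
  apply: (@intgr_win_bdd _ _ _ _ ((B0 * T^-1) ^+ 2)); first exact: measurable_funX.
  move=> x /andP[h1 h2]; rewrite normrX lerXn2r ?nnegrE ?mulr_ge0 ?invr_ge0 ?(ltW T0)//.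
  have := @norm_prim R al be B0 psi B00 mpsi psiB _ _ h1.
  by move=> /le_trans; apply; apply: ler_wpM2l => //; move: h2; move: T^-1 => l; lra.
apply: ge0_le_integral; first exact: measurableT.
- by move=> y _; rewrite lee_fin mulr_ge0 ?win_ge0 ?sqr_ge0.
- by apply/measurable_EFinP; apply: measurable_funM; [exact: measurable_win|exact: measurable_funX].
- by apply/measurable_EFinP; apply: measurable_funM; [exact: measurable_win|exact: measurable_tsq].
- by move=> y _; rewrite lee_fin ler_wpM2l ?win_ge0.
Qed.

Let mpsc t0 : measurable_fun setT (psc t0).
Proof. by apply: measurable_funM => //; exact: measurable_cosM. Qed.
Let mpss t0 : measurable_fun setT (pss t0).
Proof. by apply: measurable_funM => //; exact: measurable_sinM. Qed.
Let pscB t0 x : `|psc t0 x| <= B0 * win al be x. Proof. by apply: psB => y; exact: norm_cos_le1. Qed.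
Let pssB t0 x : `|pss t0 x| <= B0 * win al be x. Proof. by apply: psB => y; exact: norm_sin_le1. Qed.

Let imc (psi : R -> R) : measurable_fun setT psi -> (forall x, `|psi x| <= B0 * win al be x) -> intgr leb (fun x => m x * psi x).
Proof.
move=> mpsi psiB; apply: (@intgr_dom _ _ _ leb _ (fun x => (ka * B0) * win al be x)); last exact/intgrZl/intgr_win.
  exact: measurable_funM.
by move=> x; exact: hB.
Qed.

(** From exp(i t x) = exp(i (t - t0) x) exp(i t0 x): the second factor is absorbed into P, and the
    remaining frequency |t - t0| <= T/2 is in the range where averaging is harmless. *)
Let split_le t0 t : Fc (fun x => m x * P x) t ^+ 2 + Fs (fun x => m x * P x) t ^+ 2 <=
  2 * (Fc (fun x => m x * psc t0 x) (t - t0) ^+ 2 + Fs (fun x => m x * psc t0 x) (t - t0) ^+ 2) +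
  2 * (Fc (fun x => m x * pss t0 x) (t - t0) ^+ 2 + Fs (fun x => m x * pss t0 x) (t - t0) ^+ 2).
Proof.
have ic := imc (mpsc t0) (pscB t0); have iis := imc (mpss t0) (pssB t0).
have ttE x : cos (t * x) = cos ((t - t0) * x) * cos (t0 * x) - sin ((t - t0) * x) * sin (t0 * x).
  by rewrite -cosD -mulrDl subrK.
have ttEs x : sin (t * x) = sin ((t - t0) * x) * cos (t0 * x) + cos ((t - t0) * x) * sin (t0 * x).
  by rewrite -sinD -mulrDl subrK.
have -> : Fc (fun x => m x * P x) t = Fc (fun x => m x * psc t0 x) (t - t0) - Fs (fun x => m x * pss t0 x) (t - t0).
  rewrite /Fc /Fs -RintB; [|exact: intgr_cosM|exact: intgr_sinM].
  by apply: eq_Rint => x; rewrite ttE /psc /pss; ring.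
have -> : Fs (fun x => m x * P x) t = Fs (fun x => m x * psc t0 x) (t - t0) + Fc (fun x => m x * pss t0 x) (t - t0).
  rewrite /Fc /Fs -RintD; [|exact: intgr_sinM|exact: intgr_cosM].
  by apply: eq_Rint => x; rewrite ttEs /psc /pss; ring.
move: (Fc _ _) (Fs _ _) (Fc _ _) (Fs _ _) => x y z w.
by have := sqr_ge0 (z + w); have := sqr_ge0 (y - x); lra.
Qed.

Let tsqc t0 e y : prim (psc t0) e y ^+ 2 <= tsq t0 e y. Proof. by rewrite lerDl sqr_ge0. Qed.
Let tsqs t0 e y : prim (pss t0) e y ^+ 2 <= tsq t0 e y. Proof. by rewrite lerDr sqr_ge0. Qed.

(** The constant collects 2 from [split_le], 16 be from [moll_sup], 2 ka^2 from [moll_core], and 2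
    for the cosine and sine parts. *)
Lemma core_sup t0 t : `|t - t0| <= T / 2 ->
  ((Fc (fun x => m x * P x) t ^+ 2 + Fs (fun x => m x * P x) t ^+ 2)%:E <= (128 * be * ka ^+ 2)%:E * core_maj t0)%E.
Proof.
move=> tt; have kB : 0 <= ka * B0 by rewrite mulr_ge0.
have be0 : 0 <= be by have := ab; have := al0; lra.
have sup (psi : R -> R) (mpsi : measurable_fun setT psi) (pB : forall x, `|psi x| <= B0 * win al be x) :=
  @moll_sup R al be T (ka * B0) _ ab T0 Tbe (ltW al0) kB (measurable_funM mm mpsi) (fun x => hB x pB) _ tt.
have h1 := sup _ (mpsc t0) (pscB t0); have h2 := sup _ (mpss t0) (pssB t0).
have e1 := moll_core (mpsc t0) (pscB t0) (@tsqc t0); have e2 := moll_core (mpss t0) (pssB t0) (@tsqs t0).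
apply: (@le_trans _ _ ((32 * be)%:E * ((Rint leb (fun e => moll T (fun x => m x * psc t0 x) e ^+ 2))%:E + (Rint leb (fun e => moll T (fun x => m x * pss t0 x) e ^+ 2))%:E))%E).
  rewrite -EFinD -EFinM lee_fin; apply: le_trans (split_le t0 t) _.
  move: h1 h2; move: (Rint _ _) (Rint _ _) => I1 I2 h1 h2; lra.
apply: (@le_trans _ _ ((32 * be)%:E * ((2 * ka ^+ 2)%:E * core_maj t0 + (2 * ka ^+ 2)%:E * core_maj t0))%E).
  by apply: lee_wpmul2l; [rewrite lee_fin mulr_ge0|exact: leeD e1 e2].
move: (core_maj t0) (core_maj_ge0 t0) => A A0.
rewrite -mule2n -mule_natl !muleA -!EFinM.
by apply: lee_wpmul2r => //; rewrite lee_fin; lra.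
Qed.

Let scale_le (A J : \bar R) (I : R) : (0 <= A)%E -> (J <= (32 * pi * I)%:E)%E -> (I%:E <= (2 * ka ^+ 2)%:E * A)%E ->
  (J <= (64 * pi * ka ^+ 2)%:E * A)%E.
Proof.
move=> A0 h1 h2; have p0 : 0 <= 32 * pi :> R by rewrite mulr_ge0 ?pi_ge0.
apply: le_trans h1 _; rewrite EFinM; apply: le_trans (lee_wpmul2l _ h2) _; first by rewrite lee_fin.
rewrite muleA -EFinM; apply: lee_wpmul2r => //; rewrite lee_fin le_eqVlt; apply/orP; left; apply/eqP; ring.
Qed.

(** As for [core_sup], with 32 pi from [moll_L2] in place of 16 be. *)
Lemma core_L2 t0 : (\int[leb]_t (win (t0 - T / 2) (t0 + T / 2) t * (Fc (fun x => m x * P x) t ^+ 2 + Fs (fun x => m x * P x) t ^+ 2))%:E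
   <= (256 * pi * ka ^+ 2)%:E * core_maj t0)%E.
Proof.
have kB : 0 <= ka * B0 by rewrite mulr_ge0.
have L2 (psi : R -> R) (mpsi : measurable_fun setT psi) (pB : forall x, `|psi x| <= B0 * win al be x) :=
  @moll_L2 R al be T (ka * B0) _ T0 kB (measurable_funM mm mpsi) (fun x => hB x pB) t0.
have h1 := L2 _ (mpsc t0) (pscB t0); have h2 := L2 _ (mpss t0) (pssB t0).
have e1 := moll_core (mpsc t0) (pscB t0) (@tsqc t0); have e2 := moll_core (mpss t0) (pssB t0) (@tsqs t0).
pose Q (psi : R -> R) (t : R) := (win (t0 - T / 2) (t0 + T / 2) t * (Fc (fun x => m x * psi x) (t - t0) ^+ 2 + Fs (fun x => m x * psi x) (t - t0) ^+ 2))%:E.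
have mt : measurable_fun setT (fun t : R => t - t0) by exact: measurable_funB.
have Q0 psi t : (0 <= Q psi t)%E by rewrite lee_fin mulr_ge0 ?win_ge0// addr_ge0 ?sqr_ge0.
have mQ (psi : R -> R) : measurable_fun setT psi -> (forall x, `|psi x| <= B0 * win al be x) -> measurable_fun setT (Q psi).
  move=> mpsi pB; have i := imc mpsi pB; apply/measurable_EFinP; apply: measurable_funM; first exact: measurable_win.
  by apply: measurable_funD; apply: measurable_funX; [exact: (measurableT_comp (measurable_Fc i) mt)|exact: (measurableT_comp (measurable_Fs i) mt)].
have mQc := mQ _ (mpsc t0) (pscB t0); have mQs := mQ _ (mpss t0) (pssB t0).
have iP := imc mP PB.
apply: (@le_trans _ _ (2%:E * (\int[leb]_t Q (psc t0) t + \int[leb]_t Q (pss t0) t))%E).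
  rewrite -ge0_integralD// -ge0_integralZl//; last 2 first.
  - exact: emeasurable_funD.
  - by move=> t _; exact: adde_ge0.
  apply: ge0_le_integral; first exact: measurableT.
  - by move=> t _; rewrite lee_fin mulr_ge0 ?win_ge0// addr_ge0 ?sqr_ge0.
  - apply/measurable_EFinP; apply: measurable_funM; first exact: measurable_win.
    by apply: measurable_funD; apply: measurable_funX; [exact: measurable_Fc|exact: measurable_Fs].
  - by apply: emeasurable_funM => //; exact: emeasurable_funD.
  - move=> t _; rewrite /Q -EFinD -EFinM lee_fin -mulrDr mulrCA ler_wpM2l ?win_ge0//.
    by apply: le_trans (split_le t0 t) _; lra.
have f1 := scale_le (core_maj_ge0 t0) h1 e1; have f2 := scale_le (core_maj_ge0 t0) h2 e2.
apply: le_trans (lee_wpmul2l _ (leeD f1 f2)) _ => //.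
move: (core_maj t0) (core_maj_ge0 t0) => A A0.
rewrite -mule2n -mule_natl !muleA -!EFinM.
by apply: lee_wpmul2r => //; rewrite lee_fin le_eqVlt; apply/orP; left; apply/eqP; ring.
Qed.

End Multiplier.

End Core.

(** * One dyadic shell and one frequency band *)

Section Exponents.
Context {R : realType}.
Variables (N a b p : R).
Hypotheses (N2 : 2 <= N) (a1 : 1 < a) (b1 : 1 < b) (p1 : 1 < p) (hp : a / (b - 1) < p).

(** The first entry is the gain for r rho >= 1, where the Bessel decay outweighs the growth of the
    weight term; the second is the gain for r rho <= 1, from the small volume of the shell relative
    to the parabolic cube. *)
Definition decay_exp : R := Num.min (b - 1 - a / p) (N - N / p).

Lemma decay_exp_gt0 : 0 < decay_exp.
Proof.
rewrite /decay_exp lt_min; apply/andP; split.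
  have := hp; rewrite ltr_pdivrMr ?subr_gt0// => h.
  by rewrite ltr_pdivrMr ?(mulrC (b - 1))//; have := p1; lra.
by rewrite subr_gt0 ltr_pdivrMr; have := N2; have := p1; nra.
Qed.

Definition two_sided (s : R) : R := Num.min s s^-1 `^ decay_exp.

Variables (rho r : R).
Hypotheses (rho0 : 0 < rho) (r0 : 0 < r).

Let M := Num.max r rho^-1.
Let M0 : 0 < M. Proof. by rewrite lt_max r0. Qed.

(* The lam that balances the two terms of W Y <= lam Y + lam^(1-p) (sup Y) W^p. *)
Definition opt_level : R := (rho `^ a * M `^ (N + a - b * p) * r `^ (- N)) `^ p^-1.

Let base0 : 0 < rho `^ a * M `^ (N + a - b * p) * r `^ (- N).
Proof. by rewrite !mulr_gt0// powR_gt0. Qed.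

Lemma opt_level_gt0 : 0 < opt_level. Proof. exact: powR_gt0. Qed.

Lemma opt_levelE : opt_level `^ (1 - p) * (rho `^ a * M `^ (N + a - b * p)) = opt_level * r `^ N.
Proof.
have p0 : 0 < p by have := p1; lra.
rewrite (@powRD _ opt_level 1); last by rewrite (gt_eqF opt_level_gt0) implybT.
rewrite powRr1 ?(ltW opt_level_gt0)// -mulrA; congr (_ * _).
rewrite /opt_level -powRrM mulrN mulVf ?gt_eqF// powR_inv1 ?(ltW base0)// powRN.
have h1 : 0 < r `^ N by rewrite powR_gt0.
have h2 : 0 < rho `^ a * M `^ (N + a - b * p) by rewrite mulr_gt0// powR_gt0.
by move: h1 h2; move: (r `^ N) (rho `^ a * _) => x y x0 y0; field; rewrite !gt_eqF.
Qed.

(** In the logarithms of rho and r everything is linear, with M = r or M = 1/rho according to the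
    sign of x + y. The exponents of r rho come out as (1 - N) + (a/p - b + N) = - (b - 1 - a/p) and
    N - N/p. *)
Lemma shell_exponent : Num.min 1 ((r * rho) `^ (1 - N)) * (opt_level * r `^ N) <= two_sided (r * rho) * rho `^ (b - N).
Proof.
have p0 : 0 < p by have := p1; lra.
have rr0 : 0 < r * rho by rewrite mulr_gt0.
pose x := ln rho; pose y := ln r.
have rhoE : rho = expR x by rewrite lnK.
have rE : r = expR y by rewrite lnK.
have sE : r * rho = expR (x + y) by rewrite expRD -rhoE -rE mulrC.
have e0 := decay_exp_gt0.
have [s1|s1] := leP 1 (r * rho).
  have ME : M = expR y.
    rewrite /M max_l ?rE// -div1r ler_pdivrMr// -rE mulrC mulrC//.
  have xy : 0 <= x + y by rewrite -ler_expR expR0 -sE.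
  have -> : opt_level * r `^ N = expR (b * x + (a / p - b + N) * (x + y) - N * x) .
    rewrite /opt_level ME rE rhoE -!expRM -!expRD -!expRM -expRD; congr expR; field; rewrite gt_eqF//.
  apply: (@le_trans _ _ (expR ((1 - N) * (x + y)) * expR (b * x + (a / p - b + N) * (x + y) - N * x))).
    by rewrite ler_wpM2r ?expR_ge0// ge_min sE -expRM [_ * (1 - N)]mulrC lexx orbT.
  rewrite /two_sided min_r ?sE; last by rewrite -expRN ler_expR; lra.
  rewrite -expRN -expRM rhoE -expRM -!expRD ler_expR.
  have h : decay_exp <= b - 1 - a / p by rewrite ge_min lexx.
  have := ler_wpM2r xy h; lra.
have ME : M = expR (- x).
  rewrite /M max_r ?rhoE ?expRN// -rhoE -div1r ler_pdivlMr// ltW//.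
have xy : x + y <= 0 by rewrite -ler_expR expR0 -sE ltW.
have -> : opt_level * r `^ N = expR (b * x + (N - N / p) * (x + y) - N * x).
  rewrite /opt_level ME rE rhoE -!expRM -!expRD -!expRM -expRD; congr expR; field; rewrite gt_eqF//.
apply: (@le_trans _ _ (expR (b * x + (N - N / p) * (x + y) - N * x))).
  by rewrite ler_piMl ?expR_ge0// ge_min lexx.
rewrite /two_sided min_l ?sE; last by rewrite -expRN ler_expR; lra.
rewrite -expRM rhoE -expRM -expRD ler_expR.
have h : decay_exp <= N - N / p by rewrite ge_min lexx orbT.
have := ler_wnM2r xy h; lra.
Qed.

End Exponents.

Lemma measurable_Fc2 (R : realType) d (T : measurableType d) (f : T -> R -> R) (g : T -> R) :
  measurable_fun setT (fun z : T * measurableTypeR R => f z.1 z.2) -> measurable_fun setT g ->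
  measurable_fun setT (fun x => Fc (f x) (g x)).
Proof.
move=> mf mg; apply: (@measurable_Rint _ _ _ (measurableTypeR R) R lebesgue_measure (@sigma_finite_leb R) (fun z => cos (g z.1 * z.2) * f z.1 z.2)).
by apply: measurable_funM => //; apply: measurable_cosM => //; exact: measurableT_comp.
Qed.

Lemma measurable_Fs2 (R : realType) d (T : measurableType d) (f : T -> R -> R) (g : T -> R) :
  measurable_fun setT (fun z : T * measurableTypeR R => f z.1 z.2) -> measurable_fun setT g ->
  measurable_fun setT (fun x => Fs (f x) (g x)).
Proof.
move=> mf mg; apply: (@measurable_Rint _ _ _ (measurableTypeR R) R lebesgue_measure (@sigma_finite_leb R) (fun z => sin (g z.1 * z.2) * f z.1 z.2)).
by apply: measurable_funM => //; apply: measurable_sinM => //; exact: measurableT_comp.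
Qed.

(** * The estimate for |x| ~ r and |xi| ~ rho *)

Section Shell.
Context {R : realType} (n : nat).
Hypothesis n2 : (2 <= n)%N.
Local Notation leb := (@lebesgue_measure R).
Local Notation mu := (lebesgue_Rn n : {measure set Rn R n -> \bar R}).
Let N : R := n%:R.
Let N2 : 2 <= N. Proof. by rewrite /N ler_nat. Qed.
Variables (a b p K : R).
Hypotheses (a1 : 1 < a) (b1 : 1 < b) (p1 : 1 < p) (hp : a / (b - 1) < p) (K0 : 0 <= K).
Variable W : Rn R n -> R -> R.
Hypothesis mW : measurable_fun setT (fun z : Rn R n * measurableTypeR R => W z.1 z.2).
Hypothesis W0 : forall x t, 0 <= W x t.

(** Only cubes centred at x = 0 occur: the shell |x| ~ r lies in the one of side 4 r. The centre in
    time remains arbitrary. *)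
Definition cubei (r : R) : Rn R n -> R := \1_(cube [tuple of nseq n 0] r).

Hypothesis hW : forall r t, 0 < r ->
  (\int[mu]_x \int[leb]_s (cubei r x * win (t - r `^ a / 2) (t + r `^ a / 2) s * W x s `^ p)%:E <= (K * r `^ (N + a - b * p))%:E)%E.

(* [usq P x t] is |u(x, t)|^2, up to a constant, for the frequency profile [P] in
   the variable tau = |xi|^a. *)
Definition band (P : R -> R) (x : Rn R n) (y : R) : R := bS n.-1 (enorm x * y `^ a^-1) * P y.
Definition usq (P : R -> R) (x : Rn R n) (t : R) : R := Fc (band P x) t ^+ 2 + Fs (band P x) t ^+ 2.
Definition shell (r : R) (x : Rn R n) : R := win r (2 * r) (enorm x).

Lemma usq_ge0 P x t : 0 <= usq P x t.
Proof. by rewrite addr_ge0 ?sqr_ge0. Qed.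

Lemma measurable_bSpow d (T : measurableType d) (f : T -> Rn R n) (g : T -> R) :
  measurable_fun setT f -> measurable_fun setT g -> measurable_fun setT (fun z => bS n.-1 (enorm (f z) * g z `^ a^-1)).
Proof.
move=> mf mg; apply: (measurableT_comp (f := @bS R n.-1)).
  by apply: continuous_measurable_fun; apply: continuous_bS; rewrite -ltnS prednK// (ltn_trans _ n2).
apply: measurable_funM; first by apply: (measurableT_comp _ mf); exact: measurable_enorm.
by apply: (measurableT_comp (measurable_powR _)).
Qed.

Lemma measurable_usq P : measurable_fun setT P ->
  measurable_fun setT (fun z : Rn R n * measurableTypeR R => usq P z.1 z.2).
Proof.
move=> mP.
have mB : measurable_fun setT (fun z : (Rn R n * measurableTypeR R) * measurableTypeR R => band P z.1.1 z.2).
  by apply: measurable_funM; [apply: measurable_bSpow => //; exact: measurableT_comp|exact: measurableT_comp].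
by apply: measurable_funD; apply: measurable_funX; [apply: measurable_Fc2|apply: measurable_Fs2].
Qed.

Lemma measurable_shell r : measurable_fun setT (shell r).
Proof. by apply: measurable_win => //; exact: measurable_enorm. Qed.

Lemma enorm_coord (x : Rn R n) (i : 'I_n) : `|(tnth x i : R)| <= enorm x.
Proof.
rewrite -ler_sqr ?nnegrE ?enorm_ge0// enorm_sqr /dotp (bigD1 i)//= real_normK ?num_real// -expr2 lerDl.
by apply: sumr_ge0 => j _; rewrite -expr2 sqr_ge0.
Qed.

Lemma shell_le_cubei r x : 0 < r -> shell r x <= cubei (4 * r) x.
Proof.
move=> r0; rewrite /shell /win /cubei indicE; case: (boolP (_ && _)) => [/andP[_ h]|_]; last by rewrite ler0n.
rewrite mem_set// => i; rewrite tnth_nseq subr0; apply: le_trans (enorm_coord x i) _; lra.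
Qed.

Lemma cubei_mono r s x : r <= s -> cubei r x <= cubei s x.
Proof.
move=> rs; rewrite /cubei !indicE; have [h|h] := boolP (x \in cube _ r); last by rewrite ler0n.
rewrite mem_set// => i; move/set_mem: h => /(_ i) h; apply: le_trans h _; lra.
Qed.

Lemma cubei_ge0 r x : 0 <= cubei r x. Proof. by rewrite /cubei indicE ler0n. Qed.

Lemma measurable_cubei r : measurable_fun setT (cubei r).
Proof. by apply: measurable_indic; exact: measurable_cube. Qed.

Lemma int_shell r : 0 < r -> (\int[mu]_x (shell r x)%:E <= ((4 * r) ^+ n)%:E)%E.
Proof.
move=> r0; apply: (@le_trans _ _ (\int[mu]_x (cubei (4 * r) x)%:E)%E).
  apply: ge0_le_integral; first exact: measurableT.
  - by move=> x _; rewrite lee_fin win_ge0.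
  - by apply/measurable_EFinP; exact: measurable_shell.
  - by apply/measurable_EFinP; exact: measurable_cubei.
  - by move=> x _; rewrite lee_fin shell_le_cubei.
rewrite integral_indic//; last exact: measurable_cube.
by rewrite setIT lebesgue_Rn_cube// mulr_ge0// ltW.
Qed.

Variable C0 : R.
Hypotheses (C01 : 1 <= C0) (hC0 : forall s : R, 0 <= s -> s ^+ n.-1 * (bS n.-1 s ^+ 2 + bD n.-1 s ^+ 2) <= C0).

Section OneShell.
Variables (rho r B0 : R) (Phi : R -> R).
Hypotheses (rho0 : 0 < rho) (r0 : 0 < r) (B00 : 0 <= B0).
Let al := rho `^ a.
Let be := (2 * rho) `^ a.
Hypotheses (mPhi : measurable_fun setT Phi) (PhiB : forall y, `|Phi y| <= B0 * win al be y).

Let M := Num.max r rho^-1.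
Let T := M `^ a.
Let M0 : 0 < M. Proof. by rewrite lt_max r0. Qed.
Let T0 : 0 < T. Proof. exact: powR_gt0. Qed.
Let al0 : 0 < al. Proof. exact: powR_gt0. Qed.
Let ab : al <= be.
Proof. by have := rho0; have := a1 => h h'; apply: ge0_ler_powR; rewrite ?nnegrE; lra. Qed.
(** M >= 1/rho keeps the averaging windows, of length 1/T, no longer than the frequencies
    themselves; [moll_sup] depends on it. *)
Let Tal : T^-1 <= al.
Proof.
rewrite /T /al invf_ple ?posrE ?powR_gt0// -powRN.
have -> : rho `^ (- a) = rho^-1 `^ a by rewrite -(powR_inv1 (ltW rho0)) -powRrM mulN1r.
by apply: ge0_ler_powR; rewrite ?nnegrE ?invr_ge0 ?(ltW rho0) ?(ltW M0)//; [have := a1; lra|rewrite /M le_max lexx orbT].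
Qed.
Let Tbe : T^-1 <= be. Proof. exact: le_trans Tal ab. Qed.

(** [q0] bounds S^2 + S'^2 on the shell and the band. The factor 4 in [ka] is for the derivative,
    where |x| <= 2 r and tau^(1/a) <= 2 rho. *)
Let q0 := Num.min 1 (C0 * (r * rho) `^ (1 - N)).
Let ka := 4 * Num.sqrt q0.
Let q00 : 0 <= q0. Proof. by rewrite le_min ler01 mulr_ge0 ?powR_ge0// (le_trans _ C01). Qed.
Let ka0 : 0 <= ka. Proof. by rewrite mulr_ge0 ?sqrtr_ge0. Qed.

Let ka2 : ka ^+ 2 <= 16 * C0 * Num.min 1 ((r * rho) `^ (1 - N)).
Proof.
rewrite exprMn sqr_sqrtr//; have -> : 4 ^+ 2 = 16 :> R by ring.
rewrite -mulrA ler_pM2l// /q0; case: (leP 1 ((r * rho) `^ (1 - N))) => _; rewrite ge_min ?lexx ?orbT//.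
by rewrite mulr1 C01.
Qed.

Let m (x : Rn R n) y : R := bS n.-1 (enorm x * y `^ a^-1).
Let m' (x : Rn R n) y : R := bD n.-1 (enorm x * y `^ a^-1) * (enorm x * (a^-1 * y `^ (a^-1 - 1))).

Let ypow y : al <= y <= be -> [/\ 0 < y, rho <= y `^ a^-1 & y `^ a^-1 <= 2 * rho].
Proof.
move=> /andP[h1 h2]; have a0 : 0 < a by have := a1; lra.
have y0 : 0 < y by apply: lt_le_trans h1.
have rr z : 0 < z -> z = (z `^ a) `^ a^-1 :> R.
  by move=> z0; rewrite -powRrM mulfV ?gt_eqF// powRr1// ltW.
split => //.
  by rewrite [leLHS]rr//; apply: ge0_ler_powR; rewrite ?nnegrE ?invr_ge0 ?powR_ge0// ltW.
have r20 : 0 < 2 * rho by rewrite mulr_gt0.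
by rewrite [leRHS]rr//; apply: ge0_ler_powR; rewrite ?nnegrE ?invr_ge0 ?powR_ge0// ltW.
Qed.

Let dm x y : al <= y <= be -> der (m x) y (m' x y).
Proof.
move=> /ypow[y0 _ _]; apply: (der_comp (der_bS _ _)).
exact: derZ (derPow _ y0).
Qed.

Let cm' x y : al <= y <= be -> {for y, continuous (m' x)}.
Proof.
move=> /ypow[y0 _ _]; apply: (@der_cont _ _ _ _ (derM (der_comp (der_bD _ _) (derZ (enorm x) (derPow a^-1 y0))) (derZ (enorm x) (derZ a^-1 (derPow (a^-1 - 1) y0))))).
Qed.

Let SD x y : shell r x != 0 -> al <= y <= be ->
  bS n.-1 (enorm x * y `^ a^-1) ^+ 2 + bD n.-1 (enorm x * y `^ a^-1) ^+ 2 <= q0.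
Proof.
rewrite /shell /win; case: (boolP (_ && _)) => [/andP[h1 h2] _|_]; last by rewrite eqxx.
move=> /ypow[y0 y1 y2]; set s := enorm x * _.
have sr : r * rho <= s by apply: ler_pM => //; exact: ltW.
have rr0 : 0 < r * rho by rewrite mulr_gt0.
have s0 : 0 <= s by lra.
rewrite le_min bSD_le1//=.
have -> : (r * rho) `^ (1 - N) = ((r * rho) ^+ n.-1)^-1.
  rewrite -powR_mulrn ?(ltW rr0)// -powRN; congr (_ `^ _); rewrite /N -(bS_dim n2) -natr1; lra.
rewrite ler_pdivlMr ?exprn_gt0// mulrC; apply: le_trans (hC0 s0).
apply: ler_wpM2r; first by rewrite addr_ge0 ?sqr_ge0.
by apply: lerXn2r; rewrite ?nnegrE// ltW.
Qed.

Let mB x y : shell r x != 0 -> al <= y <= be -> `|m x y| <= ka.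
Proof.
move=> h1 h2; have := SD h1 h2; rewrite -/(m x y); move: (bD _ _) => D h.
have : `|m x y| <= Num.sqrt q0.
  by rewrite -(sqrtr_sqr (m x y)) ler_wsqrtr// (le_trans _ h)// lerDl sqr_ge0.
by rewrite /ka; have := sqrtr_ge0 q0; lra.
Qed.

(** The chain rule gives |m'| <= |S'| (2 r) (2 rho) rho^(-a). Then r <= M, and rho^(1-a) <= M^(a-1)
    because a > 1, so that m' <= ka T with T = M^a: the time scale is chosen for this inequality. *)
Let m'B x y : shell r x != 0 -> al <= y <= be -> `|m' x y| <= ka * T.
Proof.
move=> h1 h2; have := SD h1 h2; move: (bS _ _) => S h.
have D1 : `|bD n.-1 (enorm x * y `^ a^-1)| <= Num.sqrt q0.
  by rewrite -(sqrtr_sqr (bD _ _)) ler_wsqrtr// (le_trans _ h)// lerDr sqr_ge0.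
have [y0 y1 y2] := ypow h2.
move: h1; rewrite /shell /win; case: (boolP (_ && _)) => [/andP[h3 h4] _|_]; last by rewrite eqxx.
rewrite /m' normrM /ka; have -> : 4 * Num.sqrt q0 * T = Num.sqrt q0 * (4 * T) by ring.
apply: ler_pM => //.
rewrite ger0_norm; last by rewrite mulr_ge0 ?enorm_ge0// mulr_ge0 ?powR_ge0// invr_ge0; have := a1; lra.
have M1 : r <= M by rewrite le_max lexx.
have M2 : rho^-1 <= M by rewrite le_max lexx orbT.
have -> : y `^ (a^-1 - 1) = y `^ a^-1 / y.
  by rewrite powRD ?(gt_eqF y0) ?implybT// powR_inv1// ltW.
have al1 : y^-1 <= al^-1 by rewrite lef_pV2 ?posrE//; case/andP: h2.
have alE : al^-1 = rho^-1 * rho^-1 `^ (a - 1).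
  rewrite /al -powRN; have -> : rho^-1 * rho^-1 `^ (a - 1) = rho^-1 `^ a.
    have i0 : 0 < rho^-1 by rewrite invr_gt0.
    by rewrite -{1}[rho^-1](powRr1 (ltW i0)) -powRD ?(gt_eqF i0) ?implybT//; congr (_ `^ _); ring.
  by rewrite -(powR_inv1 (ltW rho0)) -powRrM mulN1r.
have TE : T = M * M `^ (a - 1).
  by rewrite -{1}[M](powRr1 (ltW M0)) -powRD ?(gt_eqF M0) ?implybT//; congr (_ `^ _); ring.
have p1' : rho^-1 `^ (a - 1) <= M `^ (a - 1).
  by apply: ge0_ler_powR; rewrite ?nnegrE ?invr_ge0 ?(ltW M0) ?(ltW rho0)//; have := a1; lra.
have a1' : a^-1 <= 1 by rewrite invf_le1; have := a1; lra.
apply: (@le_trans _ _ ((2 * r) * (1 * ((2 * rho) * al^-1)))).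
  apply: ler_pM => //; first exact: enorm_ge0.
    by rewrite mulr_ge0// ?invr_ge0 ?mulr_ge0 ?powR_ge0 ?invr_ge0//; [have := a1; lra|exact: ltW].
  apply: ler_pM => //; [by rewrite invr_ge0; have := a1; lra|by rewrite mulr_ge0 ?powR_ge0// invr_ge0 ltW|].
  by apply: ler_pM => //; [exact: powR_ge0|rewrite invr_ge0 ltW].
rewrite alE TE mul1r.
have -> : 2 * r * (2 * rho * (rho^-1 * rho^-1 `^ (a - 1))) = 4 * (r * rho^-1 `^ (a - 1)) by field; rewrite gt_eqF.
rewrite ler_pM2l//; apply: ler_pM => //; [exact: ltW|exact: powR_ge0].
Qed.

Let wJ t0 t := win (t0 - T / 2) (t0 + T / 2) t.
Let lam := opt_level N a b p rho r.
Let lam0 : 0 < lam. Proof. exact: opt_level_gt0. Qed.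
Let maj t0 := core_maj T Phi t0.
Let maj0 t0 : (0 <= maj t0)%E. Proof. by apply: core_maj_ge0 => //; exact: ltW. Qed.

Let split_level (w u : R) : 0 <= w -> 0 <= u -> w * u <= lam * u + lam `^ (1 - p) * w `^ p * u.
Proof.
move=> w0 u0; rewrite -mulrDl ler_wpM2r//; have [wl|lw] := leP w lam.
  by apply: le_trans wl _; rewrite lerDl mulr_ge0 ?powR_ge0.
have wp : 0 < w by exact: lt_trans lw.
apply: (@le_trans _ _ (lam `^ (1 - p) * w `^ p)); last by rewrite lerDr ltW.
rewrite (@powRD _ lam 1) ?(gt_eqF lam0) ?implybT// powRr1 ?(ltW lam0)// powRN -mulrA [X in _ * X]mulrC.
have l1 : 0 < lam `^ p by rewrite powR_gt0.
rewrite mulrA ler_pdivlMr//.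
have e (z : R) : 0 < z -> z `^ p = z * z `^ (p - 1).
  by move=> z0; rewrite -{2}[z](powRr1 (ltW z0)) -powRD ?(gt_eqF z0) ?implybT//; congr (_ `^ _); ring.
rewrite !e// mulrCA ler_pM2l// ler_pM2l//.
by apply: ge0_ler_powR; rewrite ?nnegrE ?(ltW lam0) ?(ltW wp) ?(ltW lw)//; have := p1; lra.
Qed.

Let Bm t0 : \bar R := ((128 * be * ka ^+ 2)%:E * maj t0)%E.
Let Bm0 t0 : (0 <= Bm t0)%E.
Proof. by apply: mule_ge0 => //; rewrite lee_fin mulr_ge0 ?sqr_ge0// mulr_ge0// powR_ge0. Qed.

Let mu1 x : measurable_fun setT (usq Phi x).
Proof. exact: (measurableT_comp (measurable_usq mPhi) (pair1_measurable x)). Qed.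
Let mW1 x : measurable_fun setT (W x : R -> R).
Proof. exact: (measurableT_comp mW (pair1_measurable x)). Qed.
Let mWp : measurable_fun setT (fun z : Rn R n * measurableTypeR R => W z.1 z.2 `^ p).
Proof. exact: (measurableT_comp (measurable_powR _)). Qed.
Let mWp1 x : measurable_fun setT (fun t : R => W x t `^ p).
Proof. exact: (measurableT_comp (measurable_powR _) (mW1 x)). Qed.
Let mwJ t0 : measurable_fun setT (wJ t0). Proof. exact: measurable_win. Qed.
Let shell01 x : shell r x = 0 \/ shell r x = 1.
Proof. by rewrite /shell /win; case: (_ && _); [right|left]. Qed.

(** With x frozen, the part lam Y is bounded by the local L^2 estimate and the part with W^p by the
    local supremum of Y. Both bounds contain the same majorant, which does not depend on x, so that
    x can be integrated afterwards against the weight alone. *)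
Let fiber_bound t0 x :
  (\int[leb]_t (shell r x * (wJ t0 t * (W x t * usq Phi x t)))%:E <=
   (lam * shell r x)%:E * ((256 * pi * ka ^+ 2)%:E * maj t0) +
   ((lam `^ (1 - p))%:E * Bm t0) * \int[leb]_t (shell r x * (wJ t0 t * W x t `^ p))%:E)%E.
Proof.
have [s0|s1] := shell01 x.
  rewrite s0 mulr0 mul0e add0e; under eq_integral do rewrite mul0r; rewrite integral0.
  apply: mule_ge0; first by apply: mule_ge0 => //; rewrite lee_fin powR_ge0.
  by apply: integral_ge0 => t _; rewrite mul0r.
have sn0 : shell r x != 0 by rewrite s1 oner_neq0.
rewrite s1 mulr1; under eq_integral do rewrite mul1r; under [X in (_ + _ * X)%E]eq_integral do rewrite mul1r.
have L2 := core_L2 T0 B00 mPhi PhiB ka0.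
have mmx : measurable_fun setT (m x) by apply: measurable_bSpow.
have mm'x : measurable_fun setT (m' x).
  apply: measurable_funM.
    apply: (measurableT_comp (f := @bD R n.-1)).
      by apply: continuous_measurable_fun => s; exact: der_cont (der_bD _ s).
    by apply: measurable_funM => //; exact: measurable_powR.
  by apply: measurable_funM => //; apply: measurable_funM => //; exact: measurable_powR.
have L2x := L2 _ _ mmx mm'x (@dm x) (@cm' x) (fun y => @mB x y sn0) (fun y => @m'B x y sn0) t0.
have sup t := core_sup ab T0 Tbe al0 B00 mPhi PhiB ka0 mmx mm'x (@dm x) (@cm' x) (fun y => @mB x y sn0) (fun y => @m'B x y sn0) (t0 := t0) (t := t).
apply: (@le_trans _ _ (\int[leb]_t (lam%:E * (wJ t0 t * usq Phi x t)%:E + ((lam `^ (1 - p))%:E * Bm t0) * (wJ t0 t * W x t `^ p)%:E))%E).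
  apply: ge0_le_integral; first exact: measurableT.
  - by move=> t _; rewrite lee_fin mulr_ge0// mulr_ge0// usq_ge0.
  - by apply/measurable_EFinP; apply: measurable_funM; [exact: mwJ|apply: measurable_funM; [exact: mW1|exact: mu1]].
  - apply: emeasurable_funD; apply: emeasurable_funM; try exact: measurable_cst.
      by apply/measurable_EFinP; apply: measurable_funM; [exact: mwJ|exact: mu1].
    by apply/measurable_EFinP; apply: measurable_funM; [exact: mwJ|exact: mWp1].
  - move=> t _; rewrite /wJ /win; case: (boolP (_ && _)) => [/andP[h1 h2]|_]; last first.
      by rewrite !mul0r !mule0 adde0.
    rewrite !mul1r; apply: (@le_trans _ _ (lam * usq Phi x t + lam `^ (1 - p) * W x t `^ p * usq Phi x t)%:E).
      by rewrite lee_fin split_level// usq_ge0.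
    rewrite EFinD EFinM; apply: leeD => //.
    have tt : `|t - t0| <= T / 2 by rewrite ler_norml; apply/andP; split; lra.
    rewrite EFinM EFinM muleAC; apply: lee_wpmul2r; first by rewrite lee_fin powR_ge0.
    by apply: lee_wpmul2l; [rewrite lee_fin powR_ge0|exact: sup].
have c0 : (0 <= (lam `^ (1 - p))%:E * Bm t0)%E by apply: mule_ge0 => //; rewrite lee_fin powR_ge0.
rewrite ge0_integralD; [|exact: measurableT|by move=> t _; apply: mule_ge0; rewrite lee_fin ?(ltW lam0)// mulr_ge0// usq_ge0| |by move=> t _; apply: mule_ge0 => //; rewrite lee_fin mulr_ge0// powR_ge0| ]; last 2 first.
- by apply: emeasurable_funM; [exact: measurable_cst|apply/measurable_EFinP; apply: measurable_funM; [exact: mwJ|exact: mu1]].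
- by apply: emeasurable_funM; [exact: measurable_cst|apply/measurable_EFinP; apply: measurable_funM; [exact: mwJ|exact: mWp1]].
apply: leeD.
  rewrite ge0_integralZl; [|exact: measurableT| |by move=> t _; rewrite lee_fin mulr_ge0// usq_ge0|by rewrite lee_fin ltW].
    by apply: lee_wpmul2l; [rewrite lee_fin ltW|exact: L2x].
  by apply/measurable_EFinP; apply: measurable_funM; [exact: mwJ|exact: mu1].
rewrite ge0_integralZl//.
  by apply/measurable_EFinP; apply: measurable_funM; [exact: mwJ|exact: mWp1].
by move=> t _; rewrite lee_fin mulr_ge0// powR_ge0.
Qed.

Let X := K * (4 * M) `^ (N + a - b * p).
Let D := lam * (256 * pi * ka ^+ 2) * (4 * r) ^+ n + lam `^ (1 - p) * (128 * be * ka ^+ 2) * X.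

Let mF : measurable_fun setT (fun z : (measurableTypeR R * Rn R n) * measurableTypeR R =>
  (shell r z.1.2 * (wJ z.1.1 z.2 * (W z.1.2 z.2 * usq Phi z.1.2 z.2)))%:E).
Proof.
have mxt : measurable_fun setT (fun z : (measurableTypeR R * Rn R n) * measurableTypeR R => (z.1.2, z.2)).
  by apply: measurable_fun_pair => //; exact: measurableT_comp.
apply/measurable_EFinP; apply: measurable_funM.
  by apply: (measurableT_comp (measurable_shell r)); exact: measurableT_comp.
apply: measurable_funM.
  by apply: measurable_win => //; [apply: measurable_funB => //|apply: measurable_funD => //]; exact: measurableT_comp.
by apply: measurable_funM; [exact: (measurableT_comp mW mxt)|exact: (measurableT_comp (measurable_usq mPhi) mxt)].
Qed.

Let slab_bound t0 :
  (\int[mu]_x \int[leb]_t (shell r x * (wJ t0 t * (W x t * usq Phi x t)))%:E <= D%:E * maj t0)%E.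
Proof.
have p0 := @pi_ge0 R.
have be0 : 0 <= be by rewrite powR_ge0.
have k2 : 0 <= ka ^+ 2 by rewrite sqr_ge0.
have c0 : (0 <= (lam `^ (1 - p))%:E * Bm t0)%E by apply: mule_ge0 => //; rewrite lee_fin powR_ge0.
have d0 : (0 <= (256 * pi * ka ^+ 2)%:E * maj t0)%E.
  apply: mule_ge0; last exact: maj0.
  by rewrite lee_fin; apply: mulr_ge0; [apply: mulr_ge0; [exact: ler0n|exact: p0]|exact: k2].
have mwp : measurable_fun setT (fun z : Rn R n * measurableTypeR R => (shell r z.1 * (wJ t0 z.2 * W z.1 z.2 `^ p))%:E).
  apply/measurable_EFinP; apply: measurable_funM.
    by apply: (measurableT_comp (measurable_shell r)).
  by apply: measurable_funM => //; apply: (measurableT_comp (mwJ t0)).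
have mwpI : measurable_fun setT (fun x => \int[leb]_t (shell r x * (wJ t0 t * W x t `^ p))%:E)%E.
  apply: (@measurable_Tonelli1 _ _ (Rn R n) (measurableTypeR R) R leb sigma_finite_leb _ mwp).
  by move=> z; rewrite lee_fin mulr_ge0 ?win_ge0// mulr_ge0// powR_ge0.
have I0 x : (0 <= \int[leb]_t (shell r x * (wJ t0 t * W x t `^ p))%:E)%E.
  by apply: integral_ge0 => t _; rewrite lee_fin mulr_ge0 ?win_ge0// mulr_ge0// powR_ge0.
have ms : measurable_fun setT (fun x => (lam * shell r x)%:E).
  by apply/measurable_EFinP; apply: measurable_funM => //; exact: measurable_shell.
have s0 x : (0 <= (lam * shell r x)%:E)%E by rewrite lee_fin mulr_ge0 ?win_ge0// ltW.
apply: (@le_trans _ _ (\int[mu]_x (((256 * pi * ka ^+ 2)%:E * maj t0) * (lam * shell r x)%:E +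
   ((lam `^ (1 - p))%:E * Bm t0) * \int[leb]_t (shell r x * (wJ t0 t * W x t `^ p))%:E))%E).
  apply: ge0_le_integral; first exact: measurableT.
  - by move=> x _; apply: integral_ge0 => t _; rewrite lee_fin mulr_ge0 ?win_ge0// mulr_ge0// mulr_ge0// usq_ge0.
  - apply: (@measurable_Tonelli1 _ _ (Rn R n) (measurableTypeR R) R leb sigma_finite_leb
      (fun z => (shell r z.1 * (wJ t0 z.2 * (W z.1 z.2 * usq Phi z.1 z.2)))%:E)).
      have mt : measurable_fun setT (fun z : Rn R n * measurableTypeR R => ((t0 : measurableTypeR R, z.1), z.2)).
        by apply: measurable_fun_pair; [apply: measurable_fun_pair|]; (exact: measurable_cst || exact: measurable_fst || exact: measurable_snd).
      exact: (measurableT_comp mF mt).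
    by move=> z; rewrite lee_fin mulr_ge0 ?win_ge0// mulr_ge0// mulr_ge0// usq_ge0.
  - by apply: emeasurable_funD; apply: emeasurable_funM => //.
  - by move=> x _; rewrite [X in (_ <= X + _)%E]muleC; exact: fiber_bound.
rewrite ge0_integralD; [|exact: measurableT|by move=> x _; exact: mule_ge0|exact: emeasurable_funM|by move=> x _; exact: mule_ge0|exact: emeasurable_funM].
rewrite ge0_integralZl; [|exact: measurableT|exact: ms|by move=> x _; exact: s0|exact: d0].
rewrite ge0_integralZl; [|exact: measurableT|exact: mwpI|by move=> x _; exact: I0|exact: c0].
have h1 : (\int[mu]_x (lam * shell r x)%:E <= (lam * (4 * r) ^+ n)%:E)%E.
  under eq_integral do rewrite EFinM; rewrite ge0_integralZl; [|exact: measurableT| |by move=> x _; rewrite lee_fin win_ge0|by rewrite lee_fin ltW].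
    by rewrite EFinM; apply: lee_wpmul2l; [rewrite lee_fin ltW|exact: int_shell].
  by apply/measurable_EFinP; exact: measurable_shell.
(* Since r <= M and T <= (4 M)^a, the shell and the time window lie in the parabolic cube of side 4
   M, where the Morrey hypothesis bounds the integral of W^p. *)
have h2 : (\int[mu]_x \int[leb]_t (shell r x * (wJ t0 t * W x t `^ p))%:E <= X%:E)%E.
  have M40 : 0 < 4 * M by rewrite mulr_gt0.
  apply: le_trans (hW t0 M40).
  have mcw : measurable_fun setT (fun z : Rn R n * measurableTypeR R => (cubei (4 * M) z.1 * win (t0 - (4 * M) `^ a / 2) (t0 + (4 * M) `^ a / 2) z.2 * W z.1 z.2 `^ p)%:E).
    apply/measurable_EFinP; apply: measurable_funM => //; apply: measurable_funM.
      by apply: (measurableT_comp (measurable_cubei _)).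
    by apply: measurable_win => //; exact: measurableT_comp.
  have cw0 z : 0 <= cubei (4 * M) z.1 * win (t0 - (4 * M) `^ a / 2) (t0 + (4 * M) `^ a / 2) z.2 * W z.1 z.2 `^ p.
    by rewrite mulr_ge0 ?powR_ge0// mulr_ge0 ?win_ge0// cubei_ge0.
  apply: ge0_le_integral; first exact: measurableT.
  - by move=> x _; exact: I0.
  - exact: mwpI.
  - by apply: (@measurable_Tonelli1 _ _ (Rn R n) (measurableTypeR R) R leb sigma_finite_leb _ mcw) => z; rewrite lee_fin cw0.
  move=> x _; apply: ge0_le_integral; first exact: measurableT.
  - by move=> t _; rewrite lee_fin mulr_ge0 ?win_ge0// mulr_ge0// powR_ge0.
  - exact: (measurableT_comp mwp (pair1_measurable x)).
  - exact: (measurableT_comp mcw (pair1_measurable x)).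
  move=> t _; rewrite lee_fin mulrA ler_wpM2r ?powR_ge0//.
  apply: ler_pM; [exact: win_ge0|exact: win_ge0| |].
    apply: le_trans (shell_le_cubei x r0) _; apply: cubei_mono.
    by rewrite ler_pM2l// /M le_max lexx.
  have TM : T <= (4 * M) `^ a by apply: ge0_ler_powR; rewrite ?nnegrE; have := M0; have := a1; lra.
  rewrite /wJ /win; case: (boolP (_ && _)) => [/andP[h3 h4]|_]; last by rewrite ler0n.
  by have -> : t0 - (4 * M) `^ a / 2 <= t <= t0 + (4 * M) `^ a / 2 by apply/andP; split; lra.
apply: le_trans (leeD (lee_wpmul2l d0 h1) (lee_wpmul2l c0 h2)) _.
rewrite /Bm; move: (maj t0) (maj0 t0) => A A0.
have M40 : 0 <= (4 * M) `^ (N + a - b * p) by rewrite powR_ge0.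
have X0 : 0 <= X by rewrite mulr_ge0.
have r40 : 0 <= (4 * r) ^+ n by rewrite exprn_ge0// mulr_ge0// ltW.
rewrite muleAC -EFinM muleA -EFinM muleAC -EFinM -ge0_muleDl ?lee_fin; last 2 first.
- exact: (mulr_ge0 (mulr_ge0 (mulr_ge0 (ler0n _ 256) p0) k2) (mulr_ge0 (ltW lam0) r40)).
- by rewrite mulr_ge0// mulr_ge0 ?powR_ge0// mulr_ge0// mulr_ge0.
by apply: lee_wpmul2r => //; rewrite -EFinD lee_fin /D le_eqVlt; apply/orP; left; apply/eqP; ring.
Qed.

Let D0 : 0 <= D.
Proof.
have p0 := @pi_ge0 R.
have M40 : 0 <= (4 * M) `^ (N + a - b * p) by rewrite powR_ge0.
have X0 : 0 <= X by rewrite mulr_ge0.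
have r40 : 0 <= (4 * r) ^+ n by rewrite exprn_ge0// mulr_ge0// ltW.
have k2 := sqr_ge0 ka; have be0 : 0 <= be by rewrite powR_ge0.
have l0 := ltW lam0; have l1 : 0 <= lam `^ (1 - p) by rewrite powR_ge0.
have n256 : 0 <= 256 :> R by exact: ler0n.
have n128 : 0 <= 128 :> R by exact: ler0n.
exact: (addr_ge0 (mulr_ge0 (mulr_ge0 l0 (mulr_ge0 (mulr_ge0 n256 p0) k2)) r40) (mulr_ge0 (mulr_ge0 l1 (mulr_ge0 (mulr_ge0 n128 be0) k2)) X0)).
Qed.

(** Averaging over the centre t0 replaces a tiling of the time axis: each t belongs to the windows
    of a set of t0 of measure T, and the majorant is integrated over all t0 by [int_core_maj]. *)
Let average : (T%:E * \int[mu]_x \int[leb]_t (shell r x * (W x t * usq Phi x t))%:E <=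
  (D * (4 * pi * T * Rint leb (fun y => Phi y ^+ 2)))%:E)%E.
Proof.
have F0 z : (0 <= (shell r z.1.2 * (wJ z.1.1 z.2 * (W z.1.2 z.2 * usq Phi z.1.2 z.2)))%:E)%E.
  by rewrite lee_fin mulr_ge0 ?win_ge0// mulr_ge0// mulr_ge0// usq_ge0.
have mF1 : measurable_fun setT (fun z : measurableTypeR R * Rn R n =>
    \int[leb]_t (shell r z.2 * (wJ z.1 t * (W z.2 t * usq Phi z.2 t)))%:E)%E.
  exact: (@measurable_Tonelli1 _ _ (measurableTypeR R * Rn R n)%type (measurableTypeR R) R leb sigma_finite_leb _ mF F0).
have mmaj : measurable_fun setT maj by apply: measurable_core_maj.
have E : (\int[leb]_t0 \int[mu]_x \int[leb]_t (shell r x * (wJ t0 t * (W x t * usq Phi x t)))%:E =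
   T%:E * \int[mu]_x \int[leb]_t (shell r x * (W x t * usq Phi x t))%:E)%E.
  rewrite (@Tonelli _ _ _ _ _ leb mu sigma_finite_leb (sigma_finite_lebesgue_Rn n) _ mF1)/=; last first.
    by move=> z; apply: integral_ge0 => t _; exact: (F0 (z, t)).
  have mSW : measurable_fun setT (fun z : Rn R n * measurableTypeR R => (shell r z.1 * (W z.1 z.2 * usq Phi z.1 z.2))%:E).
    apply/measurable_EFinP; apply: measurable_funM; first by apply: (measurableT_comp (measurable_shell r)).
    by apply: measurable_funM => //; exact: measurable_usq.
  have SW0 z : (0 <= (shell r z.1 * (W z.1 z.2 * usq Phi z.1 z.2))%:E)%E.
    by rewrite lee_fin mulr_ge0 ?win_ge0// mulr_ge0// usq_ge0.
  rewrite -ge0_integralZl; [|exact: measurableT| |by move=> x _; apply: integral_ge0 => t _; exact: (SW0 (x, t))|by rewrite lee_fin ltW]; last first.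
    exact: (@measurable_Tonelli1 _ _ (Rn R n) (measurableTypeR R) R leb sigma_finite_leb _ mSW SW0).
  apply: eq_integral => x _.
  rewrite (@Tonelli _ _ _ _ _ leb leb sigma_finite_leb sigma_finite_leb (fun z => (shell r x * (wJ z.1 z.2 * (W x z.2 * usq Phi x z.2)))%:E))/=; last 2 first.
  - have mt : measurable_fun setT (fun z : measurableTypeR R * measurableTypeR R => ((z.1, x), z.2)).
      by apply: measurable_fun_pair; [apply: measurable_fun_pair|]; (exact: measurable_cst || exact: measurable_fst || exact: measurable_snd).
    exact: (measurableT_comp mF mt).
  - by move=> z; exact: (F0 ((z.1, x), z.2)).
  rewrite -ge0_integralZl; [|exact: measurableT|exact: (measurableT_comp mSW (pair1_measurable x))|by move=> t _; exact: (SW0 (x, t))|by rewrite lee_fin ltW].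
  apply: eq_integral => t _.
  transitivity (\int[leb]_s ((shell r x * (W x t * usq Phi x t)) * win (t - T / 2) (t + T / 2) s)%:E)%E.
    apply: eq_integral => s _; congr (_%:E); rewrite mulrCA [RHS]mulrC; congr (_ * _).
    by rewrite /wJ /win; congr (nat_of_bool _)%:R; apply/andP/andP => -[h1 h2]; split; lra.
  rewrite -EFin_Rint; last exact/intgrZl/intgr_win.
  rewrite RintZl; last exact: intgr_win.
  rewrite Rint_win; last by have := T0; lra.
  by rewrite -EFinM; congr (_%:E); field.
rewrite -E; apply: (@le_trans _ _ (\int[leb]_t0 (D%:E * maj t0))%E).
  apply: ge0_le_integral; first exact: measurableT.
  - by move=> t0 _; apply: integral_ge0 => x _; apply: integral_ge0 => t _; exact: (F0 ((t0, x), t)).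
  - apply: (@measurable_Tonelli1 _ _ (measurableTypeR R) (Rn R n) R mu (sigma_finite_lebesgue_Rn n) _ mF1).
    by move=> z; apply: integral_ge0 => t _; exact: (F0 (z, t)).
  - exact: emeasurable_funM.
  - by move=> t0 _; exact: slab_bound.
rewrite ge0_integralZl; [|exact: measurableT|exact: mmaj|by move=> t0 _; exact: maj0|by rewrite lee_fin].
rewrite EFinM; apply: lee_wpmul2l; first by rewrite lee_fin.
exact: (int_core_maj T0 B00 mPhi PhiB).
Qed.

Definition shell_const : R := 4 * pi * (16 * C0) * (256 * pi * 4 ^+ n + 128 * (2 `^ a * K * 4 `^ (N + a - b * p))).

Lemma one_shell : (\int[mu]_x \int[leb]_t (shell r x * (W x t * usq Phi x t))%:E <=
  (shell_const * (two_sided N a b p (r * rho) * rho `^ (b - N)) * Rint leb (fun y => Phi y ^+ 2))%:E)%E.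
Proof.
set LHS := (\int[mu]_x _)%E; set E := Rint leb (fun y => Phi y ^+ 2).
have E0 : 0 <= E by apply: Rint_ge0 => y; exact: sqr_ge0.
have p0 := @pi_ge0 R.
(* The factor T from the averaging cancels the one in the bound of the integrated majorant. *)
have h : (LHS <= (D * (4 * pi * E))%:E)%E.
  have av : (T%:E * LHS <= (D * (4 * pi * T * E))%:E)%E := average.
  rewrite -(@lee_pmul2l _ T%:E); [|by []|by rewrite lte_fin].
  by apply: le_trans av _; rewrite -EFinM lee_fin le_eqVlt; apply/orP; left; apply/eqP; ring.
apply: le_trans h _; rewrite lee_fin.
(* The choice of lam makes the two terms of [D] proportional to the same quantity lam r^N, by
   [opt_levelE]. *)
have DE : D = ka ^+ 2 * (256 * pi * 4 ^+ n + 128 * (2 `^ a * K * 4 `^ (N + a - b * p))) * (lam * r `^ N).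
  have r0' := ltW r0; have rho0' := ltW rho0; have M0' := ltW M0.
  have hl := @opt_levelE R N a b p p1 rho r rho0 r0; rewrite -/lam -/M in hl.
  have e1 : (4 * r) ^+ n = 4 ^+ n * r `^ N by rewrite exprMn -(powR_mulrn _ r0').
  have e2 z : (4 * M) `^ z = 4 `^ z * M `^ z by rewrite powRM.
  have e3 z : (2 * rho) `^ z = 2 `^ z * rho `^ z by rewrite powRM.
  rewrite /D /X /be e1 e2 e3.
  move: hl; move: (2 `^ a) (4 `^ _) (M `^ _) (rho `^ a) (lam `^ _) (r `^ N) => c1 c2 m1 ra l1 rN hl.
  move: (ka) => k.
  have -> : l1 * (128 * (c1 * ra) * k ^+ 2) * (K * (c2 * m1)) = 128 * k ^+ 2 * (c1 * K * c2) * (l1 * (ra * m1)) by ring.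
  by rewrite hl; ring.
rewrite DE /shell_const.
have se := @shell_exponent R N a b p N2 b1 p1 hp rho r rho0 r0; rewrite -/lam in se.
move: ka2 se; set A := 256 * pi * _ + _ => k2 se.
have A0 : 0 <= A.
  have a1' := @powR_ge0 R 2 a; have a2' := @powR_ge0 R 4 (N + a - b * p).
  exact: (addr_ge0 (mulr_ge0 (mulr_ge0 (ler0n _ 256) p0) (exprn_ge0 n (ler0n _ 4))) (mulr_ge0 (ler0n _ 128) (mulr_ge0 (mulr_ge0 a1' K0) a2'))).
have lr0 : 0 <= lam * r `^ N by rewrite mulr_ge0 ?powR_ge0// ltW.
have s1 : ka ^+ 2 * (lam * r `^ N) <= 16 * C0 * (two_sided N a b p (r * rho) * rho `^ (b - N)).
  have C16 : 0 <= 16 * C0 by rewrite mulr_ge0// (le_trans _ C01).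
  by apply: le_trans (ler_wpM2r lr0 k2) _; apply: le_trans _ (ler_wpM2l C16 se); rewrite [leRHS]mulrA.
have c0 : 0 <= 4 * pi * A * E by rewrite mulr_ge0// mulr_ge0// mulr_ge0.
have := ler_wpM2l c0 s1; move: (two_sided _ _ _ _ _ * _) (lam * _) => u v h.
apply: le_trans (le_trans _ h) _; rewrite le_eqVlt; apply/orP; left; apply/eqP; ring.
Qed.

End OneShell.

End Shell.

(** * Summation over dyadic pieces *)

Section FiniteSums.
Context {R : realType}.

(** The variance of c / w for the weights w is nonnegative; the value v = S / A is the mean. *)
Lemma weighted_CS (K : nat) (c w : 'I_K -> R) : (forall k, 0 < w k) ->
  (\sum_k c k) ^+ 2 <= (\sum_k w k) * \sum_k (w k)^-1 * c k ^+ 2.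
Proof.
move=> w0; set S := \sum_k c k; set A := \sum_k w k; set B := \sum_k _.
have [A0|A0] := eqVneq A 0.
  have S0 : S = 0.
    apply: big1 => k _; have : \sum_k w k == 0 by rewrite -/A A0.
    by rewrite psumr_eq0 => [/allP/(_ k (mem_index_enum k))/=|i _]; [rewrite gt_eqF|exact: ltW].
  by rewrite S0 expr0n/= A0 mul0r.
have Ap : 0 < A by rewrite lt0r A0 sumr_ge0// => k _; exact: ltW.
have h : 0 <= \sum_k w k * ((w k)^-1 * c k - S / A) ^+ 2.
  by apply: sumr_ge0 => k _; rewrite mulr_ge0 ?sqr_ge0// ltW.
have e (v : R) : \sum_k w k * ((w k)^-1 * c k - v) ^+ 2 = B - 2 * v * S + v ^+ 2 * A.
  rewrite /B /S /A !mulr_sumr -sumrB -big_split/=; apply: eq_bigr => k _.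
  by field; rewrite gt_eqF.
rewrite {}e in h. have {}h : 0 <= B - S ^+ 2 / A.
  by move: h; congr (_ <= _); field.
by move: h; rewrite subr_ge0 ler_pdivrMr// mulrC.
Qed.

Definition symdecay (d z : R) : R := Num.min z z^-1 `^ d.

Lemma symdecay_gt0 d z : 0 < z -> 0 < symdecay d z.
Proof. by move=> z0; rewrite powR_gt0// lt_min z0 invr_gt0. Qed.

Lemma symdecayD d e z : 0 < z -> symdecay (d + e) z = symdecay d z * symdecay e z.
Proof.
move=> z0; rewrite /symdecay powRD// (@gt_eqF _ _ (Num.min z z^-1)) ?implybT//.
by rewrite lt_min z0 invr_gt0.
Qed.

Lemma symdecay_comp d s z : 0 < d -> 0 < s -> s <= z -> z <= 2 * s -> symdecay d s <= 2 `^ d * symdecay d z.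
Proof.
move=> d0 s0 sz zs; have z0 : 0 < z by lra.
have m0 : 0 <= Num.min z z^-1 by rewrite le_min invr_ge0 ltW.
rewrite /symdecay -powRM//; apply: ge0_ler_powR; rewrite ?nnegrE ?(ltW d0)// ?mulr_ge0//.
  by rewrite le_min invr_ge0 ltW.
rewrite (minr_pMr z z^-1 (ler0n _ 2)) le_min !ge_min; apply/andP; split.
  by apply/orP; left; lra.
apply/orP; right; have -> : 2 * z^-1 = (z / 2)^-1 by field; rewrite gt_eqF.
by rewrite lef_pV2 ?posrE ?divr_gt0//; lra.
Qed.

(** For phi(z) = z / (1 + z), which increases from 0 to 1, the increment phi(q z) - phi(z) equals (q
    - 1) z / ((1 + q z)(1 + z)) and is comparable to min(z, 1/z). Sums along a geometric progression
    therefore telescope, without being split where the progression crosses 1. *)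
Lemma min_inv_le (q z : R) : 1 < q -> 0 < z ->
  Num.min z z^-1 <= 2 * (q + 1) / (q - 1) * (q * z / (1 + q * z) - z / (1 + z)).
Proof.
move=> q1 z0; have qz : 0 < q * z by apply: mulr_gt0 => //; lra.
have -> : 2 * (q + 1) / (q - 1) * (q * z / (1 + q * z) - z / (1 + z)) = 2 * (q + 1) * z / ((1 + q * z) * (1 + z)).
  by field; rewrite !gt_eqF//; lra.
have dn : 0 < (1 + q * z) * (1 + z) by rewrite mulr_gt0//; lra.
rewrite ler_pdivlMr//; have [z1|z1] := leP z 1.
  have h : Num.min z z^-1 <= z by rewrite ge_min lexx.
  apply: le_trans (ler_wpM2r (ltW dn) h) _.
  have : 0 <= z * ((1 - z) * (2 * q + 1 + q * z) ) by rewrite mulr_ge0 ?(ltW z0)// mulr_ge0//; lra.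
  have : 0 <= z * (1 - z) by rewrite mulr_ge0 ?(ltW z0)//; lra.
  by lra.
have h : Num.min z z^-1 <= z^-1 by rewrite ge_min lexx orbT.
apply: le_trans (ler_wpM2r (ltW dn) h) _.
rewrite mulrC ler_pdivrMr//.
have : 0 <= (z - 1) * (q * z + 2 * z + 1) by rewrite mulr_ge0//; lra.
by lra.
Qed.

Lemma sum_min_inv (q x : R) K : 1 < q -> 0 < x ->
  \sum_(k < K) Num.min (x * q ^+ k) (x * q ^+ k)^-1 <= 2 * (q + 1) / (q - 1).
Proof.
move=> q1 x0; have q0 : 0 < q by lra.
pose phi (z : R) := z / (1 + z).
have xq k : 0 < x * q ^+ k by rewrite mulr_gt0// exprn_gt0.
have c0 : 0 <= 2 * (q + 1) / (q - 1) by rewrite divr_ge0//; lra.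
have phi1 z : 0 < z -> 0 <= phi z <= 1.
  by move=> z0; rewrite /phi divr_ge0 ?ler_pdivrMr//=; lra.
suff h : \sum_(k < K) Num.min (x * q ^+ k) (x * q ^+ k)^-1 <= 2 * (q + 1) / (q - 1) * (phi (x * q ^+ K) - phi x).
  apply: le_trans h _; rewrite ler_piMr//.
  by have /andP[] := phi1 _ x0; have /andP[] := phi1 _ (xq K); lra.
elim: K => [|K IH]; first by rewrite big_ord0 expr0 mulr1 subrr mulr0.
rewrite big_ord_recr/=; apply: le_trans (lerD IH (min_inv_le q1 (xq K))) _.
have -> : q * (x * q ^+ K) = x * q ^+ K.+1 by rewrite exprS; ring.
by rewrite -mulrDr ler_wpM2l// /phi; lra.
Qed.

Lemma sum_mm (d x : R) K : 0 < d -> 0 < x ->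
  \sum_(k < K) symdecay d (x * 2 ^+ k) <= 2 * (2 `^ d + 1) / (2 `^ d - 1).
Proof.
move=> d0 x0; have q1 : 1 < 2 `^ d :> R.
  by have := @gt0_ltr_powR R d d0 1 2; rewrite powR1; apply; rewrite ?nnegrE ?ltr1n.
apply: le_trans (sum_min_inv K q1 (powR_gt0 d x0)); apply: ler_sum => k _.
have xk : 0 < x * 2 ^+ k by rewrite mulr_gt0// exprn_gt0.
(* min(z, 1/z)^d is min(z^d, z^(-d)), along the progression of ratio 2^d. *)
have -> : x `^ d * (2 `^ d) ^+ k = (x * 2 ^+ k) `^ d.
  rewrite powRM ?(ltW x0) ?exprn_ge0//; congr (_ * _).
  have e : 2 ^+ k = 2 `^ k%:R :> R by rewrite powR_mulrn.
  have e' : (2 `^ d) ^+ k = (2 `^ d) `^ k%:R :> R by rewrite powR_mulrn ?powR_ge0.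
  by rewrite e e' -!powRrM mulrC.
have m0 : 0 <= Num.min (x * 2 ^+ k) (x * 2 ^+ k)^-1 by rewrite le_min invr_ge0 ltW.
rewrite le_min; apply/andP; split.
  by apply: ge0_ler_powR; rewrite ?nnegrE ?(ltW d0) ?(ltW xk)// ge_min lexx.
have -> : ((x * 2 ^+ k) `^ d)^-1 = (x * 2 ^+ k)^-1 `^ d.
  by rewrite -powRN -(powR_inv1 (ltW xk)) -powRrM mulN1r.
by apply: ge0_ler_powR; rewrite ?nnegrE ?(ltW d0) ?invr_ge0 ?(ltW xk)// ge_min lexx orbT.
Qed.

End FiniteSums.

Section HalfOpen.
Context {R : realType}.

(* Half-open, so that consecutive dyadic windows tile. *)
Definition hwin (c d y : R) : R := ((c <= y) && (y < d))%:R.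

Lemma measurable_hwin c d : measurable_fun setT (hwin c d).
Proof.
have mb : measurable_fun setT (fun x : R => (c <= x) && (x < d)).
  by apply: measurable_and; [exact: measurable_fun_ler|exact: measurable_fun_ltr].
by apply: (measurableT_comp (f := fun b : bool => b%:R : R)) => //.
Qed.

Lemma hwinD (u v w y : R) : u <= v -> v <= w -> hwin u v y + hwin v w y = hwin u w y.
Proof.
move=> uv vw; rewrite /hwin; have [h|h] := ltP y v.
  by rewrite /= addr0 andbT (lt_le_trans h vw) andbT.
by rewrite andbF add0r (le_trans uv h).
Qed.

End HalfOpen.

(** * The double sum over shells and bands *)

Section DyadicSum.
Context {R : realType} (n : nat).
Hypothesis n2 : (2 <= n)%N.
Local Notation leb := (@lebesgue_measure R).
Local Notation mu := (lebesgue_Rn n : {measure set Rn R n -> \bar R}).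
Let N : R := n%:R.
Variables (a b SC eps : R).
Hypotheses (a1 : 1 < a) (SC0 : 0 <= SC) (eps0 : 0 < eps).
Variable W : Rn R n -> R -> R.
Hypothesis mW : measurable_fun setT (fun z : Rn R n * measurableTypeR R => W z.1 z.2).
Hypothesis W0 : forall x t, 0 <= W x t.
Hypothesis H1 : forall (rho r B0 : R) (Phi : R -> R), 0 < rho -> 0 < r -> 0 <= B0 -> measurable_fun setT Phi ->
  (forall y, `|Phi y| <= B0 * win (rho `^ a) ((2 * rho) `^ a) y) ->
  (\int[mu]_x \int[leb]_t (shell r x * (W x t * usq a Phi x t))%:E <=
   (SC * (symdecay eps (r * rho) * rho `^ (b - N)) * Rint leb (fun y => Phi y ^+ 2))%:E)%E.

Variables (L : nat) (B0 : R) (Phi : R -> R).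
(** The points 2^(k - L) for k from 0 to 2 L, indexed by natural numbers; they cover frequencies and
    positions from 2^(-L) to 2^L, with bounds independent of L. *)
Let dy (k : nat) : R := 2 ^+ k / 2 ^+ L.
Let K := (L + L)%N.
Hypotheses (B00 : 0 <= B0) (mPhi : measurable_fun setT Phi).
Hypothesis PhiB : forall y, `|Phi y| <= B0 * hwin (dy 0 `^ a) (dy K `^ a) y.

Let dy0 k : 0 < dy k. Proof. by rewrite divr_gt0 ?exprn_gt0. Qed.
Let dyS k : dy k.+1 = 2 * dy k. Proof. by rewrite /dy exprS mulrA. Qed.
Let dyE k : dy k = dy 0 * 2 ^+ k. Proof. by rewrite /dy expr0 mulrC mul1r mulrC. Qed.

Let a0 : 0 < a. Proof. by have := a1; lra. Qed.

Let dya j k : (j <= k)%N -> dy j `^ a <= dy k `^ a.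
Proof.
move=> jk; apply: ge0_ler_powR; rewrite ?nnegrE ?(ltW a0) ?(ltW (dy0 _))//.
by rewrite /dy ler_pM2r ?invr_gt0 ?exprn_gt0// ler_weXn2l ?ler1n.
Qed.

Let Phik (k : nat) (y : R) : R := hwin (dy k `^ a) (dy k.+1 `^ a) y * Phi y.

Let mPhik k : measurable_fun setT (Phik k).
Proof. by apply: measurable_funM => //; exact: measurable_hwin. Qed.

Let PhiB1 y : `|Phi y| <= B0.
Proof. by apply: le_trans (PhiB y) _; rewrite /hwin; case: (_ && _); rewrite ?mulr1// mulr0. Qed.

Let PhikB k y : `|Phik k y| <= B0 * win (dy k `^ a) ((2 * dy k) `^ a) y.
Proof.
rewrite -dyS normrM mulrC /hwin /win; case: (boolP (_ && _)) => [/andP[h1 h2]|_].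
  by rewrite h1 (ltW h2)/= normr1 !mulr1.
by rewrite normr0 mulr0 mulr_ge0// ler0n.
Qed.

Let hwin_sum m y : \sum_(k < m) hwin (dy k `^ a) (dy k.+1 `^ a) y = hwin (dy 0 `^ a) (dy m `^ a) y.
Proof.
elim: m => [|m IH].
  by rewrite big_ord0 /hwin; case: (boolP (_ && _)) => [/andP[h1 h2]|//]; have := lt_le_trans h2 h1; rewrite ltxx.
by rewrite big_ord_recr/= IH hwinD ?dya.
Qed.

Let Phi_sum y : Phi y = \sum_(k < K) Phik k y.
Proof.
rewrite -mulr_suml hwin_sum /hwin; have := PhiB y; rewrite /hwin.
by case: (_ && _); rewrite ?mul1r// mulr0 normr_le0 mul0r => /eqP.
Qed.

Let Phi_sqsum y : \sum_(k < K) Phik k y ^+ 2 = Phi y ^+ 2.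
Proof.
have e k : Phik k y ^+ 2 = hwin (dy k `^ a) (dy k.+1 `^ a) y * Phi y ^+ 2.
  by rewrite exprMn expr2 /hwin -natrM mulnb andbb.
under eq_bigr do rewrite e.
rewrite -mulr_suml hwin_sum /hwin; have := PhiB y; rewrite /hwin.
by case: (_ && _); rewrite ?mul1r// mulr0 normr_le0 mul0r => /eqP ->; rewrite expr0n.
Qed.

Let iband k (x : Rn R n) : intgr leb (band a (Phik k) x).
Proof.
apply: (@intgr_dom _ _ _ leb _ (fun y => B0 * win (dy k `^ a) ((2 * dy k) `^ a) y)); last exact/intgrZl/intgr_win.
  apply: measurable_funM; last exact: mPhik.
  exact: (@measurable_bSpow R n n2 a _ (measurableTypeR R) (fun=> x) id).
by move=> y; rewrite normrM; apply: le_trans (PhikB k y); rewrite ler_piMl// bS_le1// mulr_ge0 ?enorm_ge0// powR_ge0.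
Qed.

Let band_sum (x : Rn R n) y : band a Phi x y = \sum_(k < K) band a (Phik k) x y.
Proof. by rewrite /band -mulr_sumr -Phi_sum. Qed.

(** Half of the decay is spent on the weights of Cauchy-Schwarz over the bands; the other half is
    left for the sum over the shells. *)
Let d := eps / 2.
Let d0 : 0 < d. Proof. by rewrite divr_gt0. Qed.
Let Cd := 2 * (2 `^ d + 1) / (2 `^ d - 1).

(** The bands are not orthogonal for the weighted norm. Cauchy-Schwarz with weights [symdecay d]
    concentrated at |x| |xi| ~ 1 replaces orthogonality; their sum is at most [Cd], whatever x and
    L. *)
Let usq_CS (x : Rn R n) t : 0 < enorm x -> usq a Phi x t <= Cd * \sum_(k < K) (symdecay d (enorm x * dy k))^-1 * usq a (Phik k) x t.
Proof.
move=> x0.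
have w0 (k : 'I_K) : 0 < symdecay d (enorm x * dy k) by rewrite symdecay_gt0// mulr_gt0.
have -> : usq a Phi x t = (\sum_(k < K) Fc (band a (Phik k) x) t) ^+ 2 + (\sum_(k < K) Fs (band a (Phik k) x) t) ^+ 2.
  congr (_ ^+ 2 + _ ^+ 2).
    rewrite /Fc -(@Rint_sum _ _ _ leb 'I_K (index_enum _) (fun k y => cos (t * y) * band a (Phik k) x y)); last by move=> k; exact: intgr_cosM.
    by apply: eq_Rint => y; rewrite band_sum mulr_sumr.
  rewrite /Fs -(@Rint_sum _ _ _ leb 'I_K (index_enum _) (fun k y => sin (t * y) * band a (Phik k) x y)); last by move=> k; exact: intgr_sinM.
  by apply: eq_Rint => y; rewrite band_sum mulr_sumr.
apply: le_trans (lerD (weighted_CS _ w0) (weighted_CS _ w0)) _.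
rewrite -mulrDr -big_split/=.
have -> : \sum_(k < K) ((symdecay d (enorm x * dy k))^-1 * Fc (band a (Phik k) x) t ^+ 2 + (symdecay d (enorm x * dy k))^-1 * Fs (band a (Phik k) x) t ^+ 2) =
    \sum_(k < K) (symdecay d (enorm x * dy k))^-1 * usq a (Phik k) x t by apply: eq_bigr => k _; rewrite -mulrDr.
apply: ler_wpM2r; first by apply: sumr_ge0 => k _; rewrite mulr_ge0 ?usq_ge0// invr_ge0 ltW.
have xd : 0 < enorm x * dy 0 by rewrite mulr_gt0.
apply: le_trans (sum_mm K d0 xd); rewrite le_eqVlt; apply/orP; left; apply/eqP.
by apply: eq_bigr => k _; rewrite dyE mulrA.
Qed.

Local Notation nu := (lebesgue_spacetime n : {measure set (spacetime R n) -> \bar R}).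

Let mg k j : measurable_fun setT (fun z : spacetime R n => shell (dy j) z.1 * (W z.1 z.2 * usq a (Phik k) z.1 z.2)).
Proof.
apply: measurable_funM; first by apply: (measurableT_comp (measurable_shell (dy j))).
by apply: measurable_funM; [exact: mW|exact: (measurable_usq n2 a (mPhik k))].
Qed.

Let g0 k j (z : spacetime R n) : 0 <= shell (dy j) z.1 * (W z.1 z.2 * usq a (Phik k) z.1 z.2).
Proof. by apply: mulr_ge0; [exact: win_ge0|apply: mulr_ge0; [exact: W0|exact: usq_ge0]]. Qed.

Let H1nu k j : (\int[nu]_z (shell (dy j) z.1 * (W z.1 z.2 * usq a (Phik k) z.1 z.2))%:E <=
   (SC * (symdecay eps (dy j * dy k) * dy k `^ (b - N)) * Rint leb (fun y => Phik k y ^+ 2))%:E)%E.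
Proof.
apply: le_trans (H1 (dy0 k) (dy0 j) B00 (mPhik k) (PhikB k)).
rewrite le_eqVlt; apply/orP; left; apply/eqP.
have T := @Tonelli_prod R _ _ _ _ (lebesgue_Rn n) (@lebesgue_measure R) (sigma_finite_lebesgue_Rn n)
  (fun z => (shell (dy j) z.1 * (W z.1 z.2 * usq a (Phik k) z.1 z.2))%:E).
apply: T; first by apply/measurable_EFinP; exact: mg.
by move=> z; rewrite lee_fin g0.
Qed.

Definition annulus (x : Rn R n) : R := hwin (2 ^+ 0 / 2 ^+ L) (2 ^+ (L + L) / 2 ^+ L) (enorm x).

Let pointwise (x : Rn R n) t : annulus x * (W x t * usq a Phi x t) <=
  \sum_(j < K) \sum_(k < K) (Cd * 2 `^ d * (symdecay d (dy j * dy k))^-1) * (shell (dy j) x * (W x t * usq a (Phik k) x t)).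
Proof.
have Cd0 : 0 <= Cd.
  have q1 : 1 < 2 `^ d :> R by have := @gt0_ltr_powR R d d0 1 2; rewrite powR1; apply; rewrite ?nnegrE ?ltr1n.
  by rewrite /Cd divr_ge0//; lra.
have rhs0 (j : 'I_K) : 0 <= \sum_(k < K) (Cd * 2 `^ d * (symdecay d (dy j * dy k))^-1) * (shell (dy j) x * (W x t * usq a (Phik k) x t)).
  apply: sumr_ge0 => k _; apply: mulr_ge0; last exact: (g0 k j (x, t)).
  by apply: mulr_ge0; [rewrite mulr_ge0 ?powR_ge0|rewrite invr_ge0 ltW// symdecay_gt0// mulr_gt0].
have annE : annulus x = \sum_(j < K) hwin (dy j) (dy j.+1) (enorm x).
  rewrite /annulus -/(dy 0) -/(dy (L + L)) -/K.
  elim: (K) => [|m IH]; first by rewrite big_ord0 /hwin; case: (boolP (_ && _)) => [/andP[h1 h2]|//]; have := lt_le_trans h2 h1; rewrite ltxx.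
  have mono k : dy 0 <= dy k by rewrite /dy ler_pM2r ?invr_gt0 ?exprn_gt0// expr0 exprn_ege1// ler1n.
  by rewrite big_ord_recr/= -IH hwinD// dyS; have := dy0 m; lra.
rewrite annE mulr_suml; apply: ler_sum => j _.
have [h|h] := boolP (dy j <= enorm x < dy j.+1); last first.
  by rewrite /hwin (negbTE h) mul0r; exact: rhs0.
have /andP[h1 h2] := h; have x0 : 0 < enorm x by exact: lt_le_trans h1.
have sh : shell (dy j) x = 1 by rewrite /shell /win h1 -dyS (ltW h2).
rewrite /hwin h mul1r; apply: le_trans (ler_wpM2l (W0 x t) (usq_CS t x0)) _.
rewrite mulrCA mulr_sumr mulr_sumr; apply: ler_sum => k _; rewrite sh mul1r.
have mk : 0 < symdecay d (dy j * dy k) by rewrite symdecay_gt0// mulr_gt0.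
have mk' : 0 < symdecay d (enorm x * dy k) by rewrite symdecay_gt0// mulr_gt0.
(* On one shell |x| is replaced by the dyadic point, at the price of 2^d; the coefficients then no
   longer depend on x. *)
have hm : (symdecay d (enorm x * dy k))^-1 <= 2 `^ d * (symdecay d (dy j * dy k))^-1.
  rewrite -ler_pdivrMr; last by rewrite invr_gt0.
  rewrite invrK mulrC ler_pdivrMr//; apply: symdecay_comp => //; first by rewrite mulr_gt0.
    by rewrite ler_pM2r.
  by rewrite [leRHS]mulrA ler_pM2r// -dyS ltW.
have u0 : 0 <= Cd * (W x t * usq a (Phik k) x t) by rewrite mulr_ge0// mulr_ge0// usq_ge0.
have := ler_wpM2r u0 hm; lra.
Qed.

Lemma pow_comp (e rho z : R) : 0 < rho -> rho <= z -> z <= 2 * rho ->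
  rho `^ e <= 2 `^ `|e| * z `^ e /\ z `^ e <= 2 `^ `|e| * rho `^ e.
Proof.
move=> r0 rz zr; have z0 : 0 < z by exact: lt_le_trans rz.
have r20 : 0 <= 2 * rho by rewrite mulr_ge0// ltW.
have q1 : 1 <= 2 `^ `|e| :> R.
  by have := @ge0_ler_powR R `|e| (normr_ge0 _) 1 2; rewrite powR1; apply; rewrite ?nnegrE ?ler1n.
have [e0|e0] := leP 0 e.
  have h1 : rho `^ e <= z `^ e by apply: ge0_ler_powR; rewrite ?nnegrE// ltW.
  have h2 : z `^ e <= (2 * rho) `^ e by apply: ge0_ler_powR; rewrite ?nnegrE// ltW.
  rewrite powRM ?(ltW r0)// in h2; rewrite ger0_norm// in q1 *; split => //.
  by apply: le_trans h1 _; rewrite ler_peMl// powR_ge0.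
have inv u : 0 < u -> u `^ e = (u `^ (- e))^-1 by move=> u0; rewrite -powRN opprK.
have ne : 0 <= - e by rewrite oppr_ge0 ltW.
have h1 : rho `^ (- e) <= z `^ (- e) by apply: ge0_ler_powR; rewrite ?nnegrE// ltW.
have h2 : z `^ (- e) <= (2 * rho) `^ (- e) by apply: ge0_ler_powR; rewrite ?nnegrE// ltW.
rewrite powRM ?(ltW r0)// in h2; rewrite ltr0_norm// in q1 *; rewrite !inv//.
have p1 : 0 < rho `^ (- e) by rewrite powR_gt0.
have p2 : 0 < z `^ (- e) by rewrite powR_gt0.
split.
  by rewrite ler_pdivlMr// mulrC ler_pdivrMr.
apply: (@le_trans _ _ (rho `^ (- e))^-1); first by rewrite lef_pV2.
by rewrite ler_peMl// invr_ge0 ltW.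
Qed.

Let e := b - N.

Let ypow k y : dy k `^ a <= y -> y < dy k.+1 `^ a -> [/\ 0 < y, dy k <= y `^ a^-1 & y `^ a^-1 <= 2 * dy k].
Proof.
move=> h1 h2; have y0 : 0 < y by apply: lt_le_trans h1; exact: powR_gt0.
have rr z : 0 < z -> z = (z `^ a) `^ a^-1 :> R.
  by move=> z0; rewrite -powRrM mulfV ?gt_eqF// powRr1// ltW.
have ai : 0 <= a^-1 by rewrite invr_ge0 ltW.
split => //.
  by rewrite [leLHS](rr _ (dy0 k)); apply: ge0_ler_powR; rewrite ?nnegrE ?powR_ge0// ltW.
by rewrite -dyS [leRHS](rr _ (dy0 _)); apply: ge0_ler_powR; rewrite ?nnegrE ?powR_ge0// ltW.
Qed.

Let yE y : y `^ (e / a) = (y `^ a^-1) `^ e.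
Proof. by rewrite -powRrM mulrC. Qed.

Let Phik0 k y : ~~ (dy k `^ a <= y < dy k.+1 `^ a) -> Phik k y = 0.
Proof. by move=> h; rewrite /Phik /hwin (negbTE h) mul0r. Qed.

Let iPhik2 k : intgr leb (fun y => Phik k y ^+ 2).
Proof.
apply: (@intgr_dom _ _ _ leb _ (fun y => B0 ^+ 2 * win (dy k `^ a) ((2 * dy k) `^ a) y)); last exact/intgrZl/intgr_win.
  by apply: measurable_funX; exact: mPhik.
move=> y; rewrite normrX; apply: le_trans (lerXn2r 2 _ _ (PhikB k y)) _; rewrite ?nnegrE ?mulr_ge0 ?win_ge0//.
by rewrite exprMn [X in _ * X]expr2 win_idem.
Qed.

Let iPhike k : intgr leb (fun y => y `^ (e / a) * Phik k y ^+ 2).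
Proof.
apply: (@intgr_dom _ _ _ leb _ (fun y => (2 `^ `|e| * dy k `^ e) * Phik k y ^+ 2)); last exact/intgrZl/iPhik2.
  by apply: measurable_funM; [exact: measurable_powR|apply: measurable_funX; exact: mPhik].
move=> y; rewrite ger0_norm; last by apply: mulr_ge0; [exact: powR_ge0|exact: sqr_ge0].
have [/andP[h1 h2]|h] := boolP (dy k `^ a <= y < dy k.+1 `^ a); last by rewrite (Phik0 h) expr0n !mulr0.
have [y0 h3 h4] := ypow h1 h2; rewrite ler_wpM2r ?sqr_ge0// yE.
by have [] := pow_comp e (dy0 k) h3 h4.
Qed.

Let Phik_le k : dy k `^ e * Rint leb (fun y => Phik k y ^+ 2) <= 2 `^ `|e| * Rint leb (fun y => y `^ (e / a) * Phik k y ^+ 2).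
Proof.
rewrite -(RintZl _ (iPhik2 k)) -(RintZl _ (iPhike k)); apply: Rint_le; [exact: intgrZl|exact: intgrZl|move=> y].
have [/andP[h1 h2]|h] := boolP (dy k `^ a <= y < dy k.+1 `^ a); last by rewrite (Phik0 h) expr0n !mulr0.
have [y0 h3 h4] := ypow h1 h2; rewrite mulrA ler_wpM2r ?sqr_ge0// yE.
by have [] := pow_comp e (dy0 k) h3 h4.
Qed.

(** One [Cd] comes from Cauchy-Schwarz over the bands and one from the sum over the shells; 2^d and
    2^|e| come from replacing |x| and |xi| by dyadic points, [SC] from a single shell and band. *)
Definition dyadic_const := Cd ^+ 2 * 2 `^ d * SC * 2 `^ `|e|.

Lemma annulus_bound : (\int[nu]_z (annulus z.1 * (W z.1 z.2 * usq a Phi z.1 z.2))%:E <=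
  (dyadic_const * Rint leb (fun y => y `^ (e / a) * Phi y ^+ 2))%:E)%E.
Proof.
have Cd0 : 0 <= Cd.
  have q1 : 1 < 2 `^ d :> R by have := @gt0_ltr_powR R d d0 1 2; rewrite powR1; apply; rewrite ?nnegrE ?ltr1n.
  by rewrite /Cd divr_ge0//; lra.
pose c j k := Cd * 2 `^ d * (symdecay d (dy j * dy k))^-1.
have c0 j k : 0 <= c j k.
  by rewrite /c; apply: mulr_ge0; [rewrite mulr_ge0 ?powR_ge0|rewrite invr_ge0 ltW// symdecay_gt0// mulr_gt0].
pose h j k (z : spacetime R n) := (c j k * (shell (dy j) z.1 * (W z.1 z.2 * usq a (Phik k) z.1 z.2)))%:E.
have mh j k : measurable_fun setT (h j k) by apply/measurable_EFinP; apply: measurable_funM => //; exact: mg.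
have h0 j k z : (0 <= h j k z)%E by rewrite lee_fin mulr_ge0// g0.
apply: (@le_trans _ _ (\int[nu]_z \sum_(j < K) \sum_(k < K) h j k z)%E).
  apply: ge0_le_integral; first exact: measurableT.
  - by move=> z _; rewrite lee_fin; apply: mulr_ge0; [rewrite /annulus /hwin ler0n|apply: mulr_ge0; [exact: W0|exact: usq_ge0]].
  - apply/measurable_EFinP; apply: measurable_funM.
      by apply: (measurableT_comp (measurable_hwin _ _)); apply: (measurableT_comp (@measurable_enorm R n)); exact: measurable_fst.
    by apply: measurable_funM; [exact: mW|exact: (measurable_usq n2 a mPhi)].
  - by apply: emeasurable_sum => j; apply: emeasurable_sum => k; exact: mh.
  - move=> z _; apply: (@le_trans _ _ (\sum_(j < K) \sum_(k < K) c j k * (shell (dy j) z.1 * (W z.1 z.2 * usq a (Phik k) z.1 z.2)))%:E).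
      by rewrite lee_fin; exact: pointwise.
    by rewrite -sumEFin; apply: lee_sum => j _; rewrite -sumEFin.
rewrite ge0_integral_sum//; last 2 first.
- by move=> j; apply: emeasurable_sum => k; exact: mh.
- by move=> j z _; apply: sume_ge0.
pose E k := Rint leb (fun y => Phik k y ^+ 2).
have E0 k : 0 <= E k by apply: Rint_ge0 => y; exact: sqr_ge0.
apply: (@le_trans _ _ (\sum_(j < K) \sum_(k < K) (Cd * 2 `^ d * SC * (symdecay d (dy j * dy k) * (dy k `^ e * E k)))%:E)%E).
  apply: lee_sum => j _; rewrite ge0_integral_sum//.
  apply: lee_sum => k _; rewrite /h; under eq_integral do rewrite EFinM.
  rewrite ge0_integralZl; [|exact: measurableT|by apply/measurable_EFinP; exact: mg|by move=> z _; rewrite lee_fin g0|by rewrite lee_fin].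
  apply: le_trans (lee_wpmul2l _ (H1nu k j)) _; first by rewrite lee_fin.
  have s0 : 0 < dy j * dy k by rewrite mulr_gt0.
  rewrite -EFinM lee_fin /c -/(E k) -/e.
  (* One of the two halves cancels the inverse weight left by Cauchy-Schwarz. *)
  have -> : symdecay eps (dy j * dy k) = symdecay d (dy j * dy k) * symdecay d (dy j * dy k).
    by rewrite -symdecayD// /d -splitr.
  have := symdecay_gt0 d s0; move: (symdecay _ _) => m m0.
  by rewrite le_eqVlt; apply/orP; left; apply/eqP; field; rewrite gt_eqF.
rewrite exchange_big/=.
under eq_bigr do rewrite sumEFin; rewrite sumEFin lee_fin.
have -> : dyadic_const * Rint leb (fun y => y `^ (e / a) * Phi y ^+ 2) =
   \sum_(k < K) Cd ^+ 2 * 2 `^ d * SC * (2 `^ `|e| * Rint leb (fun y => y `^ (e / a) * Phik k y ^+ 2)).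
  rewrite -mulr_sumr -mulr_sumr -(@Rint_sum _ _ _ leb 'I_K (index_enum _) (fun k y => y `^ (e / a) * Phik k y ^+ 2)); last by move=> k; exact: iPhike.
  have -> : Rint leb (fun x => \sum_(i < K) x `^ (e / a) * Phik i x ^+ 2) = Rint leb (fun y => y `^ (e / a) * Phi y ^+ 2).
    by apply: eq_Rint => y; rewrite -mulr_sumr Phi_sqsum.
  by rewrite /dyadic_const; ring.
apply: ler_sum => k _; rewrite -mulr_sumr -mulr_suml.
(* For each band separately, the sum over all shells is bounded; the bands themselves add up
   exactly, as the squares of disjoint pieces of Phi. *)
have hs : \sum_(j < K) symdecay d (dy j * dy k) <= Cd.
  have xd : 0 < dy 0 * dy k by rewrite mulr_gt0.
  apply: le_trans (sum_mm K d0 xd); rewrite le_eqVlt; apply/orP; left; apply/eqP.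
  by apply: eq_bigr => j _; rewrite [in LHS]dyE mulrAC.
have Ek0 : 0 <= dy k `^ e * E k by rewrite mulr_ge0 ?powR_ge0.
have cc : 0 <= Cd * 2 `^ d * SC by rewrite mulr_ge0// mulr_ge0 ?powR_ge0.
apply: le_trans (ler_wpM2l cc (ler_wpM2r Ek0 hs)) _.
apply: le_trans (ler_wpM2l cc (ler_wpM2l Cd0 (Phik_le k))) _.
by rewrite le_eqVlt; apply/orP; left; apply/eqP; ring.
Qed.

End DyadicSum.

(** * The flow with radial frequency profiles *)

Section RadialPieces.
Context {R : realType} (n : nat).
Hypothesis n2 : (2 <= n)%N.
Local Notation leb := (@lebesgue_measure R).
Local Notation mu := (lebesgue_Rn n : {measure set Rn R n -> \bar R}).
Let N : R := n%:R.

Lemma bounded_on (c d : R) (f : R -> R) : (forall x, c <= x <= d -> {for x, continuous f}) ->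
  exists2 B : R, 0 <= B & forall x, c <= x <= d -> `|f x| <= B.
Proof.
move=> cf; have [cd|dc] := leP c d; last first.
  by exists 0 => // x /andP[h1 h2]; have := lt_le_trans dc (le_trans h1 h2); rewrite ltxx.
have cn : {within `[c, d], continuous (fun x => `|f x|)}.
  apply: continuous_in_subspaceT => x; rewrite inE/= in_itv/= => h.
  by apply: (continuous_comp (g := fun z : R => `|z|)); [exact: cf|exact: norm_continuous].
have [z _ hz] := EVT_max cd cn; exists `|f z|; first by [].
by move=> x h; apply: hz.
Qed.

Lemma Rint_hwin (c d : R) (f : R -> R) : intgr leb (fun y => win c d y * f y) -> c <= d ->
  Rint leb (fun y => hwin c d y * f y) = Rint leb (fun y => win c d y * f y).
Proof.
move=> i cd.
have E y : win d d y * f y = f d * win d d y.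
  rewrite /win; case: (boolP (d <= y <= d)) => [h|_]; last by rewrite mul0r mulr0.
  by rewrite (le_anti h) mulrC.
have i' : intgr leb (fun y => win d d y * f y).
  by under eq_fun do rewrite E; exact/intgrZl/intgr_win.
have e0 : Rint leb (fun y => win d d y * f y) = 0.
  by under eq_Rint do rewrite E; rewrite RintZl ?Rint_win ?subrr ?mulr0//; exact: intgr_win.
rewrite -[RHS]subr0 -e0 -RintB//; apply: eq_Rint => y; rewrite -mulrBl; congr (_ * _).
rewrite /hwin /win; case: (ltgtP y d) => h; rewrite ?andbT ?andbF ?subr0 ?subrr//=.
by rewrite h cd subrr.
Qed.

Variables (a om : R).
Hypotheses (a1 : 1 < a) (om0 : 0 < om).
Hypothesis hP : forall (r1 r2 : R) (g : R -> R), 0 < r1 -> r1 <= r2 -> continuous g ->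
  intgr mu (shell_fun r1 r2 g) /\
  Rint mu (shell_fun r1 r2 g) = Rint leb (fun t => win (r1 `^ a) (r2 `^ a) t * (om * t `^ (N / a - 1) * g (t `^ a^-1))).

Let a0 : 0 < a. Proof. by have := a1; lra. Qed.

Variables (r1 r2 : R).
Hypotheses (r10 : 0 < r1) (r12 : r1 <= r2).

(** The Jacobian of [polar_shell] is part of the profile, so that an integral over R^n against
    Q(|xi|) becomes a plain one-dimensional transform. The half-open window is the one that dyadic
    pieces tile. *)
Definition profile (Q : R -> R) (y : R) : R := hwin (r1 `^ a) (r2 `^ a) y * (om * y `^ (N / a - 1) * Q (y `^ a^-1)).

Lemma measurable_profile0 Q : continuous Q -> measurable_fun setT (fun y : R => om * y `^ (N / a - 1) * Q (y `^ a^-1)).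
Proof.
move=> cQ; apply: measurable_funM; first by apply: measurable_funM => //; exact: measurable_powR.
by apply: (measurableT_comp (continuous_measurable_fun cQ)); exact: measurable_powR.
Qed.

Lemma measurable_profile Q : continuous Q -> measurable_fun setT (profile Q).
Proof. by move=> cQ; apply: measurable_funM; [exact: measurable_hwin|exact: measurable_profile0]. Qed.

Let ra0 y : r1 `^ a <= y -> 0 < y.
Proof. by apply: lt_le_trans; rewrite powR_gt0. Qed.

Lemma profile_bound Q : continuous Q -> exists2 B : R, 0 <= B & forall y, `|profile Q y| <= B * hwin (r1 `^ a) (r2 `^ a) y.
Proof.
move=> cQ; have [|B B0 hB] := @bounded_on (r1 `^ a) (r2 `^ a) (fun y : R => om * y `^ (N / a - 1) * Q (y `^ a^-1)).
  move=> y /andP[h1 _]; have y0 := ra0 h1.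
  apply: cvgM; first by apply: cvgMr; exact: der_cont (derPow _ y0).
  by apply: (continuous_comp (f := fun y : R => y `^ a^-1) (g := Q)); [exact: der_cont (derPow _ y0)|exact: cQ].
exists B => // y; rewrite /profile normrM mulrC /hwin; case: (boolP (_ && _)) => [/andP[h1 h2]|_].
  by rewrite normr1 !mulr1 hB// h1 ltW.
by rewrite normr0 !mulr0.
Qed.

Let rab : r1 `^ a <= r2 `^ a.
Proof. by apply: ge0_ler_powR; rewrite ?nnegrE ?(ltW a0) ?(ltW r10)//; have := r12; have := r10; lra. Qed.

Let osc (c : R -> R) (t : R) (Q : R -> R) s := c (t * `|s| `^ a) * Q s.

Let cosc (c : R -> R) t Q : continuous c -> continuous Q -> continuous (osc c t Q).
Proof.
move=> cc cQ s; apply: cvgM; last exact: cQ.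
apply: (continuous_comp (f := fun s : R => t * `|s| `^ a) (g := c)); last exact: cc.
by apply: cvgMr; exact: continuous_normpowR.
Qed.

Let mosc (c : R -> R) t Q : continuous c -> continuous Q -> measurable_fun setT (fun s : R => win r1 r2 (s `^ 2^-1) * osc c t Q (s `^ 2^-1)).
Proof.
move=> cc cQ; apply: measurable_funM; first by apply: measurable_win => //; exact: measurable_powR.
by apply: (measurableT_comp (continuous_measurable_fun (@cosc c t Q cc cQ))); exact: measurable_powR.
Qed.

Let dotp_sqrt (x : Rn R n) : dotp x x `^ 2^-1 = enorm x.
Proof. by rewrite powR12_sqrt// dotpp_ge0. Qed.

(** [c] is the cosine or the sine of the time phase. In the space phase only the cosine contributes,
    as the Bessel kernel; the sine integrates to 0 against a function of |y|. *)
Let piece (c : R -> R) t Q (x : Rn R n) : continuous c -> continuous Q ->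
  [/\ intgr mu (fun y => win r1 r2 (enorm y) * osc c t Q (enorm y)),
      Rint mu (fun y => cos (dotp x y) * (win r1 r2 (enorm y) * osc c t Q (enorm y))) =
        Rint leb (fun y => c (t * y) * band a (profile Q) x y) &
      Rint mu (fun y => sin (dotp x y) * (win r1 r2 (enorm y) * osc c t Q (enorm y))) = 0].
Proof.
move=> cc cQ.
have [i _] := hP r10 r12 (@cosc c t Q cc cQ).
pose H (s : R) := win r1 r2 (s `^ 2^-1) * osc c t Q (s `^ 2^-1).
have HE (y : Rn R n) : H (dotp y y) = win r1 r2 (enorm y) * osc c t Q (enorm y) by rewrite /H dotp_sqrt.
have iH : intgr mu (fun y => H (dotp y y)).
  by move: i; congr (intgr _ _); apply/funext => y; rewrite HE.
split; first by [].
- have := radial_cos n2 x (H := H) (@mosc c t Q cc cQ) iH; under eq_Rint do rewrite HE; move=> ->.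
  have cb : continuous (fun s => bS n.-1 (enorm x * s) * osc c t Q s).
    move=> s; apply: cvgM; last exact: (@cosc c t Q cc cQ).
    apply: (continuous_comp (f := fun s : R => enorm x * s) (g := bS n.-1)); first exact: mulrl_continuous.
    by apply: continuous_bS; rewrite -ltnS prednK// (ltn_trans _ n2).
  have [_ e] := hP r10 r12 cb.
  transitivity (Rint mu (shell_fun r1 r2 (fun s : R => bS n.-1 (enorm x * s) * osc c t Q s))).
    by apply: eq_Rint => y; rewrite HE /shell_fun mulrCA.
  rewrite e; transitivity (Rint leb (fun y => win (r1 `^ a) (r2 `^ a) y * (c (t * y) * (bS n.-1 (enorm x * y `^ a^-1) * (om * y `^ (N / a - 1) * Q (y `^ a^-1)))))).
    apply: eq_Rint => y; rewrite /win; case: (boolP (_ && _)) => [/andP[h1 _]|_]; last by rewrite !mul0r.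
    have y0 := ra0 h1; rewrite /osc (ger0_norm (powR_ge0 _ _)) -powRrM mulVf ?gt_eqF// powRr1 ?(ltW y0)//.
    by rewrite !mul1r; ring.
  rewrite -Rint_hwin//; first by apply: eq_Rint => y; rewrite /band /profile; ring.
  apply: intgr_win_cont => y /andP[h1 _]; have y0 := ra0 h1.
  have cy : {for y, continuous (fun y : R => y `^ a^-1)} by exact: der_cont (derPow _ y0).
  apply: cvgM.
    by apply: (continuous_comp (f := fun y : R => t * y) (g := c)); [exact: mulrl_continuous|exact: cc].
  apply: cvgM.
    apply: (continuous_comp (f := fun y : R => enorm x * y `^ a^-1) (g := bS n.-1)); first exact: cvgMr.
    by apply: continuous_bS; rewrite -ltnS prednK// (ltn_trans _ n2).
  apply: cvgM; first by apply: cvgMr; exact: der_cont (derPow _ y0).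
  by apply: (continuous_comp (f := fun y : R => y `^ a^-1) (g := Q)); [exact: cy|exact: cQ].
- have := radial_sin x (H := H) (@mosc c t Q cc cQ) iH; by under eq_Rint do rewrite HE.
Qed.

Definition phase (x : Rn R n) (t : R) (y : Rn R n) : R := dotp x y + t * enorm y `^ a.

Let icosM (f : Rn R n -> R) x : intgr mu f -> intgr mu (fun y => cos (dotp x y) * f y).
Proof.
move=> i; apply: (@intgr_dom _ _ _ mu _ (fun y => `|f y|)); last exact: intgr_norm.
  by apply: measurable_funM; [exact: measurable_cos_dotp|exact: intgr_meas i].
by move=> y; rewrite normrM ler_piMl ?norm_cos_le1.
Qed.

Let isinM (f : Rn R n -> R) x : intgr mu f -> intgr mu (fun y => sin (dotp x y) * f y).
Proof.
move=> i; apply: (@intgr_dom _ _ _ mu _ (fun y => `|f y|)); last exact: intgr_norm.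
  by apply: measurable_funM; [exact: measurable_sin_dotp|exact: intgr_meas i].
by move=> y; rewrite normrM ler_piMl ?norm_sin_le1.
Qed.

Lemma radial_band_cos Q x t : continuous Q ->
  Rint mu (fun y => win r1 r2 (enorm y) * (cos (phase x t y) * Q (enorm y))) = Fc (band a (profile Q) x) t.
Proof.
move=> cQ; have [i1 e1 _] := piece t x (@continuous_cos R) cQ; have [i2 _ e2] := piece t x (@continuous_sin R) cQ.
rewrite /Fc -e1 -[LHS]subr0 -[X in _ = X]subr0 -[X in _ = _ - X]e2 -RintB; [|exact: icosM|exact: isinM].
rewrite subr0; apply: eq_Rint => y; rewrite /osc (ger0_norm (enorm_ge0 y)) /phase cosD; ring.
Qed.

Lemma radial_band_sin Q x t : continuous Q ->
  Rint mu (fun y => win r1 r2 (enorm y) * (sin (phase x t y) * Q (enorm y))) = Fs (band a (profile Q) x) t.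
Proof.
move=> cQ; have [i1 _ e1] := piece t x (@continuous_cos R) cQ; have [i2 e2 _] := piece t x (@continuous_sin R) cQ.
rewrite /Fs -e2 -[LHS]addr0 -[X in _ = X]addr0 -[X in _ = _ + X]e1 -RintD; [|exact: icosM|exact: isinM].
rewrite addr0; apply: eq_Rint => y; rewrite /osc (ger0_norm (enorm_ge0 y)) /phase sinD; ring.
Qed.

(** Of the two Jacobians in the square, one returns to the measure of R^n and the other turns
    y^((b-N)/a) into |xi|^(b-a): (b-N)/a + 2 (N/a - 1) = (b-a)/a + (N/a - 1). *)
Lemma profile_norm (b : R) (Q : R -> R) : continuous Q ->
  intgr mu (fun y => win r1 r2 (enorm y) * (enorm y `^ (b - a) * Q (enorm y) ^+ 2)) /\
  Rint leb (fun y => y `^ ((b - N) / a) * profile Q y ^+ 2) =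
  om * Rint mu (fun y => win r1 r2 (enorm y) * (enorm y `^ (b - a) * Q (enorm y) ^+ 2)).
Proof.
(* The maximum with [r1] changes nothing on the shell and makes the integrand continuous on the
   whole line, as [hP] requires. *)
move=> cQ; pose g (s : R) := Num.max s r1 `^ (b - a) * Q s ^+ 2.
have cg : continuous g.
  move=> s; apply: cvgM; last by apply: cvgM; exact: cQ.
  apply: (continuous_comp (f := fun s : R => Num.max s r1) (g := fun z : R => z `^ (b - a))).
    have cmax : continuous (fun s => Num.max s r1).
      by apply: max_fun_continuous => z; [exact: cvg_id|exact: cvg_cst].
    exact: cmax.
  by apply: der_cont (derPow _ _); rewrite lt_max r10 orbT.
have gE y : win r1 r2 (enorm y) * (enorm y `^ (b - a) * Q (enorm y) ^+ 2) = shell_fun r1 r2 g y.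
  rewrite /shell_fun /g /win; case: (boolP (_ && _)) => [/andP[h1 _]|_]; last by rewrite !mul0r.
  by rewrite max_l.
have [i e] := hP r10 r12 cg; split.
  by move: i; congr (intgr _ _); apply/funext => y; rewrite gE.
transitivity (om * Rint mu (shell_fun r1 r2 g)); last by congr (_ * _); apply: eq_Rint => y; rewrite gE.
have mp : measurable_fun setT (fun y : R => (om * y `^ (N / a - 1) * Q (y `^ a^-1))).
  exact: measurable_profile0.
have iw : intgr leb (fun t => win (r1 `^ a) (r2 `^ a) t * (om * t `^ (N / a - 1) * g (t `^ a^-1))).
  apply: intgr_win_cont => t /andP[t1 _]; have t0 := ra0 t1.
  apply: cvgM; first by apply: cvgMr; exact: der_cont (derPow _ t0).
  by apply: (continuous_comp (f := fun y : R => y `^ a^-1) (g := g)); [exact: der_cont (derPow _ t0)|exact: cg].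
rewrite e -RintZl//.
transitivity (Rint leb (fun y => hwin (r1 `^ a) (r2 `^ a) y * (y `^ ((b - N) / a) * (om * y `^ (N / a - 1) * Q (y `^ a^-1)) ^+ 2))).
  by apply: eq_Rint => y; rewrite /profile exprMn expr2 /hwin -natrM mulnb andbb mulrCA.
rewrite Rint_hwin//; last first.
  apply: intgr_win_cont => y /andP[h1 _]; have y0 := ra0 h1.
  have c1 : {for y, continuous (fun y : R => om * y `^ (N / a - 1) * Q (y `^ a^-1))}.
    apply: cvgM; first by apply: cvgMr; exact: der_cont (derPow _ y0).
    by apply: (continuous_comp (f := fun y : R => y `^ a^-1) (g := Q)); [exact: der_cont (derPow _ y0)|exact: cQ].
  by apply: cvgM; [exact: der_cont (derPow _ y0)|apply: cvgM; exact: c1].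
apply: eq_Rint => y; rewrite mulrCA [RHS]mulrCA /win; case: (boolP (_ && _)) => [/andP[h1 _]|_]; last by rewrite !mul0r ?mulr0.
have y0 := ra0 h1; have yr : r1 <= y `^ a^-1.
  have -> : r1 = (r1 `^ a) `^ a^-1 by rewrite -powRrM mulfV ?gt_eqF// powRr1// ltW.
  by apply: ge0_ler_powR; rewrite ?nnegrE ?powR_ge0 ?invr_ge0 ?(ltW a0) ?(ltW y0).
rewrite /g max_l// -powRrM !mul1r.
have -> : y `^ (a^-1 * (b - a)) = y `^ ((b - N) / a) * y `^ (N / a - 1).
  rewrite -powRD; last by rewrite (gt_eqF y0) implybT.
  by congr (_ `^ _); field; rewrite gt_eqF.
by ring.
Qed.

End RadialPieces.

(** * The weighted bound for continuous radial profiles *)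

Section AnnulusFlow.
Context {R : realType} (n : nat).
Hypothesis n2 : (2 <= n)%N.
Local Notation leb := (@lebesgue_measure R).
Local Notation mu := (lebesgue_Rn n : {measure set Rn R n -> \bar R}).
Local Notation nu := (lebesgue_spacetime n : {measure set (spacetime R n) -> \bar R}).
Let N : R := n%:R.
Variables (a b p K : R).
Hypotheses (a1 : 1 < a) (b1 : 1 < b) (p1 : 1 < p) (hp : a / (b - 1) < p) (K0 : 0 <= K).
Variable W : Rn R n -> R -> R.
Hypothesis mW : measurable_fun setT (fun z : Rn R n * measurableTypeR R => W z.1 z.2).
Hypothesis W0 : forall x t, 0 <= W x t.
Hypothesis hW : forall (r t : R), 0 < r ->
  (\int[mu]_x \int[leb]_s (cubei r x * win (t - r `^ a / 2) (t + r `^ a / 2) s * W x s `^ p)%:E <= (K * r `^ (N + a - b * p))%:E)%E.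

Definition fwin (L : nat) (y : Rn R n) : R := win (2 ^+ 0 / 2 ^+ L) (2 ^+ (L + L) / 2 ^+ L) (enorm y).

Lemma annulus_flow : exists2 C : R, 0 <= C & forall (L : nat) (Q1 Q2 : R -> R), continuous Q1 -> continuous Q2 ->
  (\int[nu]_z (annulus L z.1 * (W z.1 z.2 *
     (Rint mu (fun y => fwin L y * (cos (phase a z.1 z.2 y) * Q1 (enorm y) - sin (phase a z.1 z.2 y) * Q2 (enorm y))) ^+ 2 +
      Rint mu (fun y => fwin L y * (sin (phase a z.1 z.2 y) * Q1 (enorm y) + cos (phase a z.1 z.2 y) * Q2 (enorm y))) ^+ 2)))%:E <=
   (C * Rint mu (fun y => fwin L y * (enorm y `^ (b - a) * (Q1 (enorm y) ^+ 2 + Q2 (enorm y) ^+ 2))))%:E)%E.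
Proof.
have a0 : 0 < a by have := a1; lra.
have N2 : 2 <= N by rewrite /N ler_nat.
have n1 : (0 < n.-1)%N by rewrite -ltnS prednK// (ltn_trans _ n2).
have [C0 C01 hC0] := @bessel_decay R n.-1 n1.
have [om om0 hP] := polar_shell n2 a0.
pose eps := decay_exp N a b p.
have eps0 : 0 < eps by exact: decay_exp_gt0.
pose SC := shell_const n a b p K C0.
have p0 := @pi_ge0 R.
have SC0 : 0 <= SC.
  have q1 := @powR_ge0 R 2 a; have q2 := @powR_ge0 R 4 (N + a - b * p).
  have C00 : 0 <= C0 by exact: le_trans C01.
  exact: (mulr_ge0 (mulr_ge0 (mulr_ge0 (ler0n _ 4) p0) (mulr_ge0 (ler0n _ 16) C00)) (addr_ge0 (mulr_ge0 (mulr_ge0 (ler0n _ 256) p0) (exprn_ge0 n (ler0n _ 4))) (mulr_ge0 (ler0n _ 128) (mulr_ge0 (mulr_ge0 q1 K0) q2)))).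
pose DC := dyadic_const n b SC eps.
have DC0 : 0 <= DC.
  by rewrite /DC /dyadic_const; apply: mulr_ge0; rewrite ?powR_ge0//; apply: mulr_ge0 => //; apply: mulr_ge0; rewrite ?powR_ge0// sqr_ge0.
have H1 := @one_shell R n n2 a b p K a1 b1 p1 hp K0 W mW W0 hW C0 C01 hC0.
exists (2 * DC * om); first by apply: mulr_ge0; [apply: mulr_ge0|exact: ltW].
move=> L Q1 Q2 cQ1 cQ2.
set r1 : R := 2 ^+ 0 / 2 ^+ L; set r2 : R := 2 ^+ (L + L) / 2 ^+ L.
have r10 : 0 < r1 by rewrite divr_gt0 ?exprn_gt0.
have r12 : r1 <= r2 by rewrite ler_pM2r ?invr_gt0 ?exprn_gt0// ler_weXn2l ?ler1n.
have AB Q (cQ : continuous Q) : (\int[nu]_z (annulus L z.1 * (W z.1 z.2 * usq a (profile n a om r1 r2 Q) z.1 z.2))%:E <=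
    (DC * om * Rint mu (fun y => fwin L y * (enorm y `^ (b - a) * Q (enorm y) ^+ 2)))%:E)%E.
  have [B B0 hB] := profile_bound n a om r2 r10 cQ.
  have [_ e] := profile_norm a1 hP r10 r12 b cQ.
  have := annulus_bound n2 a1 SC0 eps0 mW W0 H1 B0 (measurable_profile n a om r1 r2 cQ) hB.
  by rewrite e mulrA.
have mph x t : measurable_fun setT (fun y : Rn R n => phase a x t y).
  apply: measurable_funD; first exact: measurable_dotp.
  by apply: measurable_funM => //; apply: (measurableT_comp (measurable_powR _)); exact: measurable_enorm.
have mfw : measurable_fun setT (@fwin L) by apply: measurable_win => //; exact: measurable_enorm.
have iQ (c : R -> R) Q x t : continuous c -> (forall z, `|c z| <= 1) -> continuous Q ->
    intgr mu (fun y => fwin L y * (c (phase a x t y) * Q (enorm y))).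
  move=> cc c1 cQ.
  have cn : continuous (fun s => `|Q s|).
    by move=> s; apply: (continuous_comp (g := fun z : R => `|z|)); [exact: cQ|exact: norm_continuous].
  have [i _] := hP r1 r2 _ r10 r12 cn.
  apply: (@intgr_dom _ _ _ mu _ _ _ _ i).
    apply: measurable_funM; first exact: mfw.
    apply: measurable_funM; first exact: (measurableT_comp (continuous_measurable_fun cc) (mph x t)).
    exact: (measurableT_comp (continuous_measurable_fun cQ) (@measurable_enorm R n)).
  move=> y; rewrite /shell_fun normrM (ger0_norm (win_ge0 _ _ _)) ler_wpM2l ?win_ge0// normrM ler_piMl//.
have cosC := @continuous_cos R; have sinC := @continuous_sin R.
pose Wu Q (z : spacetime R n) := annulus L z.1 * (W z.1 z.2 * usq a (profile n a om r1 r2 Q) z.1 z.2).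
have ann0 x : 0 <= @annulus R n L x by rewrite /annulus /hwin ler0n.
have Wu0 Q z : (0 <= (Wu Q z)%:E)%E by rewrite lee_fin mulr_ge0// mulr_ge0// usq_ge0.
have mWu Q (cQ : continuous Q) : measurable_fun setT (fun z => (Wu Q z)%:E).
  apply/measurable_EFinP; apply: measurable_funM.
    by apply: (measurableT_comp (measurable_hwin _ _)); apply: (measurableT_comp (@measurable_enorm R n)); exact: measurable_fst.
  by apply: measurable_funM; [exact: mW|exact: (measurable_usq n2 a (measurable_profile n a om r1 r2 cQ))].
have eU1 (z : spacetime R n) : Rint mu (fun y => fwin L y * (cos (phase a z.1 z.2 y) * Q1 (enorm y) - sin (phase a z.1 z.2 y) * Q2 (enorm y))) =
    Fc (band a (profile n a om r1 r2 Q1) z.1) z.2 - Fs (band a (profile n a om r1 r2 Q2) z.1) z.2.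
  rewrite -(radial_band_cos n2 a1 hP r10 r12)// -(radial_band_sin n2 a1 hP r10 r12)//.
  rewrite -RintB; [|exact: (iQ cos _ _ _ cosC (@norm_cos_le1 R))|exact: (iQ sin _ _ _ sinC (@norm_sin_le1 R))].
  by apply: eq_Rint => y; rewrite mulrBr.
have eU2 (z : spacetime R n) : Rint mu (fun y => fwin L y * (sin (phase a z.1 z.2 y) * Q1 (enorm y) + cos (phase a z.1 z.2 y) * Q2 (enorm y))) =
    Fs (band a (profile n a om r1 r2 Q1) z.1) z.2 + Fc (band a (profile n a om r1 r2 Q2) z.1) z.2.
  rewrite -(radial_band_cos n2 a1 hP r10 r12)// -(radial_band_sin n2 a1 hP r10 r12)//.
  rewrite -RintD; [|exact: (iQ sin _ _ _ sinC (@norm_sin_le1 R))|exact: (iQ cos _ _ _ cosC (@norm_cos_le1 R))].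
  by apply: eq_Rint => y; rewrite mulrDr.
(* For complex data Q1 + i Q2 the square of the flow is at most twice the sum of those of Q1 and Q2,
   so that real profiles suffice. *)
have pw z : annulus L z.1 * (W z.1 z.2 *
     (Rint mu (fun y => fwin L y * (cos (phase a z.1 z.2 y) * Q1 (enorm y) - sin (phase a z.1 z.2 y) * Q2 (enorm y))) ^+ 2 +
      Rint mu (fun y => fwin L y * (sin (phase a z.1 z.2 y) * Q1 (enorm y) + cos (phase a z.1 z.2 y) * Q2 (enorm y))) ^+ 2)) <=
     2 * (Wu Q1 z + Wu Q2 z).
  rewrite eU1 eU2.
  rewrite /Wu /usq -mulrDr -mulrDr [leRHS]mulrCA ler_wpM2l// [leRHS]mulrCA ler_wpM2l//.
  move: (Fc _ _) (Fs _ _) (Fs _ _) (Fc _ _) => x y s t.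
  by have := sqr_ge0 (t + s); have := sqr_ge0 (y - x); lra.
apply: (@le_trans _ _ (2%:E * (\int[nu]_z (Wu Q1 z)%:E + \int[nu]_z (Wu Q2 z)%:E))%E).
  rewrite -ge0_integralD; [|exact: measurableT|by move=> z _; exact: Wu0|exact: mWu|by move=> z _; exact: Wu0|exact: mWu].
  rewrite -ge0_integralZl; [|exact: measurableT|by apply: emeasurable_funD; exact: mWu|by move=> z _; apply: adde_ge0; exact: Wu0|by []].
  apply: ge0_le_integral; first exact: measurableT.
  - by move=> z _; rewrite lee_fin mulr_ge0// mulr_ge0// addr_ge0// sqr_ge0.
  - apply/measurable_EFinP; under eq_fun do rewrite eU1 eU2.
    have mB Q (cQ : continuous Q) : measurable_fun setT (fun z : spacetime R n * measurableTypeR R => band a (profile n a om r1 r2 Q) z.1.1 z.2).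
      apply: measurable_funM; last by apply: (measurableT_comp (measurable_profile n a om r1 r2 cQ)).
      apply: (@measurable_bSpow R n n2 a _ (spacetime R n * measurableTypeR R)%type (fun z => z.1.1) (fun z => z.2)); last exact: measurable_snd.
      exact: (measurableT_comp measurable_fst measurable_fst).
    have mc Q (cQ : continuous Q) : measurable_fun setT (fun z : spacetime R n => Fc (band a (profile n a om r1 r2 Q) z.1) z.2).
      by apply: (@measurable_Fc2 R _ (spacetime R n)) => //; exact: mB.
    have ms Q (cQ : continuous Q) : measurable_fun setT (fun z : spacetime R n => Fs (band a (profile n a om r1 r2 Q) z.1) z.2).
      by apply: (@measurable_Fs2 R _ (spacetime R n)) => //; exact: mB.
    apply: measurable_funM.
      by apply: (measurableT_comp (measurable_hwin _ _)); apply: (measurableT_comp (@measurable_enorm R n)); exact: measurable_fst.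
    apply: measurable_funM; first exact: mW.
    by apply: measurable_funD; apply: measurable_funX; [apply: measurable_funB; [exact: mc|exact: ms]|apply: measurable_funD; [exact: ms|exact: mc]].
  - by apply: emeasurable_funM; [exact: measurable_cst|apply: emeasurable_funD; exact: mWu].
  - by move=> z _; rewrite -EFinD -EFinM lee_fin; exact: pw.
apply: le_trans (lee_wpmul2l _ (leeD (AB Q1 cQ1) (AB Q2 cQ2))) _ => //.
rewrite -EFinD -EFinM lee_fin -mulrDr -RintD; last 2 first.
- by have [] := profile_norm a1 hP r10 r12 b cQ1.
- by have [] := profile_norm a1 hP r10 r12 b cQ2.
have -> : Rint mu (fun y => fwin L y * (enorm y `^ (b - a) * (Q1 (enorm y) ^+ 2 + Q2 (enorm y) ^+ 2))) =
  Rint mu (fun y => fwin L y * (enorm y `^ (b - a) * Q1 (enorm y) ^+ 2) + fwin L y * (enorm y `^ (b - a) * Q2 (enorm y) ^+ 2)).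
  by apply: eq_Rint => y; ring.
by rewrite !mulrA.
Qed.

End AnnulusFlow.

(** * Passage to square integrable data *)

Section L2Facts.
Context {R : realType} {d : measure_display} {T : measurableType d}.
Variable mu : {measure set T -> \bar R}.

Definition csq (z : R[i]) : R := complex.Re z ^+ 2 + complex.Im z ^+ 2.

Lemma csq_ge0 z : 0 <= csq z. Proof. by rewrite addr_ge0 ?sqr_ge0. Qed.

Lemma cabs_sqr (z : R[i]) : cabs z ^+ 2 = csq z.
Proof. by case: z => x y; rewrite /cabs /ComplexField.Normc.normc sqr_sqrtr// addr_ge0 ?sqr_ge0. Qed.

Lemma cabs_ge0 (z : R[i]) : 0 <= cabs z.
Proof. by case: z => x y; exact: sqrtr_ge0. Qed.

Lemma L2normE (h : T -> R[i]) : L2norm mu h = ((\int[mu]_x (csq (h x))%:E) `^ 2^-1)%E.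
Proof.
rewrite /L2norm unlock; congr (_ `^ _)%E; apply: eq_integral => x _.
by rewrite gee0_abs ?lee_fin ?cabs_ge0// poweR_EFin powR_mulrn ?cabs_ge0// cabs_sqr.
Qed.

Lemma int_csq_ge0 (h : T -> R[i]) : (0 <= \int[mu]_x (csq (h x))%:E)%E.
Proof. by apply: integral_ge0 => x _; rewrite lee_fin csq_ge0. Qed.

Lemma L2norm_sqr (h : T -> R[i]) : (\int[mu]_x (csq (h x))%:E = L2norm mu h `^ 2)%E.
Proof. by rewrite L2normE -poweRrM mulVf// poweRe1// int_csq_ge0. Qed.

Lemma measurable_csq (h : T -> R[i]) : cmeasurable h -> measurable_fun setT (fun x => csq (h x)).
Proof. by move=> [h1 h2]; apply: measurable_funD; exact: measurable_funX. Qed.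

Lemma L2_intgr (h : T -> R[i]) : L2 mu h ->
  intgr mu (fun x => complex.Re (h x) ^+ 2) /\ intgr mu (fun x => complex.Im (h x) ^+ 2).
Proof.
move=> [mh hn]; have mc := measurable_csq mh.
have i : intgr mu (fun x => csq (h x)).
  apply: intgr_lty => //; first by move=> x; exact: csq_ge0.
  by rewrite L2norm_sqr; exact: poweR_lty.
case: mh => m1 m2; split; apply: (@intgr_dom _ _ _ mu _ _ _ _ i); try exact: measurable_funX.
  by move=> x; rewrite ger0_norm ?sqr_ge0// lerDl sqr_ge0.
by move=> x; rewrite ger0_norm ?sqr_ge0// lerDr sqr_ge0.
Qed.

Lemma L2_cvg0 (h_ : nat -> T -> R[i]) : L2norm mu (h_ k) @[k --> \oo] --> (0 : \bar R) ->
  forall e : R, 0 < e -> \forall k \near \oo, (\int[mu]_x (csq (h_ k x))%:E <= e%:E)%E.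
Proof.
move=> h e e0; have s0 : 0 < Num.sqrt e by rewrite sqrtr_gt0.
have : \forall k \near \oo, (L2norm mu (h_ k) < (Num.sqrt e)%:E)%E.
  have /fine_cvgP[hf hc] := h; near=> k; rewrite -[X in (X < _)%E]fineK; last by near: k.
  by rewrite lte_fin; near: k; exact: (cvgr_lt _ hc).
apply: filterS => k hk; rewrite L2norm_sqr.
have -> : e%:E = ((Num.sqrt e)%:E `^ 2)%E by rewrite poweR_EFin powR_mulrn ?sqrtr_ge0// sqr_sqrtr// ltW.
have L0 : (0 <= L2norm mu (h_ k))%E by rewrite L2normE poweR_ge0.
apply: gt0_ler_poweR => //; last exact: ltW.
  by rewrite in_itv/= leey L0.
by rewrite in_itv/= leey lee_fin sqrtr_ge0.
Unshelve. all: by end_near. Qed.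

End L2Facts.

(** * Truncated transforms of radial functions *)

Section RadialTransform.
Context {R : realType} (n : nat).
Hypothesis n2 : (2 <= n)%N.
Local Notation mu := (lebesgue_Rn n : {measure set Rn R n -> \bar R}).

(** A measurable section of [enorm]: composed with it, a radial function yields a measurable
    profile. *)
Definition axis (s : R) : Rn R n := [tuple (if (i == 0 :> nat) then s else 0) | i < n].

Lemma measurable_axis : measurable_fun setT axis.
Proof.
apply/(@measurable_fun_tnthP _ _ (measurableTypeR R) (measurableTypeR R) n) => i.
have -> : (tnth (T:=measurableTypeR R))^~ i \o axis = (fun s : R => if (i == 0 :> nat) then s else 0).
  by apply/funext => s; rewrite /= tnth_mktuple.
by case: (i == 0 :> nat).
Qed.

Lemma enorm_axis (s : R) : 0 <= s -> enorm (axis s) = s.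
Proof.
move=> s0; rewrite /enorm; have -> : dotp (axis s) (axis s) = s ^+ 2; last by rewrite sqrtr_sqr ger0_norm.
have n0 : (0 < n)%N by exact: ltn_trans n2.
rewrite /dotp (bigD1 (Ordinal n0))//= tnth_mktuple/= big1 ?addr0// => i; rewrite -val_eqE/= => i0.
by rewrite tnth_mktuple (negbTE i0) mul0r.
Qed.

Definition ballf (r : R) (x : Rn R n) : R := ((enorm x <= r)%R)%:R.

Lemma ballfE r x : ballf r x = \1_(cball r) x.
Proof.
rewrite /ballf indicE; congr (nat_of_bool _)%:R; apply/idP/idP => [h|/set_mem//].
by rewrite mem_set.
Qed.

Lemma measurable_ballf r : measurable_fun setT (ballf r).
Proof.
have mb : measurable_fun setT (fun x : Rn R n => enorm x <= r).
  by apply: measurable_fun_ler => //; exact: measurable_enorm.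
by apply: (measurableT_comp (f := fun b : bool => b%:R : R)) => //.
Qed.

Lemma intgr_ballf r : intgr mu (ballf r).
Proof.
apply: (@intgr_dom _ _ _ mu _ (cubei (2 * Num.max r 0))); first exact: measurable_ballf.
  move=> x; rewrite /ballf /cubei indicE; case: (leP (enorm x) r) => h; last by rewrite normr0 ler0n.
  rewrite mem_set ?normr1// => i; rewrite tnth_nseq subr0; apply: le_trans (enorm_coord x i) _.
  by apply: le_trans h _; rewrite mulrAC mulfV// mul1r le_max lexx.
apply: intgr_lty; [exact: cubei_ge0|exact: measurable_cubei|].
rewrite integral_indic//; last exact: measurable_cube.
by rewrite setIT lebesgue_Rn_cube ?ltry// mulr_ge0// le_max lexx orbT.
Qed.

Lemma intgr_ballM r (h : Rn R n -> R) : measurable_fun setT h -> intgr mu (fun x => h x ^+ 2) -> intgr mu (fun x => ballf r x * h x).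
Proof.
move=> mh ih; apply: (@intgr_dom _ _ _ mu _ (fun x => ballf r x + h x ^+ 2)); last exact: intgrD (intgr_ballf r) ih.
  by apply: measurable_funM => //; exact: measurable_ballf.
move=> x; rewrite normrM /ballf; case: (leP (enorm x) r) => _; rewrite ?normr1 ?normr0 ?mul1r ?mul0r ?addr_ge0 ?sqr_ge0//.
have -> : true%:R = 1 :> R by [].
have := sqr_ge0 (`|h x| - 2^-1); rewrite -[X in _ <= _ + X]real_normK ?num_real//; move: `|h x| => z; lra.
Qed.

(* The absolute value extends the profile to a continuous function on the line. *)
Definition radial_trunc (h : Rn R n -> R) (r s : R) : R := Rint mu (fun y => bS n.-1 (`|s| * enorm y) * (ballf r y * h y)).

Lemma bS_lip (u v : R) : 0 <= u -> u <= v -> `|bS n.-1 u - bS n.-1 v| <= v - u.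
Proof.
move=> u0 uv; rewrite ler_norml; apply/andP; split.
  have := @der_nonincreasing R (fun x => bS n.-1 x - x) (fun x => bD n.-1 x - 1) u v uv.
  move=> /(_ _ _) h; suff : bS n.-1 v - v <= bS n.-1 u - u by lra.
  apply: h => x /andP[x1 x2]; first by apply: derB (derI _); exact: der_bS.
  have := bD_le1 n (le_trans u0 x1); rewrite ler_norml => /andP[_]; lra.
have := @der_nonincreasing R (fun x => - bS n.-1 x - x) (fun x => - bD n.-1 x - 1) u v uv.
move=> /(_ _ _) h; suff : - bS n.-1 v - v <= - bS n.-1 u - u by lra.
apply: h => x /andP[x1 x2]; first by apply: derB (derI _); apply: derN; exact: der_bS.
have := bD_le1 n (le_trans u0 x1); rewrite ler_norml => /andP[h _]; lra.
Qed.

Lemma bS_lip2 (u v : R) : 0 <= u -> 0 <= v -> `|bS n.-1 u - bS n.-1 v| <= `|u - v|.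
Proof.
move=> u0 v0; have [uv|vu] := leP u v.
  by rewrite distrC [leRHS]distrC distrC (ger0_norm (x := v - u)) ?subr_ge0// bS_lip.
by rewrite distrC (ger0_norm (x := u - v)) ?subr_ge0 ?(ltW vu)// bS_lip// ltW.
Qed.

Lemma intgr_radial_trunc h r (s : R) : intgr mu (fun y => ballf r y * h y) ->
  intgr mu (fun y => bS n.-1 (`|s| * enorm y) * (ballf r y * h y)).
Proof.
move=> i; apply: (@intgr_dom _ _ _ mu _ (fun y => `|ballf r y * h y|)); last exact: intgr_norm.
  apply: measurable_funM; last exact: intgr_meas i.
  have := @measurable_bS_enorm R n n2 (axis `|s|); rewrite enorm_axis//.
by move=> y; rewrite normrM ler_piMl// bS_le1// mulr_ge0 ?enorm_ge0.
Qed.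

(** As |S'| <= 1, the kernel is |y|-Lipschitz in s, and |y| <= r on the ball; hence a Lipschitz
    constant r times the L^1 norm on the ball. The estimates for the flow are proved for continuous
    profiles, and this provides them. *)
Lemma continuous_radial_trunc h r : intgr mu (fun y => ballf r y * h y) -> continuous (radial_trunc h r).
Proof.
move=> i s; pose I := Rint mu (fun y => `|ballf r y * h y|).
have I0 : 0 <= I by exact: Rint_ge0.
pose C := `|r| * I + 1; have C0 : 0 < C by rewrite ltr_wpDl// mulr_ge0.
have lip s' : `|radial_trunc h r s - radial_trunc h r s'| <= C * `|s - s'|.
  rewrite /radial_trunc -RintB; [|exact: intgr_radial_trunc|exact: intgr_radial_trunc].
  apply: le_trans (Rint_norm (intgrB (intgr_radial_trunc s i) (intgr_radial_trunc s' i))) _.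
  apply: (@le_trans _ _ (Rint mu (fun y => (`|r| * `|s - s'|) * `|ballf r y * h y|))).
    apply: Rint_le; [exact: intgr_norm (intgrB (intgr_radial_trunc s i) (intgr_radial_trunc s' i))|exact/intgrZl/intgr_norm|].
    move=> y; rewrite -mulrBl normrM /ballf; case: (leP (enorm y) r) => hy; last by rewrite !mul0r normr0 !mulr0.
    rewrite ler_wpM2r//; apply: le_trans (bS_lip2 _ _) _; rewrite ?mulr_ge0 ?enorm_ge0//.
    rewrite -mulrBl normrM mulrC (ger0_norm (enorm_ge0 y)); apply: ler_pM => //; first exact: enorm_ge0.
      by apply: le_trans hy _; exact: ler_norm.
    exact: ler_dist_dist.
  rewrite RintZl; last exact: intgr_norm.
  by rewrite -/I mulrAC ler_wpM2r// /C lerDl.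
apply/cvgrPdist_lt => e e0; exists (e / C) => /=; first by rewrite divr_gt0.
move=> s' /= h'; apply: le_lt_trans (lip s') _.
by rewrite mulrC -ltr_pdivlMr.
Qed.

Lemma radial_comp (h : Rn R n -> R) : measurable_fun setT h -> (forall x y, enorm x = enorm y -> h x = h y) ->
  exists2 H : R -> R, measurable_fun setT H & forall x, h x = H (dotp x x).
Proof.
move=> mh rh; exists (fun s => h (axis (s `^ 2^-1))).
  apply: (measurableT_comp mh); apply: (measurableT_comp measurable_axis); exact: measurable_powR.
by move=> x; apply: rh; rewrite enorm_axis ?powR_ge0// powR12_sqrt// dotpp_ge0.
Qed.

Lemma radial_transform (h : Rn R n -> R) r (xi : Rn R n) : measurable_fun setT h -> (forall x y, enorm x = enorm y -> h x = h y) ->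
  intgr mu (fun x => h x ^+ 2) ->
  Rint mu (fun y => ballf r y * (cos (dotp y xi) * h y)) = radial_trunc h r (enorm xi) /\
  Rint mu (fun y => ballf r y * (sin (dotp y xi) * h y)) = 0.
Proof.
move=> mh rh ih; have i := intgr_ballM r mh ih.
have mb : measurable_fun setT (fun y => ballf r y * h y) by apply: measurable_funM => //; exact: measurable_ballf.
have rb x y : enorm x = enorm y -> ballf r x * h x = ballf r y * h y.
  by move=> e; rewrite (rh _ _ e) /ballf e.
have [H mH hH] := radial_comp mb rb.
have dC y : dotp y xi = dotp xi y by apply: eq_bigr => k _; rewrite mulrC.
have iH : intgr mu (fun y => H (dotp y y)) by move: i; congr (intgr _ _); apply/funext => y; rewrite hH.
split.
  transitivity (Rint mu (fun y => cos (dotp xi y) * H (dotp y y))).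
    by apply: eq_Rint => y; rewrite -hH dC mulrCA.
  rewrite (radial_cos n2 xi mH iH); apply: eq_Rint => y.
  by rewrite -hH (ger0_norm (enorm_ge0 xi)).
transitivity (Rint mu (fun y => sin (dotp xi y) * H (dotp y y))); last exact: radial_sin.
by apply: eq_Rint => y; rewrite -hH dC mulrCA.
Qed.

Lemma Re_cisM (th : R) (z : R[i]) : complex.Re (cis th * z) = cos th * complex.Re z - sin th * complex.Im z.
Proof. by case: z. Qed.
Lemma Im_cisM (th : R) (z : R[i]) : complex.Im (cis th * z) = cos th * complex.Im z + sin th * complex.Re z.
Proof. by case: z. Qed.

Lemma Rint_cball r (f : Rn R n -> R) : Rintegral mu (cball r) f = Rint mu (fun y => ballf r y * f y).
Proof.
rewrite Rintegral_mkcond; apply: eq_Rint => y; rewrite patchE ballfE indicE.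
by case: ifPn => _; rewrite ?mul1r ?mul0r.
Qed.

Lemma fourier_truncE (f : Rn R n -> R[i]) r xi : radial f -> L2 mu f ->
  fourier_trunc f r xi = Complex (radial_trunc (fun x => complex.Re (f x)) r (enorm xi))
                                 (radial_trunc (fun x => complex.Im (f x)) r (enorm xi)).
Proof.
move=> rf hf; have [i1 i2] := L2_intgr hf; have [[m1 m2] _] := hf.
have r1 x y : enorm x = enorm y -> complex.Re (f x) = complex.Re (f y) by move=> /rf ->.
have r2 x y : enorm x = enorm y -> complex.Im (f x) = complex.Im (f y) by move=> /rf ->.
have [e1 s1] := radial_transform r xi m1 r1 i1; have [e2 s2] := radial_transform r xi m2 r2 i2.
have ic (h : Rn R n -> R) (c : R -> R) : measurable_fun setT h -> intgr mu (fun x => h x ^+ 2) -> continuous c -> (forall z, `|c z| <= 1) ->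
   intgr mu (fun y => ballf r y * (c (dotp y xi) * h y)).
  move=> mh ih cc c1; apply: (@intgr_dom _ _ _ mu _ (fun y => `|ballf r y * h y|)); last exact/intgr_norm/intgr_ballM.
    apply: measurable_funM; first exact: measurable_ballf.
    apply: measurable_funM => //; apply: (measurableT_comp (continuous_measurable_fun cc)).
    have -> : (fun y => dotp y xi) = (fun y => dotp xi y) by apply/funext => y; apply: eq_bigr => k _; rewrite mulrC.
    exact: measurable_dotp.
  by move=> y; rewrite mulrCA normrM ler_piMl.
have cC := @continuous_cos R; have cS := @continuous_sin R.
rewrite /fourier_trunc /cintegral; congr Complex; rewrite Rint_cball.
- rewrite -e1 -[RHS]addr0 -s2 -RintD; [|exact: ic (@norm_cos_le1 R)|exact: ic (@norm_sin_le1 R)].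
  by apply: eq_Rint => y; rewrite Re_cisM cosN sinN; ring.
- rewrite -e2 -[RHS]subr0 -s1 -RintB; [|exact: ic (@norm_cos_le1 R)|exact: ic (@norm_sin_le1 R)].
  by apply: eq_Rint => y; rewrite Im_cisM cosN sinN; ring.
Qed.

End RadialTransform.

Lemma quadratic_perturb (R : realFieldType) (e X Y Z : R) :
  `|Z| < e / 4 -> Y <= e / 4 -> 0 <= Y -> `|X - (X + 2 * Z + Y)| < e.
Proof. by rewrite ltr_norml => /andP[w1 w2] h3 h4; rewrite ltr_norml; apply/andP; split; lra. Qed.

(** * Strong and weak convergence in L^2 *)

Section L2Convergence.
Context {R : realType} {d : measure_display} {T : measurableType d}.
Variable mu : {measure set T -> \bar R}.

(** The integrals are extended reals, so that no integrability of the differences is presupposed; it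
    follows for all large m, in [l2cvg_diff]. *)
Definition l2cvg (h_ : nat -> T -> R) (h : T -> R) : Prop := forall e : R, 0 < e ->
  \forall m \near \oo, (\int[mu]_x ((h_ m x - h x) ^+ 2)%:E <= e%:E)%E.

Lemma fatou_near (f_ : nat -> T -> R) (f : T -> R) (B : R) :
  (forall m, measurable_fun setT (f_ m)) -> (forall m x, 0 <= f_ m x) -> (forall x, f_ ^~ x @ \oo --> f x) ->
  (forall e, 0 < e -> \forall m \near \oo, (\int[mu]_x (f_ m x)%:E <= (B + e)%:E)%E) ->
  (\int[mu]_x (f x)%:E <= B%:E)%E.
Proof.
move=> mf f0 cf h; apply/lee_addgt0Pr => e e0; rewrite -EFinD.
have [n0 _ hn] := h e e0.
apply: (@fatou_cvg _ _ _ mu (fun m => f_ (m + n0)%N)) => //.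
- by move=> x; have := cf x; rewrite -(cvg_shiftn n0).
- by move=> m; apply: hn => /=; rewrite leq_addl.
Qed.

Variables (h_ : nat -> T -> R) (h : T -> R).
Hypotheses (mh_ : forall m, measurable_fun setT (h_ m)) (mh : measurable_fun setT h).
Hypotheses (ih : intgr mu (fun x => h x ^+ 2)) (hc : l2cvg h_ h).

Lemma l2cvg_diff (e : R) : 0 < e -> \forall m \near \oo,
  intgr mu (fun x => (h_ m x - h x) ^+ 2) /\ Rint mu (fun x => (h_ m x - h x) ^+ 2) <= e.
Proof.
move=> e0; apply: filterS (hc e0) => m hm.
have i : intgr mu (fun x => (h_ m x - h x) ^+ 2).
  apply: intgr_lty; [by move=> x; exact: sqr_ge0|by apply: measurable_funX; exact: measurable_funB|].
  by apply: le_lt_trans hm _; rewrite ltry.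
by split => //; rewrite -lee_fin EFin_Rint.
Qed.

Lemma weak_cvg (k : T -> R) : measurable_fun setT k -> intgr mu (fun x => k x ^+ 2) ->
  Rint mu (fun x => k x * h_ m x) @[m --> \oo] --> Rint mu (fun x => k x * h x).
Proof.
move=> mk ik; apply/cvgrPdist_lt => e e0.
pose A := Rint mu (fun x => k x ^+ 2); have A0 : 0 <= A by apply: Rint_ge0 => x; exact: sqr_ge0.
pose e' := (e / 2) ^+ 2 / (A + 1).
have e'0 : 0 < e' by rewrite divr_gt0 ?exprn_gt0 ?divr_gt0//; lra.
apply: filterS (l2cvg_diff e'0) => m [i hm].
have md : measurable_fun setT (fun x => h_ m x - h x) by exact: measurable_funB.
have i1 := intgr_mul mk mh ik ih; have i2 := intgr_mul mk md ik i.
have -> : Rint mu (fun x => k x * h_ m x) = Rint mu (fun x => k x * h x) + Rint mu (fun x => k x * (h_ m x - h x)).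
  by rewrite -RintD//; apply: eq_Rint => x; ring.
rewrite opprD addrA subrr add0r normrN.
have cs := CauchySchwarz mk md ik i.
have : `|Rint mu (fun x => k x * (h_ m x - h x))| <= e / 2; last by lra.
rewrite -ler_sqr ?nnegrE ?divr_ge0 ?(ltW e0)// real_normK ?num_real//.
apply: le_trans cs _; rewrite -/A; apply: le_trans (ler_wpM2l A0 hm) _.
rewrite /e' mulrA ler_pdivrMr; last by lra.
by rewrite mulrC ler_wpM2l ?sqr_ge0//; lra.
Qed.

(** From h_m^2 = h^2 + 2 h (h_m - h) + (h_m - h)^2: the middle term tends to 0 by [weak_cvg] against
    A h, the last one because A is bounded. *)
Lemma weighted_sq_cvg (A : T -> R) (c : R) : measurable_fun setT A -> (forall x, 0 <= A x <= c) ->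
  Rint mu (fun x => A x * h_ m x ^+ 2) @[m --> \oo] --> Rint mu (fun x => A x * h x ^+ 2).
Proof.
move=> mA Ac.
have A0 x : 0 <= A x by case/andP: (Ac x).
have Al x : A x <= c by case/andP: (Ac x).
have c0 : 0 <= c \/ (forall x : T, False).
  have [[x _]|h0] := pselect (exists x : T, True); first by left; exact: le_trans (A0 x) (Al x).
  by right => x; apply: h0; exists x.
have iA (g : T -> R) : measurable_fun setT g -> intgr mu (fun x => g x ^+ 2) -> intgr mu (fun x => A x * g x ^+ 2).
  move=> mg ig; apply: (@intgr_dom _ _ _ mu _ (fun x => c * g x ^+ 2)); last exact: intgrZl.
    by apply: measurable_funM => //; exact: measurable_funX.
  by move=> x; rewrite normrM (ger0_norm (A0 x)) (ger0_norm (sqr_ge0 _)) ler_wpM2r ?sqr_ge0.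
have mk : measurable_fun setT (fun x => A x * h x) by exact: measurable_funM.
have ik : intgr mu (fun x => (A x * h x) ^+ 2).
  apply: (@intgr_dom _ _ _ mu _ (fun x => c ^+ 2 * h x ^+ 2)); [exact: measurable_funX| |exact: intgrZl].
  move=> x; rewrite (ger0_norm (sqr_ge0 _)) exprMn ler_wpM2r ?sqr_ge0//.
  by rewrite lerXn2r ?nnegrE// (le_trans (A0 x)).
have w := weak_cvg mk ik.
have i1 := intgr_mul mk mh ik ih.
apply/cvgrPdist_lt => e e0; pose e' := e / (4 * (`|c| + 1)).
have e'0 : 0 < e' by rewrite divr_gt0// mulr_gt0// ltr_wpDl.
have e40 : 0 < e / 4 by rewrite divr_gt0.
move/cvgrPdist_lt : w => /(_ _ e40) w'; apply: filterS2 (l2cvg_diff e'0) w' => m [i hm] w1.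
have md : measurable_fun setT (fun x => h_ m x - h x) by exact: measurable_funB.
have i2 := intgr_mul mk md ik i; have i3 := iA _ md i; have i4 := iA _ mh ih.
have e1 : Rint mu (fun x => A x * h_ m x ^+ 2) =
   Rint mu (fun x => A x * h x ^+ 2) + 2 * Rint mu (fun x => A x * h x * (h_ m x - h x)) + Rint mu (fun x => A x * (h_ m x - h x) ^+ 2).
  rewrite -(RintZl _ i2) -RintD//; last exact: intgrZl.
  rewrite -RintD//; last by apply: intgrD => //; exact: intgrZl.
  by apply: eq_Rint => x; ring.
have e2 : Rint mu (fun x => A x * h x * h_ m x) = Rint mu (fun x => A x * h x * h x) + Rint mu (fun x => A x * h x * (h_ m x - h x)).
  by rewrite -RintD//; apply: eq_Rint => x; ring.
rewrite e2 opprD addrA subrr add0r normrN in w1.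
have h3 : Rint mu (fun x => A x * (h_ m x - h x) ^+ 2) <= e / 4.
  apply: (@le_trans _ _ ((`|c| + 1) * e')); last by rewrite /e' le_eqVlt; apply/orP; left; apply/eqP; field; rewrite gt_eqF// ltr_wpDl.
  apply: (@le_trans _ _ (Rint mu (fun x => (`|c| + 1) * (h_ m x - h x) ^+ 2))).
    apply: Rint_le => //; [exact: intgrZl|move=> x]; rewrite ler_wpM2r ?sqr_ge0//.
    by apply: le_trans (Al x) _; apply: le_trans (ler_norm c) _; rewrite lerDl.
  by rewrite RintZl// ler_wpM2l// addr_ge0.
have h4 : 0 <= Rint mu (fun x => A x * (h_ m x - h x) ^+ 2) by apply: Rint_ge0 => x; rewrite mulr_ge0 ?sqr_ge0.
rewrite e1; move: w1 h3 h4; move: (Rint _ _) (Rint _ _) (Rint _ _) => X Y Z; exact: quadratic_perturb.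
Qed.

End L2Convergence.

(** * From continuous profiles to L^2 data on an annulus *)

Section AnnulusLimit.
Context {R : realType} (n : nat).
Hypothesis n2 : (2 <= n)%N.
Local Notation leb := (@lebesgue_measure R).
Local Notation mu := (lebesgue_Rn n : {measure set Rn R n -> \bar R}).
Local Notation nu := (lebesgue_spacetime n : {measure set (spacetime R n) -> \bar R}).
Variables (a b C : R) (W : Rn R n -> R -> R).
Hypothesis C0 : 0 <= C.
Hypothesis mW : measurable_fun setT (fun z : Rn R n * measurableTypeR R => W z.1 z.2).
Hypothesis W0 : forall x t, 0 <= W x t.

Definition oflow1 (kap F1 F2 : Rn R n -> R) (z : spacetime R n) : R :=
  Rint mu (fun y => kap y * (cos (phase a z.1 z.2 y) * F1 y - sin (phase a z.1 z.2 y) * F2 y)).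
Definition oflow2 (kap F1 F2 : Rn R n -> R) (z : spacetime R n) : R :=
  Rint mu (fun y => kap y * (sin (phase a z.1 z.2 y) * F1 y + cos (phase a z.1 z.2 y) * F2 y)).
Definition flow1 L := oflow1 (fwin L).
Definition flow2 L := oflow2 (fwin L).
Definition energy L (F1 F2 : Rn R n -> R) : R :=
  Rint mu (fun y => fwin L y * (enorm y `^ (b - a) * (F1 y ^+ 2 + F2 y ^+ 2))).

Hypothesis H : forall (L : nat) (Q1 Q2 : R -> R), continuous Q1 -> continuous Q2 ->
  (\int[nu]_z (annulus L z.1 * (W z.1 z.2 *
     (flow1 L (fun y => Q1 (enorm y)) (fun y => Q2 (enorm y)) z ^+ 2 + flow2 L (fun y => Q1 (enorm y)) (fun y => Q2 (enorm y)) z ^+ 2)))%:E <=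
   (C * energy L (fun y => Q1 (enorm y)) (fun y => Q2 (enorm y)))%:E)%E.

Variables (Q1_ Q2_ : nat -> R -> R) (F1 F2 : Rn R n -> R).
Hypotheses (cQ1 : forall m, continuous (Q1_ m)) (cQ2 : forall m, continuous (Q2_ m)).
Hypotheses (mF1 : measurable_fun setT F1) (mF2 : measurable_fun setT F2).
Hypotheses (iF1 : intgr mu (fun y => F1 y ^+ 2)) (iF2 : intgr mu (fun y => F2 y ^+ 2)).
Hypotheses (cF1 : l2cvg mu (fun m y => Q1_ m (enorm y)) F1) (cF2 : l2cvg mu (fun m y => Q2_ m (enorm y)) F2).

Let mQ1 m : measurable_fun setT (fun y : Rn R n => Q1_ m (enorm y)).
Proof. by apply: (measurableT_comp (f := Q1_ m)); [exact: (continuous_measurable_fun (@cQ1 m))|exact: measurable_enorm]. Qed.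
Let mQ2 m : measurable_fun setT (fun y : Rn R n => Q2_ m (enorm y)).
Proof. by apply: (measurableT_comp (f := Q2_ m)); [exact: (continuous_measurable_fun (@cQ2 m))|exact: measurable_enorm]. Qed.

Lemma measurable_fwin L : measurable_fun setT (@fwin R n L).
Proof. by apply: measurable_win => //; exact: measurable_enorm. Qed.

Lemma fwin_sqr L (y : Rn R n) : fwin L y ^+ 2 = fwin L y.
Proof. by rewrite expr2 win_idem. Qed.

Lemma fwin_ge0 L (y : Rn R n) : 0 <= fwin L y. Proof. exact: win_ge0. Qed.

Lemma intgr_fwin L : intgr mu (@fwin R n L).
Proof.
apply: (@intgr_dom _ _ _ mu _ _ _ _ (intgr_ballf n (2 ^+ (L + L) / 2 ^+ L))); first exact: measurable_fwin.
move=> y; rewrite ger0_norm ?fwin_ge0// /fwin /win /ballf.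
by case: (_ <= enorm y); case: (enorm y <= _) => //=.
Qed.

Lemma measurable_phase x t : measurable_fun setT (fun y : Rn R n => phase a x t y).
Proof.
apply: measurable_funD; first exact: measurable_dotp.
by apply: measurable_funM => //; apply: (measurableT_comp (measurable_powR _)); exact: measurable_enorm.
Qed.

Lemma fwin_osc (c : R -> R) L x t : continuous c -> (forall z, `|c z| <= 1) ->
  measurable_fun setT (fun y : Rn R n => fwin L y * c (phase a x t y)) /\
  intgr mu (fun y => (fwin L y * c (phase a x t y)) ^+ 2).
Proof.
move=> cc c1; have m1 : measurable_fun setT (fun y : Rn R n => fwin L y * c (phase a x t y)).
  apply: measurable_funM; first exact: measurable_fwin.
  exact: (measurableT_comp (continuous_measurable_fun cc) (measurable_phase x t)).
split => //; apply: (@intgr_dom _ _ _ mu _ _ _ _ (intgr_fwin L)); first exact: measurable_funX.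
move=> y; rewrite (ger0_norm (sqr_ge0 _)) exprMn fwin_sqr ler_piMr ?fwin_ge0//.
by rewrite -real_normK ?num_real// expr_le1.
Qed.

Lemma intgr_fwin_osc (c Q : R -> R) L x t : continuous c -> (forall z, `|c z| <= 1) -> continuous Q ->
  intgr mu (fun y : Rn R n => fwin L y * c (phase a x t y) * Q (enorm y)).
Proof.
move=> cc c1 cQ; have [m1 _] := fwin_osc L x t cc c1.
have [|B B0 hB] := @bounded_on R (2 ^+ 0 / 2 ^+ L) (2 ^+ (L + L) / 2 ^+ L) Q; first by move=> ? _; exact: cQ.
apply: (@intgr_dom _ _ _ mu _ (fun y => B * fwin L y)); last exact/intgrZl/intgr_fwin.
  by apply: measurable_funM => //; apply: (measurableT_comp (f := Q)); [exact: continuous_measurable_fun|exact: measurable_enorm].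
move=> y; rewrite !normrM (ger0_norm (fwin_ge0 _ _)) /fwin /win.
case: (boolP (_ && _)) => h; rewrite /= ?mul0r ?mulr0// mul1r mulr1.
by rewrite -[leRHS]mul1r ler_pM ?normr_ge0// hB.
Qed.

Lemma osc_cvg (c : R -> R) (Q_ : nat -> R -> R) (F : Rn R n -> R) L x t : continuous c -> (forall z, `|c z| <= 1) ->
  (forall m, continuous (Q_ m)) -> measurable_fun setT F -> intgr mu (fun y => F y ^+ 2) ->
  l2cvg mu (fun m y => Q_ m (enorm y)) F ->
  Rint mu (fun y => fwin L y * c (phase a x t y) * Q_ m (enorm y)) @[m --> \oo] -->
  Rint mu (fun y => fwin L y * c (phase a x t y) * F y).
Proof.
move=> cc c1 cQ mF iF cF; have [m1 i1] := fwin_osc L x t cc c1.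
apply: (weak_cvg (h_ := fun m y => Q_ m (enorm y))) => //.
by move=> m; apply: (measurableT_comp (f := Q_ m)); [exact: continuous_measurable_fun|exact: measurable_enorm].
Qed.

Lemma intgr_oscF (c : R -> R) (F : Rn R n -> R) L x t : continuous c -> (forall z, `|c z| <= 1) ->
  measurable_fun setT F -> intgr mu (fun y => F y ^+ 2) ->
  intgr mu (fun y => fwin L y * c (phase a x t y) * F y).
Proof. by move=> cc c1 mF iF; have [m1 i1] := fwin_osc L x t cc c1; exact: intgr_mul. Qed.

Let cc := @continuous_cos R. Let cs := @continuous_sin R.
Let c1 := @norm_cos_le1 R. Let s1 := @norm_sin_le1 R.

Lemma flow1_cvg L z : flow1 L (fun y => Q1_ m (enorm y)) (fun y => Q2_ m (enorm y)) z @[m --> \oo] --> flow1 L F1 F2 z.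
Proof.
have e (Q1 Q2 : Rn R n -> R) : intgr mu (fun y => fwin L y * cos (phase a z.1 z.2 y) * Q1 y) ->
  intgr mu (fun y => fwin L y * sin (phase a z.1 z.2 y) * Q2 y) ->
  flow1 L Q1 Q2 z = Rint mu (fun y => fwin L y * cos (phase a z.1 z.2 y) * Q1 y) - Rint mu (fun y => fwin L y * sin (phase a z.1 z.2 y) * Q2 y).
  by move=> i j; rewrite -RintB//; apply: eq_Rint => y; ring.
rewrite e; [|exact: (intgr_oscF _ _ _ cc c1)|exact: (intgr_oscF _ _ _ cs s1)].
have -> : (fun m => flow1 L (fun y => Q1_ m (enorm y)) (fun y => Q2_ m (enorm y)) z) =
  (fun m => Rint mu (fun y => fwin L y * cos (phase a z.1 z.2 y) * Q1_ m (enorm y)) - Rint mu (fun y => fwin L y * sin (phase a z.1 z.2 y) * Q2_ m (enorm y))).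
  by apply/funext => m; rewrite e//; [exact: (intgr_fwin_osc _ _ _ cc c1)|exact: (intgr_fwin_osc _ _ _ cs s1)].
by apply: cvgB; [exact: (@osc_cvg cos Q1_ F1 L z.1 z.2)|exact: (@osc_cvg sin Q2_ F2 L z.1 z.2)].
Qed.

Lemma flow2_cvg L z : flow2 L (fun y => Q1_ m (enorm y)) (fun y => Q2_ m (enorm y)) z @[m --> \oo] --> flow2 L F1 F2 z.
Proof.
have e (Q1 Q2 : Rn R n -> R) : intgr mu (fun y => fwin L y * sin (phase a z.1 z.2 y) * Q1 y) ->
  intgr mu (fun y => fwin L y * cos (phase a z.1 z.2 y) * Q2 y) ->
  flow2 L Q1 Q2 z = Rint mu (fun y => fwin L y * sin (phase a z.1 z.2 y) * Q1 y) + Rint mu (fun y => fwin L y * cos (phase a z.1 z.2 y) * Q2 y).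
  by move=> i j; rewrite -RintD//; apply: eq_Rint => y; ring.
rewrite e; [|exact: (intgr_oscF _ _ _ cs s1)|exact: (intgr_oscF _ _ _ cc c1)].
have -> : (fun m => flow2 L (fun y => Q1_ m (enorm y)) (fun y => Q2_ m (enorm y)) z) =
  (fun m => Rint mu (fun y => fwin L y * sin (phase a z.1 z.2 y) * Q1_ m (enorm y)) + Rint mu (fun y => fwin L y * cos (phase a z.1 z.2 y) * Q2_ m (enorm y))).
  by apply/funext => m; rewrite e//; [exact: (intgr_fwin_osc _ _ _ cs s1)|exact: (intgr_fwin_osc _ _ _ cc c1)].
by apply: cvgD; [exact: (@osc_cvg sin Q1_ F1 L z.1 z.2)|exact: (@osc_cvg cos Q2_ F2 L z.1 z.2)].
Qed.

Lemma fwin_pow_bound L (s : R) : exists2 B : R, 0 <= B & forall y : Rn R n, fwin L y * enorm y `^ s <= B.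
Proof.
have r0 : (0 : R) < 2 ^+ 0 / 2 ^+ L by rewrite expr0 div1r invr_gt0 exprn_gt0.
have [|B B0 hB] := @bounded_on R (2 ^+ 0 / 2 ^+ L) (2 ^+ (L + L) / 2 ^+ L) (fun y => y `^ s).
  by move=> y /andP[h _]; exact: der_cont (derPow _ (lt_le_trans r0 h)).
exists B => // y; rewrite /fwin /win; case: (boolP (_ && _)) => h; rewrite /= ?mul0r// mul1r.
exact: le_trans (ler_norm _) (hB _ h).
Qed.

Lemma measurable_fwin_pow L (s : R) : measurable_fun setT (fun y : Rn R n => fwin L y * enorm y `^ s).
Proof.
apply: measurable_funM; first exact: measurable_fwin.
by apply: (measurableT_comp (measurable_powR _)); exact: measurable_enorm.
Qed.

Lemma intgr_fwin_pow_sqr L (s : R) (F : Rn R n -> R) : measurable_fun setT F -> intgr mu (fun y => F y ^+ 2) ->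
  intgr mu (fun y => fwin L y * enorm y `^ s * F y ^+ 2).
Proof.
move=> mF iF; have [B B0 hB] := fwin_pow_bound L s.
apply: (@intgr_dom _ _ _ mu _ (fun y => B * F y ^+ 2)); last exact: intgrZl.
  by apply: measurable_funM; [exact: measurable_fwin_pow|exact: measurable_funX].
move=> y; rewrite ger0_norm; first by rewrite ler_wpM2r ?sqr_ge0.
by apply: mulr_ge0; [apply: mulr_ge0; [exact: fwin_ge0|exact: powR_ge0]|exact: sqr_ge0].
Qed.

Lemma energyE L (F G : Rn R n -> R) : measurable_fun setT F -> intgr mu (fun y => F y ^+ 2) ->
  measurable_fun setT G -> intgr mu (fun y => G y ^+ 2) ->
  energy L F G = Rint mu (fun y => fwin L y * enorm y `^ (b - a) * F y ^+ 2) + Rint mu (fun y => fwin L y * enorm y `^ (b - a) * G y ^+ 2).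
Proof.
move=> mF iF mG iG; rewrite -RintD; [|exact: intgr_fwin_pow_sqr|exact: intgr_fwin_pow_sqr].
by apply: eq_Rint => y; ring.
Qed.

Lemma intgr_fwin_pow_sqr_cont L (Q : R -> R) : continuous Q -> intgr mu (fun y => fwin L y * enorm y `^ (b - a) * Q (enorm y) ^+ 2).
Proof.
move=> cQ; have [|B B0 hB] := @bounded_on R (2 ^+ 0 / 2 ^+ L) (2 ^+ (L + L) / 2 ^+ L) Q; first by move=> ? _; exact: cQ.
have mQ : measurable_fun setT (fun y : Rn R n => Q (enorm y)).
  by apply: (measurableT_comp (f := Q)); [exact: continuous_measurable_fun|exact: measurable_enorm].
have i : intgr mu (fun y : Rn R n => (fwin L y * Q (enorm y)) ^+ 2).
  apply: (@intgr_dom _ _ _ mu _ (fun y => B ^+ 2 * fwin L y)); last exact/intgrZl/intgr_fwin.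
    by apply: measurable_funX; apply: measurable_funM => //; exact: measurable_fwin.
  move=> y; rewrite (ger0_norm (sqr_ge0 _)) exprMn fwin_sqr mulrC /fwin /win.
  case: (boolP (_ && _)) => h; rewrite /= ?mulr0// !mulr1.
  by rewrite -[leLHS]real_normK ?num_real// lerXn2r ?nnegrE// hB.
have := @intgr_fwin_pow_sqr L (b - a) _ _ i.
rewrite (_ : (fun y => _ * (fwin L y * Q (enorm y)) ^+ 2) = (fun y => fwin L y * enorm y `^ (b - a) * Q (enorm y) ^+ 2)).
  by apply; apply: measurable_funM => //; exact: measurable_fwin.
apply/funext => y; rewrite exprMn fwin_sqr; have /esym e := fwin_sqr L y.
by rewrite [in RHS]e; ring.
Qed.

Lemma energy_cvg L : energy L (fun y => Q1_ m (enorm y)) (fun y => Q2_ m (enorm y)) @[m --> \oo] --> energy L F1 F2.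
Proof.
have [B B0 hB] := fwin_pow_bound L (b - a).
have hB' (y : Rn R n) : 0 <= fwin L y * enorm y `^ (b - a) <= B.
  by rewrite hB andbT; apply: mulr_ge0; [exact: fwin_ge0|exact: powR_ge0].
rewrite energyE//.
have -> : (fun m => energy L (fun y => Q1_ m (enorm y)) (fun y => Q2_ m (enorm y))) =
  (fun m => Rint mu (fun y => fwin L y * enorm y `^ (b - a) * Q1_ m (enorm y) ^+ 2) + Rint mu (fun y => fwin L y * enorm y `^ (b - a) * Q2_ m (enorm y) ^+ 2)).
  apply/funext => m; rewrite -RintD; [|exact: intgr_fwin_pow_sqr_cont|exact: intgr_fwin_pow_sqr_cont].
  by apply: eq_Rint => y; ring.
apply: cvgD.
  by apply: (@weighted_sq_cvg _ _ _ mu (fun m y => Q1_ m (enorm y)) F1 _ _ _ _ (fun y => fwin L y * enorm y `^ (b - a)) B) => //; exact: measurable_fwin_pow.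
by apply: (@weighted_sq_cvg _ _ _ mu (fun m y => Q2_ m (enorm y)) F2 _ _ _ _ (fun y => fwin L y * enorm y `^ (b - a)) B) => //; exact: measurable_fwin_pow.
Qed.

Lemma measurable_annulus L : measurable_fun setT (fun z : spacetime R n => annulus L z.1).
Proof.
rewrite /annulus; apply: (measurableT_comp (f := hwin _ _)); first exact: measurable_hwin.
by apply: (measurableT_comp (f := enorm)); [exact: measurable_enorm|exact: measurable_fst].
Qed.

Lemma measurable_phase2 : measurable_fun setT (fun z : spacetime R n * Rn R n => phase a z.1.1 z.1.2 z.2).
Proof.
apply: measurable_funD.
  apply: measurable_sum => i; apply: measurable_funM.
    by apply: (measurableT_comp (measurable_tnthR i)); apply: (measurableT_comp (f := fst)) => //; exact: measurable_fst.
  by apply: (measurableT_comp (measurable_tnthR i)); exact: measurable_snd.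
apply: measurable_funM.
  by apply: (measurableT_comp (f := snd)); [exact: measurable_snd|exact: measurable_fst].
apply: (measurableT_comp (measurable_powR _)); apply: (measurableT_comp (f := enorm)); [exact: measurable_enorm|exact: measurable_snd].
Qed.

Lemma measurable_oscillatory (c s : R -> R) (kap G1 G2 : Rn R n -> R) : continuous c -> continuous s ->
  measurable_fun setT kap -> measurable_fun setT G1 -> measurable_fun setT G2 ->
  measurable_fun setT (fun z : spacetime R n => Rint mu (fun y => kap y * (c (phase a z.1 z.2 y) * G1 y + s (phase a z.1 z.2 y) * G2 y))).
Proof.
move=> kc ks mk mG1 mG2.
apply: (@measurable_Rint _ _ (spacetime R n) (Rn R n) R mu (@sigma_finite_lebesgue_Rn R n)
  (fun z => kap z.2 * (c (phase a z.1.1 z.1.2 z.2) * G1 z.2 + s (phase a z.1.1 z.1.2 z.2) * G2 z.2))).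
apply: measurable_funM; first by apply: (measurableT_comp mk); exact: measurable_snd.
apply: measurable_funD; apply: measurable_funM.
- by apply: (measurableT_comp (f := c)); [exact: continuous_measurable_fun|exact: measurable_phase2].
- by apply: (measurableT_comp (f := G1)) => //; exact: measurable_snd.
- by apply: (measurableT_comp (f := s)); [exact: continuous_measurable_fun|exact: measurable_phase2].
- by apply: (measurableT_comp (f := G2)) => //; exact: measurable_snd.
Qed.

Lemma measurable_oflow1 kap G1 G2 : measurable_fun setT kap -> measurable_fun setT G1 -> measurable_fun setT G2 ->
  measurable_fun setT (oflow1 kap G1 G2).
Proof.
move=> mk m1 m2; rewrite (_ : oflow1 kap G1 G2 = (fun z => Rint mu (fun y => kap y * (cos (phase a z.1 z.2 y) * G1 y + (fun u => - sin u) (phase a z.1 z.2 y) * G2 y)))).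
  by apply: (measurable_oscillatory (s := fun u => - sin u)) => // u; apply: cvgN; exact: cs.
by apply/funext => z; apply: eq_Rint => y; rewrite mulNr.
Qed.

Lemma measurable_oflow2 kap G1 G2 : measurable_fun setT kap -> measurable_fun setT G1 -> measurable_fun setT G2 ->
  measurable_fun setT (oflow2 kap G1 G2).
Proof. by move=> mk m1 m2; exact: (measurable_oscillatory cs cc). Qed.

Lemma measurable_flow1 L G1 G2 : measurable_fun setT G1 -> measurable_fun setT G2 -> measurable_fun setT (flow1 L G1 G2).
Proof. by move=> m1 m2; apply: measurable_oflow1 => //; exact: measurable_fwin. Qed.

Lemma measurable_flow2 L G1 G2 : measurable_fun setT G1 -> measurable_fun setT G2 -> measurable_fun setT (flow2 L G1 G2).
Proof. by move=> m1 m2; apply: measurable_oflow2 => //; exact: measurable_fwin. Qed.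

(** With frequencies cut to an annulus, the flow at a point (x, t) is an inner product of the data
    with a fixed L^2 function, so that L^2 convergence gives convergence at every point; Fatou then
    handles any weight. The energies on the right converge because |xi|^(b-a) is bounded on the
    annulus. *)
Lemma annulus_flow_L2 L :
  (\int[nu]_z (annulus L z.1 * (W z.1 z.2 * (flow1 L F1 F2 z ^+ 2 + flow2 L F1 F2 z ^+ 2)))%:E <= (C * energy L F1 F2)%:E)%E.
Proof.
apply: (@fatou_near _ _ _ nu (fun m z => annulus L z.1 * (W z.1 z.2 *
     (flow1 L (fun y => Q1_ m (enorm y)) (fun y => Q2_ m (enorm y)) z ^+ 2 + flow2 L (fun y => Q1_ m (enorm y)) (fun y => Q2_ m (enorm y)) z ^+ 2)))).
- move=> m; apply: measurable_funM; first exact: measurable_annulus.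
  apply: measurable_funM; first exact: mW.
  by apply: measurable_funD; apply: measurable_funX; [exact: measurable_flow1|exact: measurable_flow2].
- move=> m z; apply: mulr_ge0; first by rewrite ler0n.
  by apply: mulr_ge0; [exact: W0|apply: addr_ge0; exact: sqr_ge0].
- move=> z; apply: cvgMr; apply: cvgMr; apply: cvgD.
    by rewrite expr2; apply: cvgM; exact: flow1_cvg.
  by rewrite expr2; apply: cvgM; exact: flow2_cvg.
- move=> e e0; have ce : C * energy L (fun y => Q1_ m (enorm y)) (fun y => Q2_ m (enorm y)) @[m --> \oo] --> C * energy L F1 F2.
    by apply: cvgMr; exact: energy_cvg.
  move/cvgrPdist_lt : ce => /(_ _ e0) ce'; apply: filterS ce' => m.
  rewrite ltr_norml => /andP[h1 h2]; apply: le_trans (H L (@cQ1 m) (@cQ2 m)) _; rewrite lee_fin.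
  by move: h1 h2; move: (C * _) (C * _) => X Y; lra.
Qed.

End AnnulusLimit.

(** * The frequency energy is bounded by the norm of g *)

Section InverseTransform.
Context {R : realType} (n : nat).
Hypothesis n2 : (2 <= n)%N.
Local Notation mu := (lebesgue_Rn n : {measure set Rn R n -> \bar R}).
Let smu := @sigma_finite_lebesgue_Rn R n.

Definition ift1 (G1 G2 : Rn R n -> R) r x : R := Rint mu (fun y => ballf r y * (cos (dotp x y) * G1 y - sin (dotp x y) * G2 y)).
Definition ift2 (G1 G2 : Rn R n -> R) r x : R := Rint mu (fun y => ballf r y * (cos (dotp x y) * G2 y + sin (dotp x y) * G1 y)).

Lemma inv_truncE (G : Rn R n -> R[i]) r x :
  inv_fourier_trunc G r x = Complex (((2 * pi) ^+ n)^-1 * ift1 (fun y => complex.Re (G y)) (fun y => complex.Im (G y)) r x)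
                                    (((2 * pi) ^+ n)^-1 * ift2 (fun y => complex.Re (G y)) (fun y => complex.Im (G y)) r x).
Proof.
rewrite /inv_fourier_trunc /cintegral !Rint_cball.
have -> : Rint mu (fun y => ballf r y * complex.Re (cis (dotp x y) * G y)) = ift1 (fun y => complex.Re (G y)) (fun y => complex.Im (G y)) r x.
  by apply: eq_Rint => y; rewrite Re_cisM.
have -> : Rint mu (fun y => ballf r y * complex.Im (cis (dotp x y) * G y)) = ift2 (fun y => complex.Re (G y)) (fun y => complex.Im (G y)) r x.
  by apply: eq_Rint => y; rewrite Im_cisM.
by congr Complex; rewrite mul0r ?subr0 ?addr0.
Qed.

Lemma measurable_dotp2 : measurable_fun setT (fun z : Rn R n * Rn R n => dotp z.1 z.2).
Proof.
apply: measurable_sum => i; apply: measurable_funM.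
  by apply: (measurableT_comp (measurable_tnthR i)); exact: measurable_fst.
by apply: (measurableT_comp (measurable_tnthR i)); exact: measurable_snd.
Qed.

Variables (G1 G2 : Rn R n -> R).
Hypotheses (mG1 : measurable_fun setT G1) (mG2 : measurable_fun setT G2).
Hypotheses (iG1 : intgr mu (fun y => G1 y ^+ 2)) (iG2 : intgr mu (fun y => G2 y ^+ 2)).

Lemma measurable_ift_kernel r (c s : R -> R) (H1 H2 : Rn R n -> R) : measurable_fun setT H1 -> measurable_fun setT H2 -> continuous c -> continuous s ->
  measurable_fun setT (fun z : Rn R n * Rn R n => ballf r z.2 * (c (dotp z.1 z.2) * H1 z.2 + s (dotp z.1 z.2) * H2 z.2)).
Proof.
move=> mH1 mH2 kc ks; apply: measurable_funM.
  by apply: (measurableT_comp (measurable_ballf r)); exact: measurable_snd.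
apply: measurable_funD; apply: measurable_funM.
- by apply: (measurableT_comp (f := c)); [exact: continuous_measurable_fun|exact: measurable_dotp2].
- by apply: (measurableT_comp (f := H1)) => //; exact: measurable_snd.
- by apply: (measurableT_comp (f := s)); [exact: continuous_measurable_fun|exact: measurable_dotp2].
- by apply: (measurableT_comp (f := H2)) => //; exact: measurable_snd.
Qed.

Let csin := @continuous_sin R. Let ccos := @continuous_cos R.
Let cNsin : continuous (fun u : R => - sin u). Proof. by move=> u; apply: cvgN; exact: csin. Qed.

Let k1E r (z : Rn R n * Rn R n) : ballf r z.2 * (cos (dotp z.1 z.2) * G1 z.2 - sin (dotp z.1 z.2) * G2 z.2) =
  ballf r z.2 * (cos (dotp z.1 z.2) * G1 z.2 + (fun u => - sin u) (dotp z.1 z.2) * G2 z.2).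
Proof. by rewrite mulNr. Qed.

Lemma measurable_ift1_kernel r : measurable_fun setT (fun z : Rn R n * Rn R n => ballf r z.2 * (cos (dotp z.1 z.2) * G1 z.2 - sin (dotp z.1 z.2) * G2 z.2)).
Proof.
rewrite (_ : (fun z => _) = (fun z : Rn R n * Rn R n => ballf r z.2 * (cos (dotp z.1 z.2) * G1 z.2 + (fun u => - sin u) (dotp z.1 z.2) * G2 z.2))).
  exact: (measurable_ift_kernel r mG1 mG2 ccos cNsin).
by apply/funext => z; exact: k1E.
Qed.

Lemma measurable_ift1 r : measurable_fun setT (ift1 G1 G2 r).
Proof.
exact: (@measurable_Rint _ _ (Rn R n) (Rn R n) R mu smu
  (fun z => ballf r z.2 * (cos (dotp z.1 z.2) * G1 z.2 - sin (dotp z.1 z.2) * G2 z.2)) (measurable_ift1_kernel r)).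
Qed.

Lemma measurable_ift2 r : measurable_fun setT (ift2 G1 G2 r).
Proof.
exact: (@measurable_Rint _ _ (Rn R n) (Rn R n) R mu smu
  (fun z => ballf r z.2 * (cos (dotp z.1 z.2) * G2 z.2 + sin (dotp z.1 z.2) * G1 z.2)) (measurable_ift_kernel r mG2 mG1 ccos csin)).
Qed.

Let envelope r (y : Rn R n) : R := `|ballf r y * G1 y| + `|ballf r y * G2 y|.

Let iB r : intgr mu (envelope r).
Proof. by apply: intgrD; apply: intgr_norm; exact: intgr_ballM. Qed.

Let bound r x y : `|ballf r y * (cos (dotp x y) * G1 y - sin (dotp x y) * G2 y)| <= envelope r y.
Proof.
rewrite mulrBr; apply: le_trans (ler_normB _ _) _; rewrite /envelope.
by rewrite ![ballf r y * (_ * _)]mulrCA ![`|_ * (ballf r y * _)|]normrM; apply: lerD; rewrite ler_piMl ?norm_cos_le1 ?norm_sin_le1.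
Qed.

Definition gaussian (l : R) (y : Rn R n) : R := expR (- (l * dotp y y)).
Definition gaussian_hat (l : R) (x : Rn R n) : R := Num.sqrt (pi / l) ^+ n * gaussian (4 * l)^-1 x.

Lemma gaussian_ge0 l y : 0 <= gaussian l y. Proof. exact: expR_ge0. Qed.

Lemma gaussian_mul k l y : gaussian k y * gaussian l y = gaussian (k + l) y.
Proof. by rewrite /gaussian -expRD; congr expR; ring. Qed.

(** The truncated inverse transform is absolutely convergent, so Fubini moves the transform onto the
    Gaussian, whose transform is known. The normalization disappears through sqrt(pi/l) sqrt(4 pi l)
    = 2 pi. *)
Lemma gauss_dual_trunc r l : 0 < l ->
  Rint mu (fun x => gaussian_hat l x * (((2 * pi) ^+ n)^-1 * ift1 G1 G2 r x)) = Rint mu (fun y => ballf r y * (gaussian l y * G1 y)).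
Proof.
move=> l0; have l4 : 0 < (4 * l)^-1 by rewrite invr_gt0 mulr_gt0.
have p0 : 0 < pi :> R by exact: pi_gt0.
have s0 : 0 <= Num.sqrt (pi / l) ^+ n by rewrite exprn_ge0 ?sqrtr_ge0.
have [ig Ig] := @gauss_Rn R n _ l4.
have ihat : intgr mu (gaussian_hat l) by exact: intgrZl.
have hat0 x : 0 <= gaussian_hat l x by rewrite /gaussian_hat mulr_ge0// gaussian_ge0.
pose f (z : Rn R n * Rn R n) : R := gaussian_hat l z.1 * (ballf r z.2 * (cos (dotp z.1 z.2) * G1 z.2 - sin (dotp z.1 z.2) * G2 z.2)).
have mf : measurable_fun setT f.
  apply: measurable_funM; last exact: measurable_ift1_kernel.
  by apply: (measurableT_comp (intgr_meas ihat)); exact: measurable_fst.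
have fAB x y : `|f (x, y)| <= gaussian_hat l x * envelope r y.
  rewrite /f normrM (ger0_norm (hat0 x)); apply: ler_wpM2l; [exact: hat0|exact: bound].
have := RFubini smu smu mf ihat (iB r) fAB; rewrite /f /=.
under eq_Rint => x.
  rewrite RintZl; last first.
    apply: (@intgr_dom _ _ _ mu _ _ _ _ (iB r)); last exact: bound.
    exact: (measurableT_comp (measurable_ift1_kernel r) (pair1_measurable x)).
  over.
move=> E1; under eq_Rint do rewrite mulrCA.
rewrite RintZl; last first.
  have := Fubini_out1 smu smu mf ihat (iB r) fAB; rewrite /f /=.
  under eq_fun => x.
    rewrite RintZl; last first.
      apply: (@intgr_dom _ _ _ mu _ _ _ _ (iB r)); last exact: bound.
      exact: (measurableT_comp (measurable_ift1_kernel r) (pair1_measurable x)).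
    over.
  by [].
rewrite [X in _ * X]E1 -RintZl; last exact: (Fubini_out2 smu smu mf ihat (iB r) fAB).
apply: eq_Rint => y.
have [ec es] := gauss_Rn_cis y l4.
have dC x : dotp x y = dotp y x by apply: eq_bigr => k _; rewrite mulrC.
have i1 (c : R -> R) : continuous c -> (forall z, `|c z| <= 1) -> intgr mu (fun x => c (dotp y x) * gaussian (4 * l)^-1 x).
  move=> kc c1; apply: (@intgr_dom _ _ _ mu _ _ _ _ ig).
    apply: measurable_funM; last exact: measurable_gauss_Rn.
    by apply: (measurableT_comp (f := c)); [exact: continuous_measurable_fun|exact: measurable_dotp].
  by move=> x; rewrite normrM (ger0_norm (gaussian_ge0 _ _)) ler_piMl ?gaussian_ge0.
have -> : Rint mu (fun x => gaussian_hat l x * (ballf r y * (cos (dotp x y) * G1 y - sin (dotp x y) * G2 y))) =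
  (Num.sqrt (pi / l) ^+ n * (ballf r y * G1 y)) * Rint mu (fun x => cos (dotp y x) * gaussian (4 * l)^-1 x) -
  (Num.sqrt (pi / l) ^+ n * (ballf r y * G2 y)) * Rint mu (fun x => sin (dotp y x) * gaussian (4 * l)^-1 x).
  rewrite -!RintZl; [|exact: i1 csin (@norm_sin_le1 R)|exact: i1 ccos (@norm_cos_le1 R)].
  rewrite -RintB; [|exact/intgrZl/(i1 _ ccos (@norm_cos_le1 R))|exact/intgrZl/(i1 _ csin (@norm_sin_le1 R))].
  by apply: eq_Rint => x; rewrite dC /gaussian_hat; ring.
rewrite ec es mulr0 subr0.
have -> : expR (- (dotp y y / (4 * (4 * l)^-1))) = gaussian l y.
  by rewrite /gaussian; congr (expR (- _)); field; rewrite gt_eqF.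
have e2 : Num.sqrt (pi / l) * Num.sqrt (pi / (4 * l)^-1) = 2 * pi.
  rewrite -sqrtrM ?divr_ge0 ?ltW//.
  have -> : pi / l * (pi / (4 * l)^-1) = (2 * pi) ^+ 2 :> R by field; rewrite gt_eqF.
  by rewrite sqrtr_sqr ger0_norm// mulr_ge0// ltW.
have pn : (2 * pi) ^+ n != 0 :> R by rewrite gt_eqF// exprn_gt0// mulr_gt0.
rewrite -e2 exprMn in pn *; move: pn; set A := _ ^+ n; set B := _ ^+ n => pn; field.
by move: pn; rewrite mulf_eq0 negb_or andbC.
Qed.

End InverseTransform.

Section L2Components.
Context {R : realType} {d : measure_display} {T : measurableType d}.
Variable mu : {measure set T -> \bar R}.
Variables (h_ : nat -> T -> R[i]) (h : T -> R[i]).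
Hypotheses (mh_ : forall k, cmeasurable (h_ k)) (mh : cmeasurable h).
Hypothesis hc : L2norm mu (fun x => h_ k x - h x) @[k --> \oo] --> (0 : \bar R).

Lemma l2cvg_components : l2cvg mu (fun k x => complex.Re (h_ k x)) (fun x => complex.Re (h x)) /\
  l2cvg mu (fun k x => complex.Im (h_ k x)) (fun x => complex.Im (h x)).
Proof.
have [m1 m2] := mh.
have mR k : measurable_fun setT (fun x => complex.Re (h_ k x) - complex.Re (h x)) by apply: measurable_funB => //; case: (mh_ k).
have mI k : measurable_fun setT (fun x => complex.Im (h_ k x) - complex.Im (h x)) by apply: measurable_funB => //; case: (mh_ k).
have E k x : csq (h_ k x - h x) = (complex.Re (h_ k x) - complex.Re (h x)) ^+ 2 + (complex.Im (h_ k x) - complex.Im (h x)) ^+ 2.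
  by rewrite /csq; case: (h_ k x) => ? ?; case: (h x).
split=> e e0; apply: filterS (L2_cvg0 hc e0) => k; apply: le_trans; apply: ge0_le_integral => //.
- by move=> x _; rewrite lee_fin sqr_ge0.
- by apply/measurable_EFinP; exact: measurable_funX.
- by apply/measurable_EFinP; under eq_fun do rewrite E; apply: measurable_funD; exact: measurable_funX.
- by move=> x _; rewrite lee_fin E lerDl sqr_ge0.
- by move=> x _; rewrite lee_fin sqr_ge0.
- by apply/measurable_EFinP; exact: measurable_funX.
- by apply/measurable_EFinP; under eq_fun do rewrite E; apply: measurable_funD; exact: measurable_funX.
- by move=> x _; rewrite lee_fin E lerDr sqr_ge0.
Qed.

End L2Components.

Section Duality.
Context {R : realType} (n : nat).
Local Notation mu := (lebesgue_Rn n : {measure set Rn R n -> \bar R}).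
Variables (G g : Rn R n -> R[i]).
Hypothesis hG : is_inv_fourier G g.

Lemma ball_cvg (p : Rn R n -> R) : intgr mu p -> Rint mu (fun y => ballf k%:R y * p y) @[k --> \oo] --> Rint mu p.
Proof.
move=> ip; apply: (@Rint_cvg _ _ _ mu (fun k y => ballf k%:R y * p y) p (fun y => `|p y|) _ _ _ _).2.
- by move=> k; apply: measurable_funM; [exact: measurable_ballf|exact: intgr_meas ip].
- move=> y; apply: cvg_near_cst; near=> k; rewrite /ballf (_ : enorm y <= k%:R) ?mul1r//.
  by near: k; exact: nbhs_infty_ger.
- exact: intgr_norm.
- by move=> k y; rewrite normrM ler_piMl// /ballf; case: (enorm y <= _) => /=; rewrite ?normr1 ?normr0.
Unshelve. all: by end_near. Qed.

Lemma intgr_gaussian l : 0 < l -> intgr mu (gaussian l).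
Proof. by move=> l0; have [] := @gauss_Rn R n l l0. Qed.

Lemma measurable_gaussian l : measurable_fun setT (@gaussian R n l).
Proof. exact: measurable_gauss_Rn. Qed.

Lemma intgr_gaussian_sqr l : 0 < l -> intgr mu (fun y => gaussian l y ^+ 2).
Proof.
move=> l0; under eq_fun do rewrite expr2 gaussian_mul.
by apply: intgr_gaussian; rewrite addr_gt0.
Qed.

(** The limit of [gauss_dual_trunc] along the balls of radius k. The Gaussian being real and even,
    real and imaginary parts do not mix. *)
Lemma gauss_dual l : 0 < l ->
  Rint mu (fun x => gaussian_hat l x * complex.Re (g x)) = Rint mu (fun y => gaussian l y * complex.Re (G y)) /\
  Rint mu (fun x => gaussian_hat l x * complex.Im (g x)) = Rint mu (fun y => gaussian l y * complex.Im (G y)).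
Proof.
move=> l0; have [LG Lg hc] := hG.
have [iG1 iG2] := L2_intgr LG; have [ig1 ig2] := L2_intgr Lg.
have [[mG1 mG2] _] := LG; have [[mg1 mg2] _] := Lg.
have l4 : 0 < (4 * l)^-1 by rewrite invr_gt0 mulr_gt0.
have mh : measurable_fun setT (@gaussian_hat R n l) by apply: measurable_funM => //; exact: measurable_gaussian.
have ih : intgr mu (fun x => gaussian_hat l x ^+ 2).
  by under eq_fun do rewrite exprMn; exact/intgrZl/intgr_gaussian_sqr.
have mt k : cmeasurable (inv_fourier_trunc G k%:R).
  split; under eq_fun do rewrite inv_truncE /=.
    by apply: measurable_funM => //; exact: measurable_ift1.
  by apply: measurable_funM => //; exact: measurable_ift2.
have [c1 c2] := l2cvg_components mt (conj mg1 mg2) hc.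
split.
- have w1 := weak_cvg (fun k => (mt k).1) mg1 ig1 c1 mh ih.
  apply: (cvg_unique _ w1) => //.
  have -> : (fun k => Rint mu (fun x => gaussian_hat l x * complex.Re (inv_fourier_trunc G k%:R x))) =
    (fun k : nat => Rint mu (fun y => ballf k%:R y * (gaussian l y * complex.Re (G y)))).
    by apply/funext => k; rewrite -(gauss_dual_trunc mG1 mG2 iG1 iG2)//; apply: eq_Rint => x; rewrite inv_truncE.
  by apply: ball_cvg; apply: intgr_mul => //; [exact: measurable_gaussian|exact: intgr_gaussian_sqr].
- have w2 := weak_cvg (fun k => (mt k).2) mg2 ig2 c2 mh ih.
  apply: (cvg_unique _ w2) => //.
  (* The imaginary part for (G1, G2) is the real part for (G2, -G1). *)
  have mN : measurable_fun setT (fun y => - complex.Re (G y)) by exact: measurableT_comp.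
  have iN : intgr mu (fun y => (- complex.Re (G y)) ^+ 2) by under eq_fun do rewrite sqrrN.
  have -> : (fun k => Rint mu (fun x => gaussian_hat l x * complex.Im (inv_fourier_trunc G k%:R x))) =
    (fun k : nat => Rint mu (fun y => ballf k%:R y * (gaussian l y * complex.Im (G y)))).
    apply/funext => k; rewrite -(gauss_dual_trunc mG2 mN iG2 iN)//; apply: eq_Rint => x; rewrite inv_truncE/=.
    by congr (_ * (_ * _)); apply: eq_Rint => y; rewrite mulrN opprK.
  by apply: ball_cvg; apply: intgr_mul => //; [exact: measurable_gaussian|exact: intgr_gaussian_sqr].
Qed.

End Duality.

(** * Parseval's identity for combinations of Gaussians *)

Section Parseval.
Context {R : realType} (n : nat).
Local Notation mu := (lebesgue_Rn n : {measure set Rn R n -> \bar R}).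
Variables (N : nat) (c : 'I_N -> R).

Definition gaussians (y : Rn R n) : R := \sum_(i < N) c i * gaussian i.+1%:R y.
Definition gaussians_hat (x : Rn R n) : R := \sum_(i < N) c i * gaussian_hat i.+1%:R x.

(** Explicit: both sides are n-th powers, and the bases agree because pi/k times pi/l times pi /
    (1/(4k) + 1/(4l)) is (2 pi)^2 pi / (k + l). *)
Lemma Rint_gaussian_hat_mul (k l : R) : 0 < k -> 0 < l ->
  Rint mu (fun x => gaussian_hat k x * gaussian_hat l x) = (2 * pi) ^+ n * Rint mu (fun y => gaussian k y * gaussian l y).
Proof.
move=> k0 l0; have k4 : 0 < (4 * k)^-1 by rewrite invr_gt0 mulr_gt0.
have l4 : 0 < (4 * l)^-1 by rewrite invr_gt0 mulr_gt0.
have p0 : 0 < pi :> R by exact: pi_gt0.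
transitivity (Num.sqrt (pi / k) ^+ n * Num.sqrt (pi / l) ^+ n * Rint mu (gaussian ((4 * k)^-1 + (4 * l)^-1))).
  rewrite -RintZl; last exact/intgr_gaussian/addr_gt0.
  by apply: eq_Rint => x; rewrite /gaussian_hat -gaussian_mul; ring.
under [in RHS]eq_Rint do rewrite gaussian_mul.
have [_ ->] := @gauss_Rn R n _ (addr_gt0 k4 l4); have [_ ->] := @gauss_Rn R n _ (addr_gt0 k0 l0).
rewrite -!exprMn; congr (_ ^+ n).
rewrite -!sqrtrM ?divr_ge0 ?mulr_ge0 ?invr_ge0 ?(ltW k0) ?(ltW l0) ?(ltW p0)//.
have -> : 2 * pi = Num.sqrt ((2 * pi) ^+ 2) :> R by rewrite sqrtr_sqr ger0_norm// mulr_ge0// ltW.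
rewrite -sqrtrM ?sqr_ge0//; congr Num.sqrt.
have kl : k + l != 0 by rewrite gt_eqF// addr_gt0.
by field; rewrite kl !gt_eqF.
Qed.

Lemma intgr_gaussian_mul (k l : R) : 0 < k -> 0 < l -> intgr mu (fun y => gaussian k y * gaussian l y).
Proof.
move=> k0 l0; have -> : (fun y : Rn R n => gaussian k y * gaussian l y) = gaussian (k + l).
  by apply/funext => y; rewrite gaussian_mul.
exact/intgr_gaussian/addr_gt0.
Qed.

Lemma sqr_sum (F : 'I_N -> R) : (\sum_(i < N) F i) ^+ 2 = \sum_(i < N) \sum_(j < N) F i * F j.
Proof. by rewrite expr2 mulr_suml; apply: eq_bigr => i _; rewrite mulr_sumr. Qed.

Lemma parseval_gaussians :
  [/\ intgr mu (fun y => gaussians y ^+ 2), intgr mu (fun x => gaussians_hat x ^+ 2) &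
  Rint mu (fun x => gaussians_hat x ^+ 2) = (2 * pi) ^+ n * Rint mu (fun y => gaussians y ^+ 2)].
Proof.
have E1 y : gaussians y ^+ 2 = \sum_(i < N) \sum_(j < N) c i * c j * (gaussian i.+1%:R y * gaussian j.+1%:R y).
  by rewrite sqr_sum; apply: eq_bigr => i _; apply: eq_bigr => j _; ring.
have E2 y : gaussians_hat y ^+ 2 = \sum_(i < N) \sum_(j < N) c i * c j * (gaussian_hat i.+1%:R y * gaussian_hat j.+1%:R y).
  by rewrite sqr_sum; apply: eq_bigr => i _; apply: eq_bigr => j _; ring.
have i1 (i j : 'I_N) : intgr mu (fun y => gaussian i.+1%:R y * gaussian j.+1%:R y) by exact: intgr_gaussian_mul.
have i2 (i j : 'I_N) : intgr mu (fun y => gaussian_hat i.+1%:R y * gaussian_hat j.+1%:R y).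
  have -> : (fun y : Rn R n => gaussian_hat i.+1%:R y * gaussian_hat j.+1%:R y) =
    (fun y => (Num.sqrt (pi / i.+1%:R) ^+ n * Num.sqrt (pi / j.+1%:R) ^+ n) * (gaussian (4 * i.+1%:R)^-1 y * gaussian (4 * j.+1%:R)^-1 y)).
    by apply/funext => y; rewrite /gaussian_hat; ring.
  by apply/intgrZl/intgr_gaussian_mul.
split.
- by under eq_fun do rewrite E1; do 2 (apply: intgr_sum => ?); exact: intgrZl.
- by under eq_fun do rewrite E2; do 2 (apply: intgr_sum => ?); exact: intgrZl.
- under eq_Rint do rewrite E2; under [in RHS]eq_Rint do rewrite E1.
  rewrite !Rint_sum; try by (move=> i; apply: intgr_sum => j; exact: intgrZl).
  rewrite mulr_sumr; apply: eq_bigr => i _; rewrite !Rint_sum; try by (move=> j; exact: intgrZl).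
  rewrite mulr_sumr; apply: eq_bigr => j _; rewrite !RintZl// Rint_gaussian_hat_mul//; ring.
Qed.

Lemma measurable_gaussians : measurable_fun setT gaussians.
Proof. by apply: measurable_sum => i; apply: measurable_funM => //; exact: measurable_gaussian. Qed.

Lemma measurable_gaussians_hat : measurable_fun setT gaussians_hat.
Proof. by apply: measurable_sum => i; do 2 (apply: measurable_funM => //); exact: measurable_gaussian. Qed.

(** Moving to the side of g1, where Cauchy-Schwarz applies, and back by Parseval for the test
    function. This bounds G1 as a functional on Gaussians by the norm of g1, with no inversion
    theorem for G1 itself. *)
Lemma gaussians_test (G1 g1 : Rn R n -> R) : measurable_fun setT G1 -> intgr mu (fun y => G1 y ^+ 2) ->
  measurable_fun setT g1 -> intgr mu (fun y => g1 y ^+ 2) ->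
  (forall l, 0 < l -> Rint mu (fun x => gaussian_hat l x * g1 x) = Rint mu (fun y => gaussian l y * G1 y)) ->
  Rint mu (fun y => gaussians y * G1 y) ^+ 2 <= ((2 * pi) ^+ n * Rint mu (fun x => g1 x ^+ 2)) * Rint mu (fun y => gaussians y ^+ 2).
Proof.
move=> mG1 iG1 mg1 ig1 dual; have [i1 i2 e] := parseval_gaussians.
have -> : Rint mu (fun y => gaussians y * G1 y) = Rint mu (fun x => gaussians_hat x * g1 x).
  under eq_Rint do rewrite mulr_suml; under [RHS]eq_Rint do rewrite mulr_suml.
  have j1 (i : 'I_N) : intgr mu (fun y => gaussian i.+1%:R y * G1 y).
    by apply: intgr_mul => //; [exact: measurable_gaussian|exact: intgr_gaussian_sqr].
  have j2 (i : 'I_N) : intgr mu (fun y => gaussian_hat i.+1%:R y * g1 y).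
    apply: intgr_mul => //; first by apply: measurable_funM => //; exact: measurable_gaussian.
    by under eq_fun do rewrite exprMn; apply/intgrZl/intgr_gaussian_sqr.
  rewrite !Rint_sum.
  - apply: eq_bigr => i _; under eq_Rint do rewrite -mulrA; under [RHS]eq_Rint do rewrite -mulrA.
    by rewrite !RintZl// dual.
  - by move=> i; under eq_fun do rewrite -mulrA; exact: intgrZl.
  - by move=> i; under eq_fun do rewrite -mulrA; exact: intgrZl.
apply: le_trans (CauchySchwarz measurable_gaussians_hat mg1 i2 ig1) _.
by rewrite e le_eqVlt; apply/orP; left; apply/eqP; ring.
Qed.

End Parseval.

(** * Test functions of exp(-|y|^2) *)

Section Cutoff.
Context {R : realType}.

Definition ramp01 (v : R) : R := Num.max 0 (Num.min 1 v).

Lemma ramp01_ge0 v : 0 <= ramp01 v. Proof. by rewrite le_max lexx. Qed.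
Lemma ramp01_le1 v : ramp01 v <= 1. Proof. by rewrite ge_max ler01 ge_min lexx. Qed.

Lemma continuous_clamp (c d : R) : continuous (fun v : R => Num.max c (Num.min d v)).
Proof.
have -> : (fun v : R => Num.max c (Num.min d v)) = (fun=> c) \max ((fun=> d) \min id) by [].
apply: max_fun_continuous; first by move=> z; exact: cst_continuous.
by apply: min_fun_continuous => z; [exact: cst_continuous|exact: cvg_id].
Qed.

Lemma ramp01_eq0 v : v <= 0 -> ramp01 v = 0.
Proof. by move=> h; apply: max_l; rewrite ge_min h orbT. Qed.
Lemma ramp01_eq1 v : 1 <= v -> ramp01 v = 1.
Proof. by move=> h; rewrite /ramp01 (min_l h) max_r. Qed.

(** For u = exp(-|y|^2) a frequency annulus is an interval inside ]0, 1[. A support away from 0 and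
    1 keeps |y| away from infinity and from 0, where the power |y|^sg could be singular. *)
Lemma cutoff (q1 q2 : R) : 0 < q1 -> q2 < 1 -> q1 <= q2 ->
  exists y1 y2 : R, exists chi : R -> R, [/\ 0 < y1, y1 <= y2, y2 < 1, continuous chi &
    [/\ forall u, 0 <= chi u, forall u, chi u <= 1, forall u, q1 <= u <= q2 -> chi u = 1 &
        forall u, chi u = 0 \/ y1 <= u <= y2]].
Proof.
move=> q10 q21 q12; pose y1 := q1 / 2; pose y2 := (1 + q2) / 2.
have d1 : 0 < q1 - y1 by rewrite /y1; lra.
have d2 : 0 < y2 - q2 by rewrite /y2; lra.
exists y1, y2, (fun u => ramp01 ((u - y1) / (q1 - y1)) * ramp01 ((y2 - u) / (y2 - q2))).
split; [by rewrite /y1; lra|by rewrite /y1 /y2; lra|by rewrite /y2; lra| |split].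
- move=> u; apply: cvgM.
    apply: (continuous_comp (f := fun u => (u - y1) / (q1 - y1)) (g := ramp01)); last exact: continuous_clamp.
    by apply: cvgMl; apply: cvgB; [exact: cvg_id|exact: cvg_cst].
  apply: (continuous_comp (f := fun u => (y2 - u) / (y2 - q2)) (g := ramp01)); last exact: continuous_clamp.
  by apply: cvgMl; apply: cvgB; [exact: cvg_cst|exact: cvg_id].
- by move=> u; rewrite mulr_ge0 ?ramp01_ge0.
- by move=> u; rewrite mulr_ile1 ?ramp01_ge0 ?ramp01_le1.
- by move=> u /andP[h1 h2]; rewrite !ramp01_eq1 ?mulr1// ler_pdivlMr// mul1r; lra.
- move=> u; have [h1|h1] := leP y1 u; last first.
    by left; rewrite ramp01_eq0 ?mul0r// pmulr_lle0 ?invr_gt0//; lra.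
  have [h2|h2] := leP u y2; first by right.
  by left; rewrite [X in _ * X]ramp01_eq0 ?mulr0// pmulr_lle0 ?invr_gt0//; lra.
Qed.

End Cutoff.

Section FrequencyTest.
Context {R : realType} (n : nat).
Local Notation mu := (lebesgue_Rn n : {measure set Rn R n -> \bar R}).
Variables (A : R) (G1 : Rn R n -> R).
Hypotheses (A0 : 0 <= A) (mG1 : measurable_fun setT G1) (iG1 : intgr mu (fun y => G1 y ^+ 2)).
Hypothesis test : forall N (c : 'I_N -> R),
  Rint mu (fun y => gaussians c y * G1 y) ^+ 2 <= A * Rint mu (fun y => gaussians c y ^+ 2).

Lemma gaussianS i (y : Rn R n) : gaussian i.+1%:R y = gaussian 1 y ^+ i.+1.
Proof.
elim: i => [|i IH]; first by rewrite expr1.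
by rewrite exprS -IH gaussian_mul; congr gaussian; rewrite -[in LHS]addn1 natrD addrC.
Qed.

Lemma gaussian_le1 (y : Rn R n) : gaussian 1 y <= 1.
Proof. by rewrite /gaussian -[leRHS]expR0 ler_expR mul1r oppr_le0 dotpp_ge0. Qed.

Lemma gaussians_poly (p : {poly R}) (y : Rn R n) :
  gaussians (fun i : 'I_(size p) => p`_i) y = gaussian 1 y * p.[gaussian 1 y].
Proof.
rewrite horner_coef mulr_sumr; apply: eq_bigr => i _.
by rewrite gaussianS exprS; ring.
Qed.

(** Combinations of exp(-l |y|^2), l = 1, 2, ..., are u p(u) with p a polynomial and u =
    exp(-|y|^2). The factor u makes the error of a uniform approximation of B square integrable. *)
Lemma continuous_test (B : R -> R) : continuous B -> let H y := gaussian 1 y * B (gaussian 1 y) in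
  intgr mu (fun y => H y ^+ 2) -> Rint mu (fun y => H y * G1 y) ^+ 2 <= A * Rint mu (fun y => H y ^+ 2).
Proof.
move=> cB H iH.
have mg : measurable_fun setT (@gaussian R n 1) by exact: measurable_gaussian.
have mH : measurable_fun setT H.
  by apply: measurable_funM => //; apply: (measurableT_comp (f := B)) => //; exact: continuous_measurable_fun.
have ig2 : intgr mu (fun y => gaussian 1 y ^+ 2) by exact: intgr_gaussian_sqr.
pose Y := Rint mu (fun y => gaussian 1 y ^+ 2).
have Y0 : 0 <= Y by apply: Rint_ge0 => y; exact: sqr_ge0.
have [p_ hp] : {p_ : nat -> {poly R} & forall k (x : R), 0 <= x <= 1 -> `|B x - (p_ k).[x]| <= k.+1%:R^-1}.
  apply: (@choice nat {poly R} (fun k p => forall x : R, 0 <= x <= 1 -> `|B x - p.[x]| <= k.+1%:R^-1)) => k.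
  by apply: Weierstrass => //; rewrite invr_gt0.
pose h_ k (y : Rn R n) := gaussians (fun i : 'I_(size (p_ k)) => (p_ k)`_i) y.
have hE k (y : Rn R n) : h_ k y = gaussian 1 y * (p_ k).[gaussian 1 y] by exact: gaussians_poly.
have mh_ k : measurable_fun setT (h_ k) by exact: measurable_gaussians.
have bd k (y : Rn R n) : (h_ k y - H y) ^+ 2 <= k.+1%:R^-1 * gaussian 1 y ^+ 2.
  have /hp hk : 0 <= gaussian 1 y <= 1 by rewrite gaussian_ge0 gaussian_le1.
  rewrite hE /H -mulrBr exprMn mulrC ler_wpM2r ?sqr_ge0//.
  rewrite -[leLHS]real_normK ?num_real// distrC expr2.
  apply: (@le_trans _ _ (k.+1%:R^-1 * 1)); last by rewrite mulr1.
  by apply: ler_pM => //; apply: le_trans (hk k) _; rewrite invf_le1 ?ler1n ?ltr0n.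
have l2 : l2cvg mu h_ H.
  move=> e e0; have e'0 : 0 < e / (Y + 1) by rewrite divr_gt0// ltr_wpDl.
  apply: filterS (near_infty_natSinv_lt (PosNum e'0)) => k /= hk.
  apply: (@le_trans _ _ (\int[mu]_x (k.+1%:R^-1 * gaussian 1 x ^+ 2)%:E)%E).
    apply: ge0_le_integral => //.
    - by move=> x _; rewrite lee_fin sqr_ge0.
    - by apply/measurable_EFinP; apply: measurable_funX; exact: measurable_funB.
    - by apply/measurable_EFinP; apply: measurable_funM => //; exact: measurable_funX.
    - by move=> x _; rewrite lee_fin bd.
  rewrite -EFin_Rint; last exact: intgrZl.
  rewrite RintZl// lee_fin -/Y; apply: (@le_trans _ _ (e / (Y + 1) * (Y + 1))); last by rewrite divfK// gt_eqF// ltr_wpDl.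
  by apply: ler_pM => //; [exact: ltW|rewrite lerDl].
have w1 := @weak_cvg _ _ _ mu h_ H mh_ mH iH l2 G1 mG1 iG1.
have w2 := @weighted_sq_cvg _ _ _ mu h_ H mh_ mH iH l2 (fun=> 1) 1 (measurable_cst _).
have h011 : forall x : Rn R n, (0 : R) <= (1 : R) <= (1 : R) by move=> x; rewrite ler01 lexx.
have {}w2 := w2 h011.
have c1 : Rint mu (fun x => G1 x * h_ k x) ^+ 2 @[k --> \oo] --> Rint mu (fun x => G1 x * H x) ^+ 2.
  by rewrite expr2; apply: cvgM.
have c2 : A * Rint mu (fun x => 1 * h_ k x ^+ 2) @[k --> \oo] --> A * Rint mu (fun x => 1 * H x ^+ 2).
  exact: cvgMr.
have -> : Rint mu (fun y => H y * G1 y) = Rint mu (fun x => G1 x * H x) by apply: eq_Rint => y; rewrite mulrC.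
have -> : Rint mu (fun y => H y ^+ 2) = Rint mu (fun x => 1 * H x ^+ 2) by apply: eq_Rint => y; rewrite mul1r.
apply: (ler_cvg_to c1 c2); near=> k.
under eq_Rint do rewrite mulrC; under [X in _ <= _ * X]eq_Rint do rewrite mul1r.
exact: test.
Unshelve. all: by end_near. Qed.

Variables (sg : R) (F1 : Rn R n -> R) (Q_ : nat -> R -> R).
Hypotheses (mF1 : measurable_fun setT F1) (iF1 : intgr mu (fun y => F1 y ^+ 2)).
Hypothesis G1E : forall y, G1 y = enorm y `^ sg * F1 y.
Hypotheses (cQ : forall m, continuous (Q_ m)) (cF : l2cvg mu (fun m y => Q_ m (enorm y)) F1).

(* Testing G1 = |xi|^sg F1 against chi |xi|^sg Q_m(|xi|), with chi a cutoff and
   Q_m(|xi|) tending to F1, gives X^2 <= A X for X the integral of chi G1^2. *)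
Lemma frequency_energy L : Rint mu (fun y => fwin L y * G1 y ^+ 2) <= A.
Proof.
pose r1 : R := 2 ^+ 0 / 2 ^+ L; pose r2 : R := 2 ^+ (L + L) / 2 ^+ L.
have r10 : 0 < r1 by rewrite /r1 expr0 div1r invr_gt0 exprn_gt0.
have r12 : r1 <= r2 by rewrite /r1 /r2 ler_pM2r ?invr_gt0 ?exprn_gt0// expr0 exprn_ege1// ler1n.
have [||| y1 [y2 [chi [y10 y12 y21 cchi [chi0 chi1 chiq chis]]]]] := @cutoff R (expR (- (r2 ^+ 2))) (expR (- (r1 ^+ 2))).
- exact: expR_gt0.
- by rewrite -[ltRHS]expR0 ltr_expR oppr_lt0 exprn_gt0.
- by rewrite ler_expR lerN2 lerXn2r ?nnegrE ?(le_trans _ r12)// ltW.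
pose clip u := Num.max y1 (Num.min y2 u).
have cl u : y1 <= clip u <= y2 by rewrite /clip le_max lexx/= ge_max y12 ge_min lexx.
have cl0 u : 0 < clip u by case/andP: (cl u) => h _; exact: lt_le_trans h.
have cl1 u : clip u < 1 by case/andP: (cl u) => _ h; exact: le_lt_trans y21.
have clE u : y1 <= u <= y2 -> clip u = u by move=> /andP[h1 h2]; rewrite /clip (min_r h2) max_r.
pose s u := Num.sqrt (- ln (clip u)).
have s0 u : 0 < s u by rewrite sqrtr_gt0 oppr_gt0 ln_lt0// cl0 cl1.
(* Here [s] is |y| as a function of u = exp(-|y|^2) on the support of [chi]; [clip] keeps the
   logarithm away from its singular values and makes [s] continuous and positive everywhere. *)
have cclip : continuous clip by exact: continuous_clamp.
have cs : continuous s.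
  move=> u; apply: (continuous_comp (f := fun u => - ln (clip u)) (g := Num.sqrt)); last exact: sqrt_continuous.
  by apply: cvgN; apply: (@continuous_comp _ _ _ clip (@ln R)); [exact: cclip|exact: (@continuous_ln R _ (cl0 u))].
have ck : continuous (fun u => s u `^ sg).
  by move=> u; apply: (continuous_comp (f := s) (g := fun x : R => x `^ sg)); [exact: cs|exact: (der_cont (@derPow R sg _ (s0 u)))].
have cV : continuous (fun u => chi u * s u `^ sg) by move=> u; apply: cvgM; [exact: cchi|exact: ck].
have sE (y : Rn R n) : y1 <= gaussian 1 y <= y2 -> s (gaussian 1 y) = enorm y.
  by move=> h; rewrite /s clE// /gaussian expRK opprK mul1r.
pose V (y : Rn R n) := chi (gaussian 1 y) * s (gaussian 1 y) `^ sg.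
have mg : measurable_fun setT (@gaussian R n 1) by exact: measurable_gaussian.
have mV : measurable_fun setT V.
  by apply: (measurableT_comp (f := fun u => chi u * s u `^ sg)) => //; exact: continuous_measurable_fun.
have mchi : measurable_fun setT (fun y : Rn R n => chi (gaussian 1 y)).
  by apply: (measurableT_comp (f := chi)) => //; exact: continuous_measurable_fun.
have [|c c0 hc] := @bounded_on R 0 1 (fun u => chi u * s u `^ sg); first by move=> u _; exact: cV.
have V0 y : 0 <= V y by rewrite mulr_ge0 ?powR_ge0.
have Vc y : V y <= c.
  by apply: le_trans (ler_norm _) (hc _ _); rewrite gaussian_ge0 gaussian_le1.
have VF y : V y * F1 y = chi (gaussian 1 y) * G1 y.
  rewrite /V G1E; case: (chis (gaussian 1 y)) => [->|/sE ->]; first by rewrite !mul0r.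
  by rewrite mulrA.
have iVF (F : Rn R n -> R) : measurable_fun setT F -> intgr mu (fun y => F y ^+ 2) -> intgr mu (fun y => (V y * F y) ^+ 2).
  move=> mF iF; apply: (@intgr_dom _ _ _ mu _ (fun y => c ^+ 2 * F y ^+ 2)); last exact: intgrZl.
    by apply: measurable_funX; exact: measurable_funM.
  by move=> y; rewrite (ger0_norm (sqr_ge0 _)) exprMn ler_wpM2r ?sqr_ge0// lerXn2r ?nnegrE.
pose H m (y : Rn R n) := V y * Q_ m (enorm y).
(* The quotient by u puts the test function H in the form u B(u) required by [continuous_test]; on
   the support of [chi], [clip u] is u. *)
pose B m u := chi u * s u `^ sg * Q_ m (s u) / clip u.
have cB m : continuous (B m).
  move=> u; apply: cvgM; last by apply: cvgV; [rewrite gt_eqF|exact: cclip].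
  apply: cvgM; first exact: cV.
  by apply: (@continuous_comp _ _ _ s (Q_ m)); [exact: cs|exact: (@cQ m (s u))].
have HB m y : H m y = gaussian 1 y * B m (gaussian 1 y).
  rewrite /H /B /V; case: (chis (gaussian 1 y)) => [->|h]; first by rewrite !mul0r mulr0.
  have := cl0 (gaussian 1 y); rewrite (clE _ h) (sE _ h) => g0.
  by field; rewrite gt_eqF.
have mQ m : measurable_fun setT (fun y : Rn R n => Q_ m (enorm y)).
  by apply: (measurableT_comp (f := Q_ m)); [exact: continuous_measurable_fun|exact: measurable_enorm].
have iVG : intgr mu (fun y => (V y * G1 y) ^+ 2) by exact: iVF.
have iH m : intgr mu (fun y => H m y ^+ 2).
  have [D D0 hD] := @bounded_on R 0 1 (B m) (fun u _ => @cB m u).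
  apply: (@intgr_dom _ _ _ mu _ (fun y => D ^+ 2 * gaussian 1 y ^+ 2)); last exact/intgrZl/intgr_gaussian_sqr.
    by apply: measurable_funX; exact: measurable_funM.
  move=> y; rewrite (ger0_norm (sqr_ge0 _)) HB exprMn mulrC ler_wpM2r ?sqr_ge0//.
  by rewrite -[leLHS]real_normK ?num_real// lerXn2r ?nnegrE// hD// gaussian_ge0 gaussian_le1.
have T m : Rint mu (fun y => V y * G1 y * Q_ m (enorm y)) ^+ 2 <= A * Rint mu (fun y => V y ^+ 2 * Q_ m (enorm y) ^+ 2).
  have := @continuous_test (B m) (cB m).
  rewrite /= (_ : (fun y => (gaussian 1 y * B m (gaussian 1 y)) ^+ 2) = (fun y => H m y ^+ 2)); last by apply/funext => y; rewrite HB.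
  move=> /(_ (iH m)); congr (_ ^+ 2 <= _ * _).
    by apply: eq_Rint => y; rewrite -HB /H mulrAC.
  by apply: eq_Rint => y; rewrite exprMn.
have w1 := @weak_cvg _ _ _ mu _ F1 mQ mF1 iF1 cF _ (measurable_funM mV mG1) iVG.
have w2 := @weighted_sq_cvg _ _ _ mu _ F1 mQ mF1 iF1 cF (fun y => V y ^+ 2) (c ^+ 2) (measurable_funX _ mV).
have {}w2 : Rint mu (fun y => V y ^+ 2 * Q_ m (enorm y) ^+ 2) @[m --> \oo] --> Rint mu (fun y => V y ^+ 2 * F1 y ^+ 2).
  by apply: w2 => y; rewrite sqr_ge0/= lerXn2r ?nnegrE.
have ichi : intgr mu (fun y => chi (gaussian 1 y) * G1 y ^+ 2).
  apply: (@intgr_dom _ _ _ mu _ _ _ _ iG1); first by apply: measurable_funM => //; exact: measurable_funX.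
  by move=> y; rewrite normrM (ger0_norm (chi0 _)) (ger0_norm (sqr_ge0 _)) ler_piMl ?sqr_ge0.
pose X := Rint mu (fun y => chi (gaussian 1 y) * G1 y ^+ 2).
have X0 : 0 <= X by apply: Rint_ge0 => y; rewrite mulr_ge0 ?sqr_ge0.
have e1 : Rint mu (fun y => V y * G1 y * F1 y) = X.
  by apply: eq_Rint => y; rewrite mulrAC VF -mulrA -expr2.
have e2 : Rint mu (fun y => V y ^+ 2 * F1 y ^+ 2) <= X.
  apply: Rint_le => //.
    rewrite (_ : (fun y => _) = (fun y => (V y * F1 y) ^+ 2)); first exact: iVF.
    by apply/funext => y; rewrite [RHS]exprMn.
  move=> y; rewrite -exprMn VF exprMn ler_wpM2r ?sqr_ge0// expr2 ler_piMl//.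
have XX : X ^+ 2 <= A * Rint mu (fun y => V y ^+ 2 * F1 y ^+ 2).
  rewrite -e1.
  have l1 : Rint mu (fun y => V y * G1 y * Q_ m (enorm y)) ^+ 2 @[m --> \oo] --> Rint mu (fun y => V y * G1 y * F1 y) ^+ 2.
    by rewrite expr2; apply: cvgM.
  have l2 : A * Rint mu (fun y => V y ^+ 2 * Q_ m (enorm y) ^+ 2) @[m --> \oo] --> A * Rint mu (fun y => V y ^+ 2 * F1 y ^+ 2).
    exact: cvgMr.
  by apply: (ler_cvg_to l1 l2); near=> m; exact: T.
(* The square on the right of [XX] is at most [X], because chi^2 <= chi; dividing by X leaves the
   bound A. *)
have XA : X <= A.
  have [->//|Xn] := eqVneq X 0.
  have Xp : 0 < X by rewrite lt_def Xn.
  rewrite -(ler_pM2r Xp) -expr2; apply: le_trans XX _; exact: ler_wpM2l.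
apply: le_trans XA; apply: Rint_le => //.
  apply: (@intgr_dom _ _ _ mu _ _ _ _ iG1); first by apply: measurable_funM; [exact: measurable_fwin|exact: measurable_funX].
  by move=> y; rewrite normrM (ger0_norm (fwin_ge0 _ _)) (ger0_norm (sqr_ge0 _)) ler_piMl ?sqr_ge0// win_le1.
move=> y; rewrite ler_wpM2r ?sqr_ge0// /fwin /win -/r1 -/r2.
case: (boolP (_ && _)) => [/andP[h1 h2]|_]; last by rewrite chi0.
have r20 : 0 <= r2 by apply: le_trans r12; exact: ltW.
rewrite chiq// /gaussian mul1r !ler_expR !lerN2 -enorm_sqr.
by rewrite !lerXn2r ?nnegrE ?enorm_ge0// ltW.
Unshelve. all: by end_near. Qed.

End FrequencyTest.

(** * Passage to the limit in space and time *)

Section FourierL2.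
Context {R : realType} (n : nat).
Hypothesis n2 : (2 <= n)%N.
Local Notation mu := (lebesgue_Rn n : {measure set Rn R n -> \bar R}).
Variables (f : Rn R n -> R[i]).
Hypothesis rf : radial f.

Lemma fourier_l2cvg F : is_fourier f F ->
  [/\ forall m : nat, continuous (radial_trunc (fun x => complex.Re (f x)) m%:R),
      forall m : nat, continuous (radial_trunc (fun x => complex.Im (f x)) m%:R),
      l2cvg mu (fun m y => radial_trunc (fun x => complex.Re (f x)) m%:R (enorm y)) (fun y => complex.Re (F y)) &
      l2cvg mu (fun m y => radial_trunc (fun x => complex.Im (f x)) m%:R (enorm y)) (fun y => complex.Im (F y))].
Proof.
move=> [Lf LF hc]; have [i1 i2] := L2_intgr Lf; have [[m1 m2] _] := Lf; have [mF _] := LF.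
have c1 (m : nat) : continuous (radial_trunc (fun x => complex.Re (f x)) m%:R).
  by apply: continuous_radial_trunc => //; exact: intgr_ballM.
have c2 (m : nat) : continuous (radial_trunc (fun x => complex.Im (f x)) m%:R).
  by apply: continuous_radial_trunc => //; exact: intgr_ballM.
have E (m : nat) : fourier_trunc f m%:R = (fun y => Complex (radial_trunc (fun x => complex.Re (f x)) m%:R (enorm y))
    (radial_trunc (fun x => complex.Im (f x)) m%:R (enorm y))).
  by apply/funext => y; exact: fourier_truncE.
have mt (m : nat) : cmeasurable (fourier_trunc f m%:R).
  rewrite E; split => /=.
    by apply: measurable_enorm_comp; apply: continuous_measurable_fun; exact: c1.
  by apply: measurable_enorm_comp; apply: continuous_measurable_fun; exact: c2.
have [l1 l2] := l2cvg_components mt mF hc.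
split; [exact: c1|exact: c2| |].
- rewrite (_ : (fun m y => _) = (fun k x => complex.Re (fourier_trunc f k%:R x))); first exact: l1.
  by apply/funext => m; rewrite E.
- rewrite (_ : (fun m y => _) = (fun k x => complex.Im (fourier_trunc f k%:R x))); first exact: l2.
  by apply/funext => m; rewrite E.
Qed.

(** [is_D] and [is_flow] each supply a transform of f of their own, the flow one for every time.
    They are compared through their integrals against L^2 functions, which is all that enters the
    truncated flow. *)
Lemma fourier_unique F F' (k : Rn R n -> R) : is_fourier f F -> is_fourier f F' ->
  measurable_fun setT k -> intgr mu (fun x => k x ^+ 2) ->
  Rint mu (fun x => k x * complex.Re (F x)) = Rint mu (fun x => k x * complex.Re (F' x)) /\
  Rint mu (fun x => k x * complex.Im (F x)) = Rint mu (fun x => k x * complex.Im (F' x)).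
Proof.
move=> hF hF' mk ik; have [c1 c2 l1 l2] := fourier_l2cvg hF; have [_ _ l1' l2'] := fourier_l2cvg hF'.
have [_ LF _] := hF; have [_ LF' _] := hF'.
have [i1 i2] := L2_intgr LF; have [i1' i2'] := L2_intgr LF'.
have [[m1 m2] _] := LF; have [[m1' m2'] _] := LF'.
have mm1 (m : nat) : measurable_fun setT (fun y : Rn R n => radial_trunc (fun x => complex.Re (f x)) m%:R (enorm y)).
  by apply: measurable_enorm_comp; apply: continuous_measurable_fun; exact: c1.
have mm2 (m : nat) : measurable_fun setT (fun y : Rn R n => radial_trunc (fun x => complex.Im (f x)) m%:R (enorm y)).
  by apply: measurable_enorm_comp; apply: continuous_measurable_fun; exact: c2.
split.
  exact: (cvg_unique _ (weak_cvg mm1 m1 i1 l1 mk ik) (weak_cvg mm1 m1' i1' l1' mk ik)).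
exact: (cvg_unique _ (weak_cvg mm2 m2 i2 l2 mk ik) (weak_cvg mm2 m2' i2' l2' mk ik)).
Qed.

End FourierL2.

Section Oscillatory.
Context {R : realType} (n : nat).
Hypothesis n2 : (2 <= n)%N.
Local Notation mu := (lebesgue_Rn n : {measure set Rn R n -> \bar R}).
Variables (a : R).

Section Fixed.
Variables (F1 F2 : Rn R n -> R).
Hypotheses (mF1 : measurable_fun setT F1) (mF2 : measurable_fun setT F2).
Hypotheses (iF1 : intgr mu (fun y => F1 y ^+ 2)) (iF2 : intgr mu (fun y => F2 y ^+ 2)).
Variable kap : Rn R n -> R.
Hypotheses (mk : measurable_fun setT kap) (kk : forall y, kap y * kap y = kap y) (ik : intgr mu kap).

Let k0 y : 0 <= kap y. Proof. by rewrite -kk -expr2 sqr_ge0. Qed.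

Let cc := @continuous_cos R. Let cs := @continuous_sin R.
Let c1 := @norm_cos_le1 R. Let s1 := @norm_sin_le1 R.

Lemma measurable_cphase (c : R -> R) x t : continuous c -> measurable_fun setT (fun y : Rn R n => c (phase a x t y)).
Proof. by move=> kc; apply: (measurableT_comp (f := c)); [exact: continuous_measurable_fun|exact: measurable_phase]. Qed.

Lemma osc_sq (c : R -> R) x t : continuous c -> (forall z, `|c z| <= 1) ->
  measurable_fun setT (fun y => kap y * c (phase a x t y)) /\ intgr mu (fun y => (kap y * c (phase a x t y)) ^+ 2).
Proof.
move=> kc kc1; have m : measurable_fun setT (fun y => kap y * c (phase a x t y)).
  by apply: measurable_funM => //; exact: measurable_cphase.
split => //; apply: (@intgr_dom _ _ _ mu _ _ _ _ ik); first exact: measurable_funX.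
move=> y; rewrite (ger0_norm (sqr_ge0 _)) exprMn [kap y ^+ 2]expr2 kk ler_piMr ?k0//.
by rewrite -real_normK ?num_real// expr_le1.
Qed.

Lemma intgr_osc (c : R -> R) (F : Rn R n -> R) x t : continuous c -> (forall z, `|c z| <= 1) -> measurable_fun setT F ->
  intgr mu (fun y => F y ^+ 2) -> intgr mu (fun y => kap y * c (phase a x t y) * F y).
Proof. by move=> kc kc1 mF iF; have [m i] := osc_sq x t kc kc1; exact: intgr_mul. Qed.

Lemma oflow1E z : oflow1 a kap F1 F2 z = Rint mu (fun y => kap y * cos (phase a z.1 z.2 y) * F1 y) - Rint mu (fun y => kap y * sin (phase a z.1 z.2 y) * F2 y).
Proof.
rewrite -RintB; [|exact: (intgr_osc _ _ cc c1)|exact: (intgr_osc _ _ cs s1)].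
by apply: eq_Rint => y; ring.
Qed.

Lemma oflow2E z : oflow2 a kap F1 F2 z = Rint mu (fun y => kap y * sin (phase a z.1 z.2 y) * F1 y) + Rint mu (fun y => kap y * cos (phase a z.1 z.2 y) * F2 y).
Proof.
rewrite -RintD; [|exact: (intgr_osc _ _ cs s1)|exact: (intgr_osc _ _ cc c1)].
by apply: eq_Rint => y; ring.
Qed.

Let CS (c s u v : R) : c ^+ 2 + s ^+ 2 = 1 -> (c * u - s * v) ^+ 2 <= u ^+ 2 + v ^+ 2.
Proof.
move=> h; rewrite -[leRHS]mul1r -h -subr_ge0.
have -> : (c ^+ 2 + s ^+ 2) * (u ^+ 2 + v ^+ 2) - (c * u - s * v) ^+ 2 = (c * v + s * u) ^+ 2 by ring.
exact: sqr_ge0.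
Qed.

Let osc_bound (c s : R -> R) (u v : Rn R n -> R) x t : continuous c -> continuous s ->
  (forall w, c w ^+ 2 + s w ^+ 2 = 1) -> measurable_fun setT u -> measurable_fun setT v ->
  (forall y, u y ^+ 2 + v y ^+ 2 = F1 y ^+ 2 + F2 y ^+ 2) ->
  Rint mu (fun y => kap y * (c (phase a x t y) * u y - s (phase a x t y) * v y)) ^+ 2 <= Rint mu kap * Rint mu (fun y => F1 y ^+ 2 + F2 y ^+ 2).
Proof.
move=> kc ks cs1 mu_ mv uv.
have m : measurable_fun setT (fun y => kap y * (c (phase a x t y) * u y - s (phase a x t y) * v y)).
  by apply: measurable_funM => //; apply: measurable_funB; apply: measurable_funM => //; exact: measurable_cphase.
have k1 y : kap y ^+ 2 = kap y by rewrite expr2 kk.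
have b y : (kap y * (c (phase a x t y) * u y - s (phase a x t y) * v y)) ^+ 2 <= F1 y ^+ 2 + F2 y ^+ 2.
  rewrite exprMn k1 -uv.
  apply: le_trans (CS (u y) (v y) (cs1 (phase a x t y))); rewrite ler_piMl ?sqr_ge0//.
  have := k0 y; rewrite le_eqVlt => /orP[/eqP <-//|kp].
  by rewrite -(ler_pM2l kp) mulr1 kk.
have i : intgr mu (fun y => (kap y * (c (phase a x t y) * u y - s (phase a x t y) * v y)) ^+ 2).
  apply: (@intgr_dom _ _ _ mu _ (fun y => F1 y ^+ 2 + F2 y ^+ 2)); [exact: measurable_funX| |exact: intgrD].
  by move=> y; rewrite (ger0_norm (sqr_ge0 _)).
apply: le_trans (Rint_sqr_le m i mk _ _ ik) _.
- by move=> y; rewrite mulrA kk.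
- by [].
- apply: ler_wpM2l; first by apply: Rint_ge0 => y; exact: k0.
  by apply: Rint_le => //; exact: intgrD.
Qed.

(** Cauchy-Schwarz on the set with indicator [kap]. Being uniform in (x, t) and proportional to the
    measure of that set, the bound makes the low frequencies negligible. *)
Lemma oflow1_bound z : oflow1 a kap F1 F2 z ^+ 2 <= Rint mu kap * Rint mu (fun y => F1 y ^+ 2 + F2 y ^+ 2).
Proof. by apply: (osc_bound z.1 z.2 cc cs) => // w; exact: cos2Dsin2. Qed.

Lemma oflow2_bound z : oflow2 a kap F1 F2 z ^+ 2 <= Rint mu kap * Rint mu (fun y => F1 y ^+ 2 + F2 y ^+ 2).
Proof.
rewrite (_ : oflow2 a kap F1 F2 z = Rint mu (fun y => kap y * (sin (phase a z.1 z.2 y) * F1 y - cos (phase a z.1 z.2 y) * - F2 y))).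
  apply: (osc_bound z.1 z.2 cs cc) => //; first by move=> w; rewrite addrC; exact: cos2Dsin2.
    exact: measurableT_comp.
  by move=> y; rewrite sqrrN.
by apply: eq_Rint => y; rewrite mulrN opprK.
Qed.

End Fixed.

Lemma oflow_unique (f F F' : Rn R n -> R[i]) (kap : Rn R n -> R) z : radial f -> is_fourier f F -> is_fourier f F' ->
  measurable_fun setT kap -> (forall y, kap y * kap y = kap y) -> intgr mu kap ->
  oflow1 a kap (fun y => complex.Re (F y)) (fun y => complex.Im (F y)) z = oflow1 a kap (fun y => complex.Re (F' y)) (fun y => complex.Im (F' y)) z /\
  oflow2 a kap (fun y => complex.Re (F y)) (fun y => complex.Im (F y)) z = oflow2 a kap (fun y => complex.Re (F' y)) (fun y => complex.Im (F' y)) z.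
Proof.
move=> rf hF hF' mk kk ik; have [_ LF _] := hF; have [_ LF' _] := hF'.
have [i1 i2] := L2_intgr LF; have [i1' i2'] := L2_intgr LF'.
have [[m1 m2] _] := LF; have [[m1' m2'] _] := LF'.
have [mc ic] := osc_sq mk kk ik z.1 z.2 (@continuous_cos R) (@norm_cos_le1 R).
have [ms iss] := osc_sq mk kk ik z.1 z.2 (@continuous_sin R) (@norm_sin_le1 R).
have [c1 c2] := fourier_unique n2 rf hF hF' mc ic; have [s1 s2] := fourier_unique n2 rf hF hF' ms iss.
rewrite (oflow1E m1 m2 i1 i2 mk kk ik) (oflow1E m1' m2' i1' i2' mk kk ik).
rewrite (oflow2E m1 m2 i1 i2 mk kk ik) (oflow2E m1' m2' i1' i2' mk kk ik).
by rewrite c1 c2 s1 s2.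
Qed.

Lemma ift_cisM (F : Rn R n -> R[i]) r (x : Rn R n) (t : R) :
  let F' := (fun xi => cis (t * enorm xi `^ a) * F xi) in
  ift1 (fun y => complex.Re (F' y)) (fun y => complex.Im (F' y)) r x = oflow1 a (ballf r) (fun y => complex.Re (F y)) (fun y => complex.Im (F y)) (x, t) /\
  ift2 (fun y => complex.Re (F' y)) (fun y => complex.Im (F' y)) r x = oflow2 a (ballf r) (fun y => complex.Re (F y)) (fun y => complex.Im (F y)) (x, t).
Proof.
move=> F'; split; apply: eq_Rint => y; rewrite /F' Re_cisM Im_cisM /phase cosD sinD; ring.
Qed.

End Oscillatory.

Section UniformPerturbation.
Context {R : realType} {d : measure_display} {T : measurableType d}.
Variable mu : {measure set T -> \bar R}.
Variables (h_ g_ : nat -> T -> R) (h ann : T -> R) (e_ : nat -> R) (k_ : nat -> nat).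
Hypotheses (mh_ : forall k, measurable_fun setT (h_ k)) (mg_ : forall k, measurable_fun setT (g_ k)) (mh : measurable_fun setT h).
Hypotheses (mann : measurable_fun setT ann) (annI : forall x, ann x * ann x = ann x) (iann : intgr mu ann).
Hypotheses (hc : l2cvg mu h_ h) (ge : forall L x, (g_ L x - h_ (k_ L) x) ^+ 2 <= e_ L).
Hypotheses (e_0 : forall e, 0 < e -> \forall L \near \oo, e_ L <= e) (k_oo : forall L, (L <= k_ L)%N).

(** (g - h)^2 <= 2 (g - h_k)^2 + 2 (h_k - h)^2. The first term is uniformly small and becomes small
    in the integral only thanks to the finite mass of [ann]; the second is the assumed convergence
    along k = [k_ L]. *)
Lemma l2cvg_perturb : l2cvg mu (fun L x => ann x * g_ L x) (fun x => ann x * h x).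
Proof.
move=> e e0; pose A := Rint mu ann.
have ann0 x : 0 <= ann x by rewrite -annI -expr2 sqr_ge0.
have A0 : 0 <= A by exact: Rint_ge0.
have ann1 x : ann x <= 1.
  have := ann0 x; rewrite le_eqVlt => /orP[/eqP <-//|kp].
  by rewrite -(ler_pM2l kp) mulr1 annI.
have e1 : 0 < e / (4 * (A + 1)) by rewrite divr_gt0// mulr_gt0// ltr_wpDl.
have e2 : 0 < e / 4 by rewrite divr_gt0.
have [n0 _ h1] := l2cvg_diff mh_ mh hc e2.
near=> L; have [|i hi] := h1 (k_ L).
  by rewrite /=; apply: leq_trans (k_oo L); near: L; exact: nbhs_infty_ge.
have eL : e_ L <= e / (4 * (A + 1)) by near: L; exact: e_0.
have i1 : intgr mu (fun x => 2 * (e_ L * ann x) + 2 * (h_ (k_ L) x - h x) ^+ 2) by apply: intgrD; apply: intgrZl => //; exact: intgrZl.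
apply: (@le_trans _ _ (\int[mu]_x (2 * (e_ L * ann x) + 2 * (h_ (k_ L) x - h x) ^+ 2)%:E)%E).
  apply: ge0_le_integral => //.
  - by move=> x _; rewrite lee_fin sqr_ge0.
  - by apply/measurable_EFinP; apply: measurable_funX; apply: measurable_funB; exact: measurable_funM.
  - by apply/measurable_EFinP; exact: intgr_meas i1.
  - move=> x _; rewrite lee_fin -mulrBr exprMn expr2 annI.
    have b1 : ann x * (g_ L x - h x) ^+ 2 <= ann x * (2 * (g_ L x - h_ (k_ L) x) ^+ 2 + 2 * (h_ (k_ L) x - h x) ^+ 2).
      apply: ler_wpM2l => //; rewrite -subr_ge0.
      have -> : 2 * (g_ L x - h_ (k_ L) x) ^+ 2 + 2 * (h_ (k_ L) x - h x) ^+ 2 - (g_ L x - h x) ^+ 2 = (g_ L x - 2 * h_ (k_ L) x + h x) ^+ 2 by ring.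
      exact: sqr_ge0.
    apply: le_trans b1 _; rewrite mulrDr; apply: lerD.
      by rewrite mulrCA ler_wpM2l// mulrC ler_wpM2r.
    by rewrite ler_piMl// mulr_ge0// sqr_ge0.
rewrite -EFin_Rint// lee_fin RintD; [|by do 2 apply: intgrZl|exact: intgrZl].
rewrite RintZl; last exact: intgrZl.
rewrite RintZl// RintZl// -/A.
have : e_ L * A <= e / 4.
  apply: (@le_trans _ _ (e / (4 * (A + 1)) * (A + 1))); last first.
    by rewrite le_eqVlt; apply/orP; left; apply/eqP; field; rewrite gt_eqF// ltr_wpDl.
  apply: (@le_trans _ _ (e / (4 * (A + 1)) * A)); first by rewrite ler_wpM2r.
  by rewrite ler_wpM2l ?lerDl// ltW.
by move: (e_ L * A) hi; move: (Rint _ _) => X Y; lra.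
Unshelve. all: by end_near. Qed.

End UniformPerturbation.

(** * Convergence of time slices *)

Section Slice.
Context {R : realType} (n : nat).
Hypothesis n2 : (2 <= n)%N.
Local Notation mu := (lebesgue_Rn n : {measure set Rn R n -> \bar R}).

Lemma Rint_ballf_le r : 0 <= r -> Rint mu (@ballf R n r) <= (2 * r) ^+ n.
Proof.
move=> r0; rewrite -lee_fin EFin_Rint; last exact: intgr_ballf.
apply: (@le_trans _ _ (\int[mu]_x (cubei (2 * r) x)%:E)%E).
  apply: ge0_le_integral => //.
  - by move=> x _; rewrite lee_fin ler0n.
  - by apply/measurable_EFinP; exact: measurable_ballf.
  - by apply/measurable_EFinP; exact: measurable_cubei.
  - move=> x _; rewrite lee_fin /ballf /cubei indicE; case: (leP (enorm x) r) => h; last by rewrite ler0n.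
    rewrite mem_set// => i; rewrite tnth_nseq subr0; apply: le_trans (enorm_coord x i) _.
    by apply: le_trans h _; rewrite mulrAC mulfV// mul1r.
rewrite integral_indic//; last exact: measurable_cube.
by rewrite setIT lebesgue_Rn_cube// mulr_ge0.
Qed.

Definition innerf (r : R) (y : Rn R n) : R := ((enorm y < r)%R)%:R.

(** Along the radii 2^L, the balls in the definition of the flow are the annuli of the estimates up
    to the balls |xi| < 2^(-L). *)
Lemma innerf_ball L y : ballf (2 ^ L)%:R y = fwin L y + innerf (2 ^+ 0 / 2 ^+ L) y.
Proof.
have p0 : (0 : R) < 2 ^+ L by rewrite exprn_gt0.
have -> : (2 ^ L)%:R = 2 ^+ (L + L) / 2 ^+ L :> R by rewrite natrX exprD mulfK// gt_eqF.
have r12 : 2 ^+ 0 / 2 ^+ L <= 2 ^+ (L + L) / 2 ^+ L :> R by rewrite ler_pM2r ?invr_gt0// expr0 exprn_ege1// ler1n.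
rewrite /ballf /fwin /win /innerf; case: (ltP (enorm y) (2 ^+ 0 / 2 ^+ L)) => h /=; last by rewrite addr0.
by rewrite (le_trans (ltW h) r12) add0r.
Qed.

Lemma measurable_innerf r : measurable_fun setT (innerf r).
Proof.
have mb : measurable_fun setT (fun x : Rn R n => enorm x < r).
  by apply: measurable_fun_ltr => //; exact: measurable_enorm.
by apply: (measurableT_comp (f := fun b : bool => b%:R : R)).
Qed.

Lemma innerf_idem r y : innerf r y * innerf r y = innerf r y.
Proof. by rewrite /innerf; case: (_ < _); rewrite /= ?mulr1 ?mulr0. Qed.

Lemma ballf_idem r (y : Rn R n) : ballf r y * ballf r y = ballf r y.
Proof. by rewrite /ballf; case: (_ <= _); rewrite /= ?mulr1 ?mulr0. Qed.

Lemma innerf_le r y : innerf r y <= ballf r y.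
Proof. by rewrite /innerf /ballf; case: ltP => //= h; rewrite ?ler0n// (ltW h). Qed.

Lemma intgr_innerf r : intgr mu (innerf r).
Proof.
apply: (@intgr_dom _ _ _ mu _ _ _ _ (intgr_ballf n r)); first exact: measurable_innerf.
by move=> y; rewrite ger0_norm ?ler0n// innerf_le.
Qed.

Lemma annulus_idem L (x : Rn R n) : annulus L x * annulus L x = annulus L x.
Proof. by rewrite /annulus /hwin; case: (_ && _); rewrite /= ?mulr1 ?mulr0. Qed.

Lemma annulus_ge0 L (x : Rn R n) : 0 <= annulus L x. Proof. by rewrite ler0n. Qed.

Lemma measurable_annulusR L : measurable_fun setT (@annulus R n L).
Proof. by rewrite /annulus; apply: (measurableT_comp (f := hwin _ _)); [exact: measurable_hwin|exact: measurable_enorm]. Qed.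

Lemma intgr_annulus L : intgr mu (@annulus R n L).
Proof.
apply: (@intgr_dom _ _ _ mu _ _ _ _ (intgr_ballf n (2 ^+ (L + L) / 2 ^+ L))); first exact: measurable_annulusR.
move=> y; rewrite ger0_norm ?annulus_ge0// /annulus /hwin /ballf.
by case: (_ <= enorm y) => /=; [case: ltP => h /=; rewrite ?ler0n// (ltW h)|rewrite ler0n].
Qed.

Variables (a : R) (f F : Rn R n -> R[i]) (u : spacetime R n -> R[i]) (t : R).
Hypotheses (rf : radial f) (hF : is_fourier f F).
Hypothesis hu : is_multiplier (fun xi => cis (t * enorm xi `^ a)) f (fun x => u (x, t)).

Let F1 y := complex.Re (F y). Let F2 y := complex.Im (F y).
Let c : R := ((2 * pi) ^+ n)^-1.
Let E := Rint mu (fun y => F1 y ^+ 2 + F2 y ^+ 2).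

Let LF : L2 mu F. Proof. by case: hF. Qed.
Let mF1 : measurable_fun setT F1. Proof. by case: LF => -[]. Qed.
Let mF2 : measurable_fun setT F2. Proof. by case: LF => -[]. Qed.
Let iF1 : intgr mu (fun y => F1 y ^+ 2). Proof. by case: (L2_intgr LF). Qed.
Let iF2 : intgr mu (fun y => F2 y ^+ 2). Proof. by case: (L2_intgr LF). Qed.

Let bk k := @measurable_ballf R n k%:R.

Lemma ball_l2cvg : l2cvg mu (fun k x => c * oflow1 a (ballf k%:R) F1 F2 (x, t)) (fun x => complex.Re (u (x, t))) /\
  l2cvg mu (fun k x => c * oflow2 a (ballf k%:R) F1 F2 (x, t)) (fun x => complex.Im (u (x, t))).
Proof.
have [F' hF' [LG [mu_ _] hc]] := hu.
have [[mG1 mG2] _] := LG; have [iG1 iG2] := L2_intgr LG.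
pose G' xi := cis (t * enorm xi `^ a) * F' xi.
have mt (k : nat) : cmeasurable (inv_fourier_trunc G' k%:R).
  split; under eq_fun do rewrite inv_truncE /=.
    by apply: measurable_funM => //; exact: measurable_ift1.
  by apply: measurable_funM => //; exact: measurable_ift2.
have [l1 l2] := l2cvg_components mt mu_ hc.
split.
- rewrite (_ : (fun k x => _) = (fun k x => complex.Re (inv_fourier_trunc G' k%:R x))); first exact: l1.
  apply/funext => k; apply/funext => x; rewrite inv_truncE /=; congr (_ * _).
  have [-> _] := ift_cisM a F' k%:R x t.
  by have [-> _] := oflow_unique n2 a (x, t) rf hF hF' (bk k) (@ballf_idem _) (intgr_ballf n k%:R).
- rewrite (_ : (fun k x => _) = (fun k x => complex.Im (inv_fourier_trunc G' k%:R x))); first exact: l2.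
  apply/funext => k; apply/funext => x; rewrite inv_truncE /=; congr (_ * _).
  have [_ ->] := ift_cisM a F' k%:R x t.
  by have [_ ->] := oflow_unique n2 a (x, t) rf hF hF' (bk k) (@ballf_idem _) (intgr_ballf n k%:R).
Qed.

Let e_ L : R := c ^+ 2 * (Rint mu (innerf (2 ^+ 0 / 2 ^+ L)) * E).

Let e_0 e : 0 < e -> \forall L \near \oo, e_ L <= e.
Proof.
move=> e0.
have E0 : 0 <= E by apply: Rint_ge0 => y; rewrite addr_ge0 ?sqr_ge0.
have c0 : 0 < c by rewrite invr_gt0 exprn_gt0// mulr_gt0// pi_gt0.
have k0 : 0 < e / (c ^+ 2 * (2 ^+ n * (E + 1))) by rewrite divr_gt0// !mulr_gt0 ?exprn_gt0// ltr_wpDl.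
near=> L.
have hL : L.+1%:R^-1 < e / (c ^+ 2 * (2 ^+ n * (E + 1))) by near: L; exact: (near_infty_natSinv_lt (PosNum k0)).
(* The crude comparison 2^(-L) <= 1/(L+1) gives an explicit sequence tending to 0. *)
have rL : (2 ^+ 0 / 2 ^+ L : R) <= L.+1%:R^-1.
  by rewrite expr0 mul1r lef_pV2 ?posrE ?exprn_gt0 ?ltr0n// -natrX ler_nat ltn_expl.
have r0 : (0 : R) <= 2 ^+ 0 / 2 ^+ L by rewrite divr_ge0// exprn_ge0.
have iL : Rint mu (innerf (2 ^+ 0 / 2 ^+ L)) <= 2 ^+ n * L.+1%:R^-1.
  apply: (@le_trans _ _ (Rint mu (@ballf R n (2 ^+ 0 / 2 ^+ L)))).
    by apply: Rint_le; [exact: intgr_innerf|exact: intgr_ballf|exact: innerf_le].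
  apply: le_trans (Rint_ballf_le r0) _; rewrite exprMn ler_wpM2l ?exprn_ge0//.
  have -> : n = (n.-1).+1 by rewrite prednK// (ltn_trans _ n2).
  rewrite exprS -[leRHS]mulr1; apply: (ler_pM r0 (exprn_ge0 _ r0) rL).
  by rewrite exprn_ile1// (le_trans rL)// invf_le1 ?ler1n ?ltr0n.
have -> : e = c ^+ 2 * (2 ^+ n * (e / (c ^+ 2 * (2 ^+ n * (E + 1)))) * (E + 1)).
  by field; rewrite ?gt_eqF ?exprn_gt0// ltr_wpDl.
rewrite /e_ ler_wpM2l ?sqr_ge0//; apply: ler_pM => //; last by rewrite lerDl.
  by apply: Rint_ge0 => y; rewrite ler0n.
by apply: le_trans iL _; rewrite ler_wpM2l ?exprn_ge0// ltW.
Unshelve. all: by end_near. Qed.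

Let flow1_split L x : oflow1 a (ballf (2 ^ L)%:R) F1 F2 (x, t) = flow1 a L F1 F2 (x, t) + oflow1 a (innerf (2 ^+ 0 / 2 ^+ L)) F1 F2 (x, t).
Proof.
have i (kap : Rn R n -> R) (mk : measurable_fun setT kap) (kk : forall y, kap y * kap y = kap y) (ik : intgr mu kap) :
  intgr mu (fun y => kap y * (cos (phase a x t y) * F1 y - sin (phase a x t y) * F2 y)).
  have -> : (fun y => kap y * (cos (phase a x t y) * F1 y - sin (phase a x t y) * F2 y)) =
    (fun y => kap y * cos (phase a x t y) * F1 y - kap y * sin (phase a x t y) * F2 y) by apply/funext => y; ring.
  by apply: intgrB; apply: intgr_osc => //; first [exact: continuous_cos|exact: continuous_sin|exact: norm_cos_le1|exact: norm_sin_le1].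
rewrite -RintD; [by apply: eq_Rint => y; rewrite innerf_ball mulrDl| |].
  by apply: i; [exact: measurable_fwin|by move=> y; exact: win_idem|exact: intgr_fwin].
by apply: i; [exact: measurable_innerf|exact: innerf_idem|exact: intgr_innerf].
Qed.

Let flow2_split L x : oflow2 a (ballf (2 ^ L)%:R) F1 F2 (x, t) = flow2 a L F1 F2 (x, t) + oflow2 a (innerf (2 ^+ 0 / 2 ^+ L)) F1 F2 (x, t).
Proof.
have i (kap : Rn R n -> R) (mk : measurable_fun setT kap) (kk : forall y, kap y * kap y = kap y) (ik : intgr mu kap) :
  intgr mu (fun y => kap y * (sin (phase a x t y) * F1 y + cos (phase a x t y) * F2 y)).
  have -> : (fun y => kap y * (sin (phase a x t y) * F1 y + cos (phase a x t y) * F2 y)) =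
    (fun y => kap y * sin (phase a x t y) * F1 y + kap y * cos (phase a x t y) * F2 y) by apply/funext => y; ring.
  by apply: intgrD; apply: intgr_osc => //; first [exact: continuous_cos|exact: continuous_sin|exact: norm_cos_le1|exact: norm_sin_le1].
rewrite -RintD; [by apply: eq_Rint => y; rewrite innerf_ball mulrDl| |].
  by apply: i; [exact: measurable_fwin|by move=> y; exact: win_idem|exact: intgr_fwin].
by apply: i; [exact: measurable_innerf|exact: innerf_idem|exact: intgr_innerf].
Qed.

(* Only locally in x: the frequencies |xi| < 2^(-L) missing from [flow1 a L] are
   small uniformly, not in L^2 a priori. *)
Lemma slice_l2cvg M :
  l2cvg mu (fun L x => annulus M x * (c * flow1 a L F1 F2 (x, t))) (fun x => annulus M x * complex.Re (u (x, t))) /\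
  l2cvg mu (fun L x => annulus M x * (c * flow2 a L F1 F2 (x, t))) (fun x => annulus M x * complex.Im (u (x, t))).
Proof.
have [l1 l2] := ball_l2cvg; have [F' hF' [LG [[mu1 mu2] _] hc]] := hu.
have kL L : (L <= 2 ^ L)%N by apply: ltnW; exact: ltn_expl.
have p2 := @pair2_measurable _ _ (Rn R n) (measurableTypeR R) t.
split.
- apply: (@l2cvg_perturb _ _ _ mu (fun k x => c * oflow1 a (ballf k%:R) F1 F2 (x, t)) _ _ _ e_ (fun L => (2 ^ L)%N)) => //.
  + by move=> k; apply: measurable_funM => //; apply: (measurableT_comp (measurable_oflow1 a (bk k) mF1 mF2)).
  + by move=> L; apply: measurable_funM => //; apply: (measurableT_comp (measurable_flow1 a L mF1 mF2)).
  + exact: measurable_annulusR.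
  + exact: annulus_idem.
  + exact: intgr_annulus.
  + move=> L x; rewrite flow1_split mulrDr opprD addrA subrr add0r sqrrN exprMn /e_ ler_wpM2l ?sqr_ge0//.
    by apply: oflow1_bound => //; [exact: measurable_innerf|exact: innerf_idem|exact: intgr_innerf].
- apply: (@l2cvg_perturb _ _ _ mu (fun k x => c * oflow2 a (ballf k%:R) F1 F2 (x, t)) _ _ _ e_ (fun L => (2 ^ L)%N)) => //.
  + by move=> k; apply: measurable_funM => //; apply: (measurableT_comp (measurable_oflow2 a (bk k) mF1 mF2)).
  + by move=> L; apply: measurable_funM => //; apply: (measurableT_comp (measurable_flow2 a L mF1 mF2)).
  + exact: measurable_annulusR.
  + exact: annulus_idem.
  + exact: intgr_annulus.
  + move=> L x; rewrite flow2_split mulrDr opprD addrA subrr add0r sqrrN exprMn /e_ ler_wpM2l ?sqr_ge0//.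
    by apply: oflow2_bound => //; [exact: measurable_innerf|exact: innerf_idem|exact: intgr_innerf].
Qed.

End Slice.

Lemma cvg_addn (R : realType) (v : nat -> R) (l : R) (k : nat) :
  v m @[m --> \oo] --> l -> v (m + k)%N @[m --> \oo] --> l.
Proof. by move=> h; rewrite (cvg_shiftn k). Qed.

(** * The weighted bound for the flow *)

Section SpacetimeBound.
Context {R : realType} (n : nat).
Hypothesis n2 : (2 <= n)%N.
Local Notation leb := (@lebesgue_measure R).
Local Notation mu := (lebesgue_Rn n : {measure set Rn R n -> \bar R}).
Local Notation nu := (lebesgue_spacetime n : {measure set (spacetime R n) -> \bar R}).
Variables (a B0 : R) (W : Rn R n -> R -> R) (f F : Rn R n -> R[i]) (u : spacetime R n -> R[i]).
Hypothesis mW : measurable_fun setT (fun z : Rn R n * measurableTypeR R => W z.1 z.2).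
Hypothesis W0 : forall x t, 0 <= W x t.
Hypotheses (rf : radial f) (hF : is_fourier f F) (mu_ : cmeasurable u).
Hypothesis hu : forall t, is_multiplier (fun xi => cis (t * enorm xi `^ a)) f (fun x => u (x, t)).

Let F1 y := complex.Re (F y). Let F2 y := complex.Im (F y).
Let c : R := ((2 * pi) ^+ n)^-1.
Hypothesis HB : forall L, (\int[nu]_z (annulus L z.1 * (W z.1 z.2 * (flow1 a L F1 F2 z ^+ 2 + flow2 a L F1 F2 z ^+ 2)))%:E <= B0%:E)%E.

Let LF : L2 mu F. Proof. by case: hF. Qed.
Let mF1 : measurable_fun setT F1. Proof. by case: LF => -[]. Qed.
Let mF2 : measurable_fun setT F2. Proof. by case: LF => -[]. Qed.
Let iF1 : intgr mu (fun y => F1 y ^+ 2). Proof. by case: (L2_intgr LF). Qed.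
Let iF2 : intgr mu (fun y => F2 y ^+ 2). Proof. by case: (L2_intgr LF). Qed.
Let smu := @sigma_finite_lebesgue_Rn R n.

Section Truncated.
Variable M : nat.

Let Wm (z : spacetime R n) : R := Num.min (W z.1 z.2) M%:R.
Let Wm0 z : 0 <= Wm z. Proof. by rewrite le_min W0 ler0n. Qed.
Let WmM z : 0 <= Wm z <= M%:R. Proof. by rewrite Wm0 ge_min lexx orbT. Qed.
Let mWm : measurable_fun setT Wm. Proof. by apply: measurable_minr. Qed.

Let g (v1 v2 : spacetime R n -> R) (z : spacetime R n) : R :=
  Wm z * (annulus M z.1 * v1 z) ^+ 2 + Wm z * (annulus M z.1 * v2 z) ^+ 2.

Let g0 v1 v2 z : 0 <= g v1 v2 z.
Proof. by rewrite /g; apply: addr_ge0; apply: mulr_ge0; rewrite ?Wm0 ?sqr_ge0. Qed.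

Let mg v1 v2 : measurable_fun setT v1 -> measurable_fun setT v2 -> measurable_fun setT (g v1 v2).
Proof.
move=> m1 m2; apply: measurable_funD; apply: measurable_funM => //; apply: measurable_funX;
  by apply: measurable_funM => //; exact: measurable_annulus.
Qed.

Let slice_int v1 v2 : measurable_fun setT v1 -> measurable_fun setT v2 ->
  (forall t, intgr mu (fun x => Wm (x, t) * (annulus M x * v1 (x, t)) ^+ 2)) ->
  (forall t, intgr mu (fun x => Wm (x, t) * (annulus M x * v2 (x, t)) ^+ 2)) ->
  (\int[leb]_t (Rint mu (fun x => Wm (x, t) * (annulus M x * v1 (x, t)) ^+ 2) + Rint mu (fun x => Wm (x, t) * (annulus M x * v2 (x, t)) ^+ 2))%:E =
   \int[nu]_z (g v1 v2 z)%:E)%E.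
Proof.
move=> m1 m2 i1 i2.
rewrite /lebesgue_spacetime (@Tonelli_prod R _ _ _ _ mu leb smu); last first.
- by move=> z; rewrite lee_fin g0.
- by apply/measurable_EFinP; exact: mg.
rewrite (@Tonelli _ _ (Rn R n) (measurableTypeR R) R mu leb smu (@sigma_finite_leb R) (fun z => (g v1 v2 z)%:E)); last first.
- by move=> z; rewrite lee_fin g0.
- by apply/measurable_EFinP; exact: mg.
apply: eq_integral => t _; rewrite -RintD// EFin_Rint//; exact: intgrD.
Qed.

Let Ann := @intgr_annulus R n M.

Let int_flow (v : spacetime R n -> R) (K : R) t : measurable_fun setT v -> (forall z, v z ^+ 2 <= K) ->
  intgr mu (fun x => Wm (x, t) * (annulus M x * v (x, t)) ^+ 2).
Proof.
move=> mv vK; apply: (@intgr_dom _ _ _ mu _ (fun x => M%:R * (K * annulus M x))); last by do 2 apply: intgrZl.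
  apply: measurable_funM; first by apply: (measurableT_comp mWm).
  apply: measurable_funX; apply: measurable_funM; first exact: measurable_annulusR.
  exact: (measurableT_comp mv).
move=> x; rewrite ger0_norm; last by apply: mulr_ge0; [exact: Wm0|exact: sqr_ge0].
rewrite exprMn [annulus M x ^+ 2]expr2 annulus_idem.
case/andP: (WmM (x, t)) => w0 w1; apply: ler_pM => //; first by apply: mulr_ge0; [exact: annulus_ge0|exact: sqr_ge0].
by rewrite mulrC; apply: ler_wpM2r; [exact: annulus_ge0|exact: vK].
Qed.

Let v1 L (z : spacetime R n) : R := c * flow1 a L F1 F2 z.
Let v2 L (z : spacetime R n) : R := c * flow2 a L F1 F2 z.
Let mv1 L : measurable_fun setT (v1 L). Proof. by apply: measurable_funM => //; exact: measurable_flow1. Qed.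
Let mv2 L : measurable_fun setT (v2 L). Proof. by apply: measurable_funM => //; exact: measurable_flow2. Qed.

Let fwin_idem L (y : Rn R n) : fwin L y * fwin L y = fwin L y. Proof. exact: win_idem. Qed.

Let K L : R := c ^+ 2 * (Rint mu (fwin L) * Rint mu (fun y => F1 y ^+ 2 + F2 y ^+ 2)).
Let b1 L z : v1 L z ^+ 2 <= K L.
Proof.
rewrite exprMn; apply: ler_wpM2l; first exact: sqr_ge0.
by apply: oflow1_bound => //; [exact: measurable_fwin|exact: intgr_fwin].
Qed.
Let b2 L z : v2 L z ^+ 2 <= K L.
Proof.
rewrite exprMn; apply: ler_wpM2l; first exact: sqr_ge0.
by apply: oflow2_bound => //; [exact: measurable_fwin|exact: intgr_fwin].
Qed.

Let annulus_mono L (x : Rn R n) : (M <= L)%N -> annulus M x <= annulus L x.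
Proof.
move=> ML; rewrite /annulus /hwin.
have p k : (0 : R) < 2 ^+ k by rewrite exprn_gt0.
have e k : 2 ^+ (k + k) / 2 ^+ k = 2 ^+ k :> R by rewrite exprD mulfK// gt_eqF.
have le : 2 ^+ M <= 2 ^+ L :> R by rewrite ler_weXn2l// ler1n.
have h1 : 2 ^+ 0 / 2 ^+ L <= 2 ^+ 0 / 2 ^+ M :> R by rewrite !expr0 !mul1r lef_pV2 ?posrE.
rewrite !e; case: (boolP ((_ <= enorm x) && _)) => [/andP[k1 k2]|_]; last by rewrite ler0n.
by rewrite (le_trans h1 k1) (lt_le_trans k2 le).
Qed.

(** For M <= L the annulus and the truncated weight of index M lie below those of index L, so that
    [HB] gives a bound independent of L. *)
Let flow_bound L : (M <= L)%N -> (\int[nu]_z (g (v1 L) (v2 L) z)%:E <= (c ^+ 2 * B0)%:E)%E.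
Proof.
move=> ML; apply: (@le_trans _ _ (\int[nu]_z ((c ^+ 2)%:E * (annulus L z.1 * (W z.1 z.2 * (flow1 a L F1 F2 z ^+ 2 + flow2 a L F1 F2 z ^+ 2)))%:E))%E).
  apply: ge0_le_integral => //.
  - by move=> z _; rewrite lee_fin g0.
  - by apply/measurable_EFinP; exact: mg.
  - apply: measurable_funeM; apply/measurable_EFinP; apply: measurable_funM; first exact: measurable_annulus.
    by apply: measurable_funM => //; apply: measurable_funD; apply: measurable_funX; [exact: measurable_flow1|exact: measurable_flow2].
  - move=> z _; rewrite -EFinM lee_fin.
    have -> : g (v1 L) (v2 L) z = c ^+ 2 * (annulus M z.1 * (Wm z * (flow1 a L F1 F2 z ^+ 2 + flow2 a L F1 F2 z ^+ 2))).
      by rewrite /g /v1 /v2 -[in RHS]annulus_idem; ring.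
    apply: ler_wpM2l; first exact: sqr_ge0.
    apply: ler_pM; [exact: annulus_ge0| |exact: annulus_mono|].
      by apply: mulr_ge0; [exact: Wm0|apply: addr_ge0; exact: sqr_ge0].
    by apply: ler_wpM2r; [apply: addr_ge0; exact: sqr_ge0|rewrite ge_min lexx].
rewrite ge0_integralZl//.
- by rewrite [leRHS]EFinM; apply: lee_wpmul2l; [rewrite lee_fin sqr_ge0|exact: HB].
- apply/measurable_EFinP; apply: measurable_funM; first exact: measurable_annulus.
  by apply: measurable_funM => //; apply: measurable_funD; apply: measurable_funX; [exact: measurable_flow1|exact: measurable_flow2].
- by move=> z _; rewrite lee_fin; apply: mulr_ge0; [exact: annulus_ge0|apply: mulr_ge0; [exact: W0|apply: addr_ge0; exact: sqr_ge0]].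
- by rewrite lee_fin sqr_ge0.
Qed.

Let iu t : intgr mu (fun x => complex.Re (u (x, t)) ^+ 2) /\ intgr mu (fun x => complex.Im (u (x, t)) ^+ 2).
Proof. by have [F' _ [_ Lu _]] := hu t; exact: L2_intgr Lu. Qed.

Let mus t : measurable_fun setT (fun x => complex.Re (u (x, t))) /\ measurable_fun setT (fun x => complex.Im (u (x, t))).
Proof. by have [F' _ [_ [[]]]] := hu t. Qed.

Let ann_sq (v : Rn R n -> R) : measurable_fun setT v -> intgr mu (fun x => v x ^+ 2) -> intgr mu (fun x => (annulus M x * v x) ^+ 2).
Proof.
move=> mv iv; apply: (@intgr_dom _ _ _ mu _ _ _ _ iv).
  by apply: measurable_funX; apply: measurable_funM => //; exact: measurable_annulusR.
move=> x; rewrite (ger0_norm (sqr_ge0 _)) exprMn [annulus M x ^+ 2]expr2 annulus_idem ler_piMl ?sqr_ge0//.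
by rewrite /annulus /hwin; case: (_ && _).
Qed.

Let slice_cvg t :
  Rint mu (fun x => Wm (x, t) * (annulus M x * v1 L (x, t)) ^+ 2) + Rint mu (fun x => Wm (x, t) * (annulus M x * v2 L (x, t)) ^+ 2) @[L --> \oo] -->
  Rint mu (fun x => Wm (x, t) * (annulus M x * complex.Re (u (x, t))) ^+ 2) + Rint mu (fun x => Wm (x, t) * (annulus M x * complex.Im (u (x, t))) ^+ 2).
Proof.
have [l1 l2] := slice_l2cvg n2 rf hF (hu t) M; have [m1 m2] := mus t; have [i1 i2] := iu t.
have mA : measurable_fun setT (fun x : Rn R n => Wm (x, t)) by exact: (measurableT_comp mWm).
have mh (v : spacetime R n -> R) : measurable_fun setT v -> measurable_fun setT (fun x => annulus M x * v (x, t)).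
  by move=> mv; apply: measurable_funM; [exact: measurable_annulusR|exact: (measurableT_comp mv)].
apply: cvgD.
- apply: (@weighted_sq_cvg _ _ _ mu (fun L x => annulus M x * v1 L (x, t)) (fun x => annulus M x * complex.Re (u (x, t))) _ _ _ l1 (fun x => Wm (x, t)) M%:R) => //.
  + by move=> L; exact: mh.
  + by apply: measurable_funM => //; exact: measurable_annulusR.
  + exact: ann_sq.
- apply: (@weighted_sq_cvg _ _ _ mu (fun L x => annulus M x * v2 L (x, t)) (fun x => annulus M x * complex.Im (u (x, t))) _ _ _ l2 (fun x => Wm (x, t)) M%:R) => //.
  + by move=> L; exact: mh.
  + by apply: measurable_funM => //; exact: measurable_annulusR.
  + exact: ann_sq.
Qed.

(* A bounded weight makes the weighted norm of each time slice continuous under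
   L^2 convergence. *)
Lemma truncated_bound : (\int[nu]_z (annulus M z.1 * (Num.min (W z.1 z.2) M%:R * csq (u z)))%:E <= (c ^+ 2 * B0)%:E)%E.
Proof.
have [mu1 mu2] := mu_.
have ic (v : Rn R n -> R) t : measurable_fun setT v -> intgr mu (fun x => v x ^+ 2) ->
    intgr mu (fun x => Wm (x, t) * (annulus M x * v x) ^+ 2).
  move=> mv iv; apply: (@intgr_dom _ _ _ mu _ (fun x => M%:R * (annulus M x * v x) ^+ 2)); last exact/intgrZl/ann_sq.
    apply: measurable_funM; first exact: (measurableT_comp mWm).
    by apply: measurable_funX; apply: measurable_funM => //; exact: measurable_annulusR.
  move=> x; rewrite ger0_norm; last by apply: mulr_ge0; [exact: Wm0|exact: sqr_ge0].
  by apply: ler_wpM2r; [exact: sqr_ge0|case/andP: (WmM (x, t))].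
have -> : (\int[nu]_z (annulus M z.1 * (Num.min (W z.1 z.2) M%:R * csq (u z)))%:E =
   \int[nu]_z (g (fun z => complex.Re (u z)) (fun z => complex.Im (u z)) z)%:E)%E.
  by apply: eq_integral => z _; rewrite /g /csq -[annulus M z.1 in LHS]annulus_idem; congr EFin; rewrite /Wm; ring.
rewrite -slice_int//.
(* Fatou in t only: the flow is known slice by slice, and on each slice the integral in x converges
   by [slice_cvg]. Indices start at M, where [flow_bound] begins to hold. *)
- apply: (@fatou_cvg _ _ _ leb (fun m t => Rint mu (fun x => Wm (x, t) * (annulus M x * v1 (m + M)%N (x, t)) ^+ 2) + Rint mu (fun x => Wm (x, t) * (annulus M x * v2 (m + M)%N (x, t)) ^+ 2))).
  + move=> m; apply: measurable_funD.
      apply: (@measurable_Rint _ _ (measurableTypeR R) (Rn R n) R mu smu (fun z => Wm (z.2, z.1) * (annulus M z.2 * v1 (m + M)%N (z.2, z.1)) ^+ 2)).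
      apply: measurable_funM; first exact: (measurableT_comp mWm (@measurable_swap _ _ (measurableTypeR R) (Rn R n))).
      apply: measurable_funX; apply: measurable_funM; last exact: (measurableT_comp (mv1 _) (@measurable_swap _ _ (measurableTypeR R) (Rn R n))).
      by apply: (measurableT_comp (@measurable_annulusR R n M)); exact: measurable_snd.
    apply: (@measurable_Rint _ _ (measurableTypeR R) (Rn R n) R mu smu (fun z => Wm (z.2, z.1) * (annulus M z.2 * v2 (m + M)%N (z.2, z.1)) ^+ 2)).
    apply: measurable_funM; first exact: (measurableT_comp mWm (@measurable_swap _ _ (measurableTypeR R) (Rn R n))).
    apply: measurable_funX; apply: measurable_funM; last exact: (measurableT_comp (mv2 _) (@measurable_swap _ _ (measurableTypeR R) (Rn R n))).
    by apply: (measurableT_comp (@measurable_annulusR R n M)); exact: measurable_snd.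
  + by move=> m t; apply: addr_ge0; apply: Rint_ge0 => x; apply: mulr_ge0; rewrite ?Wm0 ?sqr_ge0.
  + by move=> t; exact: (cvg_addn M (@slice_cvg t)).
  + move=> m; rewrite slice_int//; first exact/flow_bound/leq_addl.
      by move=> t; exact: (int_flow t (mv1 _) (b1 (m + M)%N)).
    by move=> t; exact: (int_flow t (mv2 _) (b2 (m + M)%N)).
- by move=> t; have [m1 m2] := mus t; have [i1 i2] := iu t; exact: ic.
- by move=> t; have [m1 m2] := mus t; have [i1 i2] := iu t; exact: ic.
Qed.

End Truncated.

(** At each point with x != 0 the truncated integrand is eventually constant in M, once M exceeds
    the weight and |x|, and 2^(-M) is below |x|. At x = 0 every annulus vanishes; hence the factor
    on the left. *)
Lemma spacetime_bound : (\int[nu]_z (((enorm z.1 != 0)%R)%:R * (W z.1 z.2 * csq (u z)))%:E <= (c ^+ 2 * B0)%:E)%E.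
Proof.
apply: (@fatou_cvg _ _ _ nu (fun M z => annulus M z.1 * (Num.min (W z.1 z.2) M%:R * csq (u z)))).
- move=> M; apply: measurable_funM; first exact: measurable_annulus.
  by apply: measurable_funM; [exact: measurable_minr|exact: measurable_csq].
- move=> M z; apply: mulr_ge0; first exact: annulus_ge0.
  by apply: mulr_ge0; [rewrite le_min W0 ler0n|exact: csq_ge0].
- move=> z; apply: cvg_near_cst.
  have zc : enorm z.1 = 0 \/ 0 < enorm z.1.
    by have := enorm_ge0 z.1; rewrite le_eqVlt => /orP[/eqP|]; [left|right].
  have Mi : \forall M \near \oo, enorm z.1 = 0 \/ M.+1%:R^-1 < enorm z.1.
    case: zc => [z0|zp]; first by near=> M; left.
    by apply: filterS (near_infty_natSinv_lt (PosNum zp)) => M; right.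
  near=> M.
  have p k : (0 : R) < 2 ^+ k by rewrite exprn_gt0.
  have hM : W z.1 z.2 <= M%:R by near: M; exact: nbhs_infty_ger.
  have nM : enorm z.1 <= M%:R by near: M; exact: nbhs_infty_ger.
  rewrite (min_l hM); congr (_ * _); rewrite /annulus /hwin; congr (nat_of_bool _)%:R.
  have M2 : M%:R < 2 ^+ M :> R by rewrite -natrX ltr_nat ltn_expl.
  have -> : 2 ^+ (M + M) / 2 ^+ M = 2 ^+ M :> R by rewrite exprD mulfK// gt_eqF.
  rewrite (le_lt_trans nM M2) andbT.
  have hMi : enorm z.1 = 0 \/ M.+1%:R^-1 < enorm z.1 by near: M.
  case: hMi => [z0|zM]; first by rewrite z0 eqxx leNgt divr_gt0.
  rewrite gt_eqF ?(lt_trans _ zM) ?invr_gt0//.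
  by apply: le_trans (ltW zM); rewrite expr0 mul1r lef_pV2 ?posrE// -natrX ler_nat ltn_expl.
- exact: truncated_bound.
Unshelve. all: by end_near. Qed.

End SpacetimeBound.

(** * The Morrey-Campanato weight *)

Section MorreyWeight.
Context {R : realType} (n : nat).
Local Notation leb := (@lebesgue_measure R).
Local Notation mu := (lebesgue_Rn n : {measure set Rn R n -> \bar R}).
Local Notation nu := (lebesgue_spacetime n : {measure set (spacetime R n) -> \bar R}).
Variables (a q : R) (w : spacetime R n -> \bar R).
Hypotheses (q0 : 0 < q) (hw : morrey_class a 1 q w).

Let origin : Rn R n := [tuple of nseq n 0].
Let Q (t r : R) : set (spacetime R n) := cube origin r `*` centered_itv t (r `^ a).

Lemma measurable_parabolic_cube t r : measurable (Q t r).
Proof. by apply: measurableX; [exact: measurable_cube|exact: measurable_centered_itv]. Qed.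

(** The norm with beta = 1 bounds r (r^(-(n+a)) I)^(1/q) by S; solving for the integral I gives S^q
    r^(n+a-q). *)
Lemma morrey_cube : exists2 K : R, 0 <= K & forall t r, 0 < r ->
  (\int[nu]_(z in Q t r) (w z `^ q) <= (K * r `^ (n%:R + a - q))%:E)%E.
Proof.
have [[mw w0 _ _] S_lty] := hw.
have I0 t r : (0 <= \int[nu]_(z in Q t r) (w z `^ q))%E by apply: integral_ge0 => z _; exact: poweR_ge0.
have mS t r : 0 < r -> ((r `^ 1)%:E * (((r `^ (n%:R + a))^-1)%:E * \int[nu]_(z in Q t r) (w z `^ q)) `^ q^-1 <= morrey_norm a 1 q w)%E.
  by move=> r0; apply: ereal_sup_ubound; exists origin, t, r.
have S0 : (0 <= morrey_norm a 1 q w)%E.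
  by apply: le_trans (mS 0 1 ltr01); rewrite mule_ge0 ?lee_fin ?powR_ge0 ?poweR_ge0.
pose S := fine (morrey_norm a 1 q w).
have SE : morrey_norm a 1 q w = S%:E by rewrite fineK// ge0_fin_numE.
have S0' : 0 <= S by rewrite -lee_fin -SE.
exists (S `^ q); first exact: powR_ge0.
move=> t r r0; have rn : 0 < r `^ (n%:R + a) by rewrite powR_gt0.
set J := (((r `^ (n%:R + a))^-1)%:E * \int[nu]_(z in Q t r) (w z `^ q))%E.
have J0 : (0 <= J)%E by rewrite mule_ge0// lee_fin invr_ge0 ltW.
have h1 : (J `^ q^-1 <= (r^-1 * S)%:E)%E.
  by rewrite EFinM lee_pdivlMl//; have := mS t r r0; rewrite powRr1 ?(ltW r0)// SE.
have rS : 0 <= r^-1 * S by rewrite mulr_ge0// invr_ge0 ltW.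
have h2 : (J <= ((r^-1 * S) `^ q)%:E)%E.
  have -> : J = ((J `^ q^-1) `^ q)%E by rewrite -poweRrM mulVf ?gt_eqF// poweRe1.
  rewrite -poweR_EFin; apply: gt0_ler_poweR => //; first exact: ltW.
    by rewrite in_itv/= leey poweR_ge0.
  by rewrite in_itv/= leey lee_fin rS.
move: h2; rewrite /J lee_pdivrMl//; move/le_trans; apply.
rewrite -EFinM lee_fin le_eqVlt; apply/orP; left; apply/eqP.
rewrite powRM ?invr_ge0 ?(ltW r0)//; have -> : r^-1 `^ q = r `^ (- q).
  by rewrite -powR_inv1 ?(ltW r0)// -powRrM mulN1r.
by rewrite mulrA -powRD ?(gt_eqF r0) ?implybT// mulrC.
Qed.

(* [fine +oo = 0]. *)
Lemma powR_fine_le (x : \bar R) (e : R) : (0 <= x)%E -> e != 0 -> ((fine x `^ e)%:E <= x `^ e)%E.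
Proof.
move=> x0 en; case: x x0 => [r _|_|//]; first by rewrite poweR_EFin.
by rewrite /fine powR0// poweR_ge0.
Qed.

Lemma morrey_iterated (b p : R) : q = p * b -> exists2 K : R, 0 <= K & forall r t, 0 < r ->
  (\int[mu]_x \int[leb]_s (cubei r x * win (t - r `^ a / 2) (t + r `^ a / 2) s * (fine (w (x, s)) `^ b) `^ p)%:E <=
    (K * r `^ (n%:R + a - b * p))%:E)%E.
Proof.
move=> qE; have [K K0 hK] := morrey_cube; exists K => // r t r0; have [[mw w0 _ _] _] := hw.
pose g (z : spacetime R n) : R := cubei r z.1 * win (t - r `^ a / 2) (t + r `^ a / 2) z.2 * (fine (w z) `^ b) `^ p.
have mfw : measurable_fun setT (fun z => fine (w z)) by apply: (measurableT_comp (f := fine)).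
have mg : measurable_fun setT g.
  apply: measurable_funM; last first.
    by apply: (measurableT_comp (measurable_powR p)); exact: (measurableT_comp (measurable_powR b)).
  apply: measurable_funM; first by apply: (measurableT_comp (measurable_cubei r)); exact: measurable_fst.
  by apply: measurable_win => //; exact: measurable_snd.
have g0 z : 0 <= g z by rewrite mulr_ge0 ?powR_ge0// mulr_ge0 ?win_ge0// cubei_ge0.
have -> : (\int[mu]_x \int[leb]_s (cubei r x * win (t - r `^ a / 2) (t + r `^ a / 2) s * (fine (w (x, s)) `^ b) `^ p)%:E =
    \int[nu]_z (g z)%:E)%E.
  rewrite /lebesgue_spacetime (@Tonelli_prod R _ _ _ _ mu leb (@sigma_finite_lebesgue_Rn R n))//.
  by apply/measurable_EFinP.
have := hK t r r0; rewrite qE [p * b]mulrC; apply: le_trans.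
rewrite [leRHS]integral_mkcond; apply: ge0_le_integral => //.
- by move=> z _; rewrite lee_fin.
- exact/measurable_EFinP.
- apply/(measurable_restrictT _ (measurable_parabolic_cube t r)); apply: measurable_funTS.
  exact: (measurableT_comp (measurable_poweR _)).
- move=> z _; rewrite patchE; case: ifPn => [/set_mem [h1 h2]|h].
    have -> : g z = fine (w z) `^ (b * p).
      rewrite /g /cubei indicE mem_set// -powRrM mul1r.
      rewrite (_ : win _ _ z.2 = 1) ?mul1r//; move: h2; rewrite /centered_itv /win /= ler_norml => /andP[h3 h4].
      by rewrite (_ : _ <= z.2 <= _)//; apply/andP; split; lra.
    by apply: powR_fine_le => //; rewrite mulrC -qE gt_eqF.
  rewrite lee_fin /g /cubei indicE /win.
  case: (boolP (z.1 \in _)) => [/set_mem h1|_]; last by rewrite !mul0r.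
  case: (boolP (_ <= z.2 <= _)) => [/andP[h3 h4]|_]; last by rewrite mulr0 mul0r.
  case/negP: h; rewrite mem_set//; split => //; rewrite /centered_itv /= ler_norml.
  by apply/andP; split; lra.
Qed.

(** The set x = 0 lies in the product of a cube of side 0 with the time axis, and 0 times infinity
    is 0 here. *)
Lemma negligible_enorm0 (n0 : (0 < n)%N) : nu.-negligible [set z : spacetime R n | enorm z.1 = 0].
Proof.
apply: (@negligibleS _ _ _ _ (cube origin 0 `*` setT)).
  move=> z /= h; split => //= i; rewrite tnth_nseq subr0 mul0r; apply: le_trans (enorm_coord z.1 i) _.
  by rewrite h.
apply/negligibleP; first by apply: measurableX => //; exact: measurable_cube.
have E : nu (cube origin 0 `*` setT) = (mu (cube origin 0) * leb setT)%E.
  by apply: (product_measure1E mu leb) => //; exact: measurable_cube.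
apply: etrans E _; rewrite lebesgue_Rn_cube// expr0n gtn_eqF// mul0e; exact: erefl.
Qed.

(** Off the null sets where w is 0 or infinite and where x = 0, the weight is a positive real number
    and (w^(b/2) |u|)^2 = w^b |u|^2. *)
Lemma weighted_norm_sqr (n0 : (0 < n)%N) (b : R) (u : spacetime R n -> R[i]) : b != 0 -> cmeasurable u ->
  (\int[nu]_z (`| `|w z| `^ (b / 2) * (cabs (u z))%:E | `^ 2) =
   \int[nu]_z (((enorm z.1 != 0)%R)%:R * (fine (w (z.1, z.2)) `^ b * csq (u z)))%:E)%E.
Proof.
move=> bn mu_; have [[mw w0 _ wneg] _] := hw.
have mfw : measurable_fun setT (fun z => fine (w z)) by apply: (measurableT_comp (f := fine)).
have mcabs : measurable_fun setT (fun z => cabs (u z)).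
  have -> : (fun z => cabs (u z)) = (fun z => Num.sqrt (csq (u z))).
    by apply/funext => z; rewrite -cabs_sqr sqrtr_sqr ger0_norm// cabs_ge0.
  apply: (measurableT_comp (f := @Num.sqrt R)); last exact: measurable_csq.
  by apply: continuous_measurable_fun; exact: sqrt_continuous.
apply: ge0_ae_eq_integral => //.
- apply: (measurableT_comp (measurable_poweR 2)); apply: (measurableT_comp (f := abse)) => //.
  apply: emeasurable_funM; last exact/measurable_EFinP.
  by apply: (measurableT_comp (measurable_poweR (b / 2))); exact: (measurableT_comp (f := abse)).
- apply/measurable_EFinP; apply: measurable_funM.
    apply: (measurableT_comp (f := fun c : bool => c%:R : R)) => //.
    apply: measurable_neg; apply: measurable_fun_eqr => //.
    by apply: (measurableT_comp (f := enorm)); [exact: measurable_enorm|exact: measurable_fst].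
  apply: measurable_funM; last exact: measurable_csq.
  apply: (measurableT_comp (measurable_powR b)); rewrite (_ : (fun z => _) = (fun z => fine (w z)))//.
  by apply/funext => -[].
- by move=> z _; exact: poweR_ge0.
- by move=> z _; rewrite lee_fin mulr_ge0// mulr_ge0 ?powR_ge0 ?csq_ge0.
- apply: (negligibleS _ (negligibleU wneg (negligible_enorm0 n0))) => z /= h.
  apply: contrapT => h2; apply: h => _; case: z h2 => x s h2.
  have xn : enorm x != 0 by apply/eqP => e; apply: h2; right.
  have /fineK : w (x, s) \is a fin_num by rewrite ge0_fin_numE// ltey; apply/eqP => e; apply: h2; left; right.
  rewrite /= xn mul1r; have := w0 (x, s); move: (w (x, s)) => [r|//|//] /=; rewrite lee_fin => r0 _.
  congr EFin; rewrite (ger0_norm r0) ger0_norm ?mulr_ge0 ?powR_ge0 ?cabs_ge0// powR_mulrn ?mulr_ge0 ?powR_ge0 ?cabs_ge0//.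
  by rewrite exprMn cabs_sqr -powR_mulrn ?powR_ge0// -powRrM divfK.
Qed.

End MorreyWeight.

Section Energy.
Context {R : realType} (n : nat).
Hypothesis n2 : (2 <= n)%N.
Local Notation mu := (lebesgue_Rn n : {measure set Rn R n -> \bar R}).
Variables (a b : R) (f F g : Rn R n -> R[i]).
Hypotheses (rf : radial f) (hF : is_fourier f F).
Hypothesis hg : is_inv_fourier (fun xi => Complex (enorm xi `^ ((b - a) / 2)) 0 * F xi) g.

Let A (h : Rn R n -> R) : R := (2 * pi) ^+ n * Rint mu (fun x => h x ^+ 2).
Let A0 h : 0 <= A h.
Proof. by rewrite mulr_ge0 ?Rint_ge0 ?exprn_ge0 ?mulr_ge0 ?pi_ge0// => x; exact: sqr_ge0. Qed.

(** Gaussian duality relates the real parts of F and g, and likewise the imaginary parts, because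
    the multiplier is real; [frequency_energy] is applied to each. *)
Lemma energy_le L : energy a b L (fun y => complex.Re (F y)) (fun y => complex.Im (F y)) <=
  A (fun x => complex.Re (g x)) + A (fun x => complex.Im (g x)).
Proof.
have [c1 c2 l1 l2] := fourier_l2cvg n2 rf hF.
have [_ LF _] := hF; have [LG Lg _] := hg.
have [iF1 iF2] := L2_intgr LF; have [[mF1 mF2] _] := LF.
have [iG1 iG2] := L2_intgr LG; have [[mG1 mG2] _] := LG.
have [ig1 ig2] := L2_intgr Lg; have [[mg1 mg2] _] := Lg.
set G1 := fun x => complex.Re (Complex _ _ * _) in iG1 mG1.
set G2 := fun x => complex.Im (Complex _ _ * _) in iG2 mG2.
have E1 y : G1 y = enorm y `^ ((b - a) / 2) * complex.Re (F y).
  by rewrite /G1; case: (F y) => u v /=; rewrite mul0r subr0.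
have E2 y : G2 y = enorm y `^ ((b - a) / 2) * complex.Im (F y).
  by rewrite /G2; case: (F y) => u v /=; rewrite mul0r addr0.
have f1 := @frequency_energy R n (A (fun x => complex.Re (g x))) G1 (A0 _) mG1 iG1 _ ((b - a) / 2) _ _ mF1 iF1 E1 c1 l1 L.
have f2 := @frequency_energy R n (A (fun x => complex.Im (g x))) G2 (A0 _) mG2 iG2 _ ((b - a) / 2) _ _ mF2 iF2 E2 c2 l2 L.
have e1 : energy a b L (fun y => complex.Re (F y)) (fun y => complex.Im (F y)) =
   Rint mu (fun y => fwin L y * G1 y ^+ 2) + Rint mu (fun y => fwin L y * G2 y ^+ 2).
  have e y : enorm y `^ (b - a) = (enorm y `^ ((b - a) / 2)) ^+ 2 by rewrite -powR_mulrn ?powR_ge0// -powRrM divfK.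
  by rewrite energyE//; congr (_ + _); apply: eq_Rint => y; rewrite (E1, E2) e; ring.
rewrite e1; apply: lerD; [apply: f1|apply: f2] => N c; apply: gaussians_test => // l l0.
  by have [] := gauss_dual hg l0.
by have [] := gauss_dual hg l0.
Qed.

End Energy.

Theorem corollary1p4 (R : realType) (n : nat) (a b p : R)
    (w : spacetime R n -> \bar R)
    (hn : (2 <= n)%N) (ha : 1 < a)
    (hb1 : 1 < b) (hbp : a / p < b) (hbn : b < n%:R + a)
    (hp : Num.max (a / (b - 1)) 1 < p) (hpn : p <= (n%:R + a) / b)
    (hw : morrey_class a 1 (p * b) w) :
  exists C : R, 0 < C /\
    forall (f g : Rn R n -> R[i]) (u : spacetime R n -> R[i]),
      radial f ->
      is_D ((b - a) / 2) f g ->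
      is_flow a f u ->
      (Lnorm (lebesgue_spacetime n) 2%:E
         (fun z => `|w z| `^ (b / 2) * (cabs (u z))%:E)
        <= C%:E * L2norm (lebesgue_Rn n) g)%E.
Proof.
move: (hp); rewrite gt_max => /andP[hp1 p1].
have b0 : 0 < b by exact: lt_trans hb1.
have q0 : 0 < p * b by rewrite mulr_gt0// (lt_trans _ p1).
have [[mw w0 _ _] _] := hw.
(* The weight as a real function: [fine] is harmless because w is infinite only on a null set, and
   its value 0 there preserves the upper bounds. *)
pose W (x : Rn R n) (t : R) : R := fine (w (x, t)) `^ b.
have W0 x t : 0 <= W x t by exact: powR_ge0.
have mW : measurable_fun setT (fun z : Rn R n * measurableTypeR R => W z.1 z.2).
  rewrite (_ : (fun z => _) = (fun z => fine (w z) `^ b)); last by apply/funext => -[].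
  by apply: (measurableT_comp (measurable_powR b)); exact: (measurableT_comp (f := fine)).
have [K K0 hK] := morrey_iterated q0 hw (erefl (p * b)).
have [C1 C10 hC1] := @annulus_flow R n hn a b p K ha hb1 p1 hp1 K0 W mW W0 hK.
(* The squared normalization of the inverse transform, the constant of the flow estimate, and the (2
   pi)^n of Parseval. *)
pose D : R := (((2 * pi) ^+ n)^-1) ^+ 2 * (C1 * (2 * pi) ^+ n).
have pn0 : 0 <= (2 * pi) ^+ n :> R by rewrite exprn_ge0// mulr_ge0// pi_ge0.
have D0 : 0 <= D by apply: mulr_ge0; [exact: sqr_ge0|exact: mulr_ge0].
(* The summand 1 ensures that the constant is positive. *)
exists (D `^ 2^-1 + 1); split; first by rewrite ltr_wpDl// powR_ge0.
move=> f g u rf [F hF hg] [mu_ hu].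
have [LG Lg _] := hg; have [ig1 ig2] := L2_intgr Lg.
pose N : R := Rint (lebesgue_Rn n) (fun x => complex.Re (g x) ^+ 2) + Rint (lebesgue_Rn n) (fun x => complex.Im (g x) ^+ 2).
have N0 : 0 <= N by apply: addr_ge0; apply: Rint_ge0 => x; exact: sqr_ge0.
have NE : L2norm (lebesgue_Rn n) g = (N `^ 2^-1)%:E.
  rewrite L2normE; have -> : (\int[lebesgue_Rn n]_x (csq (g x))%:E = N%:E)%E; last by rewrite poweR_EFin.
  by rewrite -EFin_Rint; [rewrite /N -RintD|exact: intgrD].
have [c1 c2 l1 l2] := fourier_l2cvg hn rf hF.
have [_ LF _] := hF; have [iF1 iF2] := L2_intgr LF; have [[mF1 mF2] _] := LF.
pose B0 : R := C1 * ((2 * pi) ^+ n * N).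
have HB L : (\int[lebesgue_spacetime n]_z (annulus L z.1 * (W z.1 z.2 *
    (flow1 a L (fun y => complex.Re (F y)) (fun y => complex.Im (F y)) z ^+ 2 +
     flow2 a L (fun y => complex.Re (F y)) (fun y => complex.Im (F y)) z ^+ 2)))%:E <= B0%:E)%E.
  apply: le_trans (@annulus_flow_L2 R n a b C1 W mW W0 hC1 _ _ _ _ c1 c2 mF1 mF2 iF1 iF2 l1 l2 L) _.
  rewrite lee_fin /B0; apply: ler_wpM2l => //.
  by apply: le_trans (energy_le hn rf hF hg L) _; rewrite -mulrDr.
have S := spacetime_bound hn mW W0 rf hF mu_ hu HB.
rewrite unlock (@weighted_norm_sqr R n a (p * b) w hw (ltnW hn) b u (lt0r_neq0 b0) mu_) NE.
have B1 : ((2 * pi) ^+ n)^-1 ^+ 2 * B0 = D * N by rewrite /B0 /D; ring.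
rewrite B1 in S.
apply: (@le_trans _ _ ((D * N)%:E `^ 2^-1)%E).
  apply: gt0_ler_poweR => //.
    rewrite in_itv/= leey andbT; apply: integral_ge0 => z _; rewrite lee_fin mulr_ge0//.
    by rewrite mulr_ge0 ?powR_ge0 ?csq_ge0.
  by rewrite in_itv/= leey andbT lee_fin mulr_ge0.
by rewrite poweR_EFin powRM// -EFinM lee_fin ler_wpM2r ?powR_ge0// lerDl.
Qed.
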